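(* Let $k$ be an algebraically closed field. Let $\mathcal F$ be a regular foliation on a minimal rational smooth projective surface $X$ over $k$. Then $X$ is a Hirzebruch surface $\mathbb F_e$, $e\ge 0$, $e\neq 1$, and either (1) $\mathrm{char}(k)\ge 0$, and $\mathcal F$ is the $\mathbb P^1_k$-fibration of $\mathbb F_e$ over $\mathbb P^1_k$; or (2) $\mathrm{char}(k)=p>0$, $p$ divides $e$ and $\mathcal F$ is a Riccati foliation on $\mathbb F_e$ given by $$\omega=dz+\gamma,$$ where $z$ stands for the coordinate of the fiber and $\gamma\in H^0(\mathbb P^1_k,\Omega^1_{\mathbb P^1_k}(e))$.
   Context: A foliation $\mathcal F$ on a smooth surface $X$ is (codimension one) given by a saturated coherent rank-one subsheaf $T_{\mathcal F}\subset T_X$ closed under the Lie bracket. It is regular if $T_{\mathcal F}$ and $T_X/T_{\mathcal F}$ are both locally free. The Hirzebruch surface is $\mathbb F_e=\mathbb P(\mathcal O_{\mathbb P^1_k}\oplus\mathcal O_{\mathbb P^1_k}(e))$, $e\ge0$. ''$\mathcal F$ is the $\mathbb P^1_k$-fibration'' means $T_{\mathcal F}$ is the relative tangent sheaf of a $\mathbb P^1_k$-bundle projection $\mathbb F_e\to\mathbb P^1_k$; for $e=0$ either of the two rulings of $\mathbb P^1_k\times\mathbb P^1_k$ is allowed. A Riccati foliation on $\mathbb F_e$ is one transverse to the generic fiber of the projection $\mathbb F_e\to\mathbb P^1_k$. Meaning of $\omega=dz+\gamma$: let $U_0,U_1$ be the two standard affine charts of $\mathbb P^1_k$, with coordinates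 $x$ and $x^{-1}$, over which $\mathbb F_e$ is trivial with affine fiber coordinates $z_0,z_1$ satisfying $z_i=g_{ij}z_j$ on $U_i\cap U_j$, where $g_{01}=x^e$ is the cocycle representing $\mathcal O_{\mathbb P^1_k}(e)$. A section $\gamma\in H^0(\mathbb P^1_k,\Omega^1_{\mathbb P^1_k}(e))$ is a pair of regular $1$-forms $\gamma_i$ on $U_i$ with $\gamma_i=g_{ij}\gamma_j$. When $p\mid e$, $dg_{ij}=0$, so the forms $\omega_i=dz_i+\gamma_i$ satisfy $\omega_i=g_{ij}\omega_j$ and define a foliation on $\mathbb F_e$; concretely, in the chart over $U_0$ it is the kernel of $dz+\gamma(x)\,dx$, with $\gamma(x)$ a polynomial of degree at most $e-2$ ($\gamma=0$ if $e<2$). *)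

(* Defs.v *)
From HB Require Import structures.
From mathcomp Require Import all_boot all_order all_algebra.
From mathcomp.multinomials Require Import mpoly.

Set Implicit Arguments.
Unset Strict Implicit.
Unset Printing Implicit Defensive.

Import GRing.Theory.
Local Open Scope ring_scope.

(* Integral varieties over an algebraically closed field k are represented     *)
(* inside their function field K, as Zariski models: an affine chart is the    *)
(* subalgebra k[g] of K generated by a finite sequence g with k(g) = K, and    *)
(* charts are glued along the equality of local rings in K.                    *)

Section Charts.
Variables (k : closedFieldType) (K : fieldType) (iota : {rmorphism k -> K}).
Implicit Types (g : seq K) (cs : seq (seq K)) (h : K).

Definition evalK g (P : {mpoly k[size g]}) : K := mmap iota (fun i => g`_i) P.

Definition generates g := forall h, exists P Q : {mpoly k[size g]},
  evalK Q != 0 /\ h = evalK P / evalK Q.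

Definition alg_indep g := forall P : {mpoly k[size g]}, evalK P = 0 -> P = 0.

Definition trdeg (n : nat) := exists t : seq K,
  [/\ size t = n, alg_indep t & forall h, ~ alg_indep (rcons t h)].

(* A closed point in one of the charts: by the Nullstellensatz, a k-point of   *)
(* Spec k[g], i.e. a common zero of the relations between the generators. The  *)
(* same closed point may be presented in several charts.                       *)
Record point cs := Point {
  chart : seq K;
  chart_in : chart \in cs;
  coord : 'I_(size chart) -> k;
  coord_zero : forall P : {mpoly k[size chart]}, evalK P = 0 -> P.@[coord] = 0
}.
Arguments coord {cs}.

Section Stalk.
Variables (cs : seq (seq K)) (a : point cs).

(* The local ring O_a and its maximal ideal m_a, inside K.                     *)
Definition stalk h := exists P Q : {mpoly k[size (chart a)]},
  Q.@[coord a] != 0 /\ h = evalK P / evalK Q.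

Definition maximal_ideal h := exists P Q : {mpoly k[size (chart a)]},
  [/\ P.@[coord a] = 0, Q.@[coord a] != 0 & h = evalK P / evalK Q].

(* m_a is generated by two elements: for a variety of dimension 2, this says   *)
(* that O_a is a regular local ring.                                           *)
Definition regular_point2 := exists s t : K, forall h,
  maximal_ideal h <-> exists u v, [/\ stalk u, stalk v & h = u * s + v * t].

End Stalk.

Definition same_points cs cs' :=
  (forall a : point cs, exists b : point cs', forall h, stalk a h <-> stalk b h) /\
  (forall b : point cs', exists a : point cs, forall h, stalk a h <-> stalk b h).

(* The standard affine charts of the closure in P^n of the K-point             *)
(* (f_0 : ... : f_n).                                                          *)
Definition proj_charts (f : seq K) : seq (seq K) :=
  [seq [seq u / v | u <- f] | v <- f & v != 0].

End Charts.

Record variety (k : closedFieldType) := Variety {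
  function_field : fieldType;
  scalar : {rmorphism k -> function_field};
  charts : seq (seq function_field);
  charts_generate : forall g, g \in charts -> generates scalar g
}.

Section Varieties.
Variable k : closedFieldType.
Implicit Types X Y : variety k.

Definition pt X := point (scalar X) (charts X).

Definition projective X := exists f : seq (function_field X),
  has (fun v => v != 0) f /\ same_points (scalar X) (charts X) (proj_charts f).

Definition smooth_projective_surface X :=
  [/\ projective X, trdeg (scalar X) 2 & forall a : pt X, regular_point2 a].

(* Birational to a projective space: K(X) is purely transcendental over k.     *)
Definition rational X := exists t : seq (function_field X),
  alg_indep (scalar X) t /\ generates (scalar X) t.

(* A birational map X --> Y is given by its comorphism K(Y) -> K(X).           *)
Definition birational X Y (phi : {rmorphism function_field Y -> function_field X}) :=
  bijective phi /\ forall c, phi (scalar Y c) = scalar X c.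

(* It is defined everywhere: each O_a dominates some O_b.                      *)
Definition everywhere_defined X Y
    (phi : {rmorphism function_field Y -> function_field X}) :=
  forall a : pt X, exists b : pt Y, forall h,
    (stalk b h -> stalk a (phi h)) /\
    (maximal_ideal b h -> maximal_ideal a (phi h)).

Definition isomorphism X Y (phi : {rmorphism function_field Y -> function_field X}) :=
  [/\ birational phi,
      forall a : pt X, exists b : pt Y, forall h, stalk b h <-> stalk a (phi h) &
      forall b : pt Y, exists a : pt X, forall h, stalk b h <-> stalk a (phi h)].

(* Every birational morphism to a smooth projective surface is an isomorphism. *)
Definition minimal X :=
  forall Y (phi : {rmorphism function_field Y -> function_field X}),
    smooth_projective_surface Y -> birational phi -> everywhere_defined phi ->
    isomorphism phi.

End Varieties.

Section Foliations.
Variables (k : closedFieldType) (X : variety k).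
Local Notation K := (function_field X).
Implicit Types (a b : pt X) (D E : K -> K) (h : K).

Definition derivation D :=
  [/\ forall u v, D (u + v) = D u + D v,
      forall u v, D (u * v) = u * D v + v * D u &
      forall c, D (scalar X c) = 0].

(* The stalk at a of T_X, namely Der_k(O_a), inside Der_k(K).                  *)
Definition tangent a D := derivation D /\ forall h, stalk a h -> stalk a (D h).

Definition lin_comb n (c : 'I_n -> K) (d : 'I_n -> K -> K) : K -> K :=
  fun h => \sum_(i < n) c i * d i h.

(* A subsheaf of T_X is given by its stalks at the closed points. The sets     *)
(* {b | s is contained in O_b}, for s a finite subset of K, form a basis of    *)
(* the Zariski topology; coherence means that around each point the stalks are *)
(* generated by finitely many common sections.                                 *)
Definition coherent (F : pt X -> (K -> K) -> Prop) :=
  forall a, exists (s : seq K) (n : nat) (d : 'I_n -> K -> K),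
    (forall h, h \in s -> stalk a h) /\
    forall b, (forall h, h \in s -> stalk b h) ->
      forall D, F b D <->
        exists c : 'I_n -> K, (forall i, stalk b (c i)) /\ D =1 lin_comb c d.

Definition rank_one (F : pt X -> (K -> K) -> Prop) :=
  forall a, exists D0, [/\ F a D0, exists h, D0 h != 0 &
    forall D, F a D -> exists f : K, D =1 (fun h => f * D0 h)].

Record foliation := Foliation {
  TF :> pt X -> (K -> K) -> Prop;
  TF_sub : forall a D, TF a D -> tangent a D;
  TF_coherent : coherent TF;
  TF_rank_one : rank_one TF;
  TF_saturated : forall a D f, tangent a D -> stalk a f -> f != 0 ->
    TF a (fun h => f * D h) -> TF a D;
  TF_bracket : forall a D E, TF a D -> TF a E -> TF a (fun h => D (E h) - E (D h))
}.

(* The O_a-module M / N is free of finite rank: the classes of the d_i form a  *)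
(* basis of it.                                                                *)
Definition free_quotient a (M N : (K -> K) -> Prop) :=
  exists (n : nat) (d : 'I_n -> K -> K),
    (forall i, M (d i)) /\
    forall D, M D ->
      (exists c : 'I_n -> K, (forall i, stalk a (c i)) /\
         N (fun h => D h - lin_comb c d h)) /\
      (forall c c' : 'I_n -> K, (forall i, stalk a (c i)) ->
         (forall i, stalk a (c' i)) ->
         N (fun h => D h - lin_comb c d h) ->
         N (fun h => D h - lin_comb c' d h) -> c =1 c').

(* T_F and T_X / T_F are locally free.                                         *)
Definition regular (F : foliation) := forall a,
  free_quotient a (F a) (fun D => D =1 (fun=> 0)) /\
  free_quotient a (tangent a) (F a).

(* The stalk at a of the relative tangent sheaf of the map x : X -> P^1.       *)
Definition relative_tangent (x : K) a D := tangent a D /\ D x = 0.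

(* T_X = T_F + T_{X/P^1} at the points of the generic fiber of x : X -> P^1,   *)
(* whose local rings are localizations of the O_a's at k(x) \ {0}.             *)
Definition riccati (F : foliation) (x : K) :=
  forall a D, tangent a D -> exists D1 D2 (q r : {poly k}),
    [/\ F a D1, relative_tangent x a D2, q != 0, r != 0 &
        forall h, (map_poly (scalar X) q).[x] * D h
                  = (map_poly (scalar X) r).[x] * (D1 h + D2 h)].

End Foliations.

Section Generation.
Variables (k : closedFieldType) (K : fieldType) (iota : {rmorphism k -> K}).
Variable g : seq K.
Local Notation ev := (@evalK k K iota g).

Definition in_field (h : K) := exists P Q : {mpoly k[size g]},
  ev Q != 0 /\ h = ev P / ev Q.

Lemma evalKM P Q : ev (P * Q) = ev P * ev Q.
Proof. exact: (rmorphM (mmap iota (fun i : 'I_(size g) => g`_i))). Qed.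

Lemma evalKD P Q : ev (P + Q) = ev P + ev Q.
Proof. exact: mmapD. Qed.

Lemma evalKC c : ev c%:MP = iota c.
Proof. exact: mmapC. Qed.

Lemma in_field_scalar c : in_field (iota c).
Proof.
by exists c%:MP, 1%:MP; rewrite !evalKC rmorph1 divr1 oner_neq0.
Qed.

Lemma in_field_gen h : h \in g -> in_field h.
Proof.
move=> hg; have lt : (index h g < size g)%N by rewrite index_mem.
exists 'X_(Ordinal lt), 1%:MP; rewrite evalKC rmorph1 divr1 oner_neq0.
by split=> //; rewrite /evalK mmapX mmap1U /= nth_index.
Qed.

Lemma in_fieldM u v : in_field u -> in_field v -> in_field (u * v).
Proof.
move=> [P [Q [Q0 ->]]] [P' [Q' [Q0' ->]]]; exists (P * P'), (Q * Q').
by rewrite !evalKM mulf_neq0 // mulf_div.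
Qed.

Lemma in_fieldD u v : in_field u -> in_field v -> in_field (u + v).
Proof.
move=> [P [Q [Q0 ->]]] [P' [Q' [Q0' ->]]].
exists (P * Q' + P' * Q), (Q * Q').
by rewrite evalKD !evalKM mulf_neq0 // addf_div.
Qed.

Lemma in_fieldV u : in_field u -> in_field u^-1.
Proof.
move=> [P [Q [Q0 ->]]]; have [P0|P0] := eqVneq (ev P) 0.
  rewrite P0 mul0r invr0 -(rmorph0 iota); exact: in_field_scalar.
by exists Q, P; rewrite P0 invf_div.
Qed.

Lemma in_fieldX u n : in_field u -> in_field (u ^+ n).
Proof.
move=> hu; elim: n => [|n IH]; last by rewrite exprS; apply: in_fieldM.
by rewrite expr0 -(rmorph1 iota); apply: in_field_scalar.
Qed.

End Generation.

Section Hirzebruch.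
Variables (k : closedFieldType) (e : nat).

Local Notation frac2 := (@tofrac {mpoly k[2]}).

Definition ratfield2 : fieldType := {fraction {mpoly k[2]}}.

Definition const2 : {rmorphism k -> ratfield2} :=
  frac2 \o @mpolyC 2 k.

Definition coordX : ratfield2 := frac2 'X_0.
Definition coordZ : ratfield2 := frac2 'X_1.

(* The fiber coordinates are z_0 = z over U_0 and z_1 = z / x^e over U_1.      *)
Definition hirzebruch_charts : seq (seq ratfield2) :=
  [:: [:: coordX; coordZ]; [:: coordX; coordZ^-1];
      [:: coordX^-1; coordZ / coordX ^+ e];
      [:: coordX^-1; (coordZ / coordX ^+ e)^-1]].

Lemma coords_generate g :
  in_field const2 g coordX -> in_field const2 g coordZ -> generates const2 g.
Proof.
move=> gx gz.
have poly (P : {mpoly k[2]}) : in_field const2 g (frac2 P).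
  elim/mpolyind: P => [|c m P _ _ IH].
    rewrite rmorph0 -(rmorph0 const2); exact: in_field_scalar.
  rewrite rmorphD; apply: in_fieldD IH.
  rewrite -mul_mpolyC rmorphM; apply: in_fieldM.
    exact: (in_field_scalar const2 g c).
  rewrite mpolyXE_id rmorph_prod /= !big_ord_recl big_ord0 mulr1.
  by rewrite !rmorphXn; apply: in_fieldM; apply: in_fieldX.
elim/quotW=> r.
suff -> : (\pi_({fraction {mpoly k[2]}}) r)%qT = frac2 \n_r / frac2 \d_r.
  by apply: in_fieldM => //; apply: in_fieldV.
have dn0 : frac2 \d_r != 0 by rewrite tofrac_eq0 denom_ratioP.
apply: (mulIf dn0); rewrite divfK //; unlock tofrac.
rewrite -[LHS]FracField.pi_mul; apply/eqmodP => /=.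
rewrite FracField.equivfE /FracField.mulf !numden_Ratio ?oner_neq0 //.
  by rewrite !mulr1 mulrC.
all: by rewrite mulr1 denom_ratioP.
Qed.

Lemma hirzebruch_charts_generate g :
  g \in hirzebruch_charts -> generates const2 g.
Proof.
have x0 : coordX ^+ e != 0.
  rewrite expf_neq0 // tofrac_eq0; apply/eqP => X0.
  have := mevalXU (fun=> 1 : k) (0 : 'I_2).
  by rewrite X0 meval0 => /esym/eqP; rewrite oner_eq0.
have head (u v : ratfield2) : in_field const2 [:: u; v] u.
  by apply: in_field_gen; rewrite mem_head.
have next (u v : ratfield2) : in_field const2 [:: u; v] v.
  by apply: in_field_gen; rewrite !inE eqxx orbT.
rewrite !inE => /or4P [] /eqP -> {g}; apply: coords_generate.
- exact: head.
- exact: next.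
- exact: head.
- by rewrite -[coordZ in X in in_field _ _ X]invrK; apply/in_fieldV/next.
- by rewrite -[X in in_field _ _ X]invrK; apply/in_fieldV/head.
- rewrite -[X in in_field _ _ X](divfK x0); apply: in_fieldM; first exact: next.
  by apply: in_fieldX; rewrite -[X in in_field _ _ X]invrK; apply/in_fieldV/head.
- by rewrite -[X in in_field _ _ X]invrK; apply/in_fieldV/head.
- rewrite -[X in in_field _ _ X](divfK x0); apply: in_fieldM.
    by rewrite -[X in in_field _ _ X]invrK; apply/in_fieldV/next.
  by apply: in_fieldX; rewrite -[X in in_field _ _ X]invrK; apply/in_fieldV/head.
Qed.

Definition hirzebruch : variety k :=
  Variety hirzebruch_charts_generate.

(* An element of H^0(P^1, Omega^1(e)): the forms gamma_0 = P(x) dx on U_0 and  *)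
(* gamma_1 = Q(1/x) d(1/x) = - Q(1/x) x^-2 dx on U_1, with                     *)
(* gamma_0 = x^e gamma_1.                                                      *)
Definition twisted_form (P Q : {poly k}) :=
  (map_poly const2 P).[coordX]
  = coordX ^+ e * - ((map_poly const2 Q).[coordX^-1] / coordX ^+ 2).

End Hirzebruch.

Section FoliatedHirzebruch.
Variables (k : closedFieldType) (X : variety k) (F : foliation X) (e : nat).
(* An identification of X with F_e, through the coordinates on X.              *)
Variable phi : {rmorphism function_field (hirzebruch k e) -> function_field X}.
Let x : function_field X := phi (coordX k).
Let z : function_field X := phi (coordZ k).

(* For e = 0 there are two rulings.                                            *)
Definition is_fibration :=
  (forall a D, F a D <-> relative_tangent x a D) \/
  (e = 0%N /\ forall a D, F a D <-> relative_tangent z a D).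

(* F is the kernel of dz + gamma. As p divides e, omega_0 = x^e omega_1, so    *)
(* omega_0 and omega_1 have the same kernel, which is expressed at every point *)
(* by the form omega_0 in the generic chart.                                   *)
Definition is_kernel_dz_plus (P Q : {poly k}) :=
  twisted_form e P Q /\
  forall a D, F a D <->
    tangent a D /\ D z + (map_poly (scalar X) P).[x] * D x = 0.

End FoliatedHirzebruch.

(* Main.v *)
(* Fix a projective embedding f of X, and choose coordinates x, z of K(X) =   *)
(* k(x, z) such that, up to a common factor lam, the f_i lie in the span of   *)
(* the x^a z^j with j <= n and a + e j <= b, where n and then 2 b - n e are   *)
(* minimal. Elementary transformations bound the multiplicities of this       *)
(* linear system at all points (Noether-Fano). A discrete valuation v centred *)
(* at a point with parameters s, t satisfies v(P) <= mult(P) v(J) for J =     *)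
(* d(x, z)/d(s, t); as a factorial local ring is the intersection of its      *)
(* discrete valuation rings, J^n / (lam f_i)^2 is regular on X (J^b / (lam    *)
(* f_i)^3 in the case of the plane). Were x or another coordinate             *)
(* indeterminate at a point a, a valuation ring dominating O_a, with residue  *)
(* field containing that coordinate, would have 1/J in its maximal ideal: a   *)
(* contradiction. Hence X has a morphism to F_e with e <> 1 or to the plane,  *)
(* which is an isomorphism by minimality, or else every local ring of the     *)
(* plane is unramified over some local ring of X.                             *)
(* F is spanned by one rational vector field, given on each affine chart of   *)
(* F_e or of the plane by polynomials A d/dx + B d/dz without common zeros.   *)
(* If A <> 0, the degrees of A and B in the fiber coordinate are m and m + 2  *)
(* on F_e, m and m + 1 on the plane, and their resultant is a nonzero         *)
(* constant. Comparison with the resultant in the chart around x = infinity   *)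
(* gives an equation between m, e and the degree of F, equivalent to c_2(T_X  *)
(* (x) T_F^-1) = 0. It has no admissible solution on the plane; on F_e it     *)
(* forces m = 0, A constant and B in k[x], with e = 0 in k.                   *)

From HB Require Import structures.
From mathcomp Require Import all_boot all_order all_algebra.
From mathcomp Require Import ring zify.
From mathcomp.multinomials Require Import mpoly.
From Stdlib Require Import Classical ClassicalEpsilon.
From mathcomp Require boolp classical_sets.
Require Import Defs.

Set Implicit Arguments.
Unset Strict Implicit.
Unset Printing Implicit Defensive.

Import Order.TTheory GRing.Theory Num.Theory.
Local Open Scope ring_scope.

(** * Local rings and derivations *)

(** The argument has two halves. The first identifies X with some F_e by a minimal linear system and
    valuations; the second studies the foliation as a polynomial vector field on the charts of F_e.

    Model of X. Let f be the sections of a projective embedding. Coordinates with K(X) = k(x, z) are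
    chosen such that a common multiple [lam] of the f lies in the span of the monomials of a linear
    system on F_e, with the numbers n and then 2b - n e minimal ([minimal_system]). An elementary
    transformation at a point of high multiplicity would decrease them, so every point lies on some
    member of multiplicity at most n / 2 ([minimal_mult], [minimal_mult_inf]). At a point a of X let
    J be the Jacobian of x, z with respect to parameters, and let g be a member of f that does not
    vanish at a. A discrete valuation satisfies v(P) <= mult(P) v(J) ([val_multiplicity]), and O_a
    is factorial ([irreducible_prime]), hence the intersection of discrete valuation rings
    ([stalk_valuations]). So J^n / (lam g)^2 is regular at a ([stalk_ruled]). If x were
    indeterminate at a, Chevalley's extension theorem would give a valuation ring dominating O_a in
    which x has transcendental residue ([indeterminate_valuation]). In that ring 1/J is in the
    maximal ideal ([exceptional_jac]), a contradiction. Thus X maps to F_e, and by minimality it is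
    isomorphic to F_e ([minimal_ruled]). The remaining numerical cases concern the plane instead
    ([surface_model]).

    Foliation. T_F is spanned by one rational vector field [D0] ([foliation_spans]). On an affine
    plane some multiple of it is polynomial, A d/dx + B d/dz, without zeros ([lattice_generator_ex],
    [line_at]). If A = 0, the foliation is the fibration. Otherwise A and B have fiber degrees m and
    m + d with d = 2 on F_e and d = 1 on the plane ([degrees_ruled], [degrees_plane]). Their
    resultant in z has no zero, hence is constant, over both charts of the base; comparing the two
    gives (w + 2)(m + d) + (w + e) m = e m (m + d), where w measures the twist of T_F over the base
    ([base_number]). Together with the degree bounds in x this is impossible on the plane
    ([plane_no_field]). On F_e with e different from 1 it leaves A constant, B = b(x) with deg b <=
    e - 2, and e = 0 in k ([ruled_field]). For e = 0 the foliation is the other ruling; for e > 0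
    the characteristic p divides e and the foliation is the kernel of dz + gamma
    ([foliation_dichotomy]). *)

Arguments coord {k K iota cs} p _.

Section LocalRings.
Variables (k : closedFieldType) (K : fieldType) (iota : {rmorphism k -> K}).
Implicit Types (R M : K -> Prop).

Definition subring R :=
  [/\ forall c, R (iota c), forall u v, R u -> R v -> R (u + v)
    & forall u v, R u -> R v -> R (u * v)].

Definition local_ring R M :=
  [/\ subring R, forall u, M u -> R u,
      M 0 /\ forall u v, M u -> M v -> M (u + v),
      forall u v, R u -> M v -> M (u * v) &
      ~ M 1 /\ forall u, R u -> ~ M u -> R u^-1].

Definition residue_k R M := forall u, R u -> exists c, M (u - iota c).

Section Subring.
Variable R : K -> Prop.
Hypothesis sR : subring R.

Lemma subr_c c : R (iota c). Proof. by case: sR. Qed.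
Lemma subr_D u v : R u -> R v -> R (u + v). Proof. by case: sR => _ + _; exact. Qed.
Lemma subr_M u v : R u -> R v -> R (u * v). Proof. by case: sR => _ _; exact. Qed.
Lemma subr_0 : R 0. Proof. by rewrite -(rmorph0 iota); apply: subr_c. Qed.
Lemma subr_1 : R 1. Proof. by rewrite -(rmorph1 iota); apply: subr_c. Qed.
Lemma subr_N u : R u -> R (- u).
Proof.
by move=> Ru; rewrite -mulN1r -(rmorphN1 iota); apply: subr_M => //; apply: subr_c.
Qed.
Lemma subr_B u v : R u -> R v -> R (u - v).
Proof. by move=> Ru /subr_N; apply: subr_D. Qed.
Lemma subr_X u n : R u -> R (u ^+ n).
Proof.
by move=> Ru; elim: n => [|n IH]; rewrite ?expr0 ?exprS; [exact: subr_1|exact: subr_M].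
Qed.
Lemma subr_n n : R n%:R.
Proof. by rewrite -(rmorph_nat iota); apply: subr_c. Qed.
Lemma subr_sum (I : Type) (r : seq I) (P : pred I) (F : I -> K) :
  (forall i, P i -> R (F i)) -> R (\sum_(i <- r | P i) F i).
Proof. by move=> H; elim/big_ind: _ => //; [exact: subr_0|exact: subr_D]. Qed.
Lemma subr_prod (I : Type) (r : seq I) (P : pred I) (F : I -> K) :
  (forall i, P i -> R (F i)) -> R (\prod_(i <- r | P i) F i).
Proof. by move=> H; elim/big_ind: _ => //; [exact: subr_1|exact: subr_M]. Qed.
End Subring.

Section Local.
Variables (R M : K -> Prop).
Hypothesis lR : local_ring R M.

Lemma loc_sub : subring R. Proof. by case: lR. Qed.
Lemma loc_R u : M u -> R u. Proof. by case: lR => _ + _ _ _; exact. Qed.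
Lemma loc_0 : M 0. Proof. by case: lR => _ _ []. Qed.
Lemma loc_D u v : M u -> M v -> M (u + v). Proof. by case: lR => _ _ [_ +] _ _; exact. Qed.
Lemma loc_Ml u v : R u -> M v -> M (u * v). Proof. by case: lR => _ _ _ + _; exact. Qed.
Lemma loc_Mr u v : M u -> R v -> M (u * v).
Proof. by move=> Mu Rv; rewrite mulrC; apply: loc_Ml. Qed.
Lemma loc_1 : ~ M 1. Proof. by case: lR => _ _ _ _ []. Qed.
Lemma loc_V u : R u -> ~ M u -> R u^-1. Proof. by case: lR => _ _ _ _ [_]; exact. Qed.
Lemma loc_N u : M u -> M (- u).
Proof. by move=> Mu; rewrite -mulN1r; apply: loc_Ml => //; exact: (subr_N loc_sub (subr_1 loc_sub)). Qed.
Lemma loc_B u v : M u -> M v -> M (u - v).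
Proof. by move=> Mu /loc_N; apply: loc_D. Qed.
Lemma loc_unit u : R u -> R u^-1 -> u != 0 -> ~ M u.
Proof. by move=> _ Rv u0 /(loc_Ml Rv); rewrite mulVf //; apply: loc_1. Qed.
Lemma loc_neq0 u : ~ M u -> u != 0.
Proof. by apply: contra_not_neq => ->; exact: loc_0. Qed.
Lemma loc_c c : c != 0 -> ~ M (iota c).
Proof.
move=> c0; apply: loc_unit; rewrite ?fmorph_eq0 //; first exact: (subr_c loc_sub _).
by rewrite -fmorphV; exact: (subr_c loc_sub _).
Qed.
Lemma loc_1B u : M u -> ~ M (1 - u).
Proof. by move=> Mu /loc_D /(_ Mu); rewrite subrK; exact: loc_1. Qed.
Lemma loc_prime u v : R u -> R v -> M (u * v) -> M u \/ M v.
Proof.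
move=> Ru Rv Muv; case: (classic (M u)) => [|nu]; first by left.
by right; rewrite -(mulKf (loc_neq0 nu) v); apply: loc_Ml => //; apply: loc_V.
Qed.
Lemma loc_XM u n : R u -> M u -> M (u ^+ n.+1).
Proof. by move=> Ru Mu; rewrite exprS; apply: loc_Mr => //; exact: (subr_X loc_sub). Qed.
End Local.

Section Evaluation.
Variable g : seq K.
Local Notation ev := (@evalK k K iota g).

Lemma evalKX i : ev 'X_i = g`_i.
Proof. by rewrite /evalK mmapX mmap1U. Qed.

Lemma evalKB P Q : ev (P - Q) = ev P - ev Q.
Proof. exact: mmapB. Qed.

Lemma evalK1 : ev 1 = 1.
Proof. by rewrite /evalK rmorph1. Qed.

Lemma evalK_sub (R : K -> Prop) : subring R -> (forall i : 'I_(size g), R g`_i) ->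
  forall P, R (ev P).
Proof.
move=> sR Rg; elim/mpolyind => [|c m P _ _ IH].
  by rewrite /evalK mmap0; exact: (subr_0 sR).
rewrite evalKD; apply: (subr_D sR) => //; rewrite -mul_mpolyC evalKM evalKC.
apply: (subr_M sR); first exact: (subr_c sR).
rewrite /evalK mmapX; apply: (subr_prod sR) => i _; exact: (subr_X sR).
Qed.

Lemma evalK_res (R M : K -> Prop) (c : 'I_(size g) -> k) : local_ring R M ->
  (forall i : 'I_(size g), M (g`_i - iota (c i))) ->
  forall P, M (ev P - iota P.@[c]).
Proof.
move=> lR Mg.
have sR := loc_sub lR.
have Rg (i : 'I_(size g)) : R g`_i.
  rewrite -(subrK (iota (c i)) g`_i); apply: (subr_D sR); first exact: (loc_R lR).
  exact: (subr_c sR).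
have MM a b a' b' : R a -> M (a - iota a') -> R b -> M (b - iota b') ->
    M (a * b - iota (a' * b')).
  move=> Ra Ma Rb Mb.
  have -> : a * b - iota (a' * b') = a * (b - iota b') + iota b' * (a - iota a').
    by rewrite rmorphM /=; ring.
  apply: (loc_D lR); apply: (loc_Ml lR) => //; exact: (subr_c sR _).
elim/mpolyind => [|c' m P _ _ IH].
  by rewrite /evalK mmap0 meval0 rmorph0 subr0; exact: (loc_0 lR).
rewrite evalKD mevalD rmorphD /= opprD addrACA; apply: (loc_D lR) => //.
rewrite -mul_mpolyC evalKM evalKC mevalM mevalC; apply: (MM).
- exact: (subr_c sR _).
- by rewrite subrr; exact: (loc_0 lR).
- exact: evalK_sub.
rewrite /evalK mmapX mevalX /mmap1.
suff [] : R (\prod_(i < size g) g`_i ^+ m i) /\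
   M (\prod_(i < size g) g`_i ^+ m i - iota (\prod_(i < size g) c i ^+ m i)) by [].
rewrite rmorph_prod /=; elim/big_rec2: _ => [|i y1 y2 _ [R1 M1]].
  by rewrite subrr; split; [exact: (subr_1 sR)|exact: (loc_0 lR)].
have [R2 M2] : R (g`_i ^+ m i) /\ M (g`_i ^+ m i - iota (c i ^+ m i)).
  elim: (m i) => [|l [IR IM]].
    by rewrite !expr0 rmorph1 subrr; split; [exact: (subr_1 sR)|exact: (loc_0 lR)].
  by rewrite !exprS; split; [exact: (subr_M sR)|exact: (MM)].
split; first exact: (subr_M sR).
have -> : g`_i ^+ m i * y2 - iota (c i ^+ m i) * y1 =
  g`_i ^+ m i * (y2 - y1) + y1 * (g`_i ^+ m i - iota (c i ^+ m i)) by ring.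
apply: (loc_D lR); apply: (loc_Ml lR) => //.
rewrite -(subKr y2 y1); apply: (subr_B sR) => //; exact: (loc_R lR).
Qed.

End Evaluation.

Section Stalks.
Variable cs : seq (seq K).
Implicit Type a : point iota cs.

Lemma evalK_neq0 a (Q : {mpoly k[size (chart a)]}) :
  Q.@[coord a] != 0 -> evalK iota Q != 0.
Proof. by apply: contra_neq => /(@coord_zero _ _ _ _ a). Qed.

Lemma stalk_ev a (P : {mpoly k[size (chart a)]}) : stalk a (evalK iota P).
Proof. by exists P, 1; rewrite meval1 oner_neq0 /evalK rmorph1 divr1. Qed.

Lemma stalk_sub a : subring (stalk a).
Proof.
split=> [c|u v|u v].
- by rewrite -(evalKC iota (chart a) c); exact: stalk_ev.
- move=> [P [Q [Q0 ->]]] [P' [Q' [Q0' ->]]].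
  exists (P * Q' + P' * Q), (Q * Q'); rewrite mevalM mulf_neq0 //; split=> //.
  by rewrite evalKD !evalKM addf_div // evalK_neq0.
- move=> [P [Q [Q0 ->]]] [P' [Q' [Q0' ->]]].
  exists (P * P'), (Q * Q'); rewrite mevalM mulf_neq0 //; split=> //.
  by rewrite !evalKM mulf_div.
Qed.

Lemma maximal_idealP a (P Q : {mpoly k[size (chart a)]}) :
  Q.@[coord a] != 0 -> maximal_ideal a (evalK iota P / evalK iota Q) -> P.@[coord a] = 0.
Proof.
move=> Q0 [P' [Q' [P'0 Q'0 /eqP]]].
rewrite eqr_div ?evalK_neq0 // -!evalKM -subr_eq0 => /eqP.
have -> : evalK iota (P * Q') - evalK iota (P' * Q) = evalK iota (P * Q' - P' * Q).
  by rewrite /evalK rmorphB.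
move/coord_zero; rewrite mevalB !mevalM P'0 mul0r subr0 => /eqP.
by rewrite mulf_eq0 (negPf Q'0) orbF => /eqP.
Qed.

Lemma stalk_local a : local_ring (stalk a) (maximal_ideal a).
Proof.
split; first exact: stalk_sub.
- by move=> u [P [Q [_ Q0 ->]]]; exists P, Q.
- split.
    by exists 0, 1; rewrite meval0 meval1 oner_neq0 /evalK mmap0 mul0r.
  move=> u v [P [Q [P0 Q0 ->]]] [P' [Q' [P0' Q0' ->]]].
  exists (P * Q' + P' * Q), (Q * Q'); rewrite mevalD !mevalM P0 P0' !mul0r addr0.
  by rewrite mulf_neq0 //; split=> //; rewrite evalKD !evalKM addf_div // evalK_neq0.
- move=> u v [P [Q [Q0 ->]]] [P' [Q' [P0' Q0' ->]]].
  exists (P * P'), (Q * Q'); rewrite !mevalM P0' mulr0 mulf_neq0 //; split=> //.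
  by rewrite !evalKM mulf_div.
- split=> [|u [P [Q [Q0 ->]]] nM].
    move=> M1; have := @maximal_idealP a 1 1; rewrite !meval1 /evalK rmorph1 divr1.
    by move=> /(_ (oner_neq0 _) M1) /eqP; rewrite oner_eq0.
  have [P0|P0] := eqVneq P.@[coord a] 0; first by case: nM; exists P, Q.
  by exists Q, P; rewrite invf_div.
Qed.

Lemma stalk_residue a : residue_k (stalk a) (maximal_ideal a).
Proof.
move=> _ [P [Q [Q0 ->]]]; exists (P.@[coord a] / Q.@[coord a]).
exists (P - (P.@[coord a] / Q.@[coord a])%:MP * Q), Q; split=> //.
  by rewrite mevalB mevalM mevalC divfK // subrr.
by rewrite evalKB evalKM evalKC mulrBl mulfK // evalK_neq0.
Qed.

Lemma chart_stalk a (i : 'I_(size (chart a))) : stalk a (chart a)`_i.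
Proof. by rewrite -(evalKX i); exact: stalk_ev. Qed.

Lemma chart_max a (i : 'I_(size (chart a))) :
  maximal_ideal a ((chart a)`_i - iota (coord a i)).
Proof.
exists ('X_i - (coord a i)%:MP), 1; rewrite mevalB mevalXU mevalC subrr meval1 oner_neq0.
by rewrite evalKB evalKX evalKC evalK1 divr1.
Qed.

(* Universal property: [stalk a] is the smallest local ring of K in which the  *)
(* generators of the chart take the prescribed residues.                       *)
Lemma stalk_min a (R M : K -> Prop) : local_ring R M ->
  (forall i : 'I_(size (chart a)), M ((chart a)`_i - iota (coord a i))) ->
  (forall h, stalk a h -> R h) /\ (forall h, maximal_ideal a h -> M h).
Proof.
move=> lR Mg; have sR := loc_sub lR.
have Rg (i : 'I_(size (chart a))) : R (chart a)`_i.
  rewrite -(subrK (iota (coord a i)) (chart a)`_i).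
  apply: (subr_D sR); first exact: (loc_R lR).
  exact: (subr_c sR).
have RQ (Q : {mpoly k[size (chart a)]}) : Q.@[coord a] != 0 -> R (evalK iota Q)^-1.
  move=> Q0; apply: (loc_V lR); first exact: evalK_sub.
  move=> MQ; have := loc_B lR MQ (evalK_res lR Mg Q); rewrite subKr.
  exact: (loc_c lR).
split=> h; first by move=> [P [Q [Q0 ->]]]; apply: (subr_M sR); [exact: evalK_sub|exact: RQ].
move=> [P [Q [P0 Q0 ->]]]; apply: (loc_Mr lR); last exact: RQ.
by have := evalK_res lR Mg P; rewrite P0 rmorph0 subr0.
Qed.

End Stalks.

End LocalRings.
Arguments stalk_residue {k K iota cs} a [u] _.
Arguments stalk_ev {k K iota cs} a P.
Arguments chart_stalk {k K iota cs} a i.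
Arguments chart_max {k K iota cs} a i.

(** Uniqueness of expansions in base M; in the Kronecker substitution below it keeps distinct
    monomials distinct. *)
Lemma digits_inj (M n : nat) (f g : nat -> nat) :
  (forall i, i < n -> f i < M /\ g i < M)%N ->
  (\sum_(i < n) f i * M ^ i = \sum_(i < n) g i * M ^ i)%N ->
  forall i, (i < n)%N -> f i = g i.
Proof.
have lt h m : (forall i, i < m -> h i < M)%N -> (\sum_(i < m) h i * M ^ i < M ^ m)%N.
  elim: m => [|m IH] H; first by rewrite big_ord0.
  rewrite big_ord_recr /= expnS; have lt := IH (fun i im => H i (ltnW im)).
  apply: (@leq_trans ((h m).+1 * M ^ m)); first by rewrite mulSn ltn_add2r.
  by rewrite leq_mul2r H ?orbT.
elim: n => [|n IH] H //.
rewrite !big_ord_recr /=.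
have lf := lt f n (fun i im => (H i (ltnW im)).1).
have lg := lt g n (fun i im => (H i (ltnW im)).2).
move=> E; have Mn : (0 < M ^ n)%N by case: (M ^ n)%N lf.
have En : f n = g n.
  have := congr1 (divn^~ (M ^ n)%N) E.
  by rewrite /= ![(\sum_(i < n) _ + _)%N]addnC !divnMDl // !divn_small ?addn0.
move: E; rewrite En => /addIn /IH {}IH i.
rewrite ltnS leq_eqVlt => /predU1P [-> //|]; apply: IH => j jn; exact: H (ltnW jn).
Qed.

(* Kronecker substitution X_i := X^(M^i), with M above all the exponents. *)
Lemma mpoly_nonroot (k : closedFieldType) (n : nat) (P : {mpoly k[n]}) :
  P != 0 -> exists c, P.@[c] != 0.
Proof.
move=> P0.
pose M := msize P.
pose W (m : 'X_{1..n}) := (\sum_(i < n) m i * M ^ i)%N.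
pose q := \sum_(m <- msupp P) P@_m *: 'X^(W m) : {poly k}.
have lm m (i : 'I_n) : m \in msupp P -> (m i < M)%N.
  move=> /msize_mdeg_lt; apply: leq_ltn_trans.
  by rewrite mdegE (bigD1 i) //= leq_addr.
have Winj m m' : m \in msupp P -> m' \in msupp P -> W m = W m' -> m = m'.
  move=> mP mP' E.
  pose f (m : 'X_{1..n}) j := if insub j is Some i then m (i : 'I_n) else 0%N.
  have fE (m1 : 'X_{1..n}) : W m1 = (\sum_(i < n) f m1 i * M ^ i)%N.
    by apply: eq_bigr => i _; rewrite /f valK.
  have := @digits_inj M n (f m) (f m') _ _.
  rewrite -!fE => /(_ _ E) H; apply/mnmP => i.
  have -> : m i = f m i by rewrite /f valK.
  have -> : m' i = f m' i by rewrite /f valK.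
  apply: H => // j jn; rewrite /f insubT /=; split; exact: lm.
have q0 : q != 0.
  move: P0; rewrite -msupp_eq0; case E: (msupp P) => [|m0 s] // _.
  have m0P : m0 \in msupp P by rewrite E mem_head.
  apply/eqP => /(congr1 (fun p : {poly k} => p`_(W m0))).
  rewrite coef0 coef_sum (bigD1_seq m0) ?msupp_uniq //= coefZ coefXn eqxx mulr1.
  rewrite big_seq_cond big1 ?addr0 => [/eqP|m /andP [mP mn]].
    by rewrite mcoeff_eq0 m0P.
  rewrite coefZ coefXn; case: eqP => [/esym/Winj|_]; last by rewrite mulr0.
  by move=> /(_ mP m0P) E'; rewrite E' eqxx in mn.
have /closed_nonrootP [y yq] := q0.
exists (fun i => y ^+ (M ^ i)); apply: contra yq.
rewrite rootE mevalE /q horner_sum => /eqP E; apply/eqP; rewrite -[RHS]E.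
apply: eq_bigr => m _; rewrite hornerZ hornerXn; congr (_ * _).
by rewrite /W expr_sum; apply: eq_bigr => i _; rewrite -exprM mulnC.
Qed.

Lemma mnm_subrr n (m : 'X_{1..n}) : (m - m)%MM = 0%MM.
Proof. by apply/mnmP=> j; rewrite mnmBE subnn mnm0E. Qed.

(** * Derivations and partial derivatives of K *)

Section Derivations.
Variables (k : closedFieldType) (K : fieldType) (iota : {rmorphism k -> K}).

Definition der (D : K -> K) :=
  [/\ forall u v, D (u + v) = D u + D v,
      forall u v, D (u * v) = u * D v + v * D u &
      forall c, D (iota c) = 0].

Section Laws.
Variable D : K -> K.
Hypothesis dD : der D.

Lemma der_D u v : D (u + v) = D u + D v. Proof. by case: dD. Qed.
Lemma der_M u v : D (u * v) = u * D v + v * D u. Proof. by case: dD. Qed.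
Lemma der_c c : D (iota c) = 0. Proof. by case: dD. Qed.
Lemma der_0 : D 0 = 0. Proof. by have := der_c 0; rewrite rmorph0. Qed.
Lemma der_1 : D 1 = 0. Proof. by have := der_c 1; rewrite rmorph1. Qed.
Lemma der_N u : D (- u) = - D u.
Proof. by apply/eqP; rewrite -addr_eq0 addrC -der_D subrr der_0. Qed.
Lemma der_B u v : D (u - v) = D u - D v. Proof. by rewrite der_D der_N. Qed.
Lemma der_cM c u : D (iota c * u) = iota c * D u.
Proof. by rewrite der_M der_c mulr0 addr0. Qed.
Lemma der_V u : u != 0 -> D u^-1 = - D u / u ^+ 2.
Proof.
move=> u0; have := der_M u u^-1; rewrite divff // der_1 => /esym/eqP.
rewrite addr_eq0 => /eqP H; apply: (mulfI u0); rewrite H; field.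
by [].
Qed.
Lemma der_div u v : v != 0 -> D (u / v) = (D u - u / v * D v) / v.
Proof. by move=> v0; rewrite der_M der_V //; field. Qed.
Lemma der_X u n : D (u ^+ n.+1) = n.+1%:R * u ^+ n * D u.
Proof.
elim: n => [|n IH]; first by rewrite expr1 expr0 !mul1r.
by rewrite exprS der_M IH !exprS -[n.+2]addn1 natrD; ring.
Qed.
Lemma der_sum (I : Type) (r : seq I) (P : pred I) (F : I -> K) :
  D (\sum_(i <- r | P i) F i) = \sum_(i <- r | P i) D (F i).
Proof. exact: (big_morph D der_D der_0). Qed.

Lemma der_evalK (g : seq K) (P : {mpoly k[size g]}) :
  D (evalK iota P) = \sum_(i < size g) evalK iota P^`M(i) * D g`_i.
Proof.
pose L (P : {mpoly k[size g]}) := \sum_(i < size g) evalK iota P^`M(i) * D g`_i.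
rewrite -/(L P).
have LD p q : L (p + q) = L p + L q.
  by rewrite -big_split; apply: eq_bigr => i _; rewrite mderivD evalKD mulrDl.
have LC c : L c%:MP = 0.
  by rewrite /L big1 // => i _; rewrite mderivC /evalK mmap0 mul0r.
have LM p q : L (p * q) = evalK iota p * L q + evalK iota q * L p.
  rewrite /L !mulr_sumr -big_split; apply: eq_bigr => i _ /=.
  by rewrite mderivM evalKD !evalKM; ring.
have LX i : L 'X_i = D g`_i.
  rewrite /L (bigD1 i) //= mderivX mnm1E eqxx /= mnm_subrr mpolyX0 scale1r evalK1 mul1r.
  rewrite big1 ?addr0 // => j ji; rewrite mderivX mnm1E eq_sym (negPf ji) scale0r.
  by rewrite /evalK mmap0 mul0r.
elim/mpolyind: P => [|c m P _ _ IH].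
  by rewrite -(rmorph0 (@mpolyC (size g) k)) evalKC der_c LC.
rewrite evalKD der_D LD IH; congr (_ + _).
rewrite -mul_mpolyC evalKM evalKC LM LC mulr0 addr0 der_cM evalKC; congr (_ * _).
rewrite mpolyXE_id; elim/big_rec: _ => [|i p _ IHp].
  by rewrite evalK1 der_1 -mpolyC1 LC.
rewrite evalKM der_M LM IHp; congr (_ + _ * _).
elim: (m i) => [|l IHl]; first by rewrite expr0 evalK1 der_1 -mpolyC1 LC.
by rewrite !exprS evalKM der_M LM IHl evalKX LX.
Qed.
End Laws.

Section Partial.
Variable tau : seq K.
Hypothesis indep : alg_indep iota tau.
Hypothesis gen : generates iota tau.
Local Notation ev := (@evalK k K iota tau).
Local Notation n := (size tau).

(** The quotient rule without division, so that one value serves all presentations of h. Two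
    presentations give the same value because [P * Q0 = P0 * Q] holds already between polynomials,
    by independence of [tau]. *)
Lemma partial_exists (i : 'I_n) h : exists e, forall P Q : {mpoly k[n]},
  ev P = h * ev Q -> ev P^`M(i) = e * ev Q + h * ev Q^`M(i).
Proof.
have [P0 [Q0 [Q00 ->]]] := gen h.
exists ((ev P0^`M(i) - ev P0 / ev Q0 * ev Q0^`M(i)) / ev Q0) => P Q E.
have /(congr1 (fun p => ev p^`M(i))) : P * Q0 = P0 * Q.
  apply/eqP; rewrite -subr_eq0; apply/eqP/indep.
  by rewrite evalKB !evalKM E mulrAC divfK // subrr.
rewrite !mderivM !evalKD !evalKM => H.
apply: (mulIf Q00); apply/eqP; rewrite -subr_eq0; apply/eqP.
have -> : ev P^`M(i) * ev Q0 =
  ev P0^`M(i) * ev Q + ev P0 * ev Q^`M(i) - ev P * ev Q0^`M(i) by rewrite -H addrK.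
by rewrite E; field.
Qed.

Definition partial (i : 'I_n) (h : K) : K :=
  proj1_sig (constructive_indefinite_description _ (partial_exists i h)).

Lemma partialP i h (P Q : {mpoly k[n]}) :
  ev P = h * ev Q -> ev P^`M(i) = partial i h * ev Q + h * ev Q^`M(i).
Proof. exact: (proj2_sig (constructive_indefinite_description _ (partial_exists i h))). Qed.

Lemma partial_ev i P : partial i (ev P) = ev P^`M(i).
Proof.
have := @partialP i (ev P) P 1; rewrite evalK1 mulr1 => /(_ erefl).
by rewrite -mpolyC1 mderivC /evalK mmap0 mulr0 addr0 mulr1.
Qed.

Lemma partial_der i : der (partial i).
Proof.
split=> [u v|u v|c]; last by rewrite -(evalKC iota tau) partial_ev mderivC /evalK mmap0.
- have [P [Q [Q0 Eu]]] := gen u; have [P' [Q' [Q0' Ev]]] := gen v.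
  have H := @partialP i (u + v) (P * Q' + P' * Q) (Q * Q').
  have H1 := @partialP i u P Q; have H2 := @partialP i v P' Q'.
  have E1 : ev P = u * ev Q by rewrite Eu divfK.
  have E2 : ev P' = v * ev Q' by rewrite Ev divfK.
  move: H; rewrite mderivD !mderivM !evalKD !evalKM (H1 E1) (H2 E2) E1 E2.
  move=> H; apply: (mulIf (mulf_neq0 Q0 Q0')); apply: (addIr ((u + v) * (ev Q^`M(i) * ev Q' + ev Q * ev Q'^`M(i)))).
  rewrite -H; ring.
- have [P [Q [Q0 Eu]]] := gen u; have [P' [Q' [Q0' Ev]]] := gen v.
  have H := @partialP i (u * v) (P * P') (Q * Q').
  have H1 := @partialP i u P Q; have H2 := @partialP i v P' Q'.
  have E1 : ev P = u * ev Q by rewrite Eu divfK.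
  have E2 : ev P' = v * ev Q' by rewrite Ev divfK.
  move: H; rewrite !mderivM !evalKD !evalKM (H1 E1) (H2 E2) E1 E2.
  move=> H; apply: (mulIf (mulf_neq0 Q0 Q0')); apply: (addIr ((u * v) * (ev Q^`M(i) * ev Q' + ev Q * ev Q'^`M(i)))).
  rewrite -H; ring.
Qed.

Lemma partial_tau (i j : 'I_n) : partial i tau`_j = (i == j)%:R.
Proof.
rewrite -(evalKX iota j) partial_ev mderivX mnm1E; case: (eqVneq i j) => [->|ne].
  by rewrite ?eqxx mnm_subrr mpolyX0 scale1r evalK1.
by rewrite 1?eq_sym ?(negPf ne) scale0r /evalK mmap0.
Qed.

Lemma der_partial D : der D -> forall h, D h = \sum_(i < n) D tau`_i * partial i h.
Proof.
move=> dD h; have [P [Q [Q0 E]]] := gen h.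
have EP : ev P = h * ev Q by rewrite E divfK.
have := congr1 D EP; rewrite (der_M dD) !(der_evalK dD) => H.
apply: (mulfI Q0); apply: (addrI (h * \sum_(i < n) ev Q^`M(i) * D tau`_i)).
rewrite -H mulr_sumr mulr_sumr -big_split; apply: eq_bigr => i _ /=.
by rewrite (partialP i EP); ring.
Qed.

End Partial.
End Derivations.

(** * Nakayama's lemma *)

Section Nakayama.
Variables (k : closedFieldType) (K : fieldType) (iota : {rmorphism k -> K}).
Variables (R M : K -> Prop) (V : lmodType K).
Hypothesis lR : local_ring iota R M.

(** The sum C l + N, with the coefficients taken off one generator at a time. *)
Fixpoint comb (C : K -> Prop) (N : V -> Prop) (l : seq V) (y : V) : Prop :=
  if l is x :: l' then exists c, C c /\ comb C N l' (y - c *: x) else N y.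

Variable N : V -> Prop.
Hypothesis N0 : N 0.
Hypothesis ND : forall x y, N x -> N y -> N (x + y).
Hypothesis NZ : forall c x, R c -> N x -> N (c *: x).

Lemma comb_D (C : K -> Prop) l x y : (forall u v, C u -> C v -> C (u + v)) ->
  comb C N l x -> comb C N l y -> comb C N l (x + y).
Proof.
move=> CD; elim: l x y => [|z l IH] x y /=; first exact: ND.
move=> [c [Cc Hc]] [c' [Cc' Hc']]; exists (c + c'); split; first exact: CD.
by rewrite scalerDl opprD addrACA; apply: IH.
Qed.

Lemma comb_Z (C C' : K -> Prop) a l x : R a -> (forall u, C u -> C' (a * u)) ->
  comb C N l x -> comb C' N l (a *: x).
Proof.
move=> Ra CZ; elim: l x => [|z l IH] x /=; first exact: NZ.
move=> [c [Cc Hc]]; exists (a * c); split; first exact: CZ.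
by rewrite -scalerA -scalerBr; apply: IH.
Qed.

Lemma comb_N (C : K -> Prop) l x : C 0 -> N x -> comb C N l x.
Proof.
by move=> C0; elim: l x => [|z l IH] x //= Nx; exists 0; rewrite scale0r subr0; split=> //; apply: IH.
Qed.

Lemma comb_mem (C : K -> Prop) l x : C 0 -> C 1 -> x \in l -> comb C N l x.
Proof.
move=> C0 C1; elim: l => [|z l IH] //=; rewrite inE => /predU1P [->|xl].
  by exists 1; rewrite scale1r subrr; split=> //; apply: comb_N.
by exists 0; rewrite scale0r subr0; split=> //; apply: IH.
Qed.

Lemma comb_in (C : K -> Prop) l y : (forall c, C c -> R c) ->
  (forall x, x \in l -> N x) -> comb C N l y -> N y.
Proof.
move=> CR; elim: l y => [|z l IH] y //= Nl [c [Cc Hc]].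
rewrite -(subrK (c *: z) y); apply: ND.
  by apply: IH => // x xl; apply: Nl; rewrite inE xl orbT.
by apply: NZ; [exact: CR|apply: Nl; rewrite mem_head].
Qed.

(** The first generator z satisfies (1 - m) z in M l' + N, where l' is the rest and 1 - m is a unit;
    so z can be eliminated, and the induction is on the number of generators. *)
Lemma nakayama l : (forall x, x \in l -> comb M N l x) -> forall x, x \in l -> N x.
Proof.
have MD : forall u v, M u -> M v -> M (u + v) by exact: (loc_D lR).
elim: l => [|z l IH] H //.
have [m [Mm Hm]] := H z (mem_head _ _).
have Hz : comb M N l z.
  have -> : z = (1 - m)^-1 *: (z - m *: z).
    rewrite -{2}(scale1r z) -scalerBl scalerA mulVf ?scale1r //.
    exact: (loc_neq0 lR (loc_1B lR Mm)).
  have Ri : R (1 - m)^-1.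
    apply: (loc_V lR); last exact: (loc_1B lR).
    by apply: (subr_B (loc_sub lR)); [exact: (subr_1 (loc_sub lR))|exact: (loc_R lR)].
  by apply: comb_Z Hm => // u; apply: (loc_Ml lR).
have Nl x : x \in l -> N x.
  apply: IH => y yl; have [|c [Mc Hc]] := H y; first by rewrite inE yl orbT.
  rewrite -(subrK (c *: z) y); apply: comb_D => //.
  by apply: comb_Z Hz => [|u Mu]; [exact: (loc_R lR)|apply: (loc_Ml lR) => //; exact: (loc_R lR)].
move=> x; rewrite inE => /predU1P [->|/Nl //].
by apply: comb_in Nl Hz => c; apply: (loc_R lR).
Qed.

End Nakayama.

(** * Differentials at a regular point *)

Section Cotangent.
Variables (k : closedFieldType) (K : fieldType) (iota : {rmorphism k -> K}).
Variable tau : seq K.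
Hypothesis indep : alg_indep iota tau.
Hypothesis gen : generates iota tau.
Variables (cs : seq (seq K)) (a : point iota cs) (s t : K).
Hypothesis st : forall h,
  maximal_ideal a h <-> exists u v, [/\ stalk a u, stalk a v & h = u * s + v * t].
Local Notation n := (size tau).
Local Notation O := (stalk a).
Local Notation M := (maximal_ideal a).

Let d h : 'rV[K]_n := \row_i partial indep gen i h.
Let lO : local_ring iota O M := stalk_local a.
Let sO : subring iota O := stalk_sub a.
Let dd := fun i => partial_der indep gen i.

Let dD u v : d (u + v) = d u + d v.
Proof. by apply/rowP => i; rewrite !mxE (der_D (dd i)). Qed.
Let dM u v : d (u * v) = u *: d v + v *: d u.
Proof. by apply/rowP => i; rewrite !mxE (der_M (dd i)). Qed.
Let dc c : d (iota c) = 0.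
Proof. by apply/rowP => i; rewrite !mxE (der_c (dd i)). Qed.
Let ddiv u v : v != 0 -> d (u / v) = v^-1 *: (d u - (u / v) *: d v).
Proof. by move=> v0; apply/rowP => i; rewrite !mxE (der_div (dd i)) // mulrC. Qed.

Let N (y : 'rV[K]_n) := exists u v, [/\ O u, O v & y = u *: d s + v *: d t].

Let N0 : N 0.
Proof. by exists 0, 0; rewrite !scale0r addr0; split=> //; exact: (subr_0 sO). Qed.
Let ND x y : N x -> N y -> N (x + y).
Proof.
move=> [u [v [Ou Ov ->]]] [u' [v' [Ou' Ov' ->]]]; exists (u + u'), (v + v').
by rewrite !scalerDl addrACA; split=> //; apply: (subr_D sO).
Qed.
Let NZ c x : O c -> N x -> N (c *: x).
Proof.
move=> Oc [u [v [Ou Ov ->]]]; exists (c * u), (c * v).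
by rewrite scalerDr !scalerA; split=> //; apply: (subr_M sO).
Qed.

Let l := [seq d x | x <- chart a].

Let combO h : O h -> comb O N l (d h).
Proof.
have OD : forall u v, O u -> O v -> O (u + v) by exact: (subr_D sO).
have OM : forall u v, O u -> O v -> O (u * v) by exact: (subr_M sO).
have O0 := subr_0 sO.
pose T h := O h /\ comb O N l (d h).
have sT : subring iota T.
  split=> [c|u v [Ou Tu] [Ov Tv]|u v [Ou Tu] [Ov Tv]].
  - by split; [exact: (subr_c sO)|rewrite dc; apply: comb_N].
  - by split; [exact: OD|rewrite dD; apply: comb_D].
  split; first exact: OM.
  rewrite dM; apply: comb_D => //; [apply: (comb_Z NZ Ou _ Tv)|apply: (comb_Z NZ Ov _ Tu)] => w;
    exact: OM.
have TX (i : 'I_(size (chart a))) : T (chart a)`_i.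
  split; first exact: chart_stalk.
  apply: comb_mem => //; first exact: (subr_1 sO).
  by apply: map_f; apply: mem_nth.
have Tev := evalK_sub sT TX.
move=> [P [Q [Q0 ->]]].
have [_ TP] := Tev P; have [_ TQ] := Tev Q.
have q0 := evalK_neq0 Q0.
have OV : O (evalK iota Q)^-1 by exists 1, Q; rewrite evalK1 div1r.
rewrite ddiv // -scaleNr.
apply: (comb_Z NZ OV (C := O)); first by move=> u; apply: OM.
have OPQ : O (- (evalK iota P / evalK iota Q)).
  by apply: (subr_N sO); apply: OM => //; exact: stalk_ev.
by apply: (comb_D ND) => //; apply: (comb_Z NZ OPQ _ TQ) => u; exact: OM.
Qed.

(** The differentials of the chart functions x generate all those of O. From x - c = u s + v t
    follows dx = u ds + v dt + s du + t dv, where the last two terms lie in M times the module of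
    differentials; Nakayama removes them. *)
Lemma cotangent_row h : O h -> N (d h).
Proof.
move=> Oh; apply: (comb_in ND NZ (C := O)) (combO Oh) => //.
apply: (nakayama lO ND NZ) => _ /mapP [x /(nthP 0) [j jl <-] ->].
have Mx := chart_max a (Ordinal jl).
have /st [u [v [Ou Ov E]]] := Mx.
have Ms : M s by apply/st; exists 1, 0; rewrite mul1r mul0r addr0; split=> //; [exact: (subr_1 sO)|exact: (subr_0 sO)].
have Mt : M t by apply/st; exists 0, 1; rewrite mul1r mul0r add0r; split=> //; [exact: (subr_0 sO)|exact: (subr_1 sO)].
have -> : d (chart a)`_j = (u *: d s + v *: d t) + (s *: d u + t *: d v).
  rewrite -[LHS]subr0 -(dc (coord a (Ordinal jl))) -[LHS]addr0.
  have dB u1 v1 : d u1 - d v1 = d (u1 - v1).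
    by apply/rowP => i; rewrite !mxE (der_B (dd i)).
  by rewrite addr0 dB E dD !dM addrACA.
have MD : forall u v, M u -> M v -> M (u + v) by exact: (loc_D lO).
apply: (comb_D ND) => //.
  by apply: comb_N; [exact: (loc_0 lO)|exists u, v].
apply: (comb_D ND) => //.
  by apply: (comb_Z NZ (loc_R lO Ms) _ (combO Ou)) => w; exact: (loc_Mr lO).
by apply: (comb_Z NZ (loc_R lO Mt) _ (combO Ov)) => w; exact: (loc_Mr lO).
Qed.

Lemma cotangent h : O h -> exists u v, [/\ O u, O v &
  forall i, partial indep gen i h = u * partial indep gen i s + v * partial indep gen i t].
Proof.
move=> /cotangent_row [u [v [Ou Ov E]]]; exists u, v; split=> // i.
by have := congr1 (fun y : 'rV[K]_n => y ord0 i) E; rewrite !mxE.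
Qed.

Lemma cotangentK : generates iota (chart a) -> forall h, exists u v, forall i,
  partial indep gen i h = u * partial indep gen i s + v * partial indep gen i t.
Proof.
move=> ga h; have [P [Q [Q0 ->]]] := ga h.
have [u [v [_ _ E]]] := cotangent (stalk_ev a P).
have [u' [v' [_ _ E']]] := cotangent (stalk_ev a Q).
set p := evalK iota P in E *; set q := evalK iota Q in Q0 E' *.
exists ((u - p / q * u') / q), ((v - p / q * v') / q) => i.
by rewrite (der_div (dd i)) // E E'; field.
Qed.

(** The differentials of the coordinates [tau] are the unit row vectors and are combinations of ds
    and dt: the identity matrix factors through K^2. *)
Lemma regular_point_size : generates iota (chart a) -> (size tau <= 2)%N.
Proof.
move=> ga.
pose B : 'M[K]_(2, n) := \matrix_(j, i) partial indep gen i (if j == 0 then s else t).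
have H (j : 'I_n) : exists w : 'rV[K]_2, w *m B = row j 1%:M.
  have [u [v E]] := cotangentK ga tau`_j.
  exists (\row_i if i == 0 then u else v); apply/rowP => i.
  by rewrite !mxE !big_ord_recl big_ord0 !mxE /= addr0 -E partial_tau eq_sym.
have [W EW] : exists W : 'M[K]_(n, 2), W *m B = 1%:M.
  exists (\matrix_j proj1_sig (constructive_indefinite_description _ (H j))).
  apply/row_matrixP => j; rewrite row_mul rowK.
  by case: constructive_indefinite_description.
have := mxrankM_maxr W B; rewrite EW mxrank1 => /leq_trans; apply; exact: rank_leq_row.
Qed.

End Cotangent.

(** * Transcendence degree one *)

Section Rational.
Variables (k : closedFieldType) (K : fieldType) (iota : {rmorphism k -> K}).

(* Two elements P1/Q and P2/Q of k(y) are dependent: clearing denominators, the *)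
(* N^2 monomials of degree < N in each variable live in a space of polynomials  *)
(* of dimension O(N).                                                           *)
Lemma trdeg1_dependent (y : K) (t : seq K) :
  (forall h, exists P Q : {poly k}, (map_poly iota Q).[y] != 0 /\
     h = (map_poly iota P).[y] / (map_poly iota Q).[y]) ->
  size t = 2 -> ~ alg_indep iota t.
Proof.
move=> gen; case: t => [|t1 [|t2 [|//]]] // _ indep.
pose e (P : {poly k}) := (map_poly iota P).[y].
have eM P Q : e (P * Q) = e P * e Q by rewrite /e rmorphM hornerM.
have eX P n : e (P ^+ n) = e P ^+ n by rewrite /e rmorphXn horner_exp.
have [P1 [Q1 [Q10 E1]]] := gen t1; have [P2 [Q2 [Q20 E2]]] := gen t2.
rewrite -!/(e _) in Q10 Q20 E1 E2.
pose R1 := P1 * Q2; pose R2 := P2 * Q1; pose Q := Q1 * Q2.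
have eQ0 : e Q != 0 by rewrite eM mulf_neq0.
have F1 : t1 * e Q = e R1 by rewrite E1 /Q /R1 !eM; field.
have F2 : t2 * e Q = e R2 by rewrite E2 /Q /R2 !eM; field.
clearbody R1 R2 Q.
pose D := maxn (size R1) (maxn (size R2) (size Q)).
(* Multiplied by Q^(2N), each monomial t1^i t2^j with i, j < N becomes a polynomial in y of degree
   at most 2ND. The choice N = 2D + 2 makes N^2 exceed the dimension 2ND + 1. *)
pose N := (2 * D + 2)%N; pose L := (2 * N * D).+1.
have sX (P : {poly k}) n : (size P <= D)%N -> (size (P ^+ n) <= (n * D).+1)%N.
  move=> PD; apply: leq_trans (size_poly_exp_leq _ _) _; rewrite ltnS mulnC leq_mul2l.
  by rewrite (leq_trans (leq_pred _) PD) orbT.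
pose p (i : 'I_(N * N)) := R1 ^+ (i %/ N) * (R2 ^+ (i %% N) * Q ^+ (2 * N - i %/ N - i %% N)).
have N0 : (0 < N)%N by rewrite /N addn2.
have dN (i : 'I_(N * N)) : (i %/ N < N)%N by rewrite ltn_divLR.
have mN (i : 'I_(N * N)) : (i %% N < N)%N by rewrite ltn_mod.
have sp i : (size (p i) <= L)%N.
  have h1 : (size R1 <= D)%N by rewrite leq_max leqnn.
  have h2 : (size R2 <= D)%N by rewrite !leq_max leqnn !orbT.
  have h3 : (size Q <= D)%N by rewrite !leq_max leqnn !orbT.
  have sM (q1 q2 : {poly k}) a b : (size q1 <= a.+1 -> size q2 <= b.+1 -> size (q1 * q2)%R <= (a + b).+1)%N.
    by move=> s1 s2; apply: leq_trans (size_polyMleq _ _) _; lia.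
  apply: leq_trans (sM _ _ _ _ (sX _ _ h1) (sM _ _ _ _ (sX _ _ h2) (sX _ _ h3))) _.
  have := dN i; have := mN i; rewrite /L ltnS -!mulnDl leq_mul2r; lia.
pose A : 'M[k]_(N * N, L) := \matrix_i poly_rV (p i).
have [v v0 vA] : exists2 v : 'rV_(N * N), v != 0 & v *m A = 0.
  have : (\rank A < N * N)%N.
    apply: leq_ltn_trans (rank_leq_col _) _; rewrite /L /N; nia.
  rewrite -subn_gt0 -mxrank_ker lt0n mxrank_eq0 => /rowV0Pn [v /sub_kermxP vA v0].
  by exists v.
pose i0 : 'I_2 := ord0; pose i1 : 'I_2 := lift ord0 ord0.
pose m (i : 'I_(N * N)) : 'X_{1..2} :=
  (U_(i0) *+ (i %/ N) + U_(i1) *+ (i %% N))%MM.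
have m0 i : m i i0 = (i %/ N)%N.
  by rewrite mnmDE !mulmnE !mnm1E /= ?mul1n ?mul0n ?muln1 ?muln0 addn0.
have m1 i : m i i1 = (i %% N)%N.
  by rewrite mnmDE !mulmnE !mnm1E /= ?mul1n ?mul0n ?muln1 ?muln0 add0n.
have minj : injective m.
  move=> i j E; apply: val_inj; rewrite /= (divn_eq i N) (divn_eq j N).
  by rewrite -!m0 -!m1 E.
pose P : {mpoly k[2]} := \sum_i v 0 i *: 'X_[m i].
have P0 : P = 0.
  apply: (indep P).
  apply: (mulIf (expf_neq0 (2 * N) eQ0)); rewrite mul0r.
  have -> : @evalK _ _ iota [:: t1; t2] P = \sum_i iota (v 0 i) * (t1 ^+ (i %/ N) * t2 ^+ (i %% N)).
    rewrite /evalK /P raddf_sum /=; apply: eq_bigr => i _.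
    rewrite -mul_mpolyC rmorphM /= mmapC mmapX /mmap1 !big_ord_recl big_ord0 mulr1.
    by rewrite m0 m1.
  have E0 : e (\sum_i v 0 i *: p i) = 0.
    suff -> : \sum_i v 0 i *: p i = rVpoly (v *m A) by rewrite vA raddf0 /e rmorph0 horner0.
    rewrite mulmx_sum_row raddf_sum /=; apply: eq_bigr => i _.
    by rewrite rowK linearZ /= poly_rV_K.
  rewrite -[RHS]E0.
  have -> : e (\sum_i v 0 i *: p i) = \sum_i iota (v 0 i) * e (p i).
    by rewrite /e raddf_sum /= horner_sum; apply: eq_bigr => i _; rewrite map_polyZ hornerZ.
  rewrite mulr_suml; apply: eq_bigr => i _.
  rewrite /p !eM !eX -F1 -F2 !exprMn -mulrA; congr (_ * _).
  have := dN i; have := mN i; move: (i %/ N)%N (i %% N)%N => a b bN aN.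
  have -> : e Q ^+ (2 * N) = e Q ^+ a * (e Q ^+ b * e Q ^+ (2 * N - a - b)).
    by rewrite -!exprD; congr (_ ^+ _); lia.
  by move: (_ ^+ (2 * N - a - b)) (_ ^+ a) (_ ^+ b) (_ ^+ a) (_ ^+ b) => c1 c2 c3 c4 c5; ring.
move/negP: v0; apply; apply/eqP/rowP => i; rewrite mxE.
have := congr1 (fun q : {mpoly k[2]} => q@_(m i)) P0.
rewrite mcoeff0 /P raddf_sum (bigD1 i) //= mcoeffZ mcoeffX eqxx mulr1 big1 ?addr0 // => j ji.
by rewrite mcoeffZ mcoeffX (inj_eq minj) (negPf ji) mulr0.
Qed.

End Rational.

(** * Centres of local rings and generic points *)

Section Center.
Variables (k : closedFieldType) (K : fieldType) (iota : {rmorphism k -> K}).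

(** The centre is given by the residues of the generators of g. A relation between the generators
    takes there a value c in k whose image lies in M, so c = 0. *)
Lemma center (R M : K -> Prop) (cs : seq (seq K)) g : local_ring iota R M ->
  residue_k iota R M -> g \in cs -> (forall h, h \in g -> R h) ->
  exists a : point iota cs, [/\ forall h, stalk a h -> R h,
    forall h, maximal_ideal a h -> M h &
    forall P Q : {mpoly k[size g]}, evalK iota Q != 0 -> R (evalK iota Q)^-1 ->
      stalk a (evalK iota P / evalK iota Q)].
Proof.
move=> lR res gcs Rg.
have gb (j : 'I_(size g)) : exists y, M (g`_j - iota y) by apply/res/Rg/mem_nth.
pose y j := proj1_sig (constructive_indefinite_description _ (gb j)).
have yE (j : 'I_(size g)) : M (g`_j - iota (y j)).
  exact: proj2_sig (constructive_indefinite_description _ (gb j)).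
have y0 (P : {mpoly k[size g]}) : evalK iota P = 0 -> P.@[y] = 0.
  move=> E; have := evalK_res lR yE P; rewrite E sub0r => /(loc_N lR); rewrite opprK.
  by apply: contraPeq => /(loc_c lR).
have [sa ma] := @stalk_min _ _ _ _ (Point gcs y0) _ _ lR yE.
exists (Point gcs y0); split=> // P Q Q0 RQ; exists P, Q; split=> //.
apply/eqP => /= Qy; have := evalK_res lR yE Q; rewrite Qy rmorph0 subr0.
by apply: (loc_unit lR) => //; apply: (evalK_sub (loc_sub lR)) => j; apply/Rg/mem_nth.
Qed.

Section GenericPoint.
Variable tau : seq K.
Hypothesis indep : alg_indep iota tau.
Hypothesis gen : generates iota tau.

Definition affine_point (c : 'I_(size tau) -> k) : point iota [:: tau] :=
  @Point k K iota [:: tau] tau (mem_head _ _) c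
    (fun P E => etrans (congr1 (meval c) (indep E)) (meval0 c)).

(** All of l is regular where the product of the denominators does not vanish. *)
Lemma affine_point_stalk (l : seq K) : exists c, forall h, h \in l -> stalk (affine_point c) h.
Proof.
suff [D D0 H] : exists2 D : {mpoly k[size tau]}, D != 0 & forall c, D.@[c] != 0 ->
    forall h, h \in l -> stalk (affine_point c) h.
  by have [c /H] := mpoly_nonroot D0; exists c.
elim: l => [|h l [D D0 IH]]; first by exists 1 => //; exact: oner_neq0.
have [P [Q [Q0 E]]] := gen h.
exists (D * Q).
  by rewrite mulf_neq0 //; apply: contra_neq Q0 => ->; rewrite /evalK mmap0.
move=> c; rewrite mevalM mulf_eq0 negb_or => /andP [Dc Qc] h'.
by rewrite inE => /predU1P [->|/(IH c Dc)] //; exists P, Q.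
Qed.

Lemma point_exists (cs : seq (seq K)) g : g \in cs -> inhabited (point iota cs).
Proof.
move=> gcs; have [c Hc] := affine_point_stalk g.
by have [a _] := center (stalk_local _) (@stalk_residue _ _ _ _ _) gcs Hc.
Qed.

(** Take a point of affine space at which g and the inverses of suitable denominators of l are
    regular; at its centre on the chart g these denominators are units. *)
Lemma generic_point (cs : seq (seq K)) g (l : seq K) : g \in cs -> generates iota g ->
  exists a : point iota cs, forall h, h \in l -> stalk a h.
Proof.
move=> gcs gg.
have gg' h : exists PQ : {mpoly k[size g]} * {mpoly k[size g]},
    evalK iota PQ.2 != 0 /\ h = evalK iota PQ.1 / evalK iota PQ.2.
  by have [P [Q H]] := gg h; exists (P, Q).
pose F h := proj1_sig (constructive_indefinite_description _ (gg' h)).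
have FE h : evalK iota (F h).2 != 0 /\ h = evalK iota (F h).1 / evalK iota (F h).2.
  exact: proj2_sig (constructive_indefinite_description _ (gg' h)).
have [c Hc] := affine_point_stalk (g ++ [seq (evalK iota (F h).2)^-1 | h <- l]).
have [|a [_ _ Ha]] := center (stalk_local (affine_point c)) (@stalk_residue _ _ _ _ _) gcs.
  by move=> h hg; apply: Hc; rewrite mem_cat hg.
exists a => h hl; have [Q0 ->] := FE h; apply: Ha => //.
by apply: Hc; rewrite mem_cat; apply/orP; right; apply/mapP; exists h.
Qed.

End GenericPoint.
End Center.

Section SurfaceCoordinates.
Variables (k : closedFieldType) (X : variety k).
Local Notation K := (function_field X).
Local Notation iota := (scalar X).

(** A regular point allows at most two independent differentials, so a transcendental generating
    system has at most two members. With fewer than two, any two elements of K would be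
    algebraically dependent, against transcendence degree 2. *)
Lemma surface_coordinates : smooth_projective_surface X -> rational X ->
  exists x z : K, alg_indep iota [:: x; z] /\ generates iota [:: x; z].
Proof.
move=> [[f [/hasP [v vf v0] [_ H']]] [t2 [st2 it2 _]] reg] [tau [it gt]].
have [b] : inhabited (point iota (proj_charts f)).
  apply: (point_exists it gt (g := [seq u / v | u <- f])).
  by apply/mapP; exists v; rewrite ?mem_filter ?v0.
have [a _] := H' b; have [s [t st]] := reg a.
have := regular_point_size it gt st (charts_generate (chart_in a)).
case: tau it gt => [|x [|z [|w tau]]] it gt // _; last by exists x, z.
- case: (@trdeg1_dependent _ _ iota 0 t2 _ st2 it2) => h.
  have [P [Q [Q0 ->]]] := gt h.
  exists (P@_0%MM)%:P, (Q@_0%MM)%:P.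
  have E (p : {mpoly k[size ([::] : seq K)]}) : evalK iota p = iota p@_0%MM.
    rewrite -(evalKC iota [::]); congr evalK; apply/mpolyP => m.
    rewrite mcoeffC; case: eqP => [->|]; rewrite ?mulr1 //.
    by case: m => m; move=> []; apply/mnmP; case.
  rewrite !map_polyC !hornerC /=; split; first by rewrite -(E Q).
  by rewrite -(E P) -(E Q).
case: (@trdeg1_dependent _ _ iota x t2 _ st2 it2) => h.
have [P [Q [Q0 ->]]] := gt h.
have E (p : {mpoly k[1]}) : exists q : {poly k},
    evalK iota (p : {mpoly k[size [:: x]]}) = (map_poly iota q).[x].
  elim/mpolyind: p => [|c m p _ _ [q Eq]].
    by exists 0; rewrite /evalK mmap0 rmorph0 horner0.
  exists (c *: 'X^(m ord0) + q); rewrite evalKD Eq rmorphD hornerD /=; congr (_ + _).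
  rewrite -mul_mpolyC evalKM evalKC map_polyZ map_polyXn hornerZ hornerXn.
  by rewrite /evalK mmapX /mmap1 big_ord_recl big_ord0 mulr1.
have [P' EP] := E P; have [Q' EQ] := E Q.
by exists P', Q'; rewrite -EP -EQ.
Qed.

End SurfaceCoordinates.

(** * Regular local rings of dimension two are factorial *)
Lemma dependent_choice (T : Type) (P : T -> Prop) (Q : T -> T -> Prop) :
  (forall x, P x -> exists y, P y /\ Q x y) -> forall x0, P x0 ->
  exists f : nat -> T, f 0%N = x0 /\ forall n, P (f n) /\ Q (f n) (f n.+1).
Proof.
move=> step x0 Px0.
have step' (x : {x | P x}) : exists y : {y | P y}, Q (sval x) (sval y).
  by case: x => x Px; have [y [Py Qxy]] := step x Px; exists (exist _ y Py).
pose F x := proj1_sig (constructive_indefinite_description _ (step' x)).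
have FE x : Q (sval x) (sval (F x)).
  exact: proj2_sig (constructive_indefinite_description _ (step' x)).
pose f n := iter n F (exist _ x0 Px0).
by exists (fun n => sval (f n)); split=> // n; split; [exact: (svalP (f n))|exact: FE].
Qed.

Section Noetherian.
Variables (k : closedFieldType) (K : fieldType) (iota : {rmorphism k -> K}).

Definition ideal (R : K -> Prop) (y : nat -> K) n h :=
  exists c : nat -> K, (forall i, R (c i)) /\ h = \sum_(i < n) c i * y i.

(** The ascending chain condition in terms of sequences: no sequence leaves the ideal of its
    predecessors at every step. *)
Definition noetherian (R : K -> Prop) :=
  forall y : nat -> K, (forall i, R (y i)) -> exists n, ideal R y n (y n).

Section Ideal.
Variable R : K -> Prop.
Hypothesis sR : subring iota R.

Lemma ideal_0 y n : ideal R y n 0.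
Proof. by exists (fun=> 0); split=> [i|]; [exact: (subr_0 sR)|rewrite big1 // => i _; rewrite mul0r]. Qed.

Lemma ideal_D y n a b : ideal R y n a -> ideal R y n b -> ideal R y n (a + b).
Proof.
move=> [c [Rc ->]] [c' [Rc' ->]]; exists (fun i => c i + c' i).
split=> [i|]; first exact: (subr_D sR).
by rewrite -big_split; apply: eq_bigr => i _; rewrite mulrDl.
Qed.

Lemma ideal_M y n a b : R a -> ideal R y n b -> ideal R y n (a * b).
Proof.
move=> Ra [c [Rc ->]]; exists (fun i => a * c i).
split=> [i|]; first exact: (subr_M sR).
by rewrite mulr_sumr; apply: eq_bigr => i _; rewrite mulrA.
Qed.

Lemma ideal_gen y n i : (i < n)%N -> ideal R y n (y i).
Proof.
move=> lt; exists (fun j => (j == i)%:R); split=> [j|]; first exact: (subr_n sR).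
rewrite (bigD1 (Ordinal lt)) //= eqxx mul1r big1 ?addr0 // => j /negPf.
by rewrite -val_eqE /= => ->; rewrite mul0r.
Qed.

Lemma ideal_sum y n (I : Type) (r : seq I) (F : I -> K) :
  (forall i, ideal R y n (F i)) -> ideal R y n (\sum_(i <- r) F i).
Proof. by move=> H; elim/big_ind: _ => //; [exact: ideal_0|exact: ideal_D]. Qed.

Lemma ideal_le y n m h : (n <= m)%N -> ideal R y n h -> ideal R y m h.
Proof.
move=> nm [c [Rc ->]]; apply: ideal_sum => i; apply: ideal_M => //.
by apply: ideal_gen; apply: leq_trans nm.
Qed.

Lemma noetherian_ge : noetherian R -> forall y N, (forall i, R (y i)) ->
  exists n, (N <= n)%N /\ ideal R y n (y n).
Proof.
move=> nR y N Ry; have [|n [c [Rc E]]] := nR (fun i => y (N + i)%N); first by [].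
exists (N + n)%N; rewrite leq_addr E; split=> //.
apply: ideal_sum => i; apply: ideal_M => //; apply: ideal_gen.
by rewrite ltn_add2l.
Qed.

(* A chain of ideals (g, x_0) <= (g, x_1) <= ... is stationary.                *)
Lemma noetherian_chain : noetherian R -> forall g x, R g -> (forall i, R (x i)) ->
  (forall i, exists c d, [/\ R c, R d & x i = c * g + d * x i.+1]) ->
  exists n c d, [/\ R c, R d & x n.+1 = c * g + d * x n].
Proof.
move=> nR g x Rg Rx H.
pose y i := if i is j.+1 then x j else g.
have Ry i : R (y i) by case: i.
have [n0 [n2 [e [Re E]]]] := noetherian_ge nR 2 Ry.
case: n0 n2 E => [|[|n]] // _ E; exists n.
have chain j : (j <= n)%N -> exists c d, [/\ R c, R d & x j = c * g + d * x n].
  move=> jn; rewrite -(subKn jn); elim: (n - j)%N => [|l [c [d [Rc Rd IH]]]].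
    by exists 0, 1; rewrite mul0r mul1r add0r subn0; split; [exact: (subr_0 sR)|exact: (subr_1 sR)|].
  case: (ltnP l n) => ln; last first.
    exists c, d; split=> //; rewrite -IH; congr x; lia.
  have [c' [d' [Rc' Rd' E']]] := H (n - l.+1)%N.
  exists (c' + d' * c), (d' * d); rewrite E'.
  have -> : (n - l.+1).+1 = (n - l)%N by lia.
  rewrite IH; split; [|exact: (subr_M sR)|ring].
  by apply: (subr_D sR) => //; apply: (subr_M sR).
have : forall j, (j < n.+2)%N -> exists c d, [/\ R c, R d & e j * y j = c * g + d * x n].
  case=> [_|j]; first by exists (e 0%N), 0; rewrite mul0r addr0; split=> //; exact: (subr_0 sR).
  rewrite ltnS => /chain [c [d [Rc Rd Ej]]]; exists (e j.+1 * c), (e j.+1 * d).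
  by rewrite /= Ej; split; [exact: (subr_M sR)|exact: (subr_M sR)|ring].
have -> : x n.+1 = \sum_(i < n.+2) e i * y i by exact: E.
elim: (n.+2) => [|m IH] Hm.
  by exists 0, 0; rewrite big_ord0 !mul0r addr0; split=> //; exact: (subr_0 sR).
have [c [d [Rc Rd E1]]] := IH (fun j jm => Hm j (ltnW jm)).
have [c' [d' [Rc' Rd' E2]]] := Hm m (ltnSn m).
exists (c + c'), (d + d'); rewrite big_ord_recr /= E1 E2.
by split; [exact: (subr_D sR)|exact: (subr_D sR)|ring].
Qed.
End Ideal.

Section Hilbert.
Variables (R : K -> Prop) (g : K).
Hypothesis sR : subring iota R.
Let pol (p : {poly K}) := forall i, R p`_i.

Definition adjoin h := exists p, pol p /\ h = p.[g].

Let pol_C c : R c -> pol c%:P.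
Proof. by move=> Rc i; rewrite coefC; case: ifP => // _; exact: (subr_0 sR). Qed.
Let pol_D p q : pol p -> pol q -> pol (p + q).
Proof. by move=> Rp Rq i; rewrite coefD; apply: (subr_D sR). Qed.
Let pol_M p q : pol p -> pol q -> pol (p * q).
Proof. by move=> Rp Rq i; rewrite coefM; apply: (subr_sum sR) => j _; apply: (subr_M sR). Qed.
Let pol_X n : pol 'X^n.
Proof. by move=> i; rewrite coefXn; exact: (subr_n sR). Qed.

Lemma adjoin_subring : subring iota adjoin.
Proof.
split=> [c|u v|u v].
- by exists (iota c)%:P; rewrite hornerC; split=> //; apply/pol_C/(subr_c sR).
- by move=> [p [Rp ->]] [q [Rq ->]]; exists (p + q); rewrite hornerD; split=> //; apply: pol_D.
- by move=> [p [Rp ->]] [q [Rq ->]]; exists (p * q); rewrite hornerM; split=> //; apply: pol_M.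
Qed.

Lemma adjoin_sub h : R h -> adjoin h.
Proof. by move=> Rh; exists h%:P; rewrite hornerC; split=> //; exact: pol_C. Qed.

Lemma adjoin_gen : adjoin g.
Proof. by exists 'X^1; rewrite hornerXn; split; [exact: (pol_X 1)|rewrite expr1]. Qed.

Lemma adjoin_min (S : K -> Prop) : subring iota S -> (forall h, R h -> S h) -> S g ->
  forall h, adjoin h -> S h.
Proof.
move=> sS RS Sg h [p [Rp ->]]; rewrite horner_coef; apply: (subr_sum sS) => i _.
by apply: (subr_M sS); [exact: RS|exact: (subr_X sS)].
Qed.

(** From a bad sequence y, the polynomials whose value at g lies in the ideal of some initial
    segment form an ideal that is not finitely generated. Choosing repeatedly an element of least
    degree outside the ideal of the previous choices gives a sequence whose leading coefficients
    contradict noetherianity of R. *)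
Lemma hilbert_basis : noetherian R -> noetherian adjoin.
Proof.
move=> nR y Ay; apply: NNPP => /not_ex_all_not bad.
have sA := adjoin_subring.
pose I p := pol p /\ exists n, ideal adjoin y n p.[g].
pose inid (l : seq {poly K}) q := exists c : nat -> {poly K},
  (forall i, pol (c i)) /\ q = \sum_(i < size l) c i * l`_i.
have common (l : seq {poly K}) : (forall p, p \in l -> I p) ->
    exists n, forall p, p \in l -> ideal adjoin y n p.[g].
  elim: l => [|p l IH] Il; first by exists 0%N.
  have [|n Hn] := IH; first by move=> q ql; apply: Il; rewrite inE ql orbT.
  have [_ [m Hm]] := Il p (mem_head _ _); exists (maxn n m) => q.
  rewrite inE => /predU1P [->|/Hn H].
    exact: (ideal_le sA (leq_maxr n m) Hm).
  exact: (ideal_le sA (leq_maxl n m) H).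
have inidI l q : (forall p, p \in l -> I p) -> inid l q -> I q.
  move=> Il [c [pc ->]]; split.
    elim/big_ind: _ => [i|p r|i _]; [by rewrite coef0; exact: (subr_0 sR)|exact: pol_D|].
    by apply: pol_M => //; case: (Il l`_i (mem_nth _ (ltn_ord i))).
  have [n Hn] := common l Il; exists n; rewrite horner_sum; apply: (ideal_sum sA) => i.
  rewrite hornerM; apply: (ideal_M sA); first by exists (c i).
  by apply: Hn; apply: mem_nth.
have ID p q : I p -> I q -> I (p - q).
  move=> [pp [n Hn]] [pq [m Hm]]; split.
    by move=> i; rewrite coefB; apply: (subr_B sR).
  exists (maxn n m); rewrite hornerD hornerN -mulN1r; apply: (ideal_D sA).
    exact: (ideal_le sA (leq_maxl _ _) Hn).
  apply: (ideal_M sA); first exact: (subr_N sA (subr_1 sA)).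
  exact: (ideal_le sA (leq_maxr _ _) Hm).
have new (l : seq {poly K}) : (forall p, p \in l -> I p) -> exists q, I q /\ ~ inid l q.
  move=> Il; have [n Hn] := common l Il.
  have [p [pp Ep]] := Ay n; exists p; split.
    by split=> //; exists n.+1; rewrite -Ep; exact: (ideal_gen sA).
  move=> [c [pc E]]; apply: (bad n); rewrite Ep E horner_sum; apply: (ideal_sum sA) => i.
  rewrite hornerM; apply: (ideal_M sA); first by exists (c i).
  by apply: Hn; apply: mem_nth.
have newmin (l : seq {poly K}) : (forall p, p \in l -> I p) -> exists q, [/\ I q, ~ inid l q &
    forall r, I r -> ~ inid l r -> (size q <= size r)%N].
  move=> Il; have [q [Iq nq]] := new l Il.
  move: {2}(size q) (leqnn (size q)) => m; elim: m q Iq nq => [|m IH] q Iq nq sq.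
    by exists q; split=> // r _ _; move: sq; rewrite leqn0 => /eqP ->.
  case: (classic (exists r, [/\ I r, ~ inid l r & (size r < size q)%N])) => [[r [Ir nr lt]]|H].
    by apply: (IH r) => //; rewrite -ltnS (leq_trans lt).
  exists q; split=> // r Ir nr; rewrite leqNgt; apply/negP => lt; apply: H; exists r.
  by split.
pose good (l : seq {poly K}) := forall p, p \in l -> I p.
have step (l : seq {poly K}) : good l -> exists l', good l' /\ exists q,
   [/\ l' = rcons l q, I q, ~ inid l q & forall r, I r -> ~ inid l r -> (size q <= size r)%N].
  move=> gl; have [q [Iq nq mq]] := newmin l gl; exists (rcons l q); split; last by exists q.
  by move=> p; rewrite mem_rcons inE => /predU1P [->|/gl].
have [L [L0 HL]] := dependent_choice step (x0 := [::]) (fun p => ltac:(by [])).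
pose f n := (L n.+1)`_n.
have sL n : size (L n) = n.
  elim: n => [|n IH]; first by rewrite L0.
  by have [_ [q [-> _ _ _]]] := HL n; rewrite size_rcons IH.
have Lf n i : (i < n)%N -> (L n)`_i = f i.
  elim: n => // n IH; rewrite ltnS leq_eqVlt => /predU1P [->|lt] //.
  by rewrite -IH //; have [_ [q [-> _ _ _]]] := HL n; rewrite nth_rcons sL lt.
have Hf n : [/\ I (f n), ~ inid (L n) (f n) &
    forall r, I r -> ~ inid (L n) r -> (size (f n) <= size r)%N].
  have [_ [q [E Iq nq mq]]] := HL n.
  suff -> : f n = q by [].
  by rewrite /f E nth_rcons sL ltnn eqxx.
have inid_le n m q : (n <= m)%N -> inid (L n) q -> inid (L m) q.
  move=> nm [c [pc ->]]; exists (fun i => if (i < n)%N then c i else 0).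
  split=> [i|]; first by case: ifP => // _ j; rewrite coef0; exact: (subr_0 sR).
  rewrite !sL (big_ord_widen_cond m xpredT (fun i => c i * (L n)`_i)) // big_mkcond /=.
  apply: eq_bigr => i _; case: ifP => lt; last by rewrite mul0r.
  by rewrite !Lf // (leq_trans lt).
have mono i n : (i <= n)%N -> (size (f i) <= size (f n))%N.
  move=> lein; have [_ _ +] := Hf i; apply; first by case: (Hf n).
  by move=> /(inid_le _ _ _ lein); case: (Hf n).
have [|n [r [Rr E]]] := nR (fun n => lead_coef (f n)).
  by move=> i; rewrite lead_coefE; case: (Hf i) => [[]].
(* q lies in the ideal of the predecessors and has the leading term of [f n], so [f n - q] is an
   admissible choice of smaller degree. *)
pose q := \sum_(i < n) (r i)%:P * 'X^(size (f n) - size (f i)) * f i.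
have iq : inid (L n) q.
  exists (fun i => (r i)%:P * 'X^(size (f n) - size (f i))); split.
    by move=> i; apply: pol_M => //; exact: pol_C.
  by rewrite sL; apply: eq_bigr => i _; rewrite Lf.
have gL : good (L n) by case: (HL n).
have [If nf mf] := Hf n.
have fn0 : f n != 0.
  apply/eqP => f0; apply: nf; rewrite f0; exists (fun=> 0); split.
    by move=> i j; rewrite coef0; exact: (subr_0 sR).
  by rewrite big1 // => i _; rewrite mul0r.
have : (size (f n) <= size (f n - q)%R)%N.
  apply: mf; first by apply: ID => //; exact: (inidI (L n)).
  move=> [c [pc E']]; apply: nf; have [c' [pc' E'']] := iq.
  exists (fun i => c i + c' i); split; first by move=> i; apply: pol_D.
  rewrite -(subrK q (f n)) {1}E' {1}E'' -big_split; apply: eq_bigr => i _.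
  by rewrite mulrDl.
rewrite leqNgt => /negP; apply.
have sf : (0 < size (f n))%N by rewrite size_poly_gt0.
rewrite -(prednK sf) ltnS; apply/leq_sizeP => j lej.
rewrite coefB /q coef_sum.
have coefq (i : 'I_n) : ((r i)%:P * 'X^(size (f n) - size (f i)) * f i)`_j =
    r i * (f i)`_(j - (size (f n) - size (f i))).
  rewrite -mulrA coefCM coefXnM ltnNge.
  have fi0 : (0 < size (f i))%N.
    rewrite size_poly_gt0; apply/eqP => f0; have [_ + _] := Hf i; apply; rewrite f0.
    exists (fun=> 0); split; first by move=> ? ?; rewrite coef0; exact: (subr_0 sR).
    by rewrite big1 // => ? _; rewrite mul0r.
  by rewrite (_ : (_ <= j)%N = true) //; lia.
rewrite (eq_bigr _ (fun i _ => coefq i)).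
have : (j == (size (f n)).-1) || (size (f n) <= j)%N by lia.
case/orP => [/eqP ->|ge].
  rewrite -lead_coefE E; apply/eqP; rewrite subr_eq0; apply/eqP; apply: eq_bigr => i _.
  by rewrite lead_coefE; congr (_ * _`_ _); have := mono i n (ltnW (ltn_ord i)); lia.
rewrite nth_default // big1 ?subr0 // => i _; rewrite nth_default ?mulr0 //.
have le := mono i n (ltnW (ltn_ord i)).
by rewrite leq_subRL ?(leq_trans (leq_subr _ _)) // subnK.
Qed.
End Hilbert.

Lemma noetherian_k : noetherian (fun h => exists c, h = iota c).
Proof.
move=> y Hy; have [y0|y0] := eqVneq (y 0%N) 0.
  by exists 0%N, (fun=> 0); split=> [i|]; [exists 0; rewrite rmorph0|rewrite big_ord0].
have [a Ea] := Hy 0%N; have [b Eb] := Hy 1%N.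
exists 1%N, (fun=> iota (b / a)); split=> [i|]; first by exists (b / a).
by rewrite big_ord1 /= fmorph_div -Ea -Eb divfK.
Qed.

(** The coordinate ring A of the chart is obtained from k by adjoining the generators one by one. A
    sequence in the localization O is moved into A by denominators that are units of O. *)
Lemma stalk_noetherian (cs : seq (seq K)) (a : point iota cs) : noetherian (stalk a).
Proof.
pose A := foldr (fun g R => adjoin R g) (fun h => exists c, h = iota c) (chart a).
have : [/\ subring iota A, noetherian A, forall h, h \in chart a -> A h &
   forall S, subring iota S -> (forall h, h \in chart a -> S h) -> forall h, A h -> S h].
  rewrite /A; elim: (chart a) => [|g l [sA nA Al mA]] /=.
    split=> //; [|exact: noetherian_k|by move=> S sS _ _ [c ->]; exact: (subr_c sS)].
    split=> [c|u v [c ->] [d ->]|u v [c ->] [d ->]]; first by exists c.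
      by exists (c + d); rewrite rmorphD.
    by exists (c * d); rewrite rmorphM.
  split; [exact: adjoin_subring|exact: hilbert_basis| |].
    move=> h; rewrite inE => /predU1P [->|/Al]; [exact: adjoin_gen|exact: adjoin_sub].
  move=> S sS Sl; apply: adjoin_min => //; last by apply: Sl; rewrite mem_head.
  by apply: mA => // h hl; apply: Sl; rewrite inE hl orbT.
move=> [sA nA Al mA] y Oy.
have lO := stalk_local a; have sO := stalk_sub a.
have AO : forall h, A h -> stalk a h.
  by apply: mA => // h /(nthP 0) [j jl <-]; exact: (chart_stalk a (Ordinal jl)).
have den i : exists q, [/\ A (q * y i), stalk a q, stalk a q^-1 & q != 0].
  have [P [Q [Q0 ->]]] := Oy i; exists (evalK iota Q); rewrite evalK_neq0 // mulrC divfK ?evalK_neq0 //.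
  split=> //; last by exists 1, Q; rewrite evalK1 div1r.
    by apply: evalK_sub => // j; apply: Al; exact: mem_nth.
  exact: stalk_ev.
pose q i := proj1_sig (constructive_indefinite_description _ (den i)).
have qE i : [/\ A (q i * y i), stalk a (q i), stalk a (q i)^-1 & q i != 0].
  exact: proj2_sig (constructive_indefinite_description _ (den i)).
have [|n [c [Ac E]]] := nA (fun i => q i * y i); first by move=> i; case: (qE i).
exists n, (fun i => (q n)^-1 * (c i * q i)); split.
  move=> i; have [_ qi _ _] := qE i; have [_ _ qn _] := qE n.
  by apply: (subr_M sO) => //; apply: (subr_M sO) => //; apply: AO.
have [_ _ _ qn] := qE n; apply: (mulfI qn); rewrite E mulr_sumr.
by apply: eq_bigr => i _; rewrite !mulrA mulfV // mul1r.
Qed.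
End Noetherian.

Section Factorial.
Variables (k : closedFieldType) (K : fieldType) (iota : {rmorphism k -> K}).
Variables (R M : K -> Prop).
Hypothesis lR : local_ring iota R M.
Let sR : subring iota R := loc_sub lR.

Definition dv u h := exists r, R r /\ h = u * r.

Definition prime_elt p :=
  [/\ M p, p != 0 & forall f g, R f -> R g -> dv p (f * g) -> dv p f \/ dv p g].

Definition irreducible_elt p :=
  [/\ M p, p != 0 & forall f g, R f -> R g -> p = f * g -> ~ M f \/ ~ M g].

Lemma dv_mulr p f g : R g -> dv p f -> dv p (f * g).
Proof. by move=> Rg [r [Rr ->]]; exists (r * g); rewrite mulrA; split=> //; apply: (subr_M sR). Qed.

Lemma dv_mull p f g : R f -> dv p g -> dv p (f * g).
Proof. by move=> Rf /(dv_mulr Rf); rewrite mulrC. Qed.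

Lemma dv_refl p : dv p p.
Proof. by exists 1; rewrite mulr1; split=> //; exact: (subr_1 sR). Qed.

Lemma dv_M p f : M p -> dv p f -> M f.
Proof. by move=> Mp [r [Rr ->]]; apply: (loc_Mr lR). Qed.

Section Descent.
Hypothesis nR : noetherian R.

(** Successive proper divisors x_n = x_(n+1) b_n, with b_n in M, would generate a strictly
    increasing chain of ideals. The existence of irreducible divisors, of prime orders and of lowest
    terms are all instances of this descent. *)
Lemma divisor_descent (P : K -> Prop) : (forall x, P x -> R x /\ x != 0) ->
  (forall x, P x -> exists y b, [/\ P y, M b & x = y * b]) -> forall x, ~ P x.
Proof.
move=> PR H x Px.
have step z : P z -> exists y, P y /\ exists b, M b /\ z = y * b.
  by move=> /H [y [b [Py Mb E]]]; exists y; split=> //; exists b.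
have [f [f0 Hf]] := dependent_choice step Px.
have [| | |n [c [d [_ Rd E]]]] := noetherian_chain sR nR (g := 0) (x := f).
- exact: (subr_0 sR).
- by move=> i; case: (Hf i) => /PR [].
- move=> i; have [_ [b [Mb E]]] := Hf i; exists 0, b; rewrite mul0r add0r mulrC.
  by split=> //; [exact: (subr_0 sR)|exact: (loc_R lR)].
have [/PR [_ fn0] _] := Hf n.+1; have [_ [b [Mb E']]] := Hf n.
apply: (loc_1 lR); have -> : 1 = d * b; last exact: (loc_Ml lR).
by apply: (mulfI fn0); rewrite mulr1 {1}E E' mulr0 add0r; ring.
Qed.

Lemma irreducible_divisor f : M f -> f != 0 -> exists p, irreducible_elt p /\ dv p f.
Proof.
move=> Mf f0; apply: NNPP => nf.
pose P x := [/\ M x, x != 0, dv x f & ~ exists p, irreducible_elt p /\ dv p f].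
apply: (@divisor_descent P _ _ f) => [x [Mx x0 _ _]|x [Mx x0 xf nx]|].
- by split=> //; exact: (loc_R lR).
- apply: NNPP => H; apply: nx; exists x; split=> //; split=> // a b Ra Rb E.
  apply: NNPP => /not_or_and [/NNPP Ma /NNPP Mb]; apply: H; exists a, b; split=> //.
  split=> //; first by move: x0; rewrite E mulf_eq0 negb_or => /andP [].
  by have [r [Rr ->]] := xf; exists (b * r); rewrite E mulrA; split=> //; apply: (subr_M sR).
- by split=> //; exact: dv_refl.
Qed.

Lemma prime_power p f : prime_elt p -> R f -> f != 0 ->
  exists n f0, [/\ R f0, ~ dv p f0 & f = p ^+ n * f0].
Proof.
move=> [Mp p0 _] Rf f0; apply: NNPP => nf.
pose P x := [/\ R x, x != 0 & ~ exists n f0, [/\ R f0, ~ dv p f0 & x = p ^+ n * f0]].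
apply: (@divisor_descent P _ _ f) => [x [Rx x0 _]|x [Rx x0 nx]|//]; first by [].
have [r [Rr E]] : dv p x.
  by apply: NNPP => nd; apply: nx; exists 0%N, x; rewrite mul1r.
exists r, p; split=> //; last by rewrite mulrC.
split=> //; first by move: x0; rewrite E mulf_eq0 negb_or => /andP [].
by move=> [n [g [Rg ng E']]]; apply: nx; exists n.+1, g; rewrite exprS -mulrA -E'.
Qed.

Hypothesis frac : forall h, exists u w, [/\ R u, R w, w != 0 & h = u / w].

Lemma lowest_terms h : exists u w, [/\ R u, R w, w != 0, h = u / w &
  forall p, prime_elt p -> ~ (dv p u /\ dv p w)].
Proof.
have [h0|h0] := eqVneq h 0.
  exists 0, 1; rewrite mul0r oner_neq0; split=> //; [exact: (subr_0 sR)|exact: (subr_1 sR)|].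
  by move=> p [Mp _ _] [_ /(dv_M Mp) /(loc_1 lR)].
apply: NNPP => nh.
have [u [w [Ru Rw w0 E]]] := frac h.
pose P x := [/\ R x, x != 0 & R (h * x)].
apply: (@divisor_descent P _ _ w) => [x [Rx x0 _]|x [Rx x0 Rhx]|]; first by [].
  have [p [pp [[r [Rr E1]] [r' [Rr' E2]]]]] : exists p, prime_elt p /\ (dv p (h * x) /\ dv p x).
    apply: NNPP => H; apply: nh; exists (h * x), x; rewrite mulfK //; split=> //.
    by move=> p pp H'; apply: H; exists p.
  have [Mp p0 _] := pp.
  exists r', p; split=> //; last by rewrite mulrC.
  split=> //; first by move: x0; rewrite E2 mulf_eq0 negb_or => /andP [].
  suff -> : h * r' = r by [].
  by apply: (mulfI p0); rewrite -E1 E2; ring.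
by rewrite /P E divfK.
Qed.

(* Integral parameters: R/(s) is a discrete valuation ring with uniformizer t. *)
Variables s t : K.
Hypothesis Ms : M s.
Hypothesis Mt : M t.
Hypothesis s0 : s != 0.
Hypothesis st : forall h, M h -> exists u v, [/\ R u, R v & h = u * s + v * t].
Hypothesis dim2 : forall n u, R u -> t ^+ n <> s * u.

(** As long as the remainder x is in M, it is a s + b t and b replaces it. If this never stopped,
    the ideals (s, x_n) would be stationary: x_n = a s + t x_(n+1) and x_(n+1) = c s + d x_n put (1
    - d t) x_(n+1), hence x_(n+1), into (s). *)
Lemma t_expansion f : R f -> ~ dv s f ->
  exists j u r, [/\ R u, ~ M u, R r & f = u * t ^+ j + s * r].
Proof.
move=> Rf nf; apply: NNPP => bad.
pose P x := [/\ R x, ~ dv s x & ~ exists j u r, [/\ R u, ~ M u, R r & x = u * t ^+ j + s * r]].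
have step x : P x -> exists y, P y /\ exists c, R c /\ x = c * s + t * y.
  move=> [Rx nx bx].
  have Mx : M x.
    apply: NNPP => nM; apply: bx; exists 0%N, x, 0; rewrite mulr1 mulr0 addr0.
    by split=> //; exact: (subr_0 sR).
  have [a [b [Ra Rb E]]] := st Mx; exists b; split; last by exists a; rewrite [t * b]mulrC.
  split=> //.
    move=> [r [Rr E']]; apply: nx; exists (a + r * t).
    split; last by rewrite E E'; ring.
    by apply: (subr_D sR) => //; apply: (subr_M sR) => //; exact: (loc_R lR).
  move=> [j [u [r [Ru nu Rr E']]]]; apply: bx; exists j.+1, u, (a + r * t).
  split=> //; last by rewrite E E' exprS; ring.
  by apply: (subr_D sR) => //; apply: (subr_M sR) => //; exact: (loc_R lR).
have [x [x0 Hx]] := dependent_choice step (And3 Rf nf bad : P f).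
have [| | |n [c [d [Rc Rd E]]]] := noetherian_chain sR nR (g := s) (x := x).
- exact: (loc_R lR).
- by move=> i; case: (Hx i) => [[]].
- move=> i; have [_ [c [Rc E]]] := Hx i; exists c, t; split=> //; exact: (loc_R lR).
have [_ [a [Ra E']]] := Hx n; have [[_ nx _] _] := Hx n.+1; apply: nx.
have Rt := loc_R lR Mt.
have nM : ~ M (1 - d * t) by apply: (loc_1B lR); apply: (loc_Ml lR).
exists ((c + d * a) / (1 - d * t)); split.
  apply: (subr_M sR); first by apply: (subr_D sR) => //; apply: (subr_M sR).
  apply: (loc_V lR) => //; apply: (subr_B sR); [exact: (subr_1 sR)|exact: (subr_M sR)].
have n0 := loc_neq0 lR nM.
apply: (mulIf n0); rewrite mulrA divfK // mulrBr mulr1 {1}E E'; ring.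
Qed.

(** Modulo s two elements outside (s) are units times powers of t; if their product were in (s), so
    would be a power of t, against [dim2]. *)
Lemma prime_s : prime_elt s.
Proof.
split=> // f g Rf Rg [w [Rw E]]; apply: NNPP => /not_or_and [nf ng].
have [i [u [r [Ru nu Rr Ef]]]] := t_expansion Rf nf.
have [j [u' [r' [Ru' nu' Rr' Eg]]]] := t_expansion Rg ng.
have Rt := loc_R lR Mt; have Rs := loc_R lR Ms.
have u0 := loc_neq0 lR nu; have u'0 := loc_neq0 lR nu'.
have RtX l : R (t ^+ l) by apply: (subr_X sR).
apply: (@dim2 (i + j) ((w - u * t ^+ i * r' - r * g) * (u^-1 * u'^-1))).
  apply: (subr_M sR); last by apply: (subr_M sR); apply: (loc_V lR).
  by apply: (subr_B sR); [apply: (subr_B sR) => //|]; do ?apply: (subr_M sR).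
have -> : t ^+ (i + j) = u * u' * (t ^+ i * t ^+ j) * (u^-1 * u'^-1).
  by rewrite exprD; field; rewrite u0 u'0.
rewrite [RHS]mulrA; congr (_ * _).
have -> : s * (w - u * t ^+ i * r' - r * g) = f * g - s * (u * t ^+ i * r') - s * (r * g).
  by rewrite E; ring.
by rewrite Ef Eg; ring.
Qed.

(** If s divides p, the two are associate. Otherwise let p divide f g, and let I consist of the h
    with p dividing h f; it contains p and g. An element g0 of I of least t-order modulo s generates
    I. Write p = c g0: if g0 is a unit, then p divides f; if c is a unit, then p divides g. *)
Lemma irreducible_prime p : irreducible_elt p -> prime_elt p.
Proof.
move=> [Mp p0 ip]; case: (classic (dv s p)) => [[u [Ru E]]|nsp].
  have [//|nu] := ip _ _ (loc_R lR Ms) Ru E.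
  have [_ _ ps] := prime_s; have u0 := loc_neq0 lR nu; have Ru' := loc_V lR Ru nu.
  have H h : dv p h <-> dv s h.
    split=> [[r [Rr ->]]|[r [Rr ->]]].
      by exists (u * r); rewrite E mulrA; split=> //; apply: (subr_M sR).
    exists (u^-1 * r); rewrite E; split; first exact: (subr_M sR).
    by rewrite mulrA mulfK.
  by split=> // f g Rf Rg; rewrite !H; apply: ps.
split=> // f g Rf Rg pfg; apply: NNPP => /not_or_and [npf npg].
(* I = {h | p divides h f} satisfies I : s = I, so that its image in the       *)
(* discrete valuation ring R/(s) decides its generators.                       *)
pose I h := R h /\ dv p (h * f).
have Ip : I p by split; [exact: (loc_R lR)|apply: dv_mulr => //; exact: dv_refl].
have [_ _ ps] := prime_s; have Rs := loc_R lR Ms; have Rp := loc_R lR Mp.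
have IM a h : R a -> I h -> I (a * h).
  by move=> Ra [Rh ph]; split; [exact: (subr_M sR)|rewrite -mulrA; apply: dv_mull].
have IB a b : I a -> I b -> I (a - b).
  move=> [Ra [r [Rr Er]]] [Rb [r' [Rr' Er']]]; split; first exact: (subr_B sR).
  by exists (r - r'); rewrite mulrBl Er Er' mulrBr; split=> //; apply: (subr_B sR).
have Is h : R h -> I (s * h) -> I h.
  move=> Rh [_ [w [Rw E]]]; split=> //.
  have [|//|[w' [Rw' Ew]]] := ps p w Rp Rw.
    by exists (h * f); rewrite -E mulrA; split=> //; apply: (subr_M sR).
  exists w'; split=> //; apply: (mulfI s0); rewrite mulrA E Ew; ring.
pose E j h := exists u r, [/\ R u, ~ M u, R r & h = u * t ^+ j + s * r].
have [g0 [j [Ig0 ng0 Eg0 minj]]] : exists g0 j, [/\ I g0, ~ dv s g0, E j g0 &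
    forall h j', I h -> E j' h -> (j <= j')%N].
  have [j0 [u [r [Ru nu Rr Ep]]]] := t_expansion Rp nsp.
  have : exists h, I h /\ E j0 h by exists p; split=> //; exists u, r.
  elim/ltn_ind: j0 {Ep} => j IH [h [Ih Eh]].
  case: (classic (exists j' h, [/\ I h, E j' h & (j' < j)%N])).
    by move=> [j' [h' [Ih' Eh' lt]]]; apply: (IH j') => //; exists h'.
  move=> H; exists h, j; split=> //; last first.
    by move=> h' j' Ih' Eh'; rewrite leqNgt; apply/negP => lt; apply: H; exists j', h'.
  have [u1 [r1 [Ru1 nu1 Rr1 Eh1]]] := Eh.
  move=> [w [Rw Ew]]; apply: (@dim2 j ((w - r1) / u1)).
    by apply: (subr_M sR); [exact: (subr_B sR)|exact: (loc_V lR)].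
  have u10 := loc_neq0 lR nu1; apply: (mulfI u10).
  have -> : u1 * t ^+ j = h - s * r1 by rewrite Eh1 addrK.
  by rewrite Ew; field.
have [Rg0 pg0] := Ig0.
have Igen h : I h -> exists c h', [/\ R c, I h' & h = c * g0 + s * h'].
  move=> Ih; have [Rh _] := Ih; case: (classic (dv s h)) => [[r [Rr Er]]|nh].
    exists 0, r; rewrite mul0r add0r; split=> //; first exact: (subr_0 sR).
    by apply: Is => //; rewrite -Er.
  have [j' [u [r [Ru nu Rr Eh]]]] := t_expansion Rh nh.
  have lejj' : (j <= j')%N by apply: (minj h) => //; exists u, r.
  have [u1 [r1 [Ru1 nu1 Rr1 Eg]]] := Eg0; have u10 := loc_neq0 lR nu1.
  pose c := u / u1 * t ^+ (j' - j).
  have Rc : R c.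
    apply: (subr_M sR); first by apply: (subr_M sR) => //; apply: (loc_V lR).
    by apply: (subr_X sR); exact: (loc_R lR).
  have Rh' : R (r - c * r1) by apply: (subr_B sR) => //; apply: (subr_M sR).
  have Ehc : h = c * g0 + s * (r - c * r1).
    have tj : t ^+ j' = t ^+ (j' - j) * t ^+ j by rewrite -exprD subnK.
    by rewrite Eh Eg tj /c; field.
  exists c, (r - c * r1); split=> //; apply: Is => //.
  have -> : s * (r - c * r1) = h - c * g0 by rewrite {1}Ehc; ring.
  by apply: IB => //; apply: IM.
(* Every h in I is c g0 + s h' with h' again in I. Iterating, the ideals (g0, h_n) become
   stationary, and 1 - d s is a unit. *)
have Ig0all h : I h -> dv g0 h.
  move=> Ih; apply: NNPP => nh.
  pose P x := I x /\ ~ dv g0 x.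
  have step x : P x -> exists y, P y /\ exists c, R c /\ x = c * g0 + s * y.
    move=> [Ix nx]; have [c [y [Rc Iy Ex]]] := Igen x Ix; exists y; split; last by exists c.
    split=> // [[r [Rr Ey]]]; apply: nx; exists (c + s * r); split.
      by apply: (subr_D sR) => //; apply: (subr_M sR).
    by rewrite Ex Ey; ring.
  have [x [x0 Hx]] := dependent_choice step (conj Ih nh : P h).
  have [| | |n [c [d [Rc Rd Ec]]]] := noetherian_chain sR nR (g := g0) (x := x) => //.
  - by move=> i; case: (Hx i) => [[[]]].
  - by move=> i; have [_ [c [Rc Ec]]] := Hx i; exists c, s.
  have [_ [a [Ra Ea]]] := Hx n; have [[_ nx] _] := Hx n.+1; apply: nx.
  have nM : ~ M (1 - d * s) by apply: (loc_1B lR); apply: (loc_Ml lR).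
  exists ((c + d * a) / (1 - d * s)); split.
    apply: (subr_M sR); first by apply: (subr_D sR) => //; apply: (subr_M sR).
    apply: (loc_V lR) => //; apply: (subr_B sR); [exact: (subr_1 sR)|exact: (subr_M sR)].
  have n0 := loc_neq0 lR nM.
  apply: (mulIf n0); rewrite mulrA divfK // mulrBr mulr1 {1}Ec Ea; ring.
have [c [Rc Ec]] := Ig0all p Ip.
have Ig : I g by split=> //; rewrite mulrC.
have [w [Rw Ew]] := Ig0all g Ig.
have [ng|nc] := ip _ _ Rg0 Rc Ec.
  apply: npf; have [r [Rr Er]] := pg0; exists (g0^-1 * r).
  split; first by apply: (subr_M sR) => //; apply: (loc_V lR).
  by have g00 := loc_neq0 lR ng; apply: (mulfI g00); rewrite Er; field.
apply: npg; exists (c^-1 * w); split; first by apply: (subr_M sR) => //; apply: (loc_V lR).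
by have c0 := loc_neq0 lR nc; rewrite Ew Ec; field.
Qed.

(** Bring c / w to lowest terms c' / w'. If w' is not a unit, a prime dividing it divides w, hence
    neither u nor c', and yet it divides c' u, a multiple of w'. *)
Lemma lowest_dvd u w c : R u -> R w -> w != 0 ->
  (forall p, prime_elt p -> ~ (dv p u /\ dv p w)) -> R c -> dv w (c * u) -> dv w c.
Proof.
move=> Ru Rw w0 cop Rc [r [Rr E]].
have [c' [w' [Rc' Rw' w'0 E' cop']]] := lowest_terms (c / w).
have Ecw : c * w' = c' * w.
  by move/eqP: E'; rewrite eqr_div // => /eqP.
case: (classic (M w')) => [Mw'|nw']; last first.
  exists (c' / w'); split; first by apply: (subr_M sR) => //; apply: (loc_V lR).
  by apply: (mulIf w'0); rewrite Ecw mulrA divfK // mulrC.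
have [p [/irreducible_prime pp pw']] := irreducible_divisor Mw' w'0.
have [Mp p0 ppr] := pp.
have nc' : ~ dv p c' by move=> H; case: (cop' p).
have pw : dv p w by case: (ppr c' w Rc' Rw) => //; rewrite -Ecw; apply: dv_mull.
have nu : ~ dv p u by move=> H; case: (cop p).
case: (ppr c' u Rc' Ru) => //; have -> : c' * u = w' * r; last exact: dv_mulr.
by apply: (mulIf w0); rewrite mulrAC -Ecw mulrAC E; ring.
Qed.

Lemma local_fraction h : ~ R h -> exists u w p, [/\ R u, R w, prime_elt p, h = u / w &
  w != 0 /\ (~ dv p u /\ dv p w)].
Proof.
move=> nh; have [u [w [Ru Rw w0 E cop]]] := lowest_terms h.
have Mw : M w.
  by apply: NNPP => nM; apply: nh; rewrite E; apply: (subr_M sR) => //; apply: (loc_V lR).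
have [p [/irreducible_prime pp pw]] := irreducible_divisor Mw w0.
by exists u, w, p; split=> //; split=> //; split=> // pu; case: (cop p).
Qed.

End Descent.
End Factorial.

(** * Parameters and derivations at a smooth point *)
Section ConstantExpansion.
Variables (k : closedFieldType) (K : fieldType) (iota : {rmorphism k -> K}).
Variables (D : K -> K) (s : K).
Hypothesis dD : der iota D.
Hypothesis Ds : D s = 1.

(** Since D s = 1 and the coefficients are constants, D turns the relation into one with fewer
    terms, and the integers that appear are invertible. *)
Lemma constant_expansion n (G : nat -> K) : (forall i, (0 < i < n)%N -> i%:R != 0 :> K) ->
  (forall i, D (G i) = 0) -> \sum_(i < n) G i * s ^+ i = 0 ->
  forall i, (i < n)%N -> G i = 0.
Proof.
elim: n G => [|n IH] G cn DG E i //.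
have E1 : \sum_(i < n) (i.+1%:R * G i.+1) * s ^+ i = 0.
  have := congr1 D E; rewrite (der_0 dD) (der_sum dD) big_ord_recl /=.
  rewrite expr0 mulr1 DG add0r => E0; rewrite -[RHS]E0; apply: eq_bigr => j _.
  by rewrite (der_M dD) DG mulr0 addr0 (der_X dD) Ds /bump /= add1n; ring.
have D1 j : D (j.+1%:R * G j.+1) = 0.
  by rewrite -(rmorph_nat iota) (der_cM dD) DG mulr0.
have H1 j : (j < n)%N -> G j.+1 = 0.
  move=> jn; have H := IH (fun j => j.+1%:R * G j.+1) _ D1 E1 j jn.
  have cn' l : (0 < l < n)%N -> l%:R != 0 :> K by move=> /andP [l0 ln]; apply: cn; rewrite l0 ltnW.
  have /eqP := H cn'.
  by rewrite mulf_eq0 (negPf (cn j.+1 _)) //= => /eqP.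
case: i => [|i] lt; last exact: H1.
move: E; rewrite big_ord_recl expr0 mulr1 big1 ?addr0 // => j _.
by rewrite /= /bump add1n H1 ?mul0r.
Qed.
End ConstantExpansion.

Section Params.
Variables (k : closedFieldType) (K : fieldType) (iota : {rmorphism k -> K}).
Variables x0 z0 : K.
Hypothesis indep : alg_indep iota [:: x0; z0].
Hypothesis gen : generates iota [:: x0; z0].

Let i0 : 'I_(size [:: x0; z0]) := ord0.
Let i1 : 'I_(size [:: x0; z0]) := lift ord0 ord0.
Definition dX := partial indep gen i0.
Definition dZ := partial indep gen i1.

Lemma dX_der : der iota dX. Proof. exact: partial_der. Qed.
Lemma dZ_der : der iota dZ. Proof. exact: partial_der. Qed.
Lemma dXx : dX x0 = 1. Proof. exact: (partial_tau indep gen i0 i0). Qed.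
Lemma dXz : dX z0 = 0. Proof. exact: (partial_tau indep gen i0 i1). Qed.
Lemma dZx : dZ x0 = 0. Proof. exact: (partial_tau indep gen i1 i0). Qed.
Lemma dZz : dZ z0 = 1. Proof. exact: (partial_tau indep gen i1 i1). Qed.

Lemma der_dXZ D : der iota D -> forall h, D h = D x0 * dX h + D z0 * dZ h.
Proof.
by move=> dD h; rewrite (der_partial indep gen dD) !big_ord_recl big_ord0 addr0.
Qed.

Definition jacobian (D1 D2 : K -> K) u v := D1 u * D2 v - D1 v * D2 u.

Definition dual_ders (D1 D2 : K -> K) s t :=
  [/\ der iota D1, der iota D2, D1 s = 1 /\ D1 t = 0 & D2 s = 0 /\ D2 t = 1].

Lemma dual_ders_ex s t : jacobian dX dZ s t != 0 -> exists D1 D2, dual_ders D1 D2 s t /\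
  forall h, D1 h = (dX h * dZ t - dX t * dZ h) / jacobian dX dZ s t /\
            D2 h = (dX s * dZ h - dX h * dZ s) / jacobian dX dZ s t.
Proof.
rewrite /jacobian => J0.
exists (fun h => (dX h * dZ t - dX t * dZ h) / jacobian dX dZ s t),
  (fun h => (dX s * dZ h - dX h * dZ s) / jacobian dX dZ s t); split=> //.
have X := dX_der; have Z := dZ_der; rewrite /jacobian.
split; [split|split| |].
- by move=> u v; rewrite (der_D X) (der_D Z); ring.
- by move=> u v; rewrite (der_M X) (der_M Z); ring.
- by move=> c; rewrite (der_c X) (der_c Z); ring.
- by move=> u v; rewrite (der_D X) (der_D Z); ring.
- by move=> u v; rewrite (der_M X) (der_M Z); ring.
- by move=> c; rewrite (der_c X) (der_c Z); ring.
- by split; [rewrite divff|rewrite subrr mul0r].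
- by split; [rewrite subrr mul0r|rewrite divff].
Qed.

Lemma dual_ders_basis D1 D2 s t D : dual_ders D1 D2 s t -> der iota D ->
  forall h, D h = D s * D1 h + D t * D2 h.
Proof.
move=> [d1 d2 [D1s D1t] [D2s D2t]] dD.
pose D' h := D h - D s * D1 h - D t * D2 h.
have dD' : der iota D'.
  split=> [u v|u v|c]; rewrite /D'.
  - by rewrite (der_D dD) (der_D d1) (der_D d2); ring.
  - by rewrite (der_M dD) (der_M d1) (der_M d2); ring.
  - by rewrite (der_c dD) (der_c d1) (der_c d2); ring.
have Ds : D' s = 0 by rewrite /D' D1s D2s; ring.
have Dt : D' t = 0 by rewrite /D' D1t D2t; ring.
have H := der_dXZ dD'; have H1 := der_dXZ d1; have H2 := der_dXZ d2.
have Es := H s; have Et := H t; rewrite Ds in Es; rewrite Dt in Et.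
have J : jacobian dX dZ s t != 0.
  apply/eqP => J0; have /eqP := oner_neq0 K; apply.
  have E1 := H1 s; have E2 := H1 t; have E3 := H2 s; have E4 := H2 t.
  rewrite D1s in E1; rewrite D1t in E2; rewrite D2s in E3; rewrite D2t in E4.
  have -> : 1 = 1 * 1 - 0 * 0 :> K by ring.
  rewrite {1}E1 E4 {1}E2 E3.
  transitivity ((D1 x0 * D2 z0 - D1 z0 * D2 x0) * jacobian dX dZ s t); first by rewrite /jacobian; ring.
  by rewrite J0 mulr0.
have a0 : D' x0 = 0.
  apply: (mulIf J); rewrite mul0r /jacobian.
  transitivity ((D' x0 * dX s + D' z0 * dZ s) * dZ t - (D' x0 * dX t + D' z0 * dZ t) * dZ s); first by ring.
  by rewrite -Es -Et; ring.
have b0 : D' z0 = 0.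
  apply: (mulIf J); rewrite mul0r /jacobian.
  transitivity ((D' x0 * dX t + D' z0 * dZ t) * dX s - (D' x0 * dX s + D' z0 * dZ s) * dX t); first by ring.
  by rewrite -Es -Et; ring.
move=> h; have := H h; rewrite a0 b0 !mul0r addr0 /D' => E.
by apply/eqP; rewrite -subr_eq0 opprD addrA; apply/eqP.
Qed.

Section Point.
Variables (cs : seq (seq K)) (a : point iota cs).
Hypothesis ga : generates iota (chart a).
Local Notation O := (stalk a).
Local Notation M := (maximal_ideal a).
Let lO : local_ring iota O M := stalk_local a.
Let sO : subring iota O := stalk_sub a.

Section LocalParameters.
Variables (s t : K).
Hypothesis st : forall h, M h <-> exists u v, [/\ O u, O v & h = u * s + v * t].

Let Ms : M s.
Proof. by apply/st; exists 1, 0; rewrite mul1r mul0r addr0; split=> //; [exact: (subr_1 sO)|exact: (subr_0 sO)]. Qed.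
Let Mt : M t.
Proof. by apply/st; exists 0, 1; rewrite mul1r mul0r add0r; split=> //; [exact: (subr_0 sO)|exact: (subr_1 sO)]. Qed.

(** By [cotangentK] the differentials of [x0] and [z0] are combinations of ds and dt, so 1, the
    Jacobian of [x0], [z0], is a multiple of the Jacobian of s, t. *)
Lemma param_jac : jacobian dX dZ s t != 0.
Proof.
have [u [v E]] := cotangentK indep gen st ga x0.
have [u' [v' E']] := cotangentK indep gen st ga z0.
apply/eqP => J0; have /eqP := oner_neq0 K; apply.
have E1 := E i0; have E2 := E i1; have E3 := E' i0; have E4 := E' i1.
rewrite -!/(dX _) -!/(dZ _) dXx dZx dXz dZz in E1 E2 E3 E4.
have -> : 1 = 1 * 1 - 0 * 0 :> K by ring.
rewrite {1}E1 E4 {1}E2 E3.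
transitivity ((u * v' - v * u') * jacobian dX dZ s t); first by rewrite /jacobian; ring.
by rewrite J0 mulr0.
Qed.

(** By Cramer's rule the derivations dual to s, t read off the coefficients of dh = u ds + v dt, and
    these are in O by [cotangent]. *)
Lemma param_ders : exists D1 D2, dual_ders D1 D2 s t /\ forall h, O h -> O (D1 h) /\ O (D2 h).
Proof.
have J := param_jac; have [D1 [D2 [dd DE]]] := dual_ders_ex J; exists D1, D2; split=> // h Oh.
have [u [v [Ou Ov E]]] := cotangent indep gen st Oh.
have E1 := E i0; have E2 := E i1; rewrite -!/(dX _) -!/(dZ _) in E1 E2.
have [-> ->] := DE h; rewrite E1 E2.
have -> : ((u * dX s + v * dX t) * dZ t - dX t * (u * dZ s + v * dZ t)) / jacobian dX dZ s t = u.
  by move: J; rewrite /jacobian => J; field.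
have -> : (dX s * (u * dZ s + v * dZ t) - (u * dX s + v * dX t) * dZ s) / jacobian dX dZ s t = v.
  by move: J; rewrite /jacobian => J; field.
by [].
Qed.

(* In characteristic p, O is spanned by the s^i t^j with i, j < p over the      *)
(* subring O^p of p-th powers (Nakayama), on which all derivations vanish.      *)
Lemma frobenius_span p : p \in [pchar k] -> forall h, O h ->
  exists c : nat -> nat -> K, (forall i j, O (c i j)) /\
    h = \sum_(i < p) (\sum_(j < p) c i j ^+ p * t ^+ j) * s ^+ i.
Proof.
move=> pk; have pK : p \in [pchar K] by rewrite (fmorph_pchar iota).
have p_pr := pcharf_prime pk; have p_gt0 := prime_gt0 p_pr.
have pD (u v : K) : (u + v) ^+ p = u ^+ p + v ^+ p.
  by apply: exprDn_pchar; rewrite (eq_pnat _ (pcharf_eq pK)) pnat_id.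
pose R h := exists g, O g /\ h = g ^+ p.
pose N h := exists g, M g /\ h = g ^+ p.
have root (c : k) : exists d, c = d ^+ p.
  have [d] := solve_monicpoly (fun i => if i == 0%N then c else 0) p_gt0.
  case: (p) p_gt0 => // q _; rewrite big_ord_recl expr0 mulr1 big1 ?addr0 => [E|i _]; first by exists d.
  by rewrite mul0r.
have sR : subring iota R.
  split=> [c|u v [f [Of ->]] [g [Og ->]]|u v [f [Of ->]] [g [Og ->]]].
  - by have [d ->] := root c; exists (iota d); rewrite rmorphXn; split=> //; exact: (subr_c sO).
  - by exists (f + g); rewrite pD; split=> //; exact: (subr_D sO).
  - by exists (f * g); rewrite exprMn; split=> //; exact: (subr_M sO).
have lR : local_ring iota R N.
  split=> //; first by move=> u [g [Mg ->]]; exists g; split=> //; exact: (loc_R lO).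
  - split; first by exists 0; rewrite expr0n (gtn_eqF p_gt0); split=> //; exact: (loc_0 lO).
    move=> u v [f [Of ->]] [g [Og ->]]; exists (f + g).
    by rewrite pD; split=> //; exact: (loc_D lO).
  - move=> u v [f [Of ->]] [g [Og ->]]; exists (f * g).
    by rewrite exprMn; split=> //; exact: (loc_Ml lO).
  split=> [[g [Mg E]]|u [f [Of ->]] nN].
    by apply: (loc_1 lO); rewrite E -(prednK p_gt0); apply: (loc_XM lO) => //; exact: (loc_R lO).
  exists f^-1; rewrite exprVn; split=> //; apply: (loc_V lO) => // Mf.
  by apply: nN; exists f.
pose B (y : K^o) := exists c : nat -> nat -> K, (forall i j, O (c i j)) /\
    y = \sum_(i < p) (\sum_(j < p) c i j ^+ p * t ^+ j) * s ^+ i.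
have B0 : B 0.
  exists (fun _ _ => 0); split=> [i j|]; first exact: (subr_0 sO).
  rewrite big1 // => i _; rewrite big1 ?mul0r // => j _.
  by rewrite expr0n (gtn_eqF p_gt0) mul0r.
have BD u v : B u -> B v -> B (u + v).
  move=> [c [Oc ->]] [c' [Oc' ->]]; exists (fun i j => c i j + c' i j).
  split=> [i j|]; first exact: (subr_D sO).
  rewrite -big_split; apply: eq_bigr => i _ /=; rewrite -mulrDl; congr (_ * _).
  by rewrite -big_split; apply: eq_bigr => j _ /=; rewrite pD mulrDl.
have BZ c u : R c -> B u -> B (c *: u).
  move=> [g [Og ->]] [c' [Oc' ->]]; exists (fun i j => g * c' i j).
  split=> [i j|]; first exact: (subr_M sO).
  rewrite [LHS]mulr_sumr; apply: eq_bigr => i _; rewrite mulrA mulr_sumr; congr (_ * _).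
  by apply: eq_bigr => j _; rewrite exprMn mulrA.
have Bmon c i j : (i < p)%N -> (j < p)%N -> B (iota c * s ^+ i * t ^+ j).
  move=> ip jp; have [d ->] := root c.
  exists (fun i' j' => if (i' == i) && (j' == j) then iota d else 0); split.
    by move=> i' j'; case: ifP => _; [exact: (subr_c sO)|exact: (subr_0 sO)].
  rewrite (bigD1 (Ordinal ip)) //= (bigD1 (Ordinal jp)) //= !eqxx /=.
  rewrite big1 ?addr0 => [|j' /negPf]; last first.
    by rewrite -val_eqE /= => ->; rewrite expr0n (gtn_eqF p_gt0) mul0r.
  rewrite big1 ?addr0 ?rmorphXn => [|i' /negPf]; first by rewrite -!mulrA [s ^+ i * _]mulrC.
  rewrite -val_eqE /= => ->; rewrite big1 ?mul0r // => j' _.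
  by rewrite expr0n (gtn_eqF p_gt0) mul0r.
(* [B'] is B + s^p O + t^p O. Expanding in s and t up to total order 2p shows that it is all of O,
   as a monomial of that order is divisible by s^p or t^p. *)
pose B' y := exists w1 w2 y0, [/\ B y0, O w1, O w2 & y = y0 + s ^+ p * w1 + t ^+ p * w2].
have B'D u v : B' u -> B' v -> B' (u + v).
  move=> [w1 [w2 [y0 [By Ow1 Ow2 ->]]]] [w1' [w2' [y0' [By' Ow1' Ow2' ->]]]].
  exists (w1 + w1'), (w2 + w2'), (y0 + y0').
  by split; [exact: BD|exact: (subr_D sO)|exact: (subr_D sO)|ring].
have Os := loc_R lO Ms; have Ot := loc_R lO Mt.
have B's i j h : O h -> (p <= i)%N || (p <= j)%N -> B' (s ^+ i * t ^+ j * h).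
  move=> Oh; case: (leqP p i) => [pi _|_ /= pj].
    exists (s ^+ (i - p) * t ^+ j * h), 0, 0; split=> //; last by rewrite -{1}(subnKC pi) exprD; ring.
      by do ?apply: (subr_M sO) => //; apply: (subr_X sO).
    exact: (subr_0 sO).
  exists 0, (s ^+ i * t ^+ (j - p) * h), 0; split=> //; last by rewrite -{1}(subnKC pj) exprD; ring.
    exact: (subr_0 sO).
  by do ?apply: (subr_M sO) => //; apply: (subr_X sO).
have OB' h : O h -> B' h.
  suff H r i j : (2 * p <= i + j + r)%N -> forall h, O h -> B' (s ^+ i * t ^+ j * h).
    by move=> Oh; have := H (2 * p)%N 0%N 0%N (leqnn _) h Oh; rewrite !mul1r.
  elim: r i j => [|r IH] i j le h' Oh.
    by apply: B's => //; apply/orP; lia.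
  case: (boolP ((p <= i)%N || (p <= j)%N)) => [H|]; first exact: B's.
  rewrite negb_or -!ltnNge => /andP [ip jp].
  have [c Mh] := stalk_residue a Oh.
  have /st [u [v [Ou Ov E]]] := Mh.
  have -> : s ^+ i * t ^+ j * h' = iota c * s ^+ i * t ^+ j +
      (s ^+ i.+1 * t ^+ j * u + s ^+ i * t ^+ j.+1 * v).
    rewrite !exprS; have -> : h' = u * s + v * t + iota c by rewrite -E subrK.
    ring.
  apply: (B'D); last by apply: (B'D); apply: IH => //; lia.
  exists 0, 0, (iota c * s ^+ i * t ^+ j); rewrite !mulr0 !addr0.
  by split; [exact: Bmon|exact: (subr_0 sO)|exact: (subr_0 sO)|].
pose g := chart a.
(* O is a finite module over R, the ring of p-th powers: division of exponents by p leaves the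
   monomials in the generators with exponents below p, and a denominator Q is replaced by Q^p. *)
pose L : seq K^o := [seq evalK iota 'X_[r] | r : bmultinom (size g) (size g * p).+1].
have RO c : R c -> O c by move=> [u [Ou ->]]; apply: (subr_X sO).
have R0 := subr_0 sR; have R1 := subr_1 sR.
have RM : forall u v, R u -> R v -> R (u * v) by exact: (subr_M sR).
have RD : forall u v, R u -> R v -> R (u + v) by exact: (subr_D sR).
have spanO h : O h -> comb R B L (h : K^o).
  have spanX (m : 'X_{1..size g}) : comb R B L (evalK iota 'X_[m] : K^o).
    pose q := [multinom (m i %/ p)%N | i < size g].
    pose r := [multinom (m i %% p)%N | i < size g].
    have -> : m = (q *+ p + r)%MM by apply/mnmP => i; rewrite mnmDE mulmnE !mnmE -divn_eq.
    rewrite mpolyXD -mpolyXn evalKM.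
    have -> : evalK iota ('X_[q] ^+ p) = evalK iota 'X_[q] ^+ p.
      by rewrite /evalK rmorphXn.
    have Rq : R (evalK iota 'X_[q] ^+ p) by exists (evalK iota 'X_[q]); split=> //; exact: (stalk_ev a).
    apply: (comb_Z (V := K^o) BZ Rq (C := R)) => [u|]; first exact: RM.
    apply: (comb_mem (V := K^o) B0) => //.
    have dr : (mdeg r < (size g * p).+1)%N.
      rewrite ltnS mdegE -[X in (_ <= X * _)%N](card_ord (size g)) -sum_nat_const.
      by apply: leq_sum => i _; rewrite mnmE ltnW // ltn_mod.
    by apply/mapP; exists (BMultinom dr); rewrite ?mem_enum.
  have spanP (P : {mpoly k[size g]}) : comb R B L (evalK iota P : K^o).
    elim/mpolyind: P => [|c m P _ _ IH].
      by rewrite /evalK mmap0; apply: (comb_N (V := K^o)).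
    rewrite evalKD; apply: (comb_D (V := K^o) BD) => //.
    rewrite -mul_mpolyC evalKM evalKC; apply: (comb_Z (V := K^o) BZ (subr_c sR c) (C := R)) => // u.
    exact/RM/(subr_c sR).
  move=> [P [Q [Q0 ->]]]; have q0 := evalK_neq0 Q0.
  have -> : evalK iota P / evalK iota Q = (evalK iota Q)^-1 ^+ p * evalK iota (P * Q ^+ p.-1).
    have -> : evalK iota (P * Q ^+ p.-1) = evalK iota P * evalK iota Q ^+ p.-1.
      by rewrite evalKM /evalK rmorphXn.
    by rewrite -{1}(prednK p_gt0) exprVn exprS; field; rewrite q0 expf_neq0.
  apply: (comb_Z (V := K^o) BZ (C := R)) (spanP _) => [|u].
    by exists (evalK iota Q)^-1; split=> //; exists 1, Q; rewrite evalK1 div1r.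
  apply: RM; exists (evalK iota Q)^-1; split=> //; exists 1, Q; rewrite evalK1 div1r; by split.
have LO y : y \in L -> O y by move=> /mapP [r _ ->]; exact: (stalk_ev a).
have BL : forall y, y \in L -> B y.
  apply: (nakayama (V := K^o) lR BD BZ) => y /LO /OB' [w1 [w2 [y0 [By Ow1 Ow2 ->]]]].
  have ND : forall u v, N u -> N v -> N (u + v) by exact: (loc_D lR).
  apply: (comb_D (V := K^o) BD) => //; [apply: (comb_D (V := K^o) BD) => //|].
  - by apply: (comb_N (V := K^o)) => //; exact: (loc_0 lR).
  - have Rs : R (s ^+ p) by exists s.
    apply: (comb_Z (V := K^o) BZ Rs _ (spanO _ Ow1)) => u Ru.
    by apply: (loc_Mr lR) => //; exists s.
  have Rt : R (t ^+ p) by exists t.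
  apply: (comb_Z (V := K^o) BZ Rt _ (spanO _ Ow2)) => u Ru.
  by apply: (loc_Mr lR) => //; exists t.
by move=> h Oh; apply: (comb_in (V := K^o) BD BZ (fun c Rc => Rc) BL (spanO _ Oh)).
Qed.

(** In characteristic 0, [D2] turns t^(n+1) = s u into (n+1) t^n = s [D2 u], and the descent ends
    with s a unit. In characteristic p, expand u over p-th powers in the s^i t^j. Comparing the
    coefficients of s^0 t^r in t^n = s u, where n = p n' + r and p-th powers count as constants,
    gives (t^n')^p = c^p s^p. Hence t^n' = s c with n' < n. *)
Lemma param_dim2 n u : O u -> t ^+ n <> s * u.
Proof.
have [D1 [D2 [[d1 d2 [D1s D1t] [D2s D2t]] DO]]] := param_ders.
have not1 v : O v -> 1 <> s * v.
  by move=> Ov E; apply: (loc_1 lO); rewrite E; apply: (loc_Mr lO).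
case: (classic (exists p, p \in [pchar k])) => [[p pk]|c0]; last first.
  have nz m : m.+1%:R != 0 :> K.
    rewrite -(rmorph_nat iota) fmorph_eq0; apply/negP => m0.
    by apply: c0; apply: (natf0_pchar (n := m.+1)).
  elim: n u => [|n IH] u Ou E; first by apply: (not1 u).
  apply: (IH (D2 u / n.+1%:R)).
    apply: (subr_M sO); first by case: (DO u Ou).
    by rewrite -(rmorph_nat iota) -fmorphV; exact: (subr_c sO).
  have := congr1 D2 E; rewrite (der_X d2) D2t (der_M d2) D2s mulr0 addr0 mulr1 => E'.
  move: (nz n) E'; move: (n.+1%:R) => q q0 E'; apply: (mulfI q0); rewrite E'; field.
  exact: q0.
have pK : p \in [pchar K] by rewrite (fmorph_pchar iota).
have p_pr := pcharf_prime pk; have p_gt0 := prime_gt0 p_pr.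
have pD (b1 b2 : K) : (b1 - b2) ^+ p = b1 ^+ p - b2 ^+ p.
  have np : [pchar K].-nat p by rewrite (eq_pnat _ (pcharf_eq pK)) pnat_id.
  by rewrite exprDn_pchar // exprNn_pchar.
have Dp D c : der iota D -> D (c ^+ p) = 0.
  move=> dD; rewrite -(prednK p_gt0) (der_X dD) (prednK p_gt0).
  by rewrite (pcharf0 pK) !mul0r.
have cp i : (0 < i < p)%N -> i%:R != 0 :> K.
  by move=> /andP [i0' ip]; rewrite -(dvdn_pcharf pK); apply/negP => /dvdn_leq; lia.
elim/ltn_ind: n u => n IH u Ou E.
have [n0|n0] := posnP n; first by apply: (not1 u) => //; rewrite -E n0.
have [c [Oc Eu]] := frobenius_span pk Ou.
pose r := (n %% p)%N; pose n' := (n %/ p)%N.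
have rp : (r < p)%N by rewrite ltn_mod.
(* The coefficient of s^i in s u - t^n over the constants of [D1]: the factor s shifts the index,
   and the term with s^(p-1) comes back to index 0 with the constant s^p. *)
pose G i := if i is i'.+1 then \sum_(j < p) c i' j ^+ p * t ^+ j else
  \sum_(j < p) (c p.-1 j ^+ p * s ^+ p - (j == r :> nat)%:R * (t ^+ n') ^+ p) * t ^+ j.
have DG i : D1 (G i) = 0.
  case: i => [|i]; rewrite /G (der_sum d1) big1 // => j _; rewrite (der_M d1).
    have -> : D1 (t ^+ j) = 0.
      by case: (nat_of_ord j) => [|l]; rewrite ?expr0 ?(der_1 d1) // (der_X d1) D1t mulr0.
    rewrite mulr0 add0r (der_B d1) -exprMn (Dp _ _ d1) -(rmorph_nat iota) (der_cM d1) (Dp _ _ d1).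
    by rewrite mulr0 subr0 mulr0.
  rewrite (Dp _ _ d1) mulr0 addr0.
  by case: (nat_of_ord j) => [|l]; rewrite ?expr0 ?(der_1 d1) ?mulr0 // (der_X d1) D1t !mulr0.
have En : t ^+ n = (t ^+ n') ^+ p * t ^+ r by rewrite -exprM -exprD -divn_eq.
have EG : \sum_(i < p) G i * s ^+ i = 0.
  have Etn : \sum_(j < p) ((j == r :> nat)%:R * (t ^+ n') ^+ p) * t ^+ j = s * u.
    rewrite (bigD1 (Ordinal rp)) //= eqxx mul1r -En E big1 ?addr0 // => j /negPf.
    by rewrite -val_eqE /= => ->; rewrite !mul0r.
  have -> : \sum_(i < p) G i * s ^+ i = s * u - s * u; last by rewrite subrr.
  rewrite -{2}Etn Eu; case: (p) p_gt0 @G DG => // q _ G DG.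
  rewrite big_ord_recl [in RHS]big_ord_recr /= expr0 mulr1.
  have -> : \sum_(j < q.+1) (c q j ^+ q.+1 * s ^+ q.+1 - (j == r :> nat)%:R * (t ^+ n') ^+ q.+1) * t ^+ j =
      (\sum_(j < q.+1) c q j ^+ q.+1 * t ^+ j) * s ^+ q.+1 -
      \sum_(j < q.+1) ((j == r :> nat)%:R * (t ^+ n') ^+ q.+1) * t ^+ j.
    by rewrite mulr_suml -sumrB; apply: eq_bigr => j _; ring.
  have -> : \sum_(l < q) (\sum_(j < q.+1) c (0 + l)%N j ^+ q.+1 * t ^+ j) * s ^+ bump 0 l =
      (\sum_(l < q) (\sum_(j < q.+1) c l j ^+ q.+1 * t ^+ j) * s ^+ l) * s.
    by rewrite mulr_suml; apply: eq_bigr => l _; rewrite /bump /= add1n exprS; ring.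
  by rewrite exprS; ring.
have G0 := constant_expansion d1 D1s cp DG EG p_gt0.
have Dg i : D2 (c p.-1 i ^+ p * s ^+ p - (i == r :> nat)%:R * (t ^+ n') ^+ p) = 0.
  rewrite (der_B d2) -exprMn (Dp _ _ d2) -(rmorph_nat iota) (der_cM d2) (Dp _ _ d2).
  by rewrite mulr0 subr0.
have := constant_expansion d2 D2t cp Dg G0 rp.
rewrite eqxx mul1r -exprMn -pD => /eqP; rewrite expf_eq0 p_gt0 subr_eq0 /= => /eqP E'.
apply: (IH n' _ (c p.-1 r)) => //; last by rewrite -E' mulrC.
by rewrite ltn_Pdiv // prime_gt1.
Qed.

Lemma param_neq0 : s != 0.
Proof.
apply: contraNneq param_jac => s0; rewrite /jacobian s0 (der_0 dX_der) (der_0 dZ_der).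
by rewrite mul0r mulr0 subrr.
Qed.

Lemma param_gen h : M h -> exists u v, [/\ O u, O v & h = u * s + v * t].
Proof. by move/st. Qed.

Lemma param_s : M s. Proof. exact: Ms. Qed.
Lemma param_t : M t. Proof. exact: Mt. Qed.
End LocalParameters.

Lemma stalk_frac h : exists u w, [/\ O u, O w, w != 0 & h = u / w].
Proof.
have [P [Q [Q0 ->]]] := ga h; exists (evalK iota P), (evalK iota Q).
by split=> //; exact: (stalk_ev a).
Qed.

End Point.
End Params.

(** * Discrete valuations *)
Section Valuations.
Variables (k : closedFieldType) (K : fieldType) (iota : {rmorphism k -> K}).

(** The value at 0 is arbitrary instead of infinite, whence the conditions on nonzero arguments here
    and in [nn] and [pos]. *)
Definition dval (v : K -> int) :=
  [/\ forall a b, a != 0 -> b != 0 -> v (a * b) = v a + v b,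
      forall m a b, a != 0 -> b != 0 -> a + b != 0 -> m <= v a -> m <= v b -> m <= v (a + b)
    & forall c, c != 0 -> v (iota c) = 0].

Definition nn (v : K -> int) h := h != 0 -> 0 <= v h.
Definition pos (v : K -> int) h := h != 0 -> 0 < v h.

Section Laws.
Variable v : K -> int.
Hypothesis dv : dval v.

Lemma val_M a b : a != 0 -> b != 0 -> v (a * b) = v a + v b.
Proof. by case: dv => + _ _; exact. Qed.
Lemma val_1 : v 1 = 0.
Proof. by case: dv => _ _ /(_ 1); rewrite rmorph1; apply; exact: oner_neq0. Qed.
Lemma val_V a : a != 0 -> v a^-1 = - v a.
Proof.
move=> a0; apply/eqP; rewrite -addr_eq0 -val_M ?invr_eq0 // mulVf // val_1 //.
Qed.
Lemma val_div a b : a != 0 -> b != 0 -> v (a / b) = v a - v b.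
Proof. by move=> a0 b0; rewrite val_M ?invr_eq0 // val_V. Qed.
Lemma val_N a : v (- a) = v a.
Proof.
have [->|a0] := eqVneq a 0; first by rewrite oppr0.
rewrite -mulN1r val_M ?oppr_eq0 ?oner_neq0 //.
by case: dv => _ _ /(_ (-1)); rewrite rmorphN1 => -> //; rewrite ?oppr_eq0 ?oner_neq0 ?add0r.
Qed.
Lemma val_X a n : a != 0 -> v (a ^+ n) = n%:R * v a.
Proof.
move=> a0; elim: n => [|n IH]; first by rewrite expr0 val_1 mul0r.
by rewrite exprS val_M ?expf_neq0 // IH -[in RHS]natr1 mulrDl mul1r addrC.
Qed.
Lemma val_c c : c != 0 -> v (iota c) = 0. Proof. by case: dv => _ _; exact. Qed.

Lemma nn_subring : subring iota (nn v).
Proof.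
split=> [c|a b na nb|a b na nb].
- by move=> c0; rewrite val_c //; apply: contraNneq c0 => ->; rewrite rmorph0.
- move=> ab0; have [a0|a0] := eqVneq a 0; first by move: nb ab0; rewrite a0 add0r.
  have [b0|b0] := eqVneq b 0; first by move: na ab0; rewrite b0 addr0.
  by case: dv => _ H _; apply: H => //; [exact: na|exact: nb].
- rewrite /nn mulf_eq0 negb_or => /andP [a0 b0]; rewrite val_M //.
  by apply: addr_ge0; [exact: na|exact: nb].
Qed.

Lemma val_local : local_ring iota (nn v) (pos v).
Proof.
split; first exact: nn_subring.
- by move=> u pu u0; exact: (ltW (pu u0)).
- split=> [|a b pa pb]; first by move=> /eqP.
  move=> ab0; have [a0|a0] := eqVneq a 0; first by move: pb ab0; rewrite a0 add0r.
  have [b0|b0] := eqVneq b 0; first by move: pa ab0; rewrite b0 addr0.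
  have := pa a0; have := pb b0; case: dv => _ H _ vb va.
  have va1 : 1 <= v a by lia.
  have vb1 : 1 <= v b by lia.
  exact: (lt_le_trans ltr01 (H 1 a b a0 b0 ab0 va1 vb1)).
- move=> a b na pb; rewrite /pos mulf_eq0 negb_or => /andP [a0 b0]; rewrite val_M //.
  by have := na a0; have := pb b0; lia.
split=> [H|u nu np].
  by have := H (oner_neq0 _); rewrite val_1.
rewrite /nn invr_eq0 => u0; rewrite val_V //.
have := nu u0; case: (ltrP 0 (v u)) => [lt|]; last by lia.
by case: np.
Qed.

Lemma nn_or u : nn v u \/ pos v u^-1.
Proof.
have [u0|u0] := eqVneq u 0; first by left; move=> /negP; rewrite u0 eqxx.
case: (lerP 0 (v u)) => H; first by left.
by right => _; rewrite val_V //; lia.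
Qed.
End Laws.

(** Stability under the derivations of R is included because the multiplicity estimates need the
    Jacobians of elements of the valuation ring to stay in that ring. *)
Definition Oval (R : K -> Prop) (v : K -> int) :=
  [/\ dval v, forall h, R h -> nn v h &
      forall D, der iota D -> (forall h, R h -> R (D h)) -> forall h, nn v h -> nn v (D h)].

Section Prime.
Variables (R M : K -> Prop).
Hypothesis lR : local_ring iota R M.
Hypothesis nR : noetherian R.
Hypothesis frac : forall h, exists u w, [/\ R u, R w, w != 0 & h = u / w].
Variable p : K.
Hypothesis pp : prime_elt R M p.
Let sR : subring iota R := loc_sub lR.
Local Notation dv := (dv R).

Let Mp : M p. Proof. by case: pp. Qed.
Let p0 : p != 0. Proof. by case: pp. Qed.

Lemma not_dv_neq0 u : ~ dv p u -> u != 0.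
Proof. by apply: contra_not_neq => ->; exists 0; rewrite mulr0; split=> //; exact: (subr_0 sR). Qed.

Lemma not_dv_M u w : R u -> R w -> ~ dv p u -> ~ dv p w -> ~ dv p (u * w).
Proof. by move=> Ru Rw nu nw; case: pp => _ _ H /H [] //. Qed.

Lemma val_ex h : h != 0 -> exists z : int, exists u w,
  [/\ R u, R w, ~ dv p u, ~ dv p w & h = p ^ z * (u / w)].
Proof.
move=> h0; have [u [w [Ru Rw w0 E]]] := frac h.
have u0 : u != 0 by apply: contraNneq h0 => u0; rewrite E u0 mul0r.
have [n [u' [Ru' nu' Eu]]] := prime_power lR nR pp Ru u0.
have [m [w' [Rw' nw' Ew]]] := prime_power lR nR pp Rw w0.
exists (n%:Z - m%:Z), u', w'; split=> //.
rewrite expfzDr // -invr_expz -!exprnP E Eu Ew.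
have := not_dv_neq0 nw' => w'0; have := expf_neq0 m p0 => pm0; field; exact/andP.
Qed.

Lemma val_uniq z z' u w u' w' : R u -> R w -> R u' -> R w' ->
  ~ dv p u -> ~ dv p w -> ~ dv p u' -> ~ dv p w' ->
  p ^ z * (u / w) = p ^ z' * (u' / w') -> z = z'.
Proof.
have H y y' a b a' b' : R a -> R b -> R a' -> R b' ->
    ~ dv p a -> ~ dv p b -> ~ dv p b' ->
    p ^ y * (a / b) = p ^ y' * (a' / b') -> y' <= y.
  move=> Ra Rb Ra' Rb' na nb nb' E; rewrite leNgt; apply/negP => lt.
  have b0 := not_dv_neq0 nb; have b'0 := not_dv_neq0 nb'.
  have [n En] : exists n : nat, y' = y + n.+1%:Z.
    by exists `|y' - y|.-1%N; lia.
  apply: (not_dv_M Ra Rb' na nb').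
  exists (p ^+ n * a' * b); split.
    by apply: (subr_M sR) => //; apply: (subr_M sR) => //; apply: (subr_X sR); exact: (loc_R lR).
  have py0 : p ^ y != 0 by rewrite expfz_neq0.
  apply: (mulfI py0); transitivity (p ^ y * (a / b) * (b * b')).
    by field.
  by rewrite E En expfzDr // -exprnP exprS; field.
move=> Ru Rw Ru' Rw' nu nw nu' nw' E; apply/eqP; rewrite eq_le.
by rewrite (H z' z u' w' u w) // (H z z' u w u' w').
Qed.

Let val_ex' h : exists z : int, h != 0 -> exists u w,
  [/\ R u, R w, ~ dv p u, ~ dv p w & h = p ^ z * (u / w)].
Proof.
by have [->|/val_ex [z H]] := eqVneq h 0; [exists 0|exists z].
Qed.

Definition pval h : int := proj1_sig (constructive_indefinite_description _ (val_ex' h)).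

Lemma pvalP z u w : R u -> R w -> ~ dv p u -> ~ dv p w -> pval (p ^ z * (u / w)) = z.
Proof.
move=> Ru Rw nu nw; rewrite /pval; case: constructive_indefinite_description => z' /= [|u' [w' [Ru' Rw' nu' nw' E]]].
  by rewrite !mulf_eq0 invr_eq0 (negPf (not_dv_neq0 nu)) (negPf (not_dv_neq0 nw)) expfz_eq0 (negPf p0) andbF.
exact: val_uniq (esym E).
Qed.

Let integral h := exists u w, [/\ R u, R w, ~ dv p w & h = u / w].

Let integral_D a b : integral a -> integral b -> integral (a + b).
Proof.
move=> [u [w [Ru Rw nw ->]]] [u' [w' [Ru' Rw' nw' ->]]].
exists (u * w' + u' * w), (w * w'); split.
- by apply: (subr_D sR); apply: (subr_M sR).
- exact: (subr_M sR).
- exact: not_dv_M.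
- by rewrite addf_div ?not_dv_neq0.
Qed.

Let pval_integral h m : h != 0 -> (m <= pval h) <-> integral (h * p ^ (- m)).
Proof.
move=> h0; have [z [u [w [Ru Rw nu nw E]]]] := val_ex h0.
have w0 := not_dv_neq0 nw.
have -> : pval h = z by rewrite E pvalP.
split=> [le|[u' [w' [Ru' Rw' nw' E']]]].
  have [n En] : exists n : nat, z = m + n%:Z by exists `|z - m|%N; lia.
  exists (p ^+ n * u), w; split=> //; first by apply: (subr_M sR) => //; apply: (subr_X sR); exact: (loc_R lR).
  have pm0 : p ^ m != 0 by rewrite expfz_neq0.
  by rewrite E En expfzDr // -exprnP -invr_expz; field; exact/andP.
have u'0 : u' != 0.
  apply: contraNneq h0 => u'0; have := E'; rewrite u'0 mul0r => /eqP.
  by rewrite mulf_eq0 expfz_eq0 (negPf p0) andbF orbF.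
have [n [u1 [Ru1 nu1 Eu1]]] := prime_power lR nR pp Ru' u'0.
suff -> : z = m + n%:Z by lia.
apply: (@val_uniq _ _ u w u1 w') => //.
rewrite -E expfzDr // -exprnP; apply: (mulIf (expfz_neq0 (- m) p0)).
rewrite E' Eu1 -invr_expz; have pm0 : p ^ m != 0 by rewrite expfz_neq0.
by have w'0 := not_dv_neq0 nw'; field; exact/andP.
Qed.

Lemma pval_nn h : nn pval h <-> integral h.
Proof.
have [->|h0] := eqVneq h 0.
  split=> [_|_ /eqP //]; exists 0, 1; rewrite mul0r; split=> //; [exact: (subr_0 sR)|exact: (subr_1 sR)|].
  by move=> /(dv_M lR Mp) /(loc_1 lR).
have := pval_integral 0 h0; rewrite oppr0 expr0z mulr1 => H.
by split=> [/(_ h0) /(proj1 H)|/(proj2 H) H1 _].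
Qed.

Lemma pval_Oval : Oval R pval.
Proof.
split.
- split=> [a b a0 b0|m a b a0 b0 ab0|c c0].
  + have [z [u [w [Ru Rw nu nw Ea]]]] := val_ex a0.
    have [z' [u' [w' [Ru' Rw' nu' nw' Eb]]]] := val_ex b0.
    have w0 := not_dv_neq0 nw; have w'0 := not_dv_neq0 nw'.
    have -> : pval a = z by rewrite Ea pvalP.
    have -> : pval b = z' by rewrite Eb pvalP.
    rewrite -(@pvalP (z + z') (u * u') (w * w')); [|exact: (subr_M sR)|exact: (subr_M sR)|exact: not_dv_M|exact: not_dv_M].
    by rewrite Ea Eb expfzDr //; congr pval; field; exact/andP.
  + move=> /(pval_integral _ a0) Ia /(pval_integral _ b0) Ib; apply/(pval_integral _ ab0).
    by rewrite mulrDl; apply: integral_D.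
  + have nc : ~ dv p (iota c) by move=> /(dv_M lR Mp); exact: (loc_c lR).
    have n1 : ~ dv p 1 by move=> /(dv_M lR Mp); exact: (loc_1 lR).
    have := @pvalP 0 (iota c) 1; rewrite expr0z mul1r divr1; apply=> //; first exact: (subr_c sR).
    exact: (subr_1 sR).
- move=> h Rh; apply/pval_nn; exists h, 1; rewrite divr1; split=> //; first exact: (subr_1 sR).
  by move=> /(dv_M lR Mp); exact: (loc_1 lR).
- move=> D dD RD h /pval_nn [u [w [Ru Rw nw ->]]]; apply/pval_nn.
  have w0 := not_dv_neq0 nw.
  exists (w * D u - u * D w), (w * w); split.
  + by apply: (subr_B sR); apply: (subr_M sR) => //; apply: RD.
  + exact: (subr_M sR).
  + exact: not_dv_M.
  + by rewrite (der_div dD) //; field.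
Qed.

Lemma pval_neg u w : R u -> R w -> w != 0 -> ~ dv p u -> dv p w -> pval (u / w) < 0.
Proof.
move=> Ru Rw w0 nu pw.
have [[|n] [w' [Rw' nw' Ew]]] := prime_power lR nR pp Rw w0.
  by case: nw'; move: pw; rewrite Ew mul1r.
have w'0 := not_dv_neq0 nw'; have pn0 := expf_neq0 n.+1 p0.
suff -> : u / w = p ^ (- n.+1%:Z) * (u / w') by rewrite pvalP.
by rewrite Ew -invr_expz -exprnP; field; exact/andP.
Qed.
End Prime.

Section PointValuations.
Variables x0 z0 : K.
Hypothesis indep : alg_indep iota [:: x0; z0].
Hypothesis gen : generates iota [:: x0; z0].
Variables (cs : seq (seq K)) (a : point iota cs).
Hypothesis ga : generates iota (chart a).
Hypothesis reg : regular_point2 a.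

(** In lowest terms, a function outside O has a prime in its denominator that does not divide its
    numerator; its order at that prime is negative. *)
Lemma stalk_valuations phi : phi != 0 ->
  (forall v, Oval (stalk a) v -> 0 <= v phi) -> stalk a phi.
Proof.
move=> phi0 H; apply: NNPP => nphi.
have [s [t st]] := reg; have lO := stalk_local a.
have nO : noetherian (stalk a) by exact: stalk_noetherian.
have frac := stalk_frac ga.
have [u [w [p [Ru Rw pp E [w0 [nu pw]]]]]] := local_fraction lO nO frac (param_s st) (param_t st)
  (param_neq0 indep gen ga st) (param_gen st) (param_dim2 indep gen ga st) nphi.
have := H _ (pval_Oval lO nO frac pp); rewrite E leNgt.
by rewrite (pval_neg lO nO frac pp Ru Rw w0 nu pw).
Qed.

Lemma stalk_lowest phi : exists u w, [/\ stalk a u, stalk a w, w != 0, phi = u / w &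
  forall c, stalk a c -> stalk a (c * u / w) -> stalk a (c / w)].
Proof.
have [s [t st]] := reg; have lO := stalk_local a.
have nO : noetherian (stalk a) by exact: stalk_noetherian.
have frac := stalk_frac ga.
have [u [w [Ou Ow w0 E cop]]] := lowest_terms lO nO frac phi.
exists u, w; split=> // c Oc Ocu.
have [|r [Or Er]] := lowest_dvd lO nO frac (param_s st) (param_t st)
  (param_neq0 indep gen ga st) (param_gen st) (param_dim2 indep gen ga st) Ou Ow w0 cop Oc.
  by exists (c * u / w); split=> //; rewrite [RHS]mulrC divfK.
by rewrite Er mulrAC divff // mul1r.
Qed.
End PointValuations.
End Valuations.

(** * Coordinates on the surface *)
Section Bivariate.
Variables (k : closedFieldType) (R : comNzRingType) (iota : {rmorphism k -> R}).
Implicit Types (q : {poly k}) (P : {poly {poly k}}).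

Definition ev1 x : {poly k} -> R := horner_morph (fun c => mulrC x (iota c)).
HB.instance Definition _ x := GRing.RMorphism.on (ev1 x).

(** The inner variable is x and the outer one is z: the coefficient of x^a z^j is the a-th
    coefficient of the j-th coefficient. *)
Definition ev2 x z : {poly {poly k}} -> R := horner_morph (fun q => mulrC z (ev1 x q)).
HB.instance Definition _ x z := GRing.RMorphism.on (ev2 x z).

Lemma ev1C x c : ev1 x c%:P = iota c. Proof. exact: horner_morphC. Qed.
Lemma ev1X x : ev1 x 'X = x. Proof. exact: horner_morphX. Qed.
Lemma ev2C x z q : ev2 x z q%:P = ev1 x q. Proof. exact: horner_morphC. Qed.
Lemma ev2X x z : ev2 x z 'X = z. Proof. exact: horner_morphX. Qed.

Lemma ev1D x p q : ev1 x (p + q) = ev1 x p + ev1 x q. Proof. exact: rmorphD. Qed.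
Lemma ev1B x p q : ev1 x (p - q) = ev1 x p - ev1 x q. Proof. exact: rmorphB. Qed.
Lemma ev1M x p q : ev1 x (p * q) = ev1 x p * ev1 x q. Proof. exact: rmorphM. Qed.
Lemma ev1_exp x p n : ev1 x (p ^+ n) = ev1 x p ^+ n. Proof. exact: rmorphXn. Qed.
Lemma ev1_0 x : ev1 x 0 = 0. Proof. exact: rmorph0. Qed.
Lemma ev1_1 x : ev1 x 1 = 1. Proof. exact: rmorph1. Qed.
Lemma ev2D x z P Q : ev2 x z (P + Q) = ev2 x z P + ev2 x z Q. Proof. exact: rmorphD. Qed.
Lemma ev2B x z P Q : ev2 x z (P - Q) = ev2 x z P - ev2 x z Q. Proof. exact: rmorphB. Qed.
Lemma ev2M x z P Q : ev2 x z (P * Q) = ev2 x z P * ev2 x z Q. Proof. exact: rmorphM. Qed.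
Lemma ev2_exp x z P n : ev2 x z (P ^+ n) = ev2 x z P ^+ n. Proof. exact: rmorphXn. Qed.
Lemma ev2_0 x z : ev2 x z 0 = 0. Proof. exact: rmorph0. Qed.
Lemma ev2_1 x z : ev2 x z 1 = 1. Proof. exact: rmorph1. Qed.

Lemma ev1E x q : ev1 x q = \sum_(a < size q) iota q`_a * x ^+ a.
Proof.
rewrite -{1}[q]coefK poly_def rmorph_sum; apply: eq_bigr => i _.
by rewrite -mul_polyC rmorphM rmorphXn /= ev1C ev1X.
Qed.

Lemma ev2E x z P : ev2 x z P = \sum_(j < size P) ev1 x P`_j * z ^+ j.
Proof.
rewrite -{1}[P]coefK poly_def rmorph_sum; apply: eq_bigr => i _.
by rewrite -mul_polyC rmorphM rmorphXn /= ev2C ev2X.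
Qed.
End Bivariate.

Lemma rmorph2_eq (k : closedFieldType) (R : nzRingType) (f g : {rmorphism {poly {poly k}} -> R}) :
  (forall c, f c%:P%:P = g c%:P%:P) -> f 'X%:P = g 'X%:P -> f 'X = g 'X -> f =1 g.
Proof.
move=> fc fx fz P; elim/poly_ind: P => [|P q IH]; first by rewrite !rmorph0.
rewrite !rmorphD !rmorphM IH fz; congr (_ + _).
elim/poly_ind: q => [|q c IHq]; first by rewrite !rmorph0.
by rewrite polyCD polyCM !rmorphD !rmorphM IHq fx fc.
Qed.

Section MPoly2.
Variable k : closedFieldType.

Definition poly_of_mpoly (p : {mpoly k[2]}) : {poly {poly k}} :=
  mmap (polyC \o polyC) (fun i : 'I_2 => if i == 0 then 'X%:P else 'X) p.

Definition mpoly_of_poly (P : {poly {poly k}}) : {mpoly k[2]} :=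
  ev2 (@mpolyC 2 k) 'X_0 'X_1 P.

Lemma poly_of_mpolyX (p : {mpoly k[2]}) (R : comNzRingType) (f : {rmorphism {mpoly k[2]} -> R})
   (g : {rmorphism {poly {poly k}} -> R}) :
  (forall c, f c%:MP = g c%:P%:P) -> f 'X_0 = g 'X%:P -> f 'X_1 = g 'X -> f p = g (poly_of_mpoly p).
Proof.
move=> fc fx fz; elim/mpolyind: p => [|c m p _ _ IH].
  by rewrite /poly_of_mpoly mmap0 !rmorph0.
rewrite /poly_of_mpoly mmapD !rmorphD IH; congr (_ + _).
rewrite -mul_mpolyC !rmorphM /= mmapC fc; congr (_ * _).
rewrite mmapX /mmap1 mpolyXE_id !big_ord_recl !big_ord0 !mulr1 !rmorphM !rmorphXn /=.
rewrite fx; congr (_ * _ ^+ _).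
by rewrite -fz; congr (f 'X_ _); apply: val_inj.
Qed.

Lemma poly_of_mpolyK : cancel poly_of_mpoly mpoly_of_poly.
Proof.
move=> p; rewrite /mpoly_of_poly.
rewrite -(poly_of_mpolyX p (f := idfun) (g := ev2 (@mpolyC 2 k) 'X_0 'X_1)) //= => [c||].
- by rewrite ev2C ev1C.
- by rewrite ev2C ev1X.
- by rewrite ev2X.
Qed.

Lemma mpoly_of_polyK : cancel mpoly_of_poly poly_of_mpoly.
Proof.
move=> P; rewrite /mpoly_of_poly /poly_of_mpoly.
set f := mmap _ _; pose g := f \o ev2 (@mpolyC 2 k) 'X_0 'X_1.
apply: (rmorph2_eq (f := g) (g := idfun)) => [c||]; rewrite /g /f /=.
- by rewrite ev2C ev1C mmapC.
- by rewrite ev2C ev1X mmapX mmap1U.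
- by rewrite ev2X mmapX mmap1U.
Qed.
End MPoly2.

Section Coords.
Variables (k : closedFieldType) (K : fieldType) (iota : {rmorphism k -> K}).
Local Notation ev1 := (@ev1 k K iota).
Local Notation ev2 := (@ev2 k K iota).
Implicit Types (x z : K).

Definition coords x z := (forall P, ev2 x z P = 0 -> P = 0) /\
  generates iota [:: x; z].

Lemma evalK_ev2 x z (p : {mpoly k[2]}) :
  @evalK k K iota [:: x; z] p = ev2 x z (poly_of_mpoly p).
Proof.
apply: (poly_of_mpolyX p (f := mmap iota (fun i : 'I_2 => [:: x; z]`_i)) (g := ev2 x z)) => [c||].
- by rewrite /= ev2C ev1C mmapC.
- by rewrite /= ev2C ev1X mmapX mmap1U.
- by rewrite /= ev2X mmapX mmap1U.
Qed.

Lemma coords_indep x z : coords x z -> alg_indep iota [:: x; z].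
Proof.
move=> [inj _] p E; have := evalK_ev2 x z p; rewrite E => /esym /inj P0.
by rewrite -(poly_of_mpolyK p) P0 /mpoly_of_poly rmorph0.
Qed.

Lemma indep_coords x z : alg_indep iota [:: x; z] -> generates iota [:: x; z] -> coords x z.
Proof.
move=> ind gen; split=> // P E; rewrite -(mpoly_of_polyK P).
have -> : mpoly_of_poly P = 0; last by rewrite /poly_of_mpoly mmap0.
by apply: (ind (mpoly_of_poly P)); rewrite evalK_ev2 mpoly_of_polyK.
Qed.

Lemma coords_inj x z : coords x z -> injective (ev2 x z).
Proof. by move=> [inj _]; apply: raddf_inj. Qed.

Lemma generates2 x z : generates iota [:: x; z] <->
  forall h, exists P Q, ev2 x z Q != 0 /\ h = ev2 x z P / ev2 x z Q.
Proof.
split=> gen h; have [P [Q [Q0 E]]] := gen h.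
  by exists (poly_of_mpoly P), (poly_of_mpoly Q); rewrite -!evalK_ev2.
by exists (mpoly_of_poly P), (mpoly_of_poly Q); rewrite !evalK_ev2 !mpoly_of_polyK.
Qed.

Lemma coords_frac x z : coords x z -> forall h, exists P Q, ev2 x z Q != 0 /\ h = ev2 x z P / ev2 x z Q.
Proof. by move=> [_ /generates2]. Qed.

Lemma generates_trans x z x' z' : generates iota [:: x; z] ->
  in_field iota [:: x'; z'] x -> in_field iota [:: x'; z'] z -> generates iota [:: x'; z'].
Proof.
move=> /generates2 gen fx fz h; have [P [Q [_ ->]]] := gen h.
have f2 p : in_field iota [:: x'; z'] (ev2 x z p).
  have f0 : in_field iota [:: x'; z'] 0.
    by rewrite -(rmorph0 iota); exact: in_field_scalar.
  rewrite ev2E; elim/big_ind: _ => // [|j _]; first exact: in_fieldD.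
  apply: in_fieldM; last exact: in_fieldX.
  rewrite ev1E; elim/big_ind: _ => // [|a _]; first exact: in_fieldD.
  by apply: in_fieldM; [exact: in_field_scalar|exact: in_fieldX].
by apply: in_fieldM => //; apply: in_fieldV.
Qed.

Lemma in_field_fst x z : in_field iota [:: x; z] x.
Proof. by apply: in_field_gen; rewrite mem_head. Qed.
Lemma in_field_snd x z : in_field iota [:: x; z] z.
Proof. by apply: in_field_gen; rewrite !inE eqxx orbT. Qed.

Lemma coords_x0 x z : coords x z -> x != 0.
Proof.
move=> [inj _]; apply/eqP => x0; have := inj 'X%:P; rewrite ev2C ev1X => /(_ x0) /eqP.
by rewrite polyC_eq0 polyX_eq0.
Qed.

Lemma coords_swap x z : coords x z -> coords z x.
Proof.
move=> [inj gen]; split.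
  move=> P E; rewrite -(swapXYK P); suff -> : swapXY P = 0 by rewrite rmorph0.
  apply: inj; rewrite -E; pose f := ev2 x z \o swapXY.
  apply: (rmorph2_eq (f := f) (g := ev2 z x)) => [c||]; rewrite /f /=.
  - by rewrite swapXY_polyC map_polyC /= !ev2C !ev1C.
  - by rewrite swapXY_polyC map_polyX ev2X ev2C ev1X.
  - by rewrite swapXY_X !ev2C ev1X ev2X.
apply: (generates_trans gen); [exact: in_field_snd|exact: in_field_fst].
Qed.

Lemma coords_z0 x z : coords x z -> z != 0.
Proof. by move=> /coords_swap /coords_x0. Qed.

Lemma coords_shift x z c : coords x z -> coords (x - iota c) z.
Proof.
move=> [inj gen]; split.
  have shiftK (d : k) : cancel (comp_poly ('X + d%:P)) (comp_poly ('X - d%:P)).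
    by move=> q; rewrite -comp_polyA comp_polyD comp_polyX comp_polyC subrK comp_polyXr.
  pose T := map_poly (comp_poly ('X - c%:P)).
  have TP P : ev2 x z (T P) = ev2 (x - iota c) z P.
    pose f := ev2 x z \o T.
    apply: (rmorph2_eq (f := f) (g := ev2 (x - iota c) z)) => [d||]; rewrite /f /T /=.
    - by rewrite map_polyC /= comp_polyC !ev2C !ev1C.
    - by rewrite map_polyC /= comp_polyX !ev2C !rmorphB /= !ev1X ev1C.
    - by rewrite map_polyX !ev2X.
  move=> P; rewrite -TP => /inj TP0; apply/polyP => j; rewrite coef0.
  have := congr1 (fun p : {poly {poly k}} => p`_j) TP0; rewrite coef_map coef0 /= => E.
  have := congr1 (comp_poly ('X + c%:P)) E; rewrite comp_poly0.
  have := shiftK (- c); rewrite polyCN opprK => -> //.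
apply: (generates_trans gen); last exact: in_field_snd.
rewrite -[X in in_field _ _ X](subrK (iota c) x); apply: in_fieldD; [exact: in_field_fst|exact: in_field_scalar].
Qed.

Lemma ev2_poly x z n (F : nat -> {poly k}) : ev2 x z (\poly_(j < n) F j) = \sum_(j < n) ev1 x (F j) * z ^+ j.
Proof.
rewrite poly_def rmorph_sum; apply: eq_bigr => j _.
by rewrite -mul_polyC rmorphM rmorphXn /= ev2C ev2X.
Qed.

Lemma ev1_poly x n (F : nat -> k) : ev1 x (\poly_(j < n) F j) = \sum_(j < n) iota (F j) * x ^+ j.
Proof.
rewrite poly_def rmorph_sum; apply: eq_bigr => j _.
by rewrite -mul_polyC rmorphM rmorphXn /= ev1C ev1X.
Qed.

Lemma coords_inv x z : coords x z -> coords x^-1 z.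
Proof.
move=> c; have x0 := coords_x0 c; have [inj gen] := c; split; last first.
  apply: (generates_trans gen); last exact: in_field_snd.
  by rewrite -[X in in_field _ _ X](invrK x); apply: in_fieldV; exact: in_field_fst.
move=> P; pose N := (\max_(j < size P) size (P`_j)%R)%N.
have sN j : (size (P`_j)%R <= N)%N.
  case: (ltnP j (size P)) => jP; last by rewrite nth_default // size_poly0.
  exact: (leq_bigmax (F := fun j : 'I_(size P) => size (P`_j)%R) (Ordinal jP)).
pose T := \poly_(j < size P) \poly_(a < N.+1) P`_j`_(N - a).
have TP : ev2 x z T = x ^+ N * ev2 x^-1 z P.
  rewrite ev2_poly ev2E mulr_sumr; apply: eq_bigr => j _; rewrite mulrA; congr (_ * _).
  rewrite ev1_poly (ev1E _ _ P`_j) (big_ord_widen N.+1 (fun a => iota P`_j`_a * x^-1 ^+ a)) ?leqW //.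
  rewrite [in RHS]big_mkcond mulr_sumr [RHS](reindex_inj rev_ord_inj) /=; apply: eq_bigr => a _.
  rewrite subSS; case: ltnP => ha; last by rewrite nth_default // rmorph0 mul0r mulr0.
  have -> : x ^+ N = x ^+ a * x ^+ (N - a) by rewrite -exprD subnKC // -ltnS.
  by rewrite exprVn mulrCA mulfK ?expf_neq0.
move=> E; have : T = 0 by apply: inj; rewrite TP E mulr0.
move=> T0; apply/polyP => j; apply/polyP => a; rewrite !coef0.
case: (ltnP j (size P)) => jP; last by rewrite (nth_default 0 jP) coef0.
case: (ltnP a N.+1) => aN; last by rewrite nth_default // (leq_trans (sN j)) // ltnW.
have := congr1 (fun p : {poly {poly k}} => p`_j`_(N - a)) T0.
by rewrite /T coef_poly jP coef_poly ltnS leq_subr !coef0 subKn.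
Qed.

Lemma coords_mul x z : coords x z -> coords x (z * x).
Proof.
move=> c; have x0 := coords_x0 c; have [inj gen] := c; split; last first.
  apply: (generates_trans gen); first exact: in_field_fst.
  rewrite -[X in in_field _ _ X](mulfK x0 z); apply: in_fieldM; first exact: in_field_snd.
  by apply: in_fieldV; exact: in_field_fst.
move=> P; pose T := \poly_(j < size P) (P`_j * 'X^j).
have TP : ev2 x z T = ev2 x (z * x) P.
  rewrite ev2_poly ev2E; apply: eq_bigr => j _.
  by rewrite rmorphM rmorphXn /= ev1X exprMn -mulrA [x ^+ j * _]mulrC.
rewrite -TP => /inj T0; apply/polyP => j; rewrite coef0.
case: (ltnP j (size P)) => jP; last by rewrite nth_default.
have := congr1 (fun p : {poly {poly k}} => p`_j) T0; rewrite coef0 coef_poly jP => /eqP.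
by rewrite mulf_eq0 expf_eq0 polyX_eq0 andbF orbF => /eqP.
Qed.

Lemma coords_div x z : coords x z -> coords x (z / x).
Proof.
move=> c; have x0 := coords_x0 c; have [inj gen] := c; split; last first.
  apply: (generates_trans gen); first exact: in_field_fst.
  rewrite -[X in in_field _ _ X](divfK x0 z); apply: in_fieldM; first exact: in_field_snd.
  exact: in_field_fst.
move=> P; pose T := \poly_(j < size P) (P`_j * 'X^(size P - j)).
have TP : ev2 x z T = x ^+ (size P) * ev2 x (z / x) P.
  rewrite ev2_poly ev2E mulr_sumr; apply: eq_bigr => j _.
  rewrite rmorphM rmorphXn /= ev1X exprMn exprVn.
  have -> : x ^+ size P = x ^+ (size P - j) * x ^+ j by rewrite -exprD subnK // ltnW.
  by field; exact: expf_neq0.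
move=> E; have T0 : T = 0 by apply: inj; rewrite TP E mulr0.
apply/polyP => j; rewrite coef0.
case: (ltnP j (size P)) => jP; last by rewrite nth_default.
have := congr1 (fun p : {poly {poly k}} => p`_j) T0; rewrite coef0 coef_poly jP => /eqP.
by rewrite mulf_eq0 expf_eq0 polyX_eq0 andbF orbF => /eqP.
Qed.

Lemma coords_divX x z n : coords x z -> coords x (z / x ^+ n).
Proof.
move=> c; elim: n => [|n IH]; first by rewrite divr1.
by rewrite exprSr invfM mulrA; apply: coords_div.
Qed.

Lemma coords_inv2 x z : coords x z -> coords x z^-1.
Proof. by move=> /coords_swap /coords_inv /coords_swap. Qed.

Lemma coords_shift2 x z c : coords x z -> coords x (z - iota c).
Proof. by move=> /coords_swap /coords_shift H; apply/coords_swap/H. Qed.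

Section Span.
Implicit Type D : nat -> nat -> Prop.

Definition supp D (P : {poly {poly k}}) := forall a j, P`_j`_a != 0 -> D a j.

Definition inpoly D x z h := exists P, supp D P /\ h = ev2 x z P.

Lemma inpoly_0 D x z : inpoly D x z 0.
Proof. by exists 0; rewrite rmorph0; split=> // a j; rewrite !coef0 eqxx. Qed.

Lemma inpoly_D D x z u v : inpoly D x z u -> inpoly D x z v -> inpoly D x z (u + v).
Proof.
move=> [P [DP ->]] [Q [DQ ->]]; exists (P + Q); rewrite rmorphD; split=> // a j.
rewrite !coefD; have [->|Pa] := eqVneq P`_j`_a 0; first by rewrite add0r; exact: DQ.
by move=> _; exact: DP.
Qed.

Lemma inpoly_c D x z c u : inpoly D x z u -> inpoly D x z (iota c * u).
Proof.
move=> [P [DP ->]]; exists (c%:P%:P * P); rewrite rmorphM /= ev2C ev1C; split=> // a j.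
by rewrite !coefCM mulf_eq0 negb_or => /andP [_]; exact: DP.
Qed.

Lemma inpoly_sum D x z (I : Type) (r : seq I) (F : I -> K) :
  (forall i, inpoly D x z (F i)) -> inpoly D x z (\sum_(i <- r) F i).
Proof. by move=> H; elim/big_ind: _ => //; [exact: inpoly_0|exact: inpoly_D]. Qed.

Lemma inpoly_mono D x z a j : D a j -> inpoly D x z (x ^+ a * z ^+ j).
Proof.
move=> Daj; exists (('X^a)%:P * 'X^j); split; last by rewrite rmorphM /= ev2C !rmorphXn /= ev1X ev2X.
move=> a' j'; rewrite coefCM coefXn; case: (eqVneq j' j) => [->|_]; last by rewrite mulr0 coef0 eqxx.
by rewrite mulr1 coefXn; case: (eqVneq a' a) => [-> //|_]; rewrite eqxx.
Qed.

Lemma inpoly_sub D D' x z x' z' g h : (forall a j, D a j -> inpoly D' x' z' (g * (x ^+ a * z ^+ j))) ->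
  inpoly D x z h -> inpoly D' x' z' (g * h).
Proof.
move=> H [P [DP ->]]; rewrite ev2E mulr_sumr; apply: inpoly_sum => j.
rewrite ev1E mulr_suml mulr_sumr; apply: inpoly_sum => a.
have [->|Pa] := eqVneq P`_j`_a 0; first by rewrite rmorph0 !mul0r mulr0; exact: inpoly_0.
by rewrite -mulrA mulrCA; apply: inpoly_c; apply: H; apply: DP.
Qed.

Lemma inpoly_weak D D' x z h : (forall a j, D a j -> D' a j) -> inpoly D x z h -> inpoly D' x z h.
Proof. by move=> DD [P [DP ->]]; exists P; split=> // a j /DP /DD. Qed.

Lemma inpoly_shift D x z c d h :
  (forall a j a' j', D a j -> (a' <= a)%N -> (j' <= j)%N -> D a' j') ->
  inpoly D x z h -> inpoly D (x - iota c) (z - iota d) h.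
Proof.
move=> Dle; rewrite -{2}(mul1r h); apply: inpoly_sub => a j Daj; rewrite mul1r.
rewrite -[X in X ^+ a * _](subrK (iota c) x) -[X in _ * X ^+ j](subrK (iota d) z) !exprDn big_distrlr /=.
apply: inpoly_sum => a'; apply: inpoly_sum => j'.
rewrite -[_ *+ 'C(a, a')]mulr_natl -[_ *+ 'C(j, j')]mulr_natl -!rmorphXn.
set A := (x - iota c) ^+ _; set B := (z - iota d) ^+ _.
have -> : ('C(a, a'))%:R * (A * iota (c ^+ a')) * ('C(j, j')%:R * (B * iota (d ^+ j'))) =
   iota ('C(a, a')%:R * c ^+ a' * 'C(j, j')%:R * d ^+ j') * (A * B).
  by rewrite !rmorphM !rmorph_nat /=; ring.
by apply/inpoly_c/inpoly_mono/(Dle _ _ _ _ Daj); exact: leq_subr.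
Qed.

Lemma inpoly_or D (E : nat -> nat -> Prop) x z h : inpoly D x z h ->
  inpoly (fun a j => D a j /\ E a j) x z h \/
  exists P a j, [/\ h = ev2 x z P, supp D P, P`_j`_a != 0 & ~ E a j].
Proof.
move=> [P [DP ->]]; case: (classic (exists a j, P`_j`_a != 0 /\ ~ E a j)).
  by move=> [a [j [Pa nE]]]; right; exists P, a, j.
move=> H; left; exists P; split=> // a j Pa; split; first exact: DP.
by apply: NNPP => nE; apply: H; exists a, j.
Qed.
End Span.
End Coords.

(** * Multiplicities along a discrete valuation *)
Section LocalRoot.
Variables (k : closedFieldType) (K : fieldType) (iota : {rmorphism k -> K}).
Variables (R M : K -> Prop).
Hypothesis lR : local_ring iota R M.
Local Notation ev1 := (@ev1 k K iota).
Local Notation ev2 := (@ev2 k K iota).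

Lemma ev1_in y q : R y -> R (ev1 y q).
Proof.
move=> Ry; have sR := loc_sub lR; rewrite ev1E; apply: (subr_sum sR) => i _.
by apply: (subr_M sR); [exact: (subr_c sR)|exact: (subr_X sR)].
Qed.

Lemma ev2_in x z P : R x -> R z -> R (ev2 x z P).
Proof.
move=> Rx Rz; have sR := loc_sub lR; rewrite ev2E; apply: (subr_sum sR) => i _.
by apply: (subr_M sR); [exact: ev1_in|exact: (subr_X sR)].
Qed.

(** q splits into linear factors over k, and M is prime. *)
Lemma local_root y q : R y -> q != 0 -> M (ev1 y q) -> exists c, root q c /\ M (y - iota c).
Proof.
move=> Ry; move: {2}(size q) (leqnn (size q)) => n; elim: n q => [|n IH] q sq q0.
  by move: sq; rewrite leqn0 size_poly_eq0 (negPf q0).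
have [/eqP s1|s1] := boolP (size q == 1).
  have [c c0 ->] : exists2 c, c != 0 & q = c%:P.
    by move/eqP/size_poly1P: s1 => [c c0 ->]; exists c.
  by rewrite ev1C => /(loc_c lR c0).
have /closed_rootP [c rc] := s1.
have /factor_theorem [g Eg] := rc.
rewrite Eg rmorphM /= => /(loc_prime lR) [||Mg|Mc]; try exact: ev1_in.
  have g0 : g != 0 by apply: contraNneq q0 => g0; rewrite Eg g0 mul0r.
  have [|c' [rc' Mc']] := IH g _ g0 Mg.
    by move: sq; rewrite Eg size_Mmonic ?monicXsubC // size_XsubC addn2.
  by exists c'; split=> //; rewrite rootM rc'.
exists c; split; first by rewrite rootM root_XsubC eqxx orbT.
by move: Mc; rewrite rmorphB /= ev1X ev1C.
Qed.

Lemma ev1_const y q : R y -> M y -> M (ev1 y q - iota q`_0).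
Proof.
move=> Ry My; have sR := loc_sub lR; elim/poly_ind: q => [|q c _].
  by rewrite rmorph0 coef0 rmorph0 subr0; exact: (loc_0 lR).
rewrite rmorphD rmorphM /= ev1X ev1C coefD coefMX eqxx add0r coefC eqxx addrK.
by apply: (loc_Ml lR) => //; exact: ev1_in.
Qed.

Lemma ev2_fst x z c P : R z -> M (x - iota c) -> M (ev2 x z P - ev1 z (map_poly (horner^~ c) P)).
Proof.
move=> Rz Mx; have sR := loc_sub lR.
have Rx : R x by rewrite -(subrK (iota c) x); apply: (subr_D sR); [exact: (loc_R lR)|exact: (subr_c sR)].
elim/poly_ind: P => [|P q IH].
  by rewrite /map_poly size_poly0 poly_def big_ord0 !rmorph0 subrr; exact: (loc_0 lR).
have -> : map_poly (horner^~ c) (P * 'X + q%:P) = map_poly (horner^~ c) P * 'X + (q.[c])%:P.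
  rewrite -!/(horner_eval c _) -[horner^~ c]/(horner_eval c).
  by rewrite rmorphD rmorphM /= map_polyX map_polyC.
rewrite !rmorphD !rmorphM /= ev2X ev2C ev1X ev1C opprD addrACA -mulrBl; apply: (loc_D lR).
  exact: (loc_Mr lR).
have : M (ev1 x q - ev1 (iota c) q).
  elim/poly_ind: q => [|q d IHq]; first by rewrite !rmorph0 subrr; exact: (loc_0 lR).
  rewrite !rmorphD !rmorphM /= !ev1X !ev1C opprD addrACA subrr addr0.
  have -> : ev1 x q * x - ev1 (iota c) q * iota c =
    (ev1 x q - ev1 (iota c) q) * x + ev1 (iota c) q * (x - iota c) by ring.
  apply: (loc_D lR); first exact: (loc_Mr lR).
  by apply: (loc_Ml lR) => //; apply: ev1_in; exact: (subr_c sR).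
congr (M (_ - _)); rewrite /ev1 /horner_morph.
by rewrite horner_map.
Qed.
End LocalRoot.

Section Multiplicity.
Variables (k : closedFieldType) (K : fieldType) (iota : {rmorphism k -> K}).
Local Notation ev1 := (@ev1 k K iota).
Local Notation ev2 := (@ev2 k K iota).
Variables (v : K -> int) (D1 D2 : K -> K).
Hypothesis dv : dval iota v.
Hypothesis d1 : der iota D1.
Hypothesis d2 : der iota D2.
Hypothesis n1 : forall h, nn v h -> nn v (D1 h).
Hypothesis n2 : forall h, nn v h -> nn v (D2 h).
Local Notation jac := (jacobian D1 D2).

Lemma jac_swap s t : jac t s = - jac s t.
Proof. by rewrite /jacobian; ring. Qed.

Lemma jac_shift s t c d : jac (s - iota c) (t - iota d) = jac s t.
Proof. by rewrite /jacobian !(der_B d1) !(der_B d2) !(der_c d1) !(der_c d2) !subr0. Qed.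

Lemma jac_div s t : s != 0 -> jac s (t / s) = jac s t / s.
Proof. by move=> s0; rewrite /jacobian (der_div d1) // (der_div d2) //; field. Qed.

Lemma jac_mul s t : jac s (t * s) = jac s t * s.
Proof. by rewrite /jacobian (der_M d1) (der_M d2); ring. Qed.

Lemma jac_inv s t : t != 0 -> jac s t^-1 = - jac s t / t ^+ 2.
Proof. by move=> t0; rewrite /jacobian (der_V d1) // (der_V d2) //; field. Qed.

Lemma jac_nn s t : nn v s -> nn v t -> nn v (jac s t).
Proof.
move=> ns nt; have sR := nn_subring dv.
by apply: (subr_B sR); apply: (subr_M sR); auto.
Qed.

(* Blow up the centre of v: t = s (t' + c) divides the Jacobian by s, and the   *)
(* strict transform of a curve has at most the multiplicity of the curve.       *)
Lemma val_multiplicity s t (P : {poly {poly k}}) a j : pos v s -> pos v t -> jac s t != 0 ->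
  P`_j`_a != 0 -> ev2 s t P != 0 -> v (ev2 s t P) <= (a + j)%:R * v (jac s t).
Proof.
have lv := val_local dv; have sv := nn_subring dv.
(* Induction on the value of the Jacobian, which each blow-up divides by [s1]. *)
suff H N s1 t1 (P1 : {poly {poly k}}) a1 j1 : (`|v (jac s1 t1)| <= N)%N -> pos v s1 -> pos v t1 -> jac s1 t1 != 0 ->
    P1`_j1`_a1 != 0 -> ev2 s1 t1 P1 != 0 -> v (ev2 s1 t1 P1) <= (a1 + j1)%:R * v (jac s1 t1).
  exact: H (leqnn _).
clear s t P a j; elim: N s1 t1 P1 a1 j1 => [|N IH] s1 t1 P1 a1 j1; last first.
  move=> leN ps pt J0 Pa P0.
  wlog lest : s1 t1 P1 a1 j1 leN ps pt J0 Pa P0 / v s1 <= v t1.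
    move=> W; case: (lerP (v s1) (v t1)) => le; first exact: W.
    have EP : ev2 t1 s1 (swapXY P1) = ev2 s1 t1 P1.
      pose f := ev2 t1 s1 \o swapXY.
      apply: (rmorph2_eq (f := f) (g := ev2 s1 t1)) => [c||]; rewrite /f /=.
      - by rewrite swapXY_polyC map_polyC /= !ev2C !ev1C.
      - by rewrite swapXY_polyC map_polyX ev2X ev2C ev1X.
      - by rewrite swapXY_X !ev2C ev1X ev2X.
    have := W t1 s1 (swapXY P1) j1 a1; rewrite EP jac_swap (val_N dv) oppr_eq0 coef_swapXY addnC.
    by apply=> //; exact: ltW.
  have s0 : s1 != 0.
    by apply: contraNneq J0 => ->; rewrite /jacobian (der_0 d1) (der_0 d2) mul0r mulr0 subrr.
  have t0 : t1 != 0.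
    by apply: contraNneq J0 => ->; rewrite /jacobian (der_0 d1) (der_0 d2) mul0r mulr0 subrr.
  have vs := ps s0.
  pose tau := t1 / s1; have ntau : nn v tau by move=> _; rewrite (val_div dv) //; lia.
  have EJ : jac s1 tau = jac s1 t1 / s1 by exact: jac_div.
  have J'0 : jac s1 tau != 0 by rewrite EJ mulf_neq0 ?invr_eq0.
  have vJ' : 0 <= v (jac s1 tau) by apply: jac_nn => // _; exact: ltW.
  have vJ : v (jac s1 t1) = v s1 + v (jac s1 tau) by rewrite EJ (val_div dv) //; ring.
  (* m is the multiplicity of [P1] at the centre; the bound for m implies the bound for every
     monomial. *)
  have [m [j0 [a0 [mE Pm minm]]]] : exists m j0 a0, [/\ (a0 + j0)%N = m, P1`_j0`_a0 != 0 &
      forall j a, P1`_j`_a != 0 -> (m <= a + j)%N].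
    move: {2}(a1 + j1)%N (leqnn (a1 + j1)) => n.
    elim: n a1 j1 Pa => [|n IHn] a2 j2 Pa le.
      by exists (a2 + j2)%N, j2, a2; split=> // j' a' _; move: le; lia.
    case: (classic (exists j' a', P1`_j'`_a' != 0 /\ (a' + j' < a2 + j2)%N)) => [[j' [a' [Pa' lt]]]|H].
      by apply: (IHn a' j') => //; lia.
    exists (a2 + j2)%N, j2, a2; split=> // j' a' Pa'; rewrite leqNgt; apply/negP => lt.
    by apply: H; exists j', a'.
  suff : v (ev2 s1 t1 P1) <= m%:R * v (jac s1 t1).
    have := minm _ _ Pa; move: (v (ev2 _ _ _)) (v (jac s1 t1)) vJ => A B EB le1 le2.
    apply: le_trans le2 _; apply: ler_wpM2r; first by lia.
    by rewrite ler_nat.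
  pose n := size P1.
  pose L := (\max_(j < n) size (P1`_j)%R)%N.
  have sL j : (size (P1`_j)%R <= L)%N.
    case: (ltnP j n) => jn; last by rewrite (nth_default 0 jn) size_poly0.
    exact: (leq_bigmax (F := fun j : 'I_n => size (P1`_j)%R) (Ordinal jn)).
  (* The strict transform: [P1] = s1^m Q(s1, tau) where t1 = s1 tau, so the exponents (a, j) become
     (a + j - m, j). *)
  pose Q := \poly_(j < n) \poly_(l < L + n) (if (j <= l + m)%N then P1`_j`_(l + m - j) else 0).
  have EQ : ev2 s1 t1 P1 = s1 ^+ m * ev2 s1 tau Q.
    rewrite ev2E ev2_poly mulr_sumr; apply: eq_bigr => j _.
    have -> : t1 ^+ j = s1 ^+ j * tau ^+ j by rewrite -exprMn /tau mulrC divfK.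
    rewrite mulrA mulrA; congr (_ * _); rewrite ev1E ev1_poly mulr_suml mulr_sumr.
    case: (leqP j m) => jm.
      (* exponents a + j = l + m with l = a + j - m *)
      pose F a := if (m <= a + j)%N then iota P1`_j`_a * s1 ^+ (a + j) else 0.
      transitivity (\sum_(a < L + n + m) F a).
        rewrite (big_ord_widen (L + n + m) (fun a => iota P1`_j`_a * s1 ^+ a * s1 ^+ j)); last by have := sL j; lia.
        rewrite big_mkcond; apply: eq_bigr => a _; rewrite /F -mulrA -exprD.
        case: ltnP => ha; last by rewrite nth_default // rmorph0 mul0r; case: ifP.
        case: (leqP m (a + j)) => ma //.
        have [->|/minm] := eqVneq P1`_j`_a 0; first by rewrite rmorph0 mul0r.
        by rewrite leqNgt ma.
      have -> : (L + n + m = (m - j) + (L + n + j))%N by lia.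
      rewrite big_split_ord /= big1 ?add0r => [|i _]; last first.
        by rewrite /F; case: leqP => // Hle; have := ltn_ord i; rewrite ltn_subRL addnC ltnNge Hle.
      rewrite [LHS]big_split_ord /=.
      rewrite [X in _ + X]big1 ?addr0 => [|i _].
        apply: eq_bigr => l _; rewrite /F.
        have -> : (j <= l + m)%N by lia.
        have -> : (m <= m - j + l + j)%N by lia.
        have -> : (m - j + l = l + m - j)%N by lia.
        have -> : (l + m - j + j = l + m)%N by lia.
        by rewrite exprD mulrA mulrC.
      rewrite /F nth_default ?rmorph0 ?mul0r; first by case: ifP.
      by apply: leq_trans (sL j) _; rewrite -(addnA L) addnCA leq_addr.
    transitivity (\sum_(l < L + n) (if (j - m <= l)%N then iota P1`_j`_(l + m - j) * s1 ^+ (l + m) else 0)).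
      have -> : (L + n = (j - m) + (L + n - (j - m)))%N by have := ltn_ord j; lia.
      rewrite [RHS]big_split_ord /= [X in _ = X + _]big1 ?add0r => [|i _]; last first.
        by case: leqP => // Hle; have := ltn_ord i; rewrite ltnNge Hle.
      rewrite (big_ord_widen (L + n - (j - m)) (fun a => iota P1`_j`_a * s1 ^+ a * s1 ^+ j)); last first.
        have jn : (j < n)%N := ltn_ord j.
        by apply: leq_trans (sL j) _; rewrite -addnBA ?leq_addr // (leq_trans (leq_subr _ _)) // ltnW.
      rewrite big_mkcond; apply: eq_bigr => a _; rewrite leq_addr.
      have -> : (j - m + a + m - j = a)%N by lia.
      have -> : (j - m + a + m = a + j)%N by lia.
      by rewrite exprD mulrA; case: ltnP => // ha; rewrite nth_default // rmorph0 !mul0r.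
    apply: eq_bigr => l _; have -> : (j - m <= l)%N = (j <= l + m)%N by lia.
    case: ifP => _; last by rewrite rmorph0 mul0r mulr0.
    by rewrite exprD; ring.
  have h'0 : ev2 s1 tau Q != 0 by apply: contraNneq P0 => h0; rewrite EQ h0 mulr0.
  have vh : v (ev2 s1 t1 P1) = m%:R * v s1 + v (ev2 s1 tau Q).
    by rewrite EQ (val_M dv) ?expf_neq0 // (val_X dv).
  (* Q on the exceptional curve, that is the tangent cone of [P1]: nonzero of degree at most m. *)
  pose F : {poly k} := map_poly (horner^~ 0) Q.
  have FE j : F`_j = Q`_j`_0.
    rewrite /F -[horner^~ 0]/(horner_eval 0) coef_map /= /horner_eval horner_coef0 //.
  have QE j : Q`_j`_0 = if (j < n)%N && (j <= m)%N then P1`_j`_(m - j) else 0.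
    rewrite coef_poly; case: ltnP => jn /=; last by rewrite coef0.
    rewrite coef_poly add0n; case: ltnP => // H0.
    by case: ifP => // _; rewrite nth_default //; have := sL j; lia.
  have F0 : F != 0.
    apply/eqP => F0; have := FE j0; rewrite F0 coef0 QE.
    have -> /= : (j0 <= m)%N by lia.
    have -> : (m - j0 = a0)%N by lia.
    case: ltnP => [_ /esym/eqP|jn _]; first by rewrite (negPf Pm).
    by move: Pm; rewrite (nth_default 0 jn) coef0 eqxx.
  have sF : (size F <= m.+1)%N.
    by apply/leq_sizeP => j lt; rewrite FE QE; case: andP => // [[_]]; rewrite leqNgt lt.
  have ns1 : nn v s1 by exact: (loc_R lv).
  (* If tau has a residue in k, the next centre is a point of the exceptional curve, at which Q has
     multiplicity at most m, and induction applies. Otherwise the centre is the whole curve, and Q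
     is a unit. *)
  case: (classic (exists c, pos v (tau - iota c))) => [[c pc]|nc].
    pose t' := tau - iota c; pose Q' := Q \Po ('X + (c%:P)%:P).
    have EQ' : ev2 s1 t' Q' = ev2 s1 tau Q.
      pose f := ev2 s1 t' \o comp_poly ('X + (c%:P)%:P).
      apply: (rmorph2_eq (f := f) (g := ev2 s1 tau)) => [d||]; rewrite /f /=.
      - by rewrite comp_polyC !ev2C !ev1C.
      - by rewrite comp_polyC !ev2C.
      - by rewrite comp_polyX rmorphD /= !ev2X ev2C ev1C subrK.
    have EJ' : jac s1 t' = jac s1 tau.
      by have := jac_shift s1 tau 0 c; rewrite rmorph0 subr0.
    have [j jm Qj] : exists2 j, (j <= m)%N & Q'`_j`_0 != 0.
      pose G := F \Po ('X + c%:P).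
      have GE j : G`_j = Q'`_j`_0.
        rewrite /G /F -[horner^~ 0]/(horner_eval 0).
        have -> : 'X + c%:P = map_poly (horner_eval 0) ('X + (c%:P)%:P).
          by rewrite rmorphD /= map_polyX map_polyC /= /horner_eval hornerC.
        by rewrite -map_comp_poly coef_map /= /horner_eval horner_coef0.
      have G0 : G != 0.
        rewrite /G comp_poly_eq0 // size_XaddC //.
      exists (size G).-1; last by rewrite -GE -lead_coefE lead_coef_eq0.
      by rewrite /G size_comp_poly2 ?size_XaddC // -subn1 leq_subLR add1n.
    rewrite vh -EQ'; have := IH s1 t' Q' 0%N j; rewrite EJ' add0n EQ' => /(_ _ ps pc J'0 Qj h'0) {}IH.
    have {}IH : v (ev2 s1 tau Q) <= j%:R * v (jac s1 tau) by apply: IH; rewrite vJ in leN; clear -leN vs vJ'; lia.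
    rewrite vJ mulrDr lerD2l; apply: le_trans IH _; apply: ler_wpM2r => //.
    by rewrite ler_nat.
  have vh0 : v (ev2 s1 tau Q) = 0.
    have nh : nn v (ev2 s1 tau Q) by apply: (ev2_in lv).
    have : ~ pos v (ev2 s1 tau Q).
      move=> ph.
      have ps0 : pos v (s1 - iota 0) by rewrite rmorph0 subr0.
      have := loc_B lv ph (ev2_fst lv Q ntau ps0); rewrite subKr.
      by move=> /(local_root lv ntau F0) [c [_ pc]]; apply: nc; exists c.
    have := nh h'0; case: (ltrP 0 (v (ev2 s1 tau Q))) => [lt _ H|]; last by clear; lia.
    by case: H => _.
  rewrite vh vh0 addr0 vJ mulrDr lerDl; apply: mulr_ge0 => //.
(* Value 0 is impossible: dividing by [s1] would produce elements of the valuation ring with a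
   Jacobian of negative value. *)
move=> le0 ps pt J0; exfalso.
have s0 : s1 != 0.
  by apply: contraNneq J0 => ->; rewrite /jacobian (der_0 d1) (der_0 d2) mul0r mulr0 subrr.
have t0 : t1 != 0.
  by apply: contraNneq J0 => ->; rewrite /jacobian (der_0 d1) (der_0 d2) mul0r mulr0 subrr.
wlog lest : s1 t1 le0 ps pt J0 s0 t0 / v s1 <= v t1.
  move=> W; case: (lerP (v s1) (v t1)) => le; first exact: (W s1 t1).
  by apply: (W t1 s1) => //; rewrite 1?jac_swap ?(val_N dv) ?oppr_eq0 // ltW.
have vs := ps s0.
have ntau : nn v (t1 / s1) by move=> _; rewrite (val_div dv) //; lia.
have J'0 : jac s1 (t1 / s1) != 0 by rewrite jac_div // mulf_neq0 ?invr_eq0.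
have : 0 <= v (jac s1 (t1 / s1)) by apply: jac_nn => // _; exact: ltW.
by rewrite jac_div // (val_div dv) //; move: le0; lia.
Qed.
End Multiplicity.

(** * The minimal linear system *)
Lemma nat_least (P : nat -> Prop) : (exists n, P n) -> exists n, P n /\ forall m, P m -> (n <= m)%N.
Proof.
move=> [n]; elim/ltn_ind: n => n IH Pn.
case: (classic (exists m, P m /\ (m < n)%N)) => [[m [Pm lt]]|H]; first exact: IH Pm.
exists n; split=> // m Pm; rewrite leqNgt; apply/negP => lt; apply: H; by exists m.
Qed.

Section LinearSystem.
Variables (k : closedFieldType) (K : fieldType) (iota : {rmorphism k -> K}).
Local Notation ev1 := (@ev1 k K iota).
Local Notation ev2 := (@ev2 k K iota).
Local Notation coords := (@coords k K iota).
Local Notation inpoly := (@inpoly k K iota).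
Variable f : seq K.
Hypothesis f0 : exists2 v, v \in f & v != 0.
Hypothesis fgen : forall v, v \in f -> v != 0 -> generates iota [seq u / v | u <- f].

(** The monomials of a linear system on F_e: n is its degree on the fibers, b its degree on the
    section z = 0, and b - e n that on the section at infinity. *)
Definition polygon e n b (a j : nat) : Prop := (j <= n /\ a + e * j <= b)%N.

Definition system x z e n b lam :=
  [/\ coords x z, lam != 0 & forall h, h \in f -> inpoly (polygon e n b) x z (lam * h)].

Definition admissible x z e n b := exists lam, system x z e n b lam.

Lemma inpoly_bound x z h : coords x z -> exists Q N, ev2 x z Q != 0 /\
  inpoly (polygon 0 N N) x z (ev2 x z Q * h).
Proof.
move=> c; have [P [Q [Q0 ->]]] := coords_frac c h.
pose N := (size P + \max_(j < size P) size (P`_j)%R)%N.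
exists Q, N; split=> //; exists P; split; last by rewrite mulrC divfK.
move=> a j Pa; rewrite /polygon mul0n addn0.
have jP : (j < size P)%N.
  by rewrite ltnNge; apply: contraNN Pa => le; rewrite (nth_default 0 le) coef0.
have aP : (a < size (P`_j)%R)%N.
  by rewrite ltnNge; apply: contraNN Pa => le; rewrite (nth_default 0 le).
have le := leq_bigmax (F := fun j : 'I_(size P) => size (P`_j)%R) (Ordinal jP).
split; first by apply: leq_trans (ltnW jP) (leq_addr _ _).
by apply: leq_trans (ltnW aP) _; apply: leq_trans le (leq_addl _ _).
Qed.

Lemma inpoly_mulev2 (D D' : nat -> nat -> Prop) x z (Q : {poly {poly k}}) h : (forall a j a' j', D a j -> Q`_j'`_a' != 0 -> D' (a' + a)%N (j' + j)%N) ->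
  inpoly D x z h -> inpoly D' x z (ev2 x z Q * h).
Proof.
move=> H; apply: inpoly_sub => a j Daj; rewrite ev2E mulr_suml; apply: inpoly_sum => j'.
rewrite ev1E -mulrA mulr_suml; apply: inpoly_sum => a'.
have [->|Qa] := eqVneq Q`_j'`_a' 0; first by rewrite rmorph0 !mul0r; exact: inpoly_0.
rewrite -mulrA; apply: inpoly_c.
have -> : x ^+ a' * (z ^+ j' * (x ^+ a * z ^+ j)) = x ^+ (a' + a) * z ^+ (j' + j).
  by rewrite !exprD; ring.
by apply: inpoly_mono; apply: H.
Qed.

Lemma admissible_ex x z : coords x z -> exists N, admissible x z 0 N N.
Proof.
move=> c.
suff [N [lam [l0 H]]] : exists N lam, lam != 0 /\ forall h, h \in f -> inpoly (polygon 0 N N) x z (lam * h).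
  by exists N, lam.
elim: (f) => [|g l [N [lam [l0 IH]]]]; first by exists 0%N, 1; rewrite oner_neq0.
have [Q [N' [Q0 HQ]]] := inpoly_bound (lam * g) c.
have [B HB] : exists B, forall a j, Q`_j`_a != 0 -> (a <= B)%N /\ (j <= B)%N.
  exists (size Q + \max_(j < size Q) size (Q`_j)%R)%N => a j Qa.
  have jQ : (j < size Q)%N.
    by rewrite ltnNge; apply: contraNN Qa => le; rewrite (nth_default 0 le) coef0.
  have aQ : (a < size (Q`_j)%R)%N.
    by rewrite ltnNge; apply: contraNN Qa => le; rewrite (nth_default 0 le).
  have le := leq_bigmax (F := fun j : 'I_(size Q) => size (Q`_j)%R) (Ordinal jQ).
  split; last by apply: leq_trans (ltnW jQ) (leq_addr _ _).
  by apply: leq_trans (ltnW aQ) _; apply: leq_trans le (leq_addl _ _).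
exists (N + N' + B)%N, (ev2 x z Q * lam); split; first by rewrite mulf_neq0.
move=> h; rewrite inE -mulrA => /predU1P [->|hl].
  by apply: inpoly_weak HQ => a j []; rewrite /polygon !mul0n !addn0; lia.
apply: inpoly_mulev2 (IH h hl) => a j a' j' [] + + /HB []; rewrite /polygon !mul0n !addn0; lia.
Qed.

(** For n = 0 all quotients of the f would lie in k(x), which does not contain z. *)
Lemma admissible_pos x z e n b : admissible x z e n b -> (0 < n)%N.
Proof.
move=> [lam [c l0 H]]; rewrite lt0n; apply/eqP => n0.
have [inj gen] := c.
pose F h := exists P Q, ev1 x Q != 0 /\ h = ev1 x P / ev1 x Q.
have sF : subring iota F.
  split=> [d|u v [P [Q [Q0 ->]]] [P' [Q' [Q'0 ->]]]|u v [P [Q [Q0 ->]]] [P' [Q' [Q'0 ->]]]].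
  - by exists d%:P, 1; rewrite ev1_1 ev1C divr1 oner_neq0.
  - exists (P * Q' + P' * Q), (Q * Q'); rewrite ev1D !ev1M mulf_neq0 //.
    by rewrite addf_div.
  - by exists (P * P'), (Q * Q'); rewrite !ev1M mulf_neq0 // mulf_div.
have FV u : F u -> F u^-1.
  move=> [P [Q [Q0 ->]]]; have [P0|P0] := eqVneq (ev1 x P) 0.
    by rewrite P0 mul0r invr0; exact: (subr_0 sF).
  by exists Q, P; rewrite invf_div.
have Fh h : h \in f -> F (lam * h).
  move=> /H [P [DP ->]]; exists P`_0, 1; rewrite ev1_1 divr1 oner_neq0; split=> //.
  have -> : P = (P`_0)%:P; last by rewrite ev2C coefC eqxx.
  apply/polyP => -[|j]; rewrite coefC //=; apply/polyP => a; rewrite coef0.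
  by apply/eqP; apply: contraT => /DP []; rewrite n0.
have [v vf v0] := f0.
have [p [q [q0 E]]] := fgen vf v0 z.
have [P [Q [Q0 Ez]]] : F z.
  have Fg (i : 'I_(size [seq u / v | u <- f])) : F [seq u / v | u <- f]`_i.
    have /mapP [u uf ->] : [seq u / v | u <- f]`_i \in [seq u / v | u <- f] by exact: mem_nth.
    have -> : u / v = (lam * u) / (lam * v) by field; apply/andP.
    by apply: (subr_M sF); [exact: Fh|apply: FV; exact: Fh].
  by rewrite E; apply: (subr_M sF); [exact: (evalK_sub sF Fg)|apply: FV; exact: (evalK_sub sF Fg)].
have : 'X * Q%:P - P%:P = 0 :> {poly {poly k}}.
  by apply: inj; rewrite ev2B ev2M !ev2C ev2X {1}Ez divfK // subrr.
move=> /(congr1 (fun p : {poly {poly k}} => p`_1)); rewrite coefB coefXM coefC coef0 coefC eqxx /= subr0.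
by move=> Q00; move: Q0; rewrite Q00 ev1_0 eqxx.
Qed.

(** Least n, then least 2b - n e; the comparison is additive because subtraction of naturals
    truncates. *)
Definition minimal_system x z e n b lam := system x z e n b lam /\
  forall x' z' e' n' b', admissible x' z' e' n' b' ->
    (n <= n')%N /\ (n' = n -> 2 * b + n * e' <= 2 * b' + n * e)%N.

(** The chart over x = infinity: multiplication by x^-b reverses the monomials within the same
    polygon. *)
Lemma system_inv x z e n b lam : system x z e n b lam ->
  system x^-1 (z / x ^+ e) e n b (lam * x^-1 ^+ b).
Proof.
move=> [c l0 H]; have x0 := coords_x0 c; split.
- by apply: coords_inv; apply: coords_divX.
- by rewrite mulf_neq0 // expf_neq0 ?invr_eq0.
move=> h hf; rewrite mulrAC [lam * h * _]mulrC; apply: inpoly_sub (H h hf) => a j [jn aj].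
have -> : x^-1 ^+ b * (x ^+ a * z ^+ j) = x^-1 ^+ (b - a - e * j) * (z / x ^+ e) ^+ j.
  rewrite exprMn !exprVn -exprM.
  have -> : x ^+ b = x ^+ (b - a - e * j) * x ^+ a * x ^+ (e * j) by rewrite -!exprD; congr (_ ^+ _); lia.
  by field; rewrite !expf_neq0.
by apply: inpoly_mono; rewrite /polygon; lia.
Qed.

Lemma minimal_inv x z e n b lam : minimal_system x z e n b lam ->
  minimal_system x^-1 (z / x ^+ e) e n b (lam * x^-1 ^+ b).
Proof. by move=> [s H]; split=> //; exact: system_inv. Qed.

Lemma system_shift x z e n b lam c d : system x z e n b lam ->
  system (x - iota c) (z - iota d) e n b lam.
Proof.
move=> [C l0 H]; split=> //; first by apply/coords_shift2/coords_shift.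
move=> h /H; apply: inpoly_shift => a j a' j' [jn aj] aa jj.
by rewrite /polygon; split; nia.
Qed.

Lemma system_shift0 x z e n b lam c : system x z e n b lam ->
  system (x - iota c) z e n b lam.
Proof. by move=> /(system_shift c 0); rewrite rmorph0 subr0. Qed.

(** How minimality is exploited: in the first alternative all monomials satisfy E and the system can
    be made smaller; in the second a monomial violating E bounds a multiplicity. *)
Lemma system_or x z e n b lam (E : nat -> nat -> Prop) : system x z e n b lam ->
  (forall h, h \in f -> inpoly (fun a j => polygon e n b a j /\ E a j) x z (lam * h)) \/
  exists h P a j, [/\ h \in f, lam * h = ev2 x z P, supp (polygon e n b) P, P`_j`_a != 0 & ~ E a j].
Proof.
move=> [c l0 H].
case: (classic (exists h, h \in f /\ ~ inpoly (fun a j => polygon e n b a j /\ E a j) x z (lam * h))).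
  move=> [h [hf nh]]; right; have [//|[P [a [j [E1 DP Pa nE]]]]] := inpoly_or E (H h hf).
  by exists h, P, a, j.
by move=> nex; left=> h hf; apply: NNPP => nh; apply: nex; exists h.
Qed.

(** For the least n no truncation occurs in 2b - n e: if b < e n, the power z^n could not occur and
    n could be lowered. *)
Lemma minimal_ex : (exists x z, coords x z) -> exists x z e n b lam, minimal_system x z e n b lam.
Proof.
move=> [x0 [z0 c0]].
have [n [[x1 [z1 [e1 [b1 A1]]]] minn]] := @nat_least (fun n => exists x z e b, admissible x z e n b)
  (let: ex_intro N A := admissible_ex c0 in ex_intro _ N (ex_intro _ x0 (ex_intro _ z0 (ex_intro _ 0%N (ex_intro _ N A))))).
have n0 := admissible_pos A1.
have lb x z e b : admissible x z e n b -> (e * n <= b)%N.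
  move=> [lam [c l0 H]]; rewrite leqNgt; apply/negP => lt.
  suff /minn : exists x z e b, admissible x z e n.-1 b by lia.
  exists x, z, e, b, lam; split=> // h /H; apply: inpoly_weak => a j [jn aj].
  by rewrite /polygon; split; nia.
have [mu [[x [z [e [b [A Emu]]]]] minmu]] := @nat_least (fun mu => exists x z e b,
   admissible x z e n b /\ mu = (2 * b - n * e)%N)
   (ex_intro _ _ (ex_intro _ x1 (ex_intro _ z1 (ex_intro _ e1 (ex_intro _ b1 (conj A1 erefl)))))).
have [lam S] := A; exists x, z, e, n, b, lam; split=> // x' z' e' n' b' A'.
split; first by apply: minn; exists x', z', e', b'.
move=> En; rewrite En in A'.
have := minmu (2 * b' - n * e')%N; have := lb _ _ _ _ A'; have := lb _ _ _ _ A.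
move=> h1 h2 /(_ (ex_intro _ x' (ex_intro _ z' (ex_intro _ e' (ex_intro _ b' (conj A' erefl)))))).
by rewrite Emu; nia.
Qed.

Section Minimal.
Variables (x z : K) (e n b : nat) (lam : K).
Hypothesis min : minimal_system x z e n b lam.
Let S : system x z e n b lam. Proof. by case: min. Qed.
Let minn x' z' e' n' b' : admissible x' z' e' n' b' -> (n <= n')%N.
Proof. by case: min => _ H /H []. Qed.
Let minb x' z' e' b' : admissible x' z' e' n b' -> (2 * b + n * e' <= 2 * b' + n * e)%N.
Proof. by case: min => _ H /H [_]; apply. Qed.
Let n0 : (0 < n)%N. Proof. by apply: admissible_pos; exists lam; exact: S. Qed.

Lemma minimal_coords : coords x z. Proof. by case: S. Qed.
Lemma minimal_n0 : (0 < n)%N. Proof. exact: n0. Qed.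

Lemma minimal_top : exists h P, [/\ h \in f, lam * h = ev2 x z P, supp (polygon e n b) P & P`_n != 0].
Proof.
have [H|] := system_or (fun a j => j < n)%N S; last first.
  move=> [h [P [a [j [hf E DP Pa nj]]]]]; exists h, P; split=> //.
  have [jn _] := DP a j Pa; have Ej : j = n by lia.
  by apply: contraNneq Pa => P0; rewrite Ej P0 coef0.
exfalso; suff : (n <= n.-1)%N by lia.
apply: (@minn x z e n.-1 b); exists lam; have [c l0 _] := S; split=> // h /H.
by apply: inpoly_weak => a j [[_ aj] jn]; rewrite /polygon; split=> //; lia.
Qed.

Lemma minimal_b : (e * n <= b)%N.
Proof.
have [h [P [_ _ DP Pn]]] := minimal_top.
have [a Pa] : exists a, P`_n`_a != 0.
  by exists (size P`_n).-1; rewrite -lead_coefE lead_coef_eq0.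
by have [_] := DP a n Pa; lia.
Qed.

(** The fiber x = c is not a fixed component: dividing by x - c would lower b. *)
Lemma minimal_fiber c : exists h P j, [/\ h \in f, lam * h = ev2 (x - iota c) z P,
  supp (polygon e n b) P & P`_j`_0 != 0].
Proof.
have S' := system_shift0 c S.
have [H|] := system_or (fun a j => 0 < a)%N S'; last first.
  move=> [h [P [a [j [hf E DP Pa nj]]]]]; exists h, P, j; split=> //.
  by have <- : a = 0%N by lia.
exfalso; have [C' l0 _] := S'; have x0 := coords_x0 C'.
have [v vf v0] := f0.
have b0 : (0 < b)%N.
  rewrite lt0n; apply/eqP => b0; have [P [DP E]] := H v vf.
  have P0 : P = 0.
    apply/polyP => j; apply/polyP => a; rewrite !coef0; apply/eqP; apply: contraT => /DP [[_ +]].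
    by rewrite b0; lia.
  by have := mulf_neq0 l0 v0; rewrite E P0 ev2_0 eqxx.
suff : (2 * b + n * e <= 2 * b.-1 + n * e)%N by lia.
apply: (@minb (x - iota c) z); exists (lam / (x - iota c)); split=> //.
  by rewrite mulf_neq0 ?invr_eq0.
move=> h /H; rewrite mulrAC [lam * h * _]mulrC; apply: inpoly_sub => a j [[jn aj] a0].
have -> : (x - iota c)^-1 * ((x - iota c) ^+ a * z ^+ j) = (x - iota c) ^+ a.-1 * z ^+ j.
  by rewrite -{1}(prednK a0) exprS mulrA mulKf.
by apply: inpoly_mono; rewrite /polygon; lia.
Qed.

(* A non-constant common divisor in k(x)[z] could be divided out.              *)
Lemma minimal_bezout (R M : K -> Prop) : local_ring iota R M -> R x -> R z ->
  (forall h, h \in f -> M (lam * h)) -> exists r, r != 0 /\ M (ev1 x r).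
Proof.
move=> lR Rx Rz Mf; have sR := loc_sub lR.
pose J (P : {poly {poly k}}) := M (ev2 x z P).
have [C l0 H] := S; have [inj _] := C.
have [v vf v0] := f0.
have [P0 [_ EP0]] := H v vf.
have P00 : P0 != 0 by apply: contraTneq (mulf_neq0 l0 v0) => P0z; rewrite EP0 P0z ev2_0 eqxx.
(* G has least z-degree among the nonzero polynomials with value in M. By pseudo-division it divides
   the whole system over k(x); so positive degree would lower n, and degree 0 gives r. *)
have [sg [[G [JG G0 sG]] minG]] := @nat_least (fun s => exists G, [/\ J G, G != 0 & size G = s])
  (ex_intro _ _ (ex_intro _ P0 (And3 (eq_ind _ _ (Mf v vf) _ EP0 : J P0) P00 erefl))).
have [s1|s1] := eqVneq sg 1%N.
  have [r r0 Er] : exists2 r, r != 0 & G = r%:P by apply/size_poly1P; rewrite sG s1.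
  by exists r; split=> //; move: JG; rewrite /J Er ev2C.
exfalso.
have sg1 : (1 < sg)%N by have : (0 < sg)%N; [rewrite -sG size_poly_gt0|move: s1; lia].
pose c := lead_coef G.
have c0 : ev1 x c != 0.
  apply/eqP => cx; have := inj c%:P; rewrite ev2C => /(_ cx) /eqP.
  by rewrite polyC_eq0 lead_coef_eq0 (negPf G0).
have G0' : ev2 x z G != 0 by apply: contra_neq G0 => /inj.
have divG h : h \in f -> exists N Q, [/\ ev1 x c ^+ N * (lam * h) = ev2 x z Q * ev2 x z G & (size Q <= n)%N].
  move=> hf; have [P [DP E]] := H h hf.
  have sP : (size P <= n.+1)%N.
    apply/leq_sizeP => j nj; apply/polyP => a; rewrite coef0; apply/eqP; apply: contraT => /DP [].
    by move: nj; lia.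
  exists (scalp P G), (P %/ G); rewrite E -ev1_exp -(ev2C _ x z) -!ev2M.
  have EQ := Pdiv.Idomain.divp_eq P G; rewrite -/c in EQ.
  have J0 : P %% G = 0.
    apply/eqP; apply: contraT => R0; have := @minG (size (P %% G)).
    rewrite leqNgt -sG ltn_modp G0 => /(_ _)/negP; case=> //.
    exists (P %% G); split=> //; rewrite /J.
    have -> : P %% G = (c ^+ scalp P G)%:P * P - P %/ G * G.
      by rewrite mul_polyC EQ addrC addKr.
    rewrite ev2B !ev2M; apply: (loc_B lR); apply: (loc_Ml lR) => //; try exact: (ev2_in lR).
    by rewrite -E; exact: Mf.
  split; first by rewrite mul_polyC EQ J0 addr0.
  have [->|Q0] := eqVneq (P %/ G) 0; first by rewrite size_poly0.
  have g1 : (0 < (size G).-1)%N by rewrite -subn1 subn_gt0 sG.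
  rewrite (Pdiv.Idomain.size_divp _ G0); apply: leq_trans (leq_sub2r _ sP) _.
  by rewrite leq_subLR -add1n leq_add2r.
have [N HN] : exists N, forall h, h \in f -> exists Q, ev1 x c ^+ N * (lam * h) = ev2 x z Q * ev2 x z G /\ (size Q <= n)%N.
  elim: (f) divG => [|g l IH] dl; first by exists 0%N.
  have [|N HN] := IH; first by move=> h hl; apply: dl; rewrite inE hl orbT.
  have [N' [Q [E sQ]]] := dl g (mem_head _ _).
  have up m m' h (Q1 : {poly {poly k}}) : (m <= m')%N -> ev1 x c ^+ m * (lam * h) = ev2 x z Q1 * ev2 x z G -> (size Q1 <= n)%N ->
     exists Q, ev1 x c ^+ m' * (lam * h) = ev2 x z Q * ev2 x z G /\ (size Q <= n)%N.
    move=> le E1 s; exists ((c ^+ (m' - m))%:P * Q1); split.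
      by rewrite ev2M ev2C ev1_exp -mulrA -E1 mulrA -exprD subnK.
    by rewrite mul_polyC (leq_trans (size_scale_leq _ _)).
  exists (N + N')%N => h; rewrite inE => /predU1P [->|hl]; first exact: (up N' _ g Q (leq_addl _ _) E sQ).
  have [Q1 [E1 s1']] := HN h hl; exact: (up N _ h Q1 (leq_addr _ _) E1 s1').
suff : (n <= n.-1)%N by move: n0; lia.
pose lam' := lam * ev1 x c ^+ N / ev2 x z G.
have l'0 : lam' != 0 by rewrite !mulf_neq0 ?invr_eq0 ?expf_neq0.
have poly h : h \in f -> exists Q, lam' * h = ev2 x z Q /\ (size Q <= n)%N.
  move=> /HN [Q [E sQ]]; exists Q; split=> //.
  apply: (mulIf G0'); rewrite -E /lam'; field; exact: G0'.
have [B HB] : exists B, forall h, h \in f -> inpoly (polygon 0 n.-1 B) x z (lam' * h).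
  elim: (f) poly => [|g l IH] pl; first by exists 0%N.
  have [|B HB] := IH; first by move=> h hl; apply: pl; rewrite inE hl orbT.
  have [Q [E sQ]] := pl g (mem_head _ _).
  exists (B + \max_(j < size Q) size (Q`_j)%R)%N => h; rewrite inE => /predU1P [->|hl]; last first.
    by apply: inpoly_weak (HB h hl) => a j []; rewrite /polygon; lia.
  exists Q; split=> // a j Qa.
  have jQ : (j < size Q)%N.
    by rewrite ltnNge; apply: contraNN Qa => le; rewrite (nth_default 0 le) coef0.
  have aQ : (a < size (Q`_j)%R)%N.
    by rewrite ltnNge; apply: contraNN Qa => le; rewrite (nth_default 0 le).
  have le := leq_bigmax (F := fun j : 'I_(size Q) => size (Q`_j)%R) (Ordinal jQ).
  rewrite /polygon mul0n addn0; split; first by move: n0; lia.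
  by apply: leq_trans (ltnW aQ) _; apply: leq_trans le (leq_addl _ _).
by apply: (@minn x z 0 n.-1 B); exists lam'.
Qed.

(** If all members had multiplicity at least m = n/2 + 1 at the point, the elementary transformation
    there would lower 2b - n e by 2m - n. It leads to F_(e-1), or to F_1 when e = 0. *)
Lemma minimal_mult c d : exists h P a j, [/\ h \in f, lam * h = ev2 (x - iota c) (z - iota d) P,
  P`_j`_a != 0 & (2 * (a + j) <= n)%N].
Proof.
have S' := system_shift c d S.
have [H|] := system_or (fun a j => n < 2 * (a + j))%N S'; last first.
  by move=> [h [P [a [j [hf E DP Pa nj]]]]]; exists h, P, a, j; split=> //; lia.
exfalso; have [C' l0 _] := S'; have x0 := coords_x0 C'; have z0 := coords_z0 C'.
move: (x - iota c) (z - iota d) H C' x0 z0 => x' z' H C' x0 z0.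
pose m := (n./2).+1.
have mn : (m <= n)%N by rewrite /m; have := n0; lia.
have nm : (n < 2 * m)%N by rewrite /m; lia.
have [e0|e0] := posnP e.
  suff : (2 * b + n * 1 <= 2 * (b + n - m) + n * e)%N by move: nm mn; rewrite e0; lia.
  apply: (@minb x' (z' / x')^-1); exists (lam * ((z' / x')^-1 ^+ n / x' ^+ m)).
  split; first by apply/coords_inv2/coords_div.
    by rewrite !mulf_neq0 ?expf_neq0 ?invr_eq0 ?mulf_neq0 ?invr_eq0 ?expf_neq0.
  move=> h /H; rewrite mulrAC [lam * h * _]mulrC; apply: inpoly_sub => a j [[jn aj] amj].
  have -> : (z' / x')^-1 ^+ n / x' ^+ m * (x' ^+ a * z' ^+ j) = x' ^+ (a + j - m) * (z' / x')^-1 ^+ (n - j).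
    rewrite invf_div !expr_div_n.
    have -> : z' ^+ n = z' ^+ (n - j) * z' ^+ j by rewrite -exprD subnK.
    have E : x' ^+ n * x' ^+ a = x' ^+ (a + j - m) * x' ^+ (n - j) * x' ^+ m.
      by rewrite -!exprD; congr (_ ^+ _); lia.
    transitivity ((x' ^+ n * x' ^+ a) / x' ^+ m / z' ^+ (n - j)).
      by field; rewrite !expf_neq0.
    by rewrite E; field; rewrite !expf_neq0.
  by apply: inpoly_mono; rewrite /polygon; lia.
have bm : (m <= b)%N by have := minimal_b; nia.
suff : (2 * b + n * e.-1 <= 2 * (b - m) + n * e)%N.
  move: nm mn; rewrite -{2}(prednK e0) mulnS; lia.
apply: (@minb x' (z' / x')); exists (lam / x' ^+ m).
split; first exact: coords_div.
  by rewrite mulf_neq0 ?invr_eq0 ?expf_neq0.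
move=> h /H; rewrite mulrAC [lam * h * _]mulrC; apply: inpoly_sub => a j [[jn aj] amj].
have -> : (x' ^+ m)^-1 * (x' ^+ a * z' ^+ j) = x' ^+ (a + j - m) * (z' / x') ^+ j.
  rewrite expr_div_n.
  have E : x' ^+ a * x' ^+ j = x' ^+ (a + j - m) * x' ^+ m by rewrite -!exprD; congr (_ ^+ _); lia.
  transitivity ((x' ^+ a * x' ^+ j) / x' ^+ m * z' ^+ j / x' ^+ j); first by field; rewrite !expf_neq0.
  by rewrite E; field; rewrite !expf_neq0.
apply: inpoly_mono; rewrite /polygon; split=> //.
have : (e * j = e.-1 * j + j)%N by rewrite -{1}(prednK e0) mulSn addnC.
lia.
Qed.

(** The same at a point of the section z = infinity, where the local exponents are a and n - j; the
    transformation leads to F_(e+1). *)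
Lemma minimal_mult_inf c : exists h P a j, [/\ h \in f, lam * h = ev2 (x - iota c) z P,
  supp (polygon e n b) P, P`_j`_a != 0 & (2 * (a + (n - j)) <= n)%N].
Proof.
have S' := system_shift0 c S.
have [H|] := system_or (fun a j => n < 2 * (a + (n - j)))%N S'; last first.
  by move=> [h [P [a [j [hf E DP Pa nj]]]]]; exists h, P, a, j; split=> //; lia.
exfalso; have [C' l0 _] := S'; have x0 := coords_x0 C'.
move: (x - iota c) H C' x0 => x' H C' x0.
pose m := (n./2).+1.
have mn : (m <= n)%N by rewrite /m; have := n0; lia.
have nm : (n < 2 * m)%N by rewrite /m; lia.
suff : (2 * b + n * e.+1 <= 2 * (b + n - m) + n * e)%N by move: nm mn; rewrite mulnS; lia.
apply: (@minb x' (z * x')); exists (lam * x' ^+ (n - m)).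
split; first exact: coords_mul.
  by rewrite mulf_neq0 ?expf_neq0.
move=> h /H; rewrite mulrAC [lam * h * _]mulrC; apply: inpoly_sub => a j [[jn aj] amj].
have -> : x' ^+ (n - m) * (x' ^+ a * z ^+ j) = x' ^+ (a + (n - j) - m) * (z * x') ^+ j.
  have E : x' ^+ (n - m) * x' ^+ a = x' ^+ (a + (n - j) - m) * x' ^+ j.
    by rewrite -!exprD; congr (_ ^+ _); lia.
  by rewrite exprMn mulrA E; ring.
by apply: inpoly_mono; rewrite /polygon mulSn; lia.
Qed.

(* On the projective plane: projecting from a point of higher multiplicity     *)
(* would lower n.                                                              *)
Lemma minimal_mult_plane c d : e = 1%N -> exists h P a j, [/\ h \in f,
  lam * h = ev2 (x - iota c) (z - iota d) P, P`_j`_a != 0 & (a + j <= b - n)%N].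
Proof.
move=> e1; have S' := system_shift c d S.
have [H|] := system_or (fun a j => b - n < a + j)%N S'; last first.
  by move=> [h [P [a [j [hf E DP Pa nj]]]]]; exists h, P, a, j; split=> //; lia.
exfalso; have [C' l0 _] := S'; have x0 := coords_x0 C'; have z0 := coords_z0 C'.
move: (x - iota c) (z - iota d) H C' x0 z0 => x' z' H C' x0 z0.
suff : (n <= n.-1)%N by move: n0; lia.
have bn := minimal_b; rewrite e1 mul1n in bn.
apply: (@minn (x' / z') z'^-1 1 n.-1 b); exists (lam / z' ^+ b).
split; first by apply/coords_swap/coords_inv/coords_div/coords_swap.
  by rewrite mulf_neq0 ?invr_eq0 ?expf_neq0.
move=> h /H; rewrite mulrAC [lam * h * _]mulrC; apply: inpoly_sub => a j [[jn aj] amj].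
rewrite e1 mul1n in aj.
have -> : (z' ^+ b)^-1 * (x' ^+ a * z' ^+ j) = (x' / z') ^+ a * z'^-1 ^+ (b - a - j).
  rewrite expr_div_n exprVn.
  have -> : z' ^+ b = z' ^+ (b - a - j) * z' ^+ a * z' ^+ j by rewrite -!exprD; congr (_ ^+ _); lia.
  by field; rewrite !expf_neq0.
by apply: inpoly_mono; rewrite /polygon mul1n; lia.
Qed.

(** On F_0 the two rulings can be exchanged. *)
Lemma minimal_e0 : e = 0%N -> (n <= b)%N.
Proof.
move=> e0; have [C l0 H] := S; apply: (@minn z x 0 b n); exists lam; split=> //; first exact: coords_swap.
move=> h hf; rewrite -(mul1r (lam * h)); apply: inpoly_sub (H h hf) => a j [jn aj].
by rewrite mul1r mulrC; apply: inpoly_mono; rewrite /polygon; move: aj; rewrite e0; lia.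
Qed.
End Minimal.
End LinearSystem.

Section Flip.
Variables (k : closedFieldType) (K : fieldType) (iota : {rmorphism k -> K}).
Local Notation ev1 := (@ev1 k K iota).
Local Notation ev2 := (@ev2 k K iota).

Definition flip n (P : {poly {poly k}}) : {poly {poly k}} := \poly_(l < n.+1) P`_(n - l).

Lemma flipE n (P : {poly {poly k}}) j : (j <= n)%N -> (flip n P)`_j = P`_(n - j).
Proof. by move=> jn; rewrite coef_poly ltnS jn. Qed.

Lemma ev2_flip n x z (P : {poly {poly k}}) : z != 0 -> (size P <= n.+1)%N ->
  ev2 x z^-1 (flip n P) = z^-1 ^+ n * ev2 x z P.
Proof.
move=> z0 sP; rewrite ev2_poly ev2E mulr_sumr.
rewrite (big_ord_widen n.+1 (fun j => z^-1 ^+ n * (ev1 x P`_j * z ^+ j))) // [RHS]big_mkcond.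
rewrite (reindex_inj rev_ord_inj) /=; apply: eq_bigr => j _.
have jn : (j <= n)%N by rewrite -ltnS.
rewrite subSS subKn //; case: ltnP => ha; last by rewrite nth_default // ev1_0 mul0r.
have -> : z^-1 ^+ n = z^-1 ^+ (n - j) * z^-1 ^+ j by rewrite -exprD subnK.
by rewrite !exprVn; field; rewrite !expf_neq0.
Qed.

Lemma ev2_snd (R M : K -> Prop) x y (P : {poly {poly k}}) : local_ring iota R M -> R x -> M y ->
  M (ev2 x y P - ev1 x P`_0).
Proof.
move=> lR Rx My; elim/poly_ind: P => [|P q _].
  by rewrite ev2_0 coef0 ev1_0 subrr; exact: (loc_0 lR).
rewrite ev2D ev2M ev2X ev2C coefD coefMX eqxx add0r coefC eqxx addrK.
by apply: (loc_Ml lR) => //; apply: (ev2_in lR) => //; exact: (loc_R lR).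
Qed.

(* The chart of the plane around the point at infinity of the lines x = const. *)
Definition plane_flip b (P : {poly {poly k}}) : {poly {poly k}} :=
  \poly_(a < b.+1) \poly_(l < b.+1) (if (a + l <= b)%N then P`_(b - a - l)`_a else 0).

Lemma ev2_plane_flip n b x z (P : {poly {poly k}}) : z != 0 -> supp (polygon 1 n b) P ->
  ev2 z^-1 (x / z) (plane_flip b P) = z^-1 ^+ b * ev2 x z P.
Proof.
move=> z0 DP; rewrite ev2_poly.
have sP : (size P <= b.+1)%N.
  apply/leq_sizeP => j bj; apply/polyP => a; rewrite coef0; apply/eqP; apply: contraT => /DP [].
  by rewrite mul1n; lia.
have sa j : (size (P`_j)%R <= b.+1)%N.
  by apply/leq_sizeP => a ba; apply/eqP; apply: contraT => /DP []; rewrite mul1n; lia.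
have -> : ev2 x z P = \sum_(a < b.+1) \sum_(j < b.+1) iota P`_j`_a * x ^+ a * z ^+ j.
  rewrite ev2E (big_ord_widen b.+1 (fun j => ev1 x P`_j * z ^+ j)) // big_mkcond exchange_big.
  apply: eq_bigr => j _ /=; case: ltnP => jP; last first.
    by rewrite big1 // => a _; rewrite (nth_default 0 jP) coef0 rmorph0 !mul0r.
  rewrite ev1E (big_ord_widen b.+1 (fun a => iota P`_j`_a * x ^+ a)) // mulr_suml big_mkcond.
  by apply: eq_bigr => a _; case: ltnP => // aP; rewrite nth_default // rmorph0 !mul0r.
rewrite mulr_sumr; apply: eq_bigr => a _; rewrite ev1_poly mulr_suml mulr_sumr.
have ab : (a <= b)%N by rewrite -ltnS.
pose F l := if (a + l <= b)%N then iota P`_(b - a - l)`_a * z^-1 ^+ l * (x / z) ^+ a else 0.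
transitivity (\sum_(l < b.+1) F l).
  by apply: eq_bigr => l _; rewrite /F; case: ifP => // _; rewrite rmorph0 !mul0r.
have cut G : (forall l, (b - a < l)%N -> G l = 0 :> K) -> \sum_(l < b.+1) G l = \sum_(l < (b - a).+1) G l.
  move=> G0; rewrite [RHS](big_ord_widen b.+1 G) ?ltnS ?leq_subr // [RHS]big_mkcond.
  by apply: eq_bigr => l _; case: ltnP => // /G0.
rewrite cut => [|l lt]; last by rewrite /F; case: leqP => //; lia.
rewrite (cut (fun l => z^-1 ^+ b * (iota P`_l`_a * x ^+ a * z ^+ l))) => [|l lt]; last first.
  have [->|/DP []] := eqVneq (P`_l`_a) 0; first by rewrite rmorph0 !mul0r mulr0.
  by rewrite mul1n; lia.
rewrite (reindex_inj rev_ord_inj) /=; apply: eq_bigr => l _; rewrite subSS.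
have lba : (l <= b - a)%N by rewrite -ltnS.
rewrite /F (_ : (a + (b - a - l) <= b)%N); last by lia.
rewrite subKn // expr_div_n !exprVn.
have -> : z ^+ b = z ^+ (b - a - l) * z ^+ a * z ^+ l by rewrite -!exprD; congr (_ ^+ _); lia.
by field; rewrite !expf_neq0.
Qed.
End Flip.

(** * Noether-Fano inequalities *)

Section NoetherFano.
Variables (k : closedFieldType) (K : fieldType) (iota : {rmorphism k -> K}).
Local Notation ev1 := (@ev1 k K iota).
Local Notation ev2 := (@ev2 k K iota).
Local Notation coords := (@coords k K iota).
Variable f : seq K.
Hypothesis f0 : exists2 v, v \in f & v != 0.
Hypothesis fgen : forall v, v \in f -> v != 0 -> generates iota [seq u / v | u <- f].
Variable g : K.
Hypothesis gf : g \in f.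
Hypothesis g0 : g != 0.

Section Valuation.
Variables (v : K -> int) (D1 D2 : K -> K).
Hypothesis dv : dval iota v.
Hypothesis d1 : der iota D1.
Hypothesis d2 : der iota D2.
Hypothesis n1 : forall h, nn v h -> nn v (D1 h).
Hypothesis n2 : forall h, nn v h -> nn v (D2 h).
Hypothesis vg : forall h, h \in f -> nn v (h / g).
Local Notation jac := (jacobian D1 D2).
Let lv := val_local dv.
Let sv := nn_subring dv.

Lemma val_le_gen lam h : lam != 0 -> h \in f -> lam * h != 0 -> v (lam * g) <= v (lam * h).
Proof.
move=> l0 hf lh0; have h0 : h != 0 by apply: contraNneq lh0 => ->; rewrite mulr0.
have -> : lam * h = lam * g * (h / g) by rewrite mulrAC -mulrA divfK // mulrC.
have hg0 : h / g != 0 by rewrite mulf_neq0 ?invr_eq0.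
have lg0 : lam * g != 0 by rewrite mulf_neq0.
by rewrite [v (_ * (h / g))](val_M dv) // lerDl; exact: vg.
Qed.

Lemma val_unit_gen lam N j h : lam != 0 -> h \in f -> nn v (lam * h) -> ~ pos v (lam * h) ->
  j != 0 -> nn v j -> v (lam * g) *+ N.+1 <= 0 /\ 0 <= v j.
Proof.
move=> l0 hf nh np j0 nj; split; last exact: nj.
have lh0 : lam * h != 0 by apply: contra_notN np => /eqP -> /eqP.
have H : v (lam * h) <= 0.
  by rewrite leNgt; apply/negP => lt; apply: np.
have := le_trans (val_le_gen l0 hf lh0) H.
by rewrite -mulr_natl => le; rewrite pmulr_rle0 // ltr0n.
Qed.

(** If some member is a unit at v, the left side is at most 0. Otherwise the whole system vanishes
    at the centre: [minimal_bezout] gives x a residue c, [minimal_fiber] then gives z a residue d,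
    and [val_multiplicity] applies to the member of small multiplicity at (c, d). The weights [m.+1]
    and N will be 2 and n on ruled surfaces, 3 and b on the plane. *)
Lemma val_finite x z e n b lam (m N : nat) : minimal_system iota f x z e n b lam ->
  (forall c d, exists h P a j, [/\ h \in f, lam * h = ev2 (x - iota c) (z - iota d) P,
     P`_j`_a != 0 & (m.+1 * (a + j) <= N)%N]) ->
  jac x z != 0 -> nn v x -> nn v z -> v (lam * g) *+ m.+1 <= v (jac x z) *+ N.
Proof.
move=> min Hm J0 nx nz; have C := minimal_coords min; have [[_ l0 H] _] := min.
have nJ : nn v (jac x z) by exact: (jac_nn dv n1 n2).
have nh h : h \in f -> nn v (lam * h) by move=> /H [P [_ ->]]; apply: (ev2_in lv).
case: (classic (exists h, h \in f /\ ~ pos v (lam * h))) => [[h [hf np]]|Hp].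
  have [le1 le2] := val_unit_gen m l0 hf (nh h hf) np J0 nJ.
  by apply: le_trans le1 _; apply: mulrn_wge0.
have ph h : h \in f -> pos v (lam * h) by move=> hf; apply: NNPP => np; apply: Hp; exists h.
have [r [r0 Mr]] := minimal_bezout f0 fgen min lv nx nz ph.
have [c [_ pc]] := local_root lv nx r0 Mr.
have [h [P [j [hf E _ Pj]]]] := minimal_fiber f0 fgen min c.
have pc0 : pos v ((x - iota c) - iota 0) by rewrite rmorph0 subr0.
have := loc_B lv (ph h hf) (ev2_fst lv P nz pc0); rewrite E subKr.
have F0 : map_poly (horner^~ 0) P != 0.
  apply: contraNneq Pj => F0; have := congr1 (fun q : {poly k} => q`_j) F0.
  by rewrite -[horner^~ 0]/(horner_eval 0) coef_map /= /horner_eval horner_coef0 coef0 => ->.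
move=> /(local_root lv nz F0) [d [_ pd]].
have [h' [P' [a' [j' [hf' E' Pa' le]]]]] := Hm c d.
have P'0 : ev2 (x - iota c) (z - iota d) P' != 0.
  have C' : coords (x - iota c) (z - iota d) by apply/coords_shift2/coords_shift.
  apply/eqP => H0; have := (proj1 C') P' H0 => P'0.
  by move: Pa'; rewrite P'0 !coef0 eqxx.
have J' : jac (x - iota c) (z - iota d) = jac x z by apply: (jac_shift d1 d2).
have := val_multiplicity dv d1 d2 n1 n2 pc pd _ Pa' P'0; rewrite J' => /(_ J0).
rewrite -E' => le2; have lh0 : lam * h' != 0 by rewrite E'.
have le3 := le_trans (val_le_gen l0 hf' lh0) le2.
have nJ0 := nJ J0.
apply: le_trans (_ : v (jac x z) *+ (m.+1 * (a' + j')) <= _).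
  by rewrite mulnC mulrnA; rewrite mulr_natl in le3; apply: ler_wMn2r.
by apply: ler_wpMn2l.
Qed.

(** The argument of [val_finite] in the coordinate 1/z. It multiplies [lam] by z^-n and the Jacobian
    by -z^-2, so both sides change by the same amount 2n v(z). *)
Lemma val_fiber_inf x z e n b lam : minimal_system iota f x z e n b lam ->
  jac x z != 0 -> nn v x -> pos v z^-1 -> v (lam * g) *+ 2 <= v (jac x z) *+ n.
Proof.
move=> min J0 nx py; have C := minimal_coords min; have [[_ l0 H] _] := min.
have z0 := coords_z0 C; have x0 := coords_x0 C.
have y0 : z^-1 != 0 by rewrite invr_eq0.
have ny := loc_R lv py.
have J'0 : jac x z^-1 != 0 by rewrite (jac_inv d1 d2) // mulf_neq0 ?oppr_eq0 ?invr_eq0 ?expf_neq0.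
have nJ' : nn v (jac x z^-1) by exact: (jac_nn dv n1 n2).
pose lam' := lam * z^-1 ^+ n.
have l'0 : lam' != 0 by rewrite mulf_neq0 ?expf_neq0.
have size_n P : supp (polygon e n b) P -> (size P <= n.+1)%N.
  move=> DP; apply/leq_sizeP => j nj; apply/polyP => a; rewrite coef0; apply/eqP; apply: contraT => /DP [].
  by lia.
have El h x' P : lam * h = ev2 x' z P -> (size P <= n.+1)%N -> lam' * h = ev2 x' z^-1 (flip n P).
  by move=> E sP; rewrite ev2_flip // -E /lam'; ring.
suff : v (lam' * g) *+ 2 <= v (jac x z^-1) *+ n.
  have -> : v (lam' * g) = v (lam * g) - v z *+ n.
    have -> : lam' * g = (lam * g) * z^-1 ^+ n by rewrite /lam'; ring.
    by rewrite (val_M dv) ?mulf_neq0 ?expf_neq0 // (val_X dv) // (val_V dv) // mulrN mulr_natl.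
  have -> : v (jac x z^-1) = v (jac x z) - v z *+ 2.
    rewrite (jac_inv d1 d2) // (val_div dv) ?oppr_eq0 ?expf_neq0 // (val_N dv) (val_X dv) //.
    by rewrite mulr_natl.
  rewrite !mulrnBl -!mulrnA [(n * 2)%N]mulnC; lia.
have nh h : h \in f -> nn v (lam' * h).
  by move=> /H [P [DP E]]; rewrite (El h x P) ?size_n //; apply: (ev2_in lv).
case: (classic (exists h, h \in f /\ ~ pos v (lam' * h))) => [[h [hf np]]|Hp].
  have [le1 le2] := val_unit_gen 1 l'0 hf (nh h hf) np J'0 nJ'.
  by apply: le_trans le1 _; apply: mulrn_wge0.
have ph h : h \in f -> pos v (lam' * h) by move=> hf; apply: NNPP => np; apply: Hp; exists h.
have [h [P [hf E DP Pn]]] := minimal_top f0 fgen min.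
have := ev2_snd (flip n P) lv nx py; rewrite -(El h x P) ?size_n // => Mh.
have := loc_B lv (ph h hf) Mh; rewrite subKr flipE // subn0.
move=> /(local_root lv nx Pn) [c [_ pc]].
have [h' [P' [a' [j' [hf' E' DP' Pa' le]]]]] := minimal_mult_inf f0 fgen min c.
have [jn _] := DP' a' j' Pa'.
have P'0 : ev2 (x - iota c) z^-1 (flip n P') != 0.
  rewrite -(El h' _ P') ?size_n // mulf_neq0 //.
  have C' : coords (x - iota c) z by apply/coords_shift.
  apply/eqP => h0; have := E'; rewrite h0 mulr0 => /esym /(proj1 C') P'0.
  by move: Pa'; rewrite P'0 !coef0 eqxx.
have J' : jac (x - iota c) z^-1 = jac x z^-1.
  by have := jac_shift d1 d2 x z^-1 c 0; rewrite rmorph0 subr0.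
have Pa'' : (flip n P')`_(n - j')`_a' != 0 by rewrite flipE ?leq_subr // subKn.
have := val_multiplicity dv d1 d2 n1 n2 pc py _ Pa'' P'0; rewrite J' => /(_ J'0).
rewrite -(El h' _ P') ?size_n // => le2.
have lh0 : lam' * h' != 0 by rewrite (El h' (x - iota c) P') ?size_n.
have le3 := le_trans (val_le_gen l'0 hf' lh0) le2.
have nJ0 := nJ' J'0.
apply: le_trans (_ : v (jac x z^-1) *+ (2 * (a' + (n - j'))) <= _).
  by rewrite mulnC mulrnA; rewrite mulr_natl in le3; apply: ler_wMn2r.
by apply: ler_wpMn2l.
Qed.

Lemma val_fiber x z e n b lam : minimal_system iota f x z e n b lam ->
  jac x z != 0 -> nn v x -> v (lam * g) *+ 2 <= v (jac x z) *+ n.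
Proof.
move=> min J0 nx; have [nz|py] := nn_or dv z; last exact: (val_fiber_inf min J0 nx py).
by apply: (val_finite min) => // c d; exact: (minimal_mult f0 fgen min c d).
Qed.

Lemma jac_inf x z e : x != 0 -> jac x^-1 (z / x ^+ e) = - jac x z / x ^+ (e + 2).
Proof.
move=> x0.
have H : jac x (z / x ^+ e) = jac x z / x ^+ e.
  elim: e => [|e IH]; first by rewrite !divr1.
  by rewrite exprSr !invfM !mulrA (jac_div d1 d2) // IH.
rewrite jac_swap (jac_inv d1 d2) // jac_swap H exprD; field; rewrite expf_neq0 ?x0 //.
Qed.

(** For x at infinity, the fiber bound holds in the coordinates there. They involve the factors x^-b
    for [lam] and x^-(e+2) for the Jacobian, and v(x) < 0 turns n(e+2) <= 2b into the right
    inequality. *)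
Lemma val_ruled x z e n b lam : minimal_system iota f x z e n b lam ->
  (n * (e + 2) <= 2 * b)%N -> jac x z != 0 -> v (lam * g) *+ 2 <= v (jac x z) *+ n.
Proof.
move=> min le J0; have [nx|px] := nn_or dv x; first exact: (val_fiber min J0 nx).
have C := minimal_coords min; have x0 := coords_x0 C; have [[_ l0 _] _] := min.
have xV : x^-1 != 0 by rewrite invr_eq0.
have := val_fiber (minimal_inv min) _ (loc_R lv px); rewrite jac_inf //.
have J'0 : - jac x z / x ^+ (e + 2) != 0 by rewrite mulf_neq0 ?oppr_eq0 ?invr_eq0 ?expf_neq0.
move=> /(_ J'0).
have -> : v (lam * x^-1 ^+ b * g) = v (lam * g) - v x *+ b.
  have -> : lam * x^-1 ^+ b * g = (lam * g) * x^-1 ^+ b by ring.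
  by rewrite (val_M dv) ?mulf_neq0 ?expf_neq0 // (val_X dv) // (val_V dv) // mulrN mulr_natl.
rewrite (val_div dv) ?oppr_eq0 ?expf_neq0 // (val_N dv) (val_X dv) // mulr_natl.
have : v x < 0 by have := px xV; rewrite (val_V dv) // oppr_gt0.
move=> x_lt0 le2; have := lerD le2 (ler_wnM2l (ltW x_lt0) (_ : (n * (e + 2))%:R <= (2 * b)%:R)).
by rewrite ler_nat => /(_ le); clear; move: (v _) (v _) (v _) => A B D; rewrite !mulrnBl -!mulrnA !mulr_natr [(b * 2)%N]mulnC [((e + 2) * n)%N]mulnC; lia.
Qed.

(** A member containing a monomial x^a z^n has multiplicity at most b - n at the third coordinate
    point, and 3(b - n) <= b. *)
Lemma val_plane_inf x z n b lam : minimal_system iota f x z 1 n b lam -> (2 * b <= 3 * n)%N ->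
  jac x z != 0 -> pos v z^-1 -> pos v (x / z) -> v (lam * g) *+ 3 <= v (jac x z) *+ b.
Proof.
move=> min le J0 py pxi; have C := minimal_coords min; have [[_ l0 H] _] := min.
have z0 := coords_z0 C; have x0 := coords_x0 C.
have y0 : z^-1 != 0 by rewrite invr_eq0.
have EJ : jac z^-1 (x / z) = jac x z / z ^+ 3.
  rewrite (jac_mul d1 d2) jac_swap (jac_inv d1 d2) //; field; exact: z0.
have J'0 : jac z^-1 (x / z) != 0 by rewrite EJ mulf_neq0 ?invr_eq0 ?expf_neq0.
have nJ' : nn v (jac z^-1 (x / z)) by apply: (jac_nn dv n1 n2); exact: (loc_R lv).
pose lam' := lam * z^-1 ^+ b.
have l'0 : lam' != 0 by rewrite mulf_neq0 ?expf_neq0.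
suff : v (lam' * g) *+ 3 <= v (jac z^-1 (x / z)) *+ b.
  have -> : v (lam' * g) = v (lam * g) - v z *+ b.
    have -> : lam' * g = (lam * g) * z^-1 ^+ b by rewrite /lam'; ring.
    by rewrite (val_M dv) ?mulf_neq0 ?expf_neq0 // (val_X dv) // (val_V dv) // mulrN mulr_natl.
  rewrite EJ (val_div dv) ?expf_neq0 // (val_X dv) // mulr_natl.
  rewrite !mulrnBl -!mulrnA [(b * 3)%N]mulnC; lia.
have [h [P [hf E DP Pn]]] := minimal_top f0 fgen min.
have [a Pa] : exists a, P`_n`_a != 0.
  by exists (size P`_n).-1; rewrite -lead_coefE lead_coef_eq0.
have [_ aj] := DP a n Pa; rewrite mul1n in aj.
have El : lam' * h = ev2 z^-1 (x / z) (plane_flip b P).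
  by rewrite (@ev2_plane_flip _ _ _ n b x z P z0 DP) -E /lam'; ring.
have Pa' : (plane_flip b P)`_a`_(b - a - n) != 0.
  have [h1 h2 h3 h4] : [/\ (a < b.+1)%N, (b - a - n < b.+1)%N, (a + (b - a - n) <= b)%N & (b - a - (b - a - n))%N = n].
    by clear -aj; split; lia.
  by rewrite coef_poly h1 coef_poly h2 h3 h4.
have lh0 : lam' * h != 0.
  rewrite mulf_neq0 //; apply/eqP => h0; have := E; rewrite h0 mulr0 => /esym /(proj1 C) P0.
  by move: Pn; rewrite P0 coef0 eqxx.
have P'0 : ev2 z^-1 (x / z) (plane_flip b P) != 0 by rewrite -El.
have := val_multiplicity dv d1 d2 n1 n2 py pxi J'0 Pa' P'0.
rewrite -El => le2.
have le3 := le_trans (val_le_gen l'0 hf lh0) le2.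
have nJ0 := nJ' J'0.
apply: le_trans (_ : v (jac z^-1 (x / z)) *+ (3 * (b - a - n + a)) <= _).
  by rewrite mulnC mulrnA; rewrite mulr_natl in le3; apply: ler_wMn2r.
by apply: ler_wpMn2l => //; clear -aj le; lia.
Qed.

(** Some chart of the plane contains the centre. A change of chart multiplies [lam] by a b-th power
    and the Jacobian by a cube of the same function, so the inequality is the same in each. *)
Lemma val_plane x z n b lam : minimal_system iota f x z 1 n b lam -> (2 * b <= 3 * n)%N ->
  jac x z != 0 -> v (lam * g) *+ 3 <= v (jac x z) *+ b.
Proof.
move=> min le J0; have C := minimal_coords min; have [[_ l0 H] _] := min.
have z0 := coords_z0 C; have x0 := coords_x0 C.
have bn := minimal_b f0 fgen min; rewrite mul1n in bn.
have mult x' z' lam' : minimal_system iota f x' z' 1 n b lam' ->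
    forall c d, exists h P a j, [/\ h \in f, lam' * h = ev2 (x' - iota c) (z' - iota d) P,
     P`_j`_a != 0 & (3 * (a + j) <= b)%N].
  move=> min' c d; have [h [P [a [j [hf E Pa ajle]]]]] := minimal_mult_plane f0 fgen min' c d erefl.
  by exists h, P, a, j; split=> //; clear -ajle le; lia.
have [nx|px] := nn_or dv x.
  have [nz|py] := nn_or dv z; first exact: (val_finite min (mult _ _ _ min)).
  by apply: (val_plane_inf min le J0 py _); exact: (loc_Ml lv).
have min' := minimal_inv min; rewrite expr1 in min'.
have xV : x^-1 != 0 by rewrite invr_eq0.
have [nz'|py'] := nn_or dv (z / x).
  have := val_finite min' (mult _ _ _ min') _ (loc_R lv px) nz'.
  have := jac_inf z 1 x0; rewrite expr1 => ->.
  have J'0 : - jac x z / x ^+ (1 + 2) != 0 by rewrite mulf_neq0 ?oppr_eq0 ?invr_eq0 ?expf_neq0.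
  move=> /(_ J'0).
  have -> : v (lam * x^-1 ^+ b * g) = v (lam * g) - v x *+ b.
    have -> : lam * x^-1 ^+ b * g = (lam * g) * x^-1 ^+ b by ring.
    by rewrite (val_M dv) ?mulf_neq0 ?expf_neq0 // (val_X dv) // (val_V dv) // mulrN mulr_natl.
  rewrite (val_div dv) ?oppr_eq0 ?expf_neq0 // (val_N dv) (val_X dv) // mulr_natl.
  rewrite !mulrnBl -!mulrnA [(b * 3)%N]mulnC; lia.
rewrite invf_div in py'.
apply: (val_plane_inf min le J0 _ py').
have -> : z^-1 = x^-1 * (x / z) by field; apply/andP.
by apply: (loc_Ml lv) => //; exact: (loc_R lv).
Qed.
End Valuation.
End NoetherFano.

(** * Valuation rings and indeterminacies *)
Section Chevalley.
Variables (k : closedFieldType) (K : fieldType) (iota : {rmorphism k -> K}).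
Implicit Types (A N R I : K -> Prop) (h : K).

Definition proper_ideal A I := [/\ subring iota A, forall u, I u -> A u,
  I 0 /\ forall u v, I u -> I v -> I (u + v),
  forall u v, A u -> I v -> I (u * v) & ~ I 1].

Definition dominates (p q : (K -> Prop) * (K -> Prop)) :=
  (forall u, p.1 u -> q.1 u) /\ (forall u, p.2 u -> q.2 u).

Definition valuation_ring A N := local_ring iota A N /\ forall h, A h \/ N h^-1.

(** Zorn's lemma: the union of a chain of such pairs is again a subring with a proper ideal. *)
Lemma maximal_pair A0 I0 : proper_ideal A0 I0 -> exists A I,
  [/\ proper_ideal A I, dominates (A0, I0) (A, I) &
      forall B J, proper_ideal B J -> dominates (A, I) (B, J) -> dominates (B, J) (A, I)].
Proof.
move=> p0.
pose T := {p : (K -> Prop) * (K -> Prop) | proper_ideal p.1 p.2 /\ dominates (A0, I0) p}.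
pose t0 : T := exist _ (A0, I0) (conj p0 (conj (fun u (Hu : A0 u) => Hu) (fun u (Hu : I0 u) => Hu))).
pose R (s t : T) := boolp.asbool (dominates (sval s) (sval t)).
have [||C tot|t max] := @classical_sets.ZL_preorder T t0 R.
- by move=> t; apply/boolp.asboolP.
- move=> r s t /boolp.asboolP [H1 H2] /boolp.asboolP [H3 H4]; apply/boolp.asboolP.
  by split=> u Hu; auto.
- case: (classic (exists c, C c)) => [[c0 C0]|nC]; last first.
    by exists t0 => s Cs; case: nC; exists s.
  pose B u := exists2 c, C c & (sval c).1 u; pose J u := exists2 c, C c & (sval c).2 u.
  have join c d : C c -> C d -> exists2 e, C e & dominates (sval c) (sval e) /\ dominates (sval d) (sval e).
    by move=> Cc Cd; case: (tot _ _ Cc Cd) => /boolp.asboolP H; [exists d|exists c].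
  have good (c : T) : proper_ideal (sval c).1 (sval c).2 by exact: (proj1 (proj2_sig c)).
  have pB : proper_ideal B J.
    split.
    - split=> [x|u v [c Cc cu] [d Cd dv]|u v [c Cc cu] [d Cd dv]].
      + by exists c0 => //; have [[]] := good c0.
      + have [e Ce [[ce _] [de _]]] := join _ _ Cc Cd; exists e => //.
        by have [[_ H _] _ _ _ _] := good e; apply: H; auto.
      + have [e Ce [[ce _] [de _]]] := join _ _ Cc Cd; exists e => //.
        by have [[_ _ H] _ _ _ _] := good e; apply: H; auto.
    - by move=> u [c Cc cu]; exists c => //; have [_ H _ _ _] := good c; exact: H.
    - split=> [|u v [c Cc cu] [d Cd dv]].
        by exists c0 => //; have [_ _ []] := good c0.
      have [e Ce [[_ ce] [_ de]]] := join _ _ Cc Cd; exists e => //.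
      by have [_ _ [_ H] _ _] := good e; apply: H; auto.
    - move=> u v [c Cc cu] [d Cd dv].
      have [e Ce [[ce _] [_ de]]] := join _ _ Cc Cd; exists e => //.
      by have [_ _ _ H _] := good e; apply: H; auto.
    - by move=> [c Cc c1]; have [_ _ _ _] := good c; apply.
  have dB : dominates (A0, I0) (B, J).
    have [_ [H1 H2]] := svalP c0.
    by split=> u Hu; exists c0 => //; [exact: H1|exact: H2].
  exists (exist _ (B, J) (conj pB dB)) => s Cs; apply/boolp.asboolP.
  by split=> u Hu; exists s.
case: t max => [[A I] /= [p d]] max; exists A, I; split=> // B J pB dB.
have dB' : dominates (A0, I0) (B, J).
  by case: (d) dB => H1 H2 [H3 H4]; split=> u Hu; [apply: H3; exact: H1|apply: H4; exact: H2].
have := max (exist _ (B, J) (conj pB dB')) => /(_ _)/boolp.asboolP; apply.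
exact/boolp.asboolP.
Qed.

Definition coefs_in A (P : {poly K}) := forall i, A P`_i.

Section Coefs.
Variables (A I : K -> Prop).
Hypothesis pA : proper_ideal A I.
Let sA : subring iota A. Proof. by case: pA. Qed.

Lemma coefs_C u : A u -> coefs_in A u%:P.
Proof. by move=> Au i; rewrite coefC; case: ifP => // _; exact: (subr_0 sA). Qed.
Lemma coefs_D P Q : coefs_in A P -> coefs_in A Q -> coefs_in A (P + Q).
Proof. by move=> AP AQ i; rewrite coefD; apply: (subr_D sA). Qed.
Lemma coefs_M P Q : coefs_in A P -> coefs_in A Q -> coefs_in A (P * Q).
Proof. by move=> AP AQ i; rewrite coefM; apply: (subr_sum sA) => j _; apply: (subr_M sA). Qed.
Lemma coefs_X : coefs_in A 'X.
Proof. by move=> i; rewrite coefX; case: eqP => _; [exact: (subr_1 sA)|exact: (subr_0 sA)]. Qed.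
Lemma coefsI_C u : I u -> coefs_in I u%:P.
Proof. by move=> Iu i; rewrite coefC; case: ifP => // _; case: pA => _ _ []. Qed.
Lemma coefsI_D P Q : coefs_in I P -> coefs_in I Q -> coefs_in I (P + Q).
Proof. by move=> AP AQ i; rewrite coefD; case: pA => _ _ [_ H] _ _; apply: H. Qed.
Lemma coefsI_M P Q : coefs_in A P -> coefs_in I Q -> coefs_in I (P * Q).
Proof.
move=> AP AQ i; rewrite coefM; case: pA => _ _ [I0 ID] IM _.
by elim/big_ind: _ => // j _; apply: IM.
Qed.
Lemma coefsI P : coefs_in I P -> coefs_in A P.
Proof. by case: pA => _ H _ _ _ IP i; exact: H. Qed.
End Coefs.

Section Maximal.
Variables (A I : K -> Prop).
Hypothesis pA : proper_ideal A I.
Hypothesis max : forall B J, proper_ideal B J -> dominates (A, I) (B, J) -> dominates (B, J) (A, I).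
Let sA : subring iota A. Proof. by case: pA. Qed.
Let IA u : I u -> A u. Proof. by case: pA => _ + _ _ _; exact. Qed.
Let I0 : I 0. Proof. by case: pA => _ _ []. Qed.
Let ID u v : I u -> I v -> I (u + v). Proof. by case: pA => _ _ [_ +] _ _; exact. Qed.
Let IM u v : A u -> I v -> I (u * v). Proof. by case: pA => _ _ _ + _; exact. Qed.
Let I1 : ~ I 1. Proof. by case: pA. Qed.

(** Otherwise I generates a proper ideal of A[h], and maximality gives h in A. *)
Lemma maximal_adjoin h : ~ A h -> exists2 P, coefs_in I P & P.[h] = 1.
Proof.
move=> nA; apply: NNPP => nP; apply: nA.
pose B u := exists2 P, coefs_in A P & P.[h] = u.
pose J u := exists2 P, coefs_in I P & P.[h] = u.
have pB : proper_ideal B J.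
  split.
  - split=> [c|u v [P AP <-] [Q AQ <-]|u v [P AP <-] [Q AQ <-]].
    + by exists (iota c)%:P; rewrite ?hornerC //; apply: (coefs_C pA); exact: (subr_c sA).
    + by exists (P + Q); rewrite ?hornerD //; exact: (coefs_D pA).
    + by exists (P * Q); rewrite ?hornerM //; exact: (coefs_M pA).
  - by move=> u [P IP <-]; exists P => //; exact: (coefsI pA).
  - split=> [|u v [P AP <-] [Q AQ <-]]; first by exists 0; rewrite ?horner0 // => i; rewrite coef0.
    by exists (P + Q); rewrite ?hornerD //; exact: (coefsI_D pA).
  - by move=> u v [P AP <-] [Q AQ <-]; exists (P * Q); rewrite ?hornerM //; exact: (coefsI_M pA).
  - by move=> [P IP E]; apply: nP; exists P.
have dB : dominates (A, I) (B, J).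
  split=> u Hu; exists u%:P; rewrite ?hornerC //; first exact: (coefs_C pA).
  exact: (coefsI_C pA).
have [+ _] := max pB dB; apply; exists 'X; rewrite ?hornerX //; exact: (coefs_X pA).
Qed.

(** If the inverse were not in A, a relation for it with coefficients in I, multiplied by a power of
    1 - d, would put that power into I; but the power is 1 modulo I. *)
Lemma maximal_1B d : I d -> A (1 - d)^-1.
Proof.
move=> Id; apply: NNPP => /maximal_adjoin [P IP E].
have d0 : 1 - d != 0 by apply/eqP => /eqP; rewrite subr_eq0 => /eqP d1; apply: I1; rewrite d1.
have A1 : A (1 - d) by apply: (subr_B sA (subr_1 sA)); exact: IA.
have H n : I (1 - (1 - d) ^+ n).
  elim: n => [|n IH]; first by rewrite subrr.
  have -> : 1 - (1 - d) ^+ n.+1 = d + (1 - d) * (1 - (1 - d) ^+ n) by rewrite exprS; ring.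
  by apply: ID => //; exact: IM.
apply: I1; rewrite -(subrK ((1 - d) ^+ (size P)) 1); apply: ID => //.
rewrite -[X in I X]mulr1 -[X in _ * X]E horner_coef mulr_sumr; elim/big_ind: _ => // i _.
have -> : (1 - d) ^+ size P * (P`_i * (1 - d)^-1 ^+ i) = (1 - d) ^+ (size P - i) * P`_i.
  by rewrite -{1}(subnK (ltnW (ltn_ord i))) exprD exprVn; field; rewrite expf_neq0.
by apply: IM => //; exact: (subr_X sA).
Qed.

Lemma maximal_local : local_ring iota A I.
Proof.
split=> //; split=> // s As nI.
pose J u := exists a i, [/\ A a, I i & u = i + s * a].
case: (classic (J 1)) => [[a [i [Aa Ii E]]]|J1].
  have H : s * a = 1 - i by rewrite E addrAC subrr add0r.
  have i0 : 1 - i != 0 by apply/eqP => /eqP; rewrite subr_eq0 => /eqP d1; apply: I1; rewrite d1.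
  have s0 : s != 0 by apply: contraNneq i0 => s0; rewrite -H s0 mul0r.
  have a0 : a != 0 by apply: contraNneq i0 => a0; rewrite -H a0 mulr0.
  have -> : s^-1 = a * (1 - i)^-1 by rewrite -H; field; apply/andP.
  by apply: (subr_M sA) => //; exact: maximal_1B.
case: nI; have pJ : proper_ideal A J.
  split=> //.
  - by move=> u [a [i [Aa Ii ->]]]; apply: (subr_D sA); [exact: IA|exact: (subr_M sA)].
  - split=> [|u v [a [i [Aa Ii ->]]] [a' [i' [Aa' Ii' ->]]]].
      by exists 0, 0; rewrite mulr0 addr0; split=> //; exact: (subr_0 sA).
    by exists (a + a'), (i + i'); split; [exact: (subr_D sA)|exact: ID|ring].
  - move=> u v Au [a [i [Aa Ii ->]]]; exists (u * a), (u * i); split; last by ring.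
      exact: (subr_M sA).
    exact: IM.
have dJ : dominates (A, I) (A, J).
  by split=> // u Iu; exists 0, u; rewrite mulr0 addr0; split=> //; exact: (subr_0 sA).
have [_ +] := max pJ dJ; apply; exists 1, 0; rewrite add0r mulr1; split=> //; exact: (subr_1 sA).
Qed.

(** If both were missing, each would satisfy a relation of value 1 with coefficients in I; the
    longer relation can always be shortened by the other. *)
Lemma maximal_or h : A h \/ A h^-1.
Proof.
have lA := maximal_local.
apply: NNPP => /not_or_and [nh nh'].
have h0 : h != 0 by apply: contra_notN nh => /eqP ->; exact: (subr_0 sA).
suff H n m : forall (u : K) (P Q : {poly K}), u != 0 -> (size P <= n)%N -> (size Q <= m)%N -> coefs_in I P -> coefs_in I Q ->
    P.[u] = 1 -> Q.[u^-1] = 1 -> False.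
  have [P IP EP] := maximal_adjoin nh; have [Q IQ EQ] := maximal_adjoin nh'.
  exact: H h0 (leqnn _) (leqnn _) IP IQ EP EQ.
have [N le] := ubnP (n + m); elim: N n m le => // N IH n m nmN u P Q u0 sP sQ IP IQ EP EQ.
wlog nm : n m nmN u u0 P Q sP sQ IP IQ EP EQ / (m <= n)%N => [H|].
  have [mn|nm] := leqP m n; first exact: (H n m nmN u u0 P Q).
  apply: (H m n _ u^-1 _ Q P) => //; rewrite ?invr_eq0 ?invrK ?(ltnW nm) //.
  by rewrite addnC.
have n0 : (0 < n)%N.
  rewrite lt0n; apply: contra_notN I1 => /eqP n0; rewrite n0 leqn0 size_poly_eq0 in sP.
  by rewrite -EP (eqP sP) horner0.
(* Use the relation for u^-1 to eliminate the leading term of the relation for u. *)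
pose c := P`_n.-1; pose d := 1 - Q`_0.
have Ad : A d^-1 by exact: maximal_1B.
have d0 : d != 0 by apply/eqP => /eqP; rewrite subr_eq0 => /eqP d1; apply: I1; rewrite d1.
pose Q1 := \poly_(i < n.-1) (if (n.-1 - i < m)%N then Q`_(n.-1 - i) else 0).
have EQ1 : d * u ^+ n.-1 = Q1.[u].
  rewrite horner_poly.
  have -> : d * u ^+ n.-1 = \sum_(i < n) Q`_i * u ^+ (n.-1 - i) - Q`_0 * u ^+ n.-1.
    have E : \sum_(i < n) Q`_i * u^-1 ^+ i = 1.
      rewrite -EQ horner_coef [RHS](big_ord_widen n (fun i => Q`_i * u^-1 ^+ i)) ?(leq_trans sQ) //.
      rewrite [RHS]big_mkcond; apply: eq_bigr => i _; case: ltnP => // le'.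
      by rewrite nth_default // mul0r.
    rewrite /d mulrBl mul1r -{1}[u ^+ _]mul1r -E mulr_suml; congr (_ - _).
    apply: eq_bigr => i _; rewrite -mulrA; congr (_ * _).
    have le' : (i <= n.-1)%N by rewrite -ltnS prednK.
    by rewrite -{1}(subnK le') exprD exprVn mulrCA mulVf ?mulr1 ?expf_neq0.
  rewrite -(big_mkord xpredT (fun i => Q`_i * u ^+ (n.-1 - i))) big_ltn // subn0 addrAC subrr add0r big_add1 big_mkord.
  rewrite (reindex_inj rev_ord_inj) /=; apply: eq_bigr => i _.
  have i1 : (i < n.-1)%N := ltn_ord i.
  rewrite subnSK // subKn ?(ltnW i1) //; case: ltnP => // le'.
  by rewrite nth_default ?mul0r // (leq_trans sQ).
pose P1 := P - c *: 'X^(n.-1) + (c / d) *: Q1.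
have IQ1 : coefs_in I Q1 by move=> i; rewrite coef_poly; do 2![case: ifP => // _].
have Ic : I c by exact: IP.
apply: (IH n.-1 m _ u P1 Q) => //.
- by rewrite -ltnS (leq_trans _ nmN) // ltnS -addSn prednK.
- apply/leq_sizeP => i le'; rewrite coefD coefB !coefZ coefXn coef_poly ltnNge le' /= mulr0 addr0.
  have [->|ne] := eqVneq i n.-1; first by rewrite mulr1 subrr.
  rewrite mulr0 subr0 nth_default // (leq_trans sP) // -(prednK n0) ltn_neqAle le' andbT eq_sym //.
- move=> i; rewrite coefD coefB !coefZ coefXn; apply: ID; last first.
    by apply: IM => //; apply: (subr_M sA) => //; exact: IA.
  rewrite -mulNr; apply: ID => //; rewrite mulrC; apply: IM; first exact: (subr_n sA).
  by rewrite -mulN1r; apply: IM => //; apply: (subr_N sA); exact: (subr_1 sA).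
- by rewrite hornerD hornerD hornerN !hornerZ hornerXn -EQ1 EP; field.
Qed.
End Maximal.

Lemma chevalley A0 I0 : proper_ideal A0 I0 -> exists A N,
  valuation_ring A N /\ dominates (A0, I0) (A, N).
Proof.
move=> /maximal_pair [A [N [pA dA max]]]; exists A, N; split=> //.
have lA := maximal_local pA max; split=> // h.
case: (classic (A h)) => [|nh]; [by left|right].
have [//|Ah'] := maximal_or pA max h; apply: NNPP => nN; apply: nh.
by rewrite -(invrK h); exact: (loc_V lA).
Qed.
End Chevalley.

(** * Points of indeterminacy *)

Section Indeterminacy.
Variables (k : closedFieldType) (K : fieldType) (iota : {rmorphism k -> K}).
Local Notation ev1 := (@ev1 k K iota).
Local Notation ev2 := (@ev2 k K iota).
Local Notation coords := (@coords k K iota).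

Section Point.
Variables x0 z0 : K.
Hypothesis C0 : coords x0 z0.
Variables (cs : seq (seq K)) (a : point iota cs).
Hypothesis ga : generates iota (chart a).
Hypothesis reg : regular_point2 a.
Local Notation O := (stalk a).
Local Notation M := (maximal_ideal a).
Let lO : local_ring iota O M := stalk_local a.
Let sO : subring iota O := stalk_sub a.

Section Transcendental.
Variable y : K.
Hypothesis ny : ~ O y.
Hypothesis nyV : ~ O y^-1.

(** Let y = u / w in lowest terms; u and w are in M. The relation makes w divide the top coefficient
    times a power of u, hence the top coefficient itself, which is w q. Adding q u to the next
    coefficient lowers the degree. *)
Lemma relation_coefs n (c : nat -> K) : (forall i, O (c i)) -> \sum_(i < n.+1) c i * y ^+ i = 0 ->
  forall i, (i <= n)%N -> M (c i).
Proof.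
have [u [w [Ou Ow w0 E cop]]] := stalk_lowest (coords_indep C0) (proj2 C0) ga reg y.
have Mw : M w by apply: NNPP => nM; apply: ny; rewrite E; apply: (subr_M sO) => //; exact: (loc_V lO).
have u0 : u != 0 by apply: contra_notN ny => /eqP u0; rewrite E u0 mul0r; exact: (subr_0 sO).
elim: n c => [|n IH] c Oc.
  rewrite big_ord_recl big_ord0 mulr1 addr0 => c0 i; rewrite leqn0 => /eqP ->.
  by rewrite c0; exact: (loc_0 lO).
move=> E0.
have Oh : O (c n.+1 / w).
  suff H m : O (c n.+1 * u ^+ m / w) -> O (c n.+1 / w).
    apply: (H n.+1).
    have -> : c n.+1 * u ^+ n.+1 / w = - \sum_(i < n.+1) c i * u ^+ i * w ^+ (n - i).
      apply: (mulIf w0); rewrite divfK // mulNr mulr_suml; apply/eqP.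
      rewrite -subr_eq0 opprK; apply/eqP.
      transitivity (w ^+ n.+1 * \sum_(i < n.+2) c i * y ^+ i); last by rewrite E0 mulr0.
      rewrite [in RHS]big_ord_recr /= mulrDr mulr_sumr addrC; congr (_ + _).
        apply: eq_bigr => i _; rewrite E expr_div_n.
        have -> : w ^+ n.+1 = w ^+ (n - i) * w ^+ i * w.
          by rewrite -exprD subnK -?exprSr // -ltnS.
        by field; rewrite expf_neq0.
      by rewrite E expr_div_n; field; rewrite expf_neq0.
    apply: (subr_N sO); apply: (subr_sum sO) => i _.
    by apply: (subr_M sO); [apply: (subr_M sO) => //|]; apply: (subr_X sO).
  elim: m => [|m IHm]; first by rewrite mulr1.
  move=> H; apply: IHm; apply: cop; first by apply: (subr_M sO) => //; exact: (subr_X sO).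
  by move: H; rewrite exprSr mulrA.
have Mh : M (c n.+1) by rewrite -(divfK w0 (c n.+1)); exact: (loc_Ml lO).
pose c' i := if i == n then c n + c n.+1 / w * u else c i.
have Oc' i : O (c' i).
  by rewrite /c'; case: ifP => // _; apply: (subr_D sO) => //; exact: (subr_M sO).
have E' : \sum_(i < n.+1) c' i * y ^+ i = 0.
  rewrite -[RHS]E0 !big_ord_recr /= /c' eqxx -addrA; congr (_ + _).
    by apply: eq_bigr => i _; rewrite (ltn_eqF (ltn_ord i)).
  by rewrite mulrDl; congr (_ + _); rewrite exprS mulrA; congr (_ * _); rewrite E; ring.
move=> i; rewrite leq_eqVlt => /predU1P [-> //|lt].
have := IH c' Oc' E' i lt; rewrite /c'; case: eqP => // -> H.
rewrite -(addrK (c n.+1 / w * u) (c n)); apply: (loc_B lO) => //.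
apply: (loc_Ml lO) => //; apply: NNPP => nM; apply: nyV.
by rewrite E invf_div; apply: (subr_M sO) => //; exact: (loc_V lO).
Qed.

Lemma poly_relation (P : {poly K}) (q : {poly k}) : coefs_in M P -> P.[y] = ev1 y q -> q = 0.
Proof.
move=> MP Eq; apply: NNPP => q0; have {}q0 : q != 0 by apply/eqP.
pose N := (size P + size q)%N.
have H : \sum_(i < N.+1) (P`_i - iota q`_i) * y ^+ i = 0.
  transitivity (P.[y] - ev1 y q); last by rewrite Eq subrr.
  rewrite horner_coef ev1E (big_ord_widen N.+1 (fun i => P`_i * y ^+ i)); last by rewrite /N; lia.
  rewrite (big_ord_widen N.+1 (fun i => iota q`_i * y ^+ i)); last by rewrite /N; lia.
  rewrite [X in _ = X - _]big_mkcond [X in _ = _ - X]big_mkcond -sumrB; apply: eq_bigr => i _.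
  rewrite mulrBl; congr (_ - _); case: ltnP => // le; rewrite nth_default ?mul0r ?rmorph0 ?mul0r //.
have Oc i : O (P`_i - iota q`_i).
  by apply: (subr_B sO); [exact: (loc_R lO)|exact: (subr_c sO)].
have le : ((size q).-1 <= N)%N by rewrite /N; lia.
have := relation_coefs Oc H le; rewrite -lead_coefE => Mc.
have := loc_B lO (MP (size q).-1) Mc; rewrite opprB addrCA subrr addr0.
by apply: (loc_c lO); rewrite lead_coef_eq0.
Qed.

(* Two algebraically independent residues cannot occur at a point, but one     *)
(* does as soon as y is indeterminate there.                                   *)
Lemma indeterminate_valuation : exists A N, [/\ valuation_ring iota A N,
  forall h, O h -> A h, forall h, M h -> N h, A y & forall q, q != 0 -> ~ N (ev1 y q)].
Proof.
have ev0 q : q != 0 -> ev1 y q != 0.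
  move=> q0; apply/eqP => E; move/eqP: q0; apply; apply: (@poly_relation 0); last by rewrite horner0.
  by move=> i; rewrite coef0; exact: (loc_0 lO).
(* O[y] localized at the nonzero polynomials of k[y], with the ideal generated by M, which is proper
   by [poly_relation]. In a valuation ring dominating this pair the residue of y is transcendental
   over k. *)
pose frac (R : K -> Prop) h := exists P q, [/\ coefs_in R P, q != 0 & h = P.[y] / ev1 y q].
have pO : proper_ideal iota O M.
  by split; [exact: sO|exact: (loc_R lO)|split; [exact: (loc_0 lO)|exact: (loc_D lO)]|exact: (loc_Ml lO)|exact: (loc_1 lO)].
have coefs_ev q : coefs_in O (map_poly iota q).
  by move=> i; rewrite coef_map; exact: (subr_c sO).
have ev_h q : (map_poly iota q).[y] = ev1 y q by [].
have pI : proper_ideal iota (frac O) (frac M).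
  split.
  - split=> [c|u v [P [p [OP p0 ->]]] [Q [q [OQ q0 ->]]]|u v [P [p [OP p0 ->]]] [Q [q [OQ q0 ->]]]].
    + exists (iota c)%:P, 1; rewrite hornerC ev1_1 divr1 oner_neq0; split=> //.
      by apply: (coefs_C pO); exact: (subr_c sO).
    + exists (P * map_poly iota q + Q * map_poly iota p), (p * q).
      rewrite hornerD !hornerM !ev_h ev1M mulf_neq0 //; split=> //; last by field; rewrite !ev0.
      by apply: (coefs_D pO); apply: (coefs_M pO).
    + exists (P * Q), (p * q); rewrite hornerM ev1M mulf_neq0 // mulf_div; split=> //.
      exact: (coefs_M pO).
  - move=> u [P [p [MP p0 ->]]]; exists P, p; split=> //; exact: (coefsI pO).
  - split=> [|u v [P [p [OP p0 ->]]] [Q [q [OQ q0 ->]]]].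
      by exists 0, 1; rewrite horner0 mul0r oner_neq0; split=> // i; rewrite coef0; exact: (loc_0 lO).
    exists (P * map_poly iota q + Q * map_poly iota p), (p * q).
    rewrite hornerD !hornerM !ev_h ev1M mulf_neq0 //; split=> //; last by field; rewrite !ev0.
    by apply: (coefsI_D pO); rewrite mulrC; apply: (coefsI_M pO).
  - move=> u v [P [p [OP p0 ->]]] [Q [q [OQ q0 ->]]].
    exists (P * Q), (p * q); rewrite hornerM ev1M mulf_neq0 // mulf_div; split=> //.
    exact: (coefsI_M pO).
  - move=> [P [q [MP q0 E]]]; move/eqP: (q0); apply; apply: (poly_relation MP).
    by rewrite -[LHS](divfK (ev0 q q0)) -E mul1r.
have [A [N [vA [dA dN]]]] := chevalley pI; exists A, N; have [lA _] := vA; split=> //.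
- move=> h Oh; apply: dA; exists h%:P, 1; rewrite hornerC ev1_1 divr1 oner_neq0; split=> //.
  exact: (coefs_C pO).
- move=> h Oh; apply: dN; exists h%:P, 1; rewrite hornerC ev1_1 divr1 oner_neq0; split=> //.
  exact: (coefsI_C pO).
- apply: dA; exists 'X, 1; rewrite hornerX ev1_1 divr1 oner_neq0; split=> //.
  exact: (coefs_X pO).
- move=> q q0; apply: (loc_unit lA); last exact: ev0.
    apply: dA; exists (map_poly iota q), 1; rewrite ev1_1 divr1 oner_neq0; split=> //.
  apply: dA; exists 1, q; rewrite hornerC mul1r; split=> //.
  by rewrite -(polyC1 K); apply: (coefs_C pO); exact: (subr_1 sO).
Qed.
End Transcendental.
End Point.

Lemma der_ev2 (A N : K -> Prop) D xi eta (P : {poly {poly k}}) : local_ring iota A N -> der iota D ->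
  A xi -> A eta -> A (D xi) -> A (D eta) -> A (D (ev2 xi eta P)).
Proof.
move=> lA dD Ax Ae ADx ADe; have sA := loc_sub lA.
have A1 q : A (ev1 xi q) by apply: (ev1_in lA).
have H1 q : A (D (ev1 xi q)).
  elim/poly_ind: q => [|q c IH]; first by rewrite ev1_0 (der_0 dD); exact: (subr_0 sA).
  rewrite ev1D ev1M ev1X ev1C (der_D dD) (der_M dD) (der_c dD) addr0.
  by apply: (subr_D sA); apply: (subr_M sA).
elim/poly_ind: P => [|P q IH]; first by rewrite ev2_0 (der_0 dD); exact: (subr_0 sA).
rewrite ev2D ev2M ev2X ev2C (der_D dD) (der_M dD); apply: (subr_D sA) => //.
by apply: (subr_D sA); apply: (subr_M sA) => //; exact: (ev2_in lA).
Qed.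

(** Chain rule: the two Jacobian matrices are inverse to each other. *)
Lemma jac_dual xi eta s t D1 D2 (ind : alg_indep iota [:: xi; eta]) (gen : generates iota [:: xi; eta]) :
  dual_ders iota D1 D2 s t -> jacobian (dX ind gen) (dZ ind gen) s t * jacobian D1 D2 xi eta = 1.
Proof.
move=> dd; set E1 := dX ind gen; set E2 := dZ ind gen.
have e1 : der iota E1 := dX_der ind gen; have e2 : der iota E2 := dZ_der ind gen.
have Ex : jacobian E1 E2 xi eta = 1.
  by rewrite /jacobian /E1 /E2 (dXx ind gen) (dZz ind gen) (dXz ind gen) mul0r subr0 mulr1.
rewrite -[RHS]Ex /jacobian !(dual_ders_basis ind gen dd e1 xi) !(dual_ders_basis ind gen dd e1 eta).
by rewrite !(dual_ders_basis ind gen dd e2 xi) !(dual_ders_basis ind gen dd e2 eta); ring.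
Qed.

Section NormalForm.
Variables (A N : K -> Prop) (xi eta : K).
Hypothesis lA : local_ring iota A N.
Hypothesis C : coords xi eta.
Hypothesis Ax : A xi.
Hypothesis Ae : A eta.
Hypothesis unit1 : forall q, q != 0 -> ~ N (ev1 xi q).
Variable P0 : {poly {poly k}}.
Hypothesis P00 : P0 != 0.
Hypothesis NP0 : N (ev2 xi eta P0).
Hypothesis minP0 : forall P, P != 0 -> N (ev2 xi eta P) -> (size P0 <= size P)%N.
Let sA := loc_sub lA.
Let A2 P : A (ev2 xi eta P). Proof. exact: (ev2_in lA). Qed.
Let A1 q : A (ev1 xi q). Proof. exact: (ev1_in lA). Qed.

Lemma ev1_ev2 q : ev1 xi q = ev2 xi eta q%:P. Proof. by rewrite ev2C. Qed.

(** Up to factors from k[xi], [P0] is the minimal polynomial of the residue of eta over k(xi). The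
    remainder of pseudo-division by it is in N and of smaller degree, hence 0. *)
Lemma equation_divides (P : {poly {poly k}}) : N (ev2 xi eta P) -> exists q (Q : {poly {poly k}}),
  [/\ q != 0, ev1 xi q * ev2 xi eta P = ev2 xi eta P0 * ev2 xi eta Q &
      P != 0 -> (size Q < size P)%N].
Proof.
move=> NP; exists (lead_coef P0 ^+ scalp P P0), (P %/ P0); split.
- by rewrite expf_neq0 ?lead_coef_eq0.
- rewrite ev1_ev2 -!ev2M; congr (ev2 xi eta _).
  have E := Pdiv.Idomain.divp_eq P P0; rewrite mul_polyC E mulrC -[RHS]addr0; congr (_ + _).
  apply/eqP; apply: contraT => R0.
  have := minP0 R0; rewrite leqNgt ltn_modp P00 => /(_ _)/negP; case=> //.
  have -> : P %% P0 = lead_coef P0 ^+ scalp P P0 *: P - P %/ P0 * P0 by rewrite E addrC addKr.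
  rewrite -mul_polyC ev2B !ev2M; apply: (loc_B lA); exact: (loc_Ml lA).
move=> Pn0; have [->|Q0] := eqVneq (P %/ P0) 0; first by rewrite size_poly0 size_poly_gt0.
rewrite (Pdiv.Idomain.size_divp _ P00).
have s1 : (1 < size P0)%N.
  have : (0 < size P0)%N by rewrite size_poly_gt0.
  rewrite leq_eqVlt => /predU1P [/esym /eqP/size_poly1P [c c0 Ec]|//].
  by have := NP0; rewrite Ec ev2C => /(unit1 c0).
have : (0 < size P)%N by rewrite size_poly_gt0.
move=> P_gt0; rewrite ltn_subrL P_gt0 andbT; by case: (size P0) s1 => [|[]].
Qed.

(** In a representation of s whose denominator has least degree, the denominator is outside N, since
    otherwise [P0] could be cancelled; the numerator is divisible by [P0]. *)
Lemma equation_frac s : N s -> exists U V, ~ N (ev2 xi eta V) /\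
  s = ev2 xi eta P0 * (ev2 xi eta U / ev2 xi eta V).
Proof.
move=> Ns; have inj P : P != 0 -> ev2 xi eta P != 0.
  by move=> Pn0; apply: contra_neq Pn0 => /(proj1 C).
have [P [Q [Q0 E]]] := coords_frac C s.
have Qn0 : Q != 0 by apply: contraNneq Q0 => ->; rewrite ev2_0.
have [n [[P1 [Q1 [Q10 E1 sQ1]]] minn]] := @nat_least (fun n => exists P Q, [/\ Q != 0,
   s = ev2 xi eta P / ev2 xi eta Q & size Q = n]) (ex_intro _ _ (ex_intro _ P (ex_intro _ Q (And3 Qn0 E erefl)))).
have NsP1 : ev2 xi eta P1 = s * ev2 xi eta Q1 by rewrite E1 divfK ?inj.
have NP1 : N (ev2 xi eta P1) by rewrite NsP1; apply: (loc_Mr lA).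
have [p [P' [p0 EP _]]] := equation_divides NP1.
case: (classic (N (ev2 xi eta Q1))) => [NQ|nNQ].
  exfalso; have [q [Q' [q0 EQ /(_ Q10) sQ']]] := equation_divides NQ.
  have q0' : ev1 xi q != 0 by rewrite ev1_ev2 inj ?polyC_eq0.
  have Q'0 : Q' != 0.
    apply: contraTneq (inj _ Q10) => Q'0; have := EQ; rewrite Q'0 ev2_0 mulr0 => /eqP.
    by rewrite mulf_eq0 (negPf q0') /= negbK.
  have := minn (size (p *: Q')); rewrite size_scale // -sQ1 leqNgt sQ' => /(_ _)/negP; case=> //.
  exists (q *: P'), (p *: Q'); rewrite size_scale // -size_poly_eq0 size_scale // size_poly_eq0; split=> //.
  have p0' : ev1 xi p != 0 by rewrite ev1_ev2 inj ?polyC_eq0.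
  rewrite -!mul_polyC !ev2M -!ev1_ev2 E1.
  apply: (mulIf (inj _ Q10)); rewrite divfK ?inj //; apply: (mulfI p0'); rewrite EP.
  apply: (mulfI q0').
  transitivity (ev1 xi q * ev2 xi eta P' / ev2 xi eta Q' * (ev1 xi q * ev2 xi eta Q1)).
    by rewrite EQ; field; rewrite inj.
  by field; rewrite inj.
exists P', (p *: Q1); rewrite -mul_polyC ev2M -ev1_ev2; split.
  by move=> /(loc_prime lA (A1 p) (A2 Q1)) [/(unit1 p0)|].
have p0' : ev1 xi p != 0 by rewrite ev1_ev2 inj ?polyC_eq0.
by rewrite mulrA -EP E1; field; rewrite p0' inj.
Qed.

(* The equation ev2 P0 of the exceptional curve divides the Jacobian of the    *)
(* parameters s, t with respect to xi, eta.                                    *)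
Lemma equation_jac s t D1 D2 : dual_ders iota D1 D2 s t -> N s -> N t ->
  exists w, A w /\ ev2 xi eta P0 * w * jacobian D1 D2 xi eta = 1.
Proof.
move=> dd Ns Nt; have ind := coords_indep C; have gen := proj2 C.
pose E1 := dX ind gen; pose E2 := dZ ind gen.
have e1 : der iota E1 := dX_der ind gen; have e2 : der iota E2 := dZ_der ind gen.
have EJ : jacobian E1 E2 s t * jacobian D1 D2 xi eta = 1 := jac_dual ind gen dd.
have AE E : der iota E -> A (E xi) -> A (E eta) -> forall U V, ~ N (ev2 xi eta V) ->
    A (ev2 xi eta U / ev2 xi eta V) /\ A (E (ev2 xi eta U / ev2 xi eta V)).
  move=> dE Exi Eeta U V nV; have AV := loc_V lA (A2 V) nV; split; first exact: (subr_M sA).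
  have V0 := loc_neq0 lA nV; rewrite (der_div dE) //; apply: (subr_M sA) => //.
  apply: (subr_B sA); first exact: (der_ev2 _ lA).
  by apply: (subr_M sA); [exact: (subr_M sA)|exact: (der_ev2 _ lA)].
have [A0 A11] := (subr_0 sA, subr_1 sA).
have [E1x E1e] : A (E1 xi) /\ A (E1 eta) by rewrite /E1 dXx dXz.
have [E2x E2e] : A (E2 xi) /\ A (E2 eta) by rewrite /E2 dZx dZz.
have [U [V [nV Es]]] := equation_frac Ns; have [U' [V' [nV' Et]]] := equation_frac Nt.
have [As A1s] := AE E1 e1 E1x E1e U V nV; have [_ A2s] := AE E2 e2 E2x E2e U V nV.
have [At A1t] := AE E1 e1 E1x E1e U' V' nV'; have [_ A2t] := AE E2 e2 E2x E2e U' V' nV'.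
move: (ev2 xi eta U / _) Es As A1s A2s => s' Es As A1s A2s.
move: (ev2 xi eta U' / _) Et At A1t A2t => t' Et At A1t A2t.
have Ap1 : A (E1 (ev2 xi eta P0)) by exact: (der_ev2 _ lA).
have Ap2 : A (E2 (ev2 xi eta P0)) by exact: (der_ev2 _ lA).
have Ap : A (ev2 xi eta P0) by [].
pose p := ev2 xi eta P0; rewrite -/p in Ap1 Ap2 Ap Es Et *.
exists (s' * (E1 p * E2 t' - E2 p * E1 t') + t' * (E2 p * E1 s' - E1 p * E2 s')
        + p * (E1 s' * E2 t' - E1 t' * E2 s')); split.
  repeat (first [assumption|apply: (subr_B sA)|apply: (subr_D sA)|apply: (subr_M sA)]).
rewrite -EJ; congr (_ * _); rewrite /jacobian Es Et !(der_M e1) !(der_M e2); ring.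
Qed.
End NormalForm.
End Indeterminacy.

(** * Powers of the Jacobian at a point of X *)

Section PointBounds.
Variables (k : closedFieldType) (K : fieldType) (iota : {rmorphism k -> K}).
Local Notation ev1 := (@ev1 k K iota).
Local Notation ev2 := (@ev2 k K iota).
Local Notation coords := (@coords k K iota).
Local Notation minimal_system := (@minimal_system k K iota).
Variable f : seq K.
Hypothesis f0 : exists2 v, v \in f & v != 0.
Hypothesis fgen : forall v, v \in f -> v != 0 -> generates iota [seq u / v | u <- f].
Variables (cs : seq (seq K)) (a : point iota cs).
Hypothesis ga : generates iota (chart a).
Hypothesis reg : regular_point2 a.
Local Notation O := (stalk a).
Local Notation M := (maximal_ideal a).
Let lO : local_ring iota O M := stalk_local a.
Let sO : subring iota O := stalk_sub a.
Variables (s t : K) (D1 D2 : K -> K).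
Hypothesis st : forall h, M h <-> exists u v, [/\ O u, O v & h = u * s + v * t].
Hypothesis dd : dual_ders iota D1 D2 s t.
Hypothesis pres : forall h, O h -> O (D1 h) /\ O (D2 h).
Variable g : K.
Hypothesis gf : g \in f.
Hypothesis g0 : g != 0.
Hypothesis vg : forall h, h \in f -> O (h / g).
Local Notation jac := (jacobian D1 D2).
Let d1 : der iota D1. Proof. by case: dd. Qed.
Let d2 : der iota D2. Proof. by case: dd. Qed.

Lemma jac_neq0 x z : coords x z -> jac x z != 0.
Proof.
move=> C; have := jac_dual (coords_indep C) (proj2 C) dd.
by move/eqP; apply: contraTneq => ->; rewrite mulr0 eq_sym oner_neq0.
Qed.

Lemma stalk_bound x z lam (m N : nat) : coords x z -> lam != 0 ->
  (forall v, dval iota v -> (forall h, nn v h -> nn v (D1 h)) -> (forall h, nn v h -> nn v (D2 h)) ->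
     (forall h, O h -> nn v h) -> v (lam * g) *+ m <= v (jac x z) *+ N) ->
  O (jac x z ^+ N / (lam * g) ^+ m).
Proof.
move=> C l0 H; have J0 := jac_neq0 C; have lg0 : lam * g != 0 by rewrite mulf_neq0.
apply: (stalk_valuations (coords_indep C) (proj2 C) ga reg).
  by rewrite mulf_neq0 ?invr_eq0 ?expf_neq0.
move=> v [dv Ov Dv]; rewrite (val_div dv) ?expf_neq0 // !(val_X dv) // !mulr_natl subr_ge0.
apply: H => // h nh; apply: Dv => // h' /pres [] //.
Qed.

Lemma stalk_fiber x z e n b lam : minimal_system f x z e n b lam -> O x ->
  O (jac x z ^+ n / (lam * g) ^+ 2).
Proof.
move=> min Ox; have C := minimal_coords min; have [[_ l0 _] _] := min.
apply: stalk_bound => // v dv n1 n2 Ov; apply: (val_fiber f0 fgen gf g0 dv d1 d2 n1 n2 (fun h hf => Ov _ (vg hf)) min); auto.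
exact: jac_neq0.
Qed.

Lemma stalk_ruled x z e n b lam : minimal_system f x z e n b lam -> (n * (e + 2) <= 2 * b)%N ->
  O (jac x z ^+ n / (lam * g) ^+ 2).
Proof.
move=> min le; have C := minimal_coords min; have [[_ l0 _] _] := min.
apply: stalk_bound => // v dv n1 n2 Ov; apply: (val_ruled f0 fgen gf g0 dv d1 d2 n1 n2 (fun h hf => Ov _ (vg hf)) min le); auto.
exact: jac_neq0.
Qed.

Lemma stalk_plane x z n b lam : minimal_system f x z 1 n b lam -> (2 * b <= 3 * n)%N ->
  O (jac x z ^+ b / (lam * g) ^+ 3).
Proof.
move=> min le; have C := minimal_coords min; have [[_ l0 _] _] := min.
apply: stalk_bound => // v dv n1 n2 Ov; apply: (val_plane f0 fgen gf g0 dv d1 d2 n1 n2 (fun h hf => Ov _ (vg hf)) min le); auto.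
exact: jac_neq0.
Qed.

Section Valuation.
Variables (A N : K -> Prop).
Hypothesis vA : valuation_ring iota A N.
Hypothesis OA : forall h, O h -> A h.
Hypothesis MN : forall h, M h -> N h.
Let lA : local_ring iota A N. Proof. by case: vA. Qed.
Let sA := loc_sub lA.

Lemma exceptional_jac xi eta : coords xi eta -> A xi -> A eta ->
  (forall q, q != 0 -> ~ N (ev1 xi q)) ->
  exists w p, [/\ A w, N p & p * w * jac xi eta = 1].
Proof.
move=> C Ax Ae unit1; have s0 := param_neq0 (coords_indep C) (proj2 C) ga st.
have Ns : N s by apply: MN; exact: (param_s st).
have [P [Q [Q0 E]]] := coords_frac C s.
have NP : N (ev2 xi eta P).
  by rewrite -[ev2 _ _ P](divfK Q0) -E; apply: (loc_Mr lA) => //; exact: (ev2_in lA).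
have P0 : P != 0 by apply: contraNneq s0 => P0; rewrite E P0 ev2_0 mul0r.
have [n [[P1 [P10 NP1 sP1]] minn]] := @nat_least (fun n => exists P, [/\ P != 0, N (ev2 xi eta P) &
  size P = n]) (ex_intro _ _ (ex_intro _ P (And3 P0 NP erefl))).
have [|w [Aw Ew]] := equation_jac lA C Ax Ae unit1 P10 NP1 _ dd Ns (MN (param_t st)).
  by move=> P2 P20 NP2; rewrite sP1; apply: minn; exists P2.
by exists w, (ev2 xi eta P1).
Qed.

(** Regularity of the quotient would put a power of the Jacobian into A, but [exceptional_jac] makes
    the Jacobian the inverse of an element of N. *)
Lemma no_exceptional_bound xi eta lam (m r : nat) : coords xi eta -> A xi -> A eta ->
  (forall q, q != 0 -> ~ N (ev1 xi q)) -> lam != 0 -> A (lam * g) -> (0 < m)%N ->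
  ~ O (jac xi eta ^+ m / (lam * g) ^+ r).
Proof.
move=> C Ax Ae unit1 l0 Alg m0 /OA AJ.
have lg0 : lam * g != 0 by rewrite mulf_neq0.
have {}AJ : A (jac xi eta ^+ m).
  by rewrite -[_ ^+ m](divfK (expf_neq0 r lg0)); apply: (subr_M sA) => //; exact: (subr_X sA).
have [w [p [Aw Np E]]] := exceptional_jac C Ax Ae unit1.
apply: (loc_1 lA); rewrite -(expr1n K m) -E exprMn; apply: (loc_Mr lA) => //.
rewrite -(prednK m0); apply: (loc_XM lA); first exact: (subr_M sA (loc_R lA Np)).
exact: (loc_Mr lA).
Qed.
End Valuation.

(** The condition that h defines a map to the projective line at the point. *)
Definition ratio h := O h \/ O h^-1.

Lemma ratioP y : (forall A N, valuation_ring iota A N -> (forall h, O h -> A h) ->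
  (forall h, M h -> N h) -> A y -> (forall q, q != 0 -> ~ N (ev1 y q)) -> False) ->
  (exists x z, coords x z) -> ratio y.
Proof.
move=> H [x [z C]]; apply: NNPP => /not_or_and [ny nyV].
by have [A [N [vA dA dN Ay unit1]]] := indeterminate_valuation C ga reg ny nyV; exact: (H A N).
Qed.

Lemma system_val x z e n b lam (A N : K -> Prop) : minimal_system f x z e n b lam ->
  local_ring iota A N -> A x -> A z -> A (lam * g).
Proof. by move=> [[_ _ H] _] lA Ax Az; have [P [_ ->]] := H g gf; exact: (ev2_in lA). Qed.

(** If z were indeterminate, the valuation ring with transcendental residue of z would also contain
    x, and [stalk_fiber] would contradict [no_exceptional_bound] for the coordinates (z, x). *)
Lemma map_snd x z e n b lam : minimal_system f x z e n b lam -> O x -> ratio z.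
Proof.
move=> min Ox; have C := minimal_coords min; have [[_ l0 _] _] := min.
apply: ratioP; last by exists x, z.
move=> A N vA OA MN Az unit1; have [lA _] := vA.
apply: (no_exceptional_bound vA OA MN (coords_swap C) Az (OA _ Ox) unit1 l0 _ (minimal_n0 f0 fgen min) (r := 2)).
  by apply: (system_val min lA) => //; exact: OA.
by rewrite (jac_swap D1 D2 x z) exprNn -mulrA; apply: (subr_M sO); [apply/(subr_X sO)/(subr_N sO)/(subr_1 sO)|exact: (stalk_fiber min Ox)].
Qed.

Lemma jac_invE x z (m : nat) : z != 0 -> jac x z^-1 ^+ m = (-1) ^+ m * jac x z ^+ m * z^-1 ^+ (2 * m).
Proof.
move=> z0; rewrite (jac_inv d1 d2) // exprM -!exprMn; congr (_ ^+ _).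
by field.
Qed.

Lemma system_flip x z e n b lam (A N : K -> Prop) : minimal_system f x z e n b lam ->
  local_ring iota A N -> A x -> A z^-1 -> A (lam * z^-1 ^+ n * g).
Proof.
move=> min lA Ax Ay; have [[C _ H] _] := min; have [P [DP E]] := H g gf.
have -> : lam * z^-1 ^+ n * g = ev2 x z^-1 (flip n P).
  rewrite ev2_flip ?(coords_z0 C) -?E; [ring|by []|].
  apply/leq_sizeP => j nj; apply/polyP => i; rewrite coef0; apply/eqP; apply: contraT => /DP [].
  by move: nj; lia.
exact: (ev2_in lA).
Qed.

(** The valuation ring contains z or 1/z. In the second case the system is rewritten in 1/z, which
    changes J^n / (lam g)^2 by a sign at most. *)
Lemma map_fst x z e n b lam : minimal_system f x z e n b lam -> (n * (e + 2) <= 2 * b)%N -> ratio x.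
Proof.
move=> min le; have C := minimal_coords min; have [[_ l0 _] _] := min; have z0 := coords_z0 C.
apply: ratioP; last by exists x, z.
move=> A N vA OA MN Ax unit1; have [lA ror] := vA; have sA := loc_sub lA.
have n0 := minimal_n0 f0 fgen min; have phi := stalk_ruled min le.
case: (ror z) => [Az|Ny].
  exact: (no_exceptional_bound vA OA MN C Ax Az unit1 l0 (system_val min lA Ax Az) n0 phi).
have l'0 : lam * z^-1 ^+ n != 0 by rewrite mulf_neq0 ?expf_neq0 ?invr_eq0.
have Ay := loc_R lA Ny.
apply: (no_exceptional_bound vA OA MN (coords_inv2 C) Ax Ay unit1 l'0 (system_flip min lA Ax Ay) n0 (r := 2)).
have -> : jac x z^-1 ^+ n / (lam * z^-1 ^+ n * g) ^+ 2 = (-1) ^+ n * (jac x z ^+ n / (lam * g) ^+ 2).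
  rewrite jac_invE // mulrAC -[in LHS](mulrA lam) [_ ^+ n * g]mulrC mulrA exprMn -exprM mulnC.
  have : z^-1 ^+ (2 * n) != 0 by rewrite expf_neq0 ?invr_eq0.
  by move: (z^-1 ^+ _) => Y Y0; field; rewrite Y0 g0 l0.
by apply: (subr_M sO) => //; apply/(subr_X sO)/(subr_N sO)/(subr_1 sO).
Qed.

(* When z is infinite, 1/z is the equation of the exceptional curve.           *)
Lemma map_fst_plane x z n b lam : minimal_system f x z 1 n b lam -> (2 * b <= 3 * n)%N -> (n < b)%N -> ratio x.
Proof.
move=> min le nb; have C := minimal_coords min; have [[_ l0 _] _] := min; have z0 := coords_z0 C.
apply: ratioP; last by exists x, z.
move=> A N vA OA MN Ax unit1; have [lA ror] := vA; have sA := loc_sub lA.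
have phi := stalk_plane min le.
have b0 : (0 < b)%N := leq_ltn_trans (leq0n n) nb.
case: (ror z) => [Az|Ny].
  exact: (no_exceptional_bound vA OA MN C Ax Az unit1 l0 (system_val min lA Ax Az) b0 phi).
have Ay := loc_R lA Ny; have Alg := system_flip min lA Ax Ay.
have Ns : N s by apply: MN; exact: (param_s st).
have Nt : N t by apply: MN; exact: (param_t st).
have X0 : 'X != 0 :> {poly {poly k}} by rewrite polyX_eq0.
have NX : N (ev2 x z^-1 'X) by rewrite ev2X.
have [|w [Aw]] := equation_jac lA (coords_inv2 C) Ax Ay unit1 X0 NX _ dd Ns Nt.
  move=> P P0 NP; rewrite size_polyX ltnNge; apply/negP => /size1_polyC EP.
  by move: NP; rewrite EP ev2C; apply: unit1; rewrite -polyC_eq0 -EP.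
rewrite ev2X => Ew; apply: (loc_1 lA).
pose y := z^-1; rewrite -/y in Ew Ny Ay Alg.
have y0 : y != 0 by rewrite invr_eq0.
(* Rewriting in y = 1/z leaves the factor y^(3b - 3n), whose exponent is positive because n < b; so
   1 would lie in N. *)
have -> : 1 = (-1) ^+ b * (jac x z ^+ b / (lam * g) ^+ 3) * (lam * y ^+ n * g) ^+ 3 * w ^+ b * y ^+ (3 * b - 3 * n).
  have E1 : 1 = (y * w) ^+ b * jac x y ^+ b by rewrite -exprMn Ew expr1n.
  rewrite [LHS]E1 exprMn (jac_invE _ b z0) -/y.
  have E : y ^+ b * y ^+ (2 * b) = (y ^+ n) ^+ 3 * y ^+ (3 * b - 3 * n).
    by rewrite -exprM -!exprD; congr (_ ^+ _); lia.
  transitivity ((-1) ^+ b * jac x z ^+ b * w ^+ b * (y ^+ b * y ^+ (2 * b))); first by ring.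
  by rewrite E; field; rewrite g0 l0.
apply: (loc_Ml lA); last first.
  have -> : (3 * b - 3 * n = (3 * b - 3 * n).-1.+1)%N by lia.
  exact: (loc_XM lA).
apply: (subr_M sA); last exact: (subr_X sA).
apply: (subr_M sA); last exact: (subr_X sA).
apply: (subr_M sA); last exact: OA.
by apply/(subr_X sA)/(subr_N sA)/(subr_1 sA).
Qed.
End PointBounds.

(** * Regular maps to ruled surfaces and to the plane *)
Section AffinePlane.
Variables (k : closedFieldType) (K : fieldType) (iota : {rmorphism k -> K}).
Local Notation ev1 := (@ev1 k K iota).
Local Notation ev2 := (@ev2 k K iota).
Local Notation coords := (@coords k K iota).
Variables xi eta : K.
Variables (cs : seq (seq K)) (p : point iota cs).
Hypothesis Ep : chart p = [:: xi; eta].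
Let lp : local_ring iota (stalk p) (maximal_ideal p) := stalk_local p.
Let sp := loc_sub lp.

Lemma plane_stalkP : [/\ stalk p xi, stalk p eta & forall h, stalk p h ->
  exists P Q, ~ maximal_ideal p (ev2 xi eta Q) /\ h = ev2 xi eta P / ev2 xi eta Q].
Proof.
case: (p) Ep => g gin c H /= Eg; move: gin c H; rewrite Eg => gin c H.
set q := Point _ _; split.
- exact: (chart_stalk q (ord0 : 'I_2)).
- exact: (chart_stalk q (lift ord0 ord0 : 'I_2)).
move=> h [P [Q [Q0 ->]]]; exists (poly_of_mpoly P), (poly_of_mpoly Q).
rewrite -!evalK_ev2; split=> // MQ.
have E : evalK iota Q = evalK iota Q / evalK iota (1 : {mpoly k[size (chart q)]}).
  by rewrite evalK1 divr1.
rewrite E in MQ; move/eqP: Q0; apply; apply: (maximal_idealP (a := q) _ MQ).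
by rewrite meval1 oner_neq0.
Qed.

Lemma plane_der (D : K -> K) : der iota D -> stalk p (D xi) -> stalk p (D eta) ->
  forall h, stalk p h -> stalk p (D h).
Proof.
move=> dD Dx De h; have [px pe H] := plane_stalkP => /H [P [Q [nQ ->]]].
have Q0 := loc_neq0 lp nQ; have A2 R : stalk p (ev2 xi eta R) by exact: (ev2_in lp).
have AD R : stalk p (D (ev2 xi eta R)) by exact: (der_ev2 _ lp).
have AV := loc_V lp (A2 Q) nQ.
rewrite (der_div dD) //; apply: (subr_M sp) => //; apply: (subr_B sp) => //.
by apply: (subr_M sp) => //; exact: (subr_M sp).
Qed.

(** By the chain rule the inverse is the Jacobian of s, t for the partial derivatives in xi and eta,
    which preserve O_p. *)
Lemma plane_jac s t D1 D2 : coords xi eta -> dual_ders iota D1 D2 s t -> stalk p s -> stalk p t ->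
  stalk p (jacobian D1 D2 xi eta)^-1.
Proof.
move=> C dd ps pt; have ind := coords_indep C; have gen := proj2 C.
have E := jac_dual ind gen dd.
have J0 : jacobian D1 D2 xi eta != 0 by apply: contraTneq (oner_neq0 K) => J0; rewrite -E J0 mulr0 eqxx.
have -> : (jacobian D1 D2 xi eta)^-1 = jacobian (dX ind gen) (dZ ind gen) s t.
  by apply: (mulIf J0); rewrite mulVf.
have [p0 p1] := (subr_0 sp, subr_1 sp).
have pX h : stalk p h -> stalk p (dX ind gen h).
  by apply: plane_der; [exact: dX_der|rewrite dXx|rewrite dXz].
have pZ h : stalk p h -> stalk p (dZ ind gen h).
  by apply: plane_der; [exact: dZ_der|rewrite dZx|rewrite dZz].
by apply: (subr_B sp); apply: (subr_M sp); auto.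
Qed.
End AffinePlane.

Lemma chart1 (k : closedFieldType) (K : fieldType) (iota : {rmorphism k -> K}) g (p : point iota [:: g]) :
  chart p = g.
Proof. by apply/eqP; have := chart_in p; rewrite inE. Qed.

Section SurfaceModel.
Variables (k : closedFieldType) (X : variety k).
Local Notation K := (function_field X).
Local Notation iota := (scalar X).
Local Notation ev1 := (@ev1 k K iota).
Local Notation ev2 := (@ev2 k K iota).
Local Notation coords := (@coords k K iota).

Definition parameters (a : pt X) s t D1 D2 :=
  [/\ forall h, maximal_ideal a h <-> exists u v, [/\ stalk a u, stalk a v & h = u * s + v * t],
      dual_ders iota D1 D2 s t & forall h, stalk a h -> stalk a (D1 h) /\ stalk a (D2 h)].

Lemma parameters_ex x z (a : pt X) : coords x z -> regular_point2 a -> exists s t D1 D2, parameters a s t D1 D2.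
Proof.
move=> C [s [t st]]; have ga := charts_generate (chart_in a).
have [D1 [D2 [dd pres]]] := param_ders (coords_indep C) (proj2 C) ga st.
by exists s, t, D1, D2.
Qed.

(* O_p is unramified over the local ring of some point of X.                   *)
Definition etale_at xi eta (p : point iota [:: [:: xi; eta]]) := exists a : pt X,
  [/\ forall h, stalk a h -> stalk p h, forall h, maximal_ideal a h -> maximal_ideal p h &
      forall s t D1 D2, parameters a s t D1 D2 -> stalk p (jacobian D1 D2 xi eta)].

Definition maps_to_ruled x z e := forall a : pt X,
  [/\ ratio a x, stalk a x -> ratio a z & stalk a x^-1 -> ratio a (z / x ^+ e)].

Definition maps_to_plane x z := forall a : pt X,
  [\/ stalk a x /\ stalk a z, stalk a x^-1 /\ stalk a (z / x) | stalk a z^-1 /\ stalk a (x / z)].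

(** The first two charts miss only one point of the plane, the origin of the third. *)
Definition etale_plane x z :=
  [/\ forall p : point iota [:: [:: x; z]], etale_at p,
      forall p : point iota [:: [:: x^-1; z / x]], etale_at p &
      forall p : point iota [:: [:: z^-1; x / z]], maximal_ideal p z^-1 -> maximal_ideal p (x / z) -> etale_at p].

(** Composition with the contraction of the negative section of F_1: where z, or z / x over x =
    infinity, has regular inverse, the third chart takes over. *)
Lemma plane_of_ratio x z : coords x z -> (forall a : pt X, [/\ ratio a x, stalk a x -> ratio a z &
  stalk a x^-1 -> ratio a (z / x)]) -> maps_to_plane x z.
Proof.
move=> C H a; have x0 := coords_x0 C; have z0 := coords_z0 C; have sO := stalk_sub a.
have [[Ox|Ox] H1 H2] := H a.
  have [Oz|Oz] := H1 Ox; first by constructor 1.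
  by constructor 3; split=> //; exact: (subr_M sO).
have [Oz|Oz] := H2 Ox; first by constructor 2.
rewrite invf_div in Oz; constructor 3; split=> //.
have -> : z^-1 = x^-1 * (x / z) by rewrite mulrA mulVf ?mul1r.
exact: (subr_M sO).
Qed.

Hypothesis smX : smooth_projective_surface X.
Variable f : seq K.
Hypothesis f0 : exists2 v, v \in f & v != 0.
Hypothesis same : same_points iota (charts X) (proj_charts f).
Hypothesis C0 : exists x z, coords x z.

Lemma embedding_generates v : v \in f -> v != 0 -> generates iota [seq u / v | u <- f].
Proof.
move=> vf v0; set g := [seq _ | _ <- _]; have [x [z C]] := C0.
have gf : g \in proj_charts f by apply/mapP; exists v; rewrite ?mem_filter ?v0.
have [[g' gin c H]] := point_exists (coords_indep C) (proj2 C) (mem_head g [::]).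
have Eg : g' = g by apply/eqP; move: gin; rewrite inE.
move: c H; rewrite Eg => c H.
pose b : point iota (proj_charts f) := Point gf H.
have [_ H'] := same; have [a sa] := H' b.
move=> h; have [u [w [Ou Ow w0 ->]]] := stalk_frac (charts_generate (chart_in a)) h.
have [P [Q [Q0 Eu]]] := proj1 (sa u) Ou.
have [P' [Q' [Q'0 Ew]]] := proj1 (sa w) Ow.
have Qn := evalK_neq0 (a := b) Q0; have Q'n := evalK_neq0 (a := b) Q'0.
have P'n : evalK iota P' != 0 by apply: contraNneq w0 => E; rewrite Ew E mul0r.
exists (P * Q'), (Q * P'); rewrite !evalKM mulf_neq0 //; split=> //.
by rewrite Eu Ew; field; rewrite Qn P'n Q'n.
Qed.

Lemma embedding_at (a : pt X) : exists g, [/\ g \in f, g != 0 & forall h, h \in f -> stalk a (h / g)].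
Proof.
have [H _] := same; have [b sb] := H a.
have /mapP [g] := chart_in b; rewrite mem_filter => /andP [g0 gf] E.
exists g; split=> // h hf; apply/sb.
have hg : h / g \in chart b by rewrite E; apply/mapP; exists h.
have lt : (index (h / g) (chart b) < size (chart b))%N by rewrite index_mem.
by have := chart_stalk b (Ordinal lt); rewrite /= nth_index.
Qed.

Section Etale.
Variables (x z : K) (n b : nat) (lam : K).
Hypothesis min : minimal_system iota f x z 1 n b lam.
Hypothesis le : (2 * b <= 3 * n)%N.
Hypothesis nb : n = b.

(** The quotients of the f by h0 are regular at p, so p lies over a point a of X. By [stalk_plane]
    at a, the power J^b is regular at p; 1/J is regular at p by [plane_jac]; and J = J^b
    (1/J)^(b-1). *)
Lemma etale_of_unit xi eta lam' h0 (p : point iota [:: [:: xi; eta]]) : coords xi eta -> h0 \in f ->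
  (forall h, h \in f -> stalk p (lam' * h)) -> ~ maximal_ideal p (lam' * h0) ->
  (forall D1 D2, der iota D1 -> der iota D2 ->
    jacobian D1 D2 xi eta ^+ b / (lam' * h0) ^+ 3 = jacobian D1 D2 x z ^+ b / (lam * h0) ^+ 3) ->
  etale_at p.
Proof.
move=> C' hf pf nM EJ; have lp := stalk_local p; have sp := loc_sub lp.
have lh0 := loc_neq0 lp nM.
have l'0 : lam' != 0 by apply: contraNneq lh0 => ->; rewrite mul0r.
have h00 : h0 != 0 by apply: contraNneq lh0 => ->; rewrite mulr0.
have pV : stalk p (lam' * h0)^-1 by apply: (loc_V lp) => //; exact: pf.
pose g := [seq u / h0 | u <- f].
have gf : g \in proj_charts f by apply/mapP; exists h0; rewrite ?mem_filter ?h00.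
have pg h : h \in g -> stalk p h.
  move=> /mapP [u uf ->]; have -> : u / h0 = lam' * u * (lam' * h0)^-1.
    by field; rewrite h00 l'0.
  by apply: (subr_M sp) => //; exact: pf.
have [a' [sa' ma' ra']] := center lp (@stalk_residue _ _ _ _ p) gf pg.
have [_ H'] := same; have [a sa] := H' a'.
have aM h : maximal_ideal a h -> maximal_ideal p h.
  move=> Mh; have la := stalk_local a; apply: ma'; have la' := stalk_local a'.
  apply: NNPP => nM'; have hO : stalk a' h by apply/sa; exact: (loc_R la).
  have := loc_V la' hO nM' => /sa Ov; apply: (loc_unit la (loc_R la Mh) Ov) => //.
  exact: (loc_neq0 la').
exists a; split=> [h /sa /sa' //|//|s t D1 D2 [st dd pres]].
have ag h : h \in f -> stalk a (h / h0).
  move=> hf'; apply/sa; have hg : h / h0 \in g by apply/mapP; exists h.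
  have lt : (index (h / h0) g < size g)%N by rewrite index_mem.
  have := ra' 'X_(Ordinal lt) 1; rewrite evalKX evalK1 divr1 /= nth_index //; apply; first exact: oner_neq0.
  by rewrite invr1; exact: (subr_1 sp).
have [d1 d2 _ _] := dd.
have fgen := embedding_generates.
have [_ _ reg] := smX.
have phi := stalk_plane f0 fgen (charts_generate (chart_in a)) (reg a) dd pres hf h00 ag min le.
have pJb : stalk p (jacobian D1 D2 xi eta ^+ b).
  rewrite -[_ ^+ b](divfK (expf_neq0 3 lh0)) EJ //; apply: (subr_M sp); first by apply/sa'/sa.
  by apply: (subr_X sp); exact: pf.
have [Ms Mt] : stalk a s /\ stalk a t by have la := stalk_local a; split; apply: (loc_R la); [exact: (param_s st)|exact: (param_t st)].
have pV' : stalk p (jacobian D1 D2 xi eta)^-1.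
  by apply: (plane_jac (chart1 p) C' dd); apply/sa'/sa.
have b0 : (0 < b)%N by rewrite -nb; exact: (minimal_n0 f0 fgen min).
have J0 : jacobian D1 D2 xi eta != 0.
  exact: (jac_neq0 dd C').
have -> : jacobian D1 D2 xi eta = jacobian D1 D2 xi eta ^+ b * (jacobian D1 D2 xi eta)^-1 ^+ b.-1.
  by case: (b) b0 => // m _; rewrite exprS exprVn -mulrA divff ?mulr1 ?expf_neq0.
by apply: (subr_M sp) => //; exact: (subr_X sp).
Qed.

(** For n = b the multiplicity bound b - n is 0: some member does not vanish at p. *)
Lemma etale_fst (p : point iota [:: [:: x; z]]) : etale_at p.
Proof.
have C := minimal_coords min; have [[_ l0 H] _] := min; have fgen := embedding_generates.
have lp := stalk_local p; have sp := loc_sub lp; have [px pz _] := plane_stalkP (chart1 p).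
have [c Mc] := stalk_residue p px; have [d Md] := stalk_residue p pz.
have [h [P [i [j [hf E Pa]]]]] := minimal_mult_plane f0 fgen min c d erefl.
rewrite nb subnn leqn0 addn_eq0 => /andP [/eqP i0 /eqP j0]; rewrite i0 j0 in Pa.
apply: (etale_of_unit (lam' := lam) C hf) => // [h' /H [P' [_ ->]]|]; first exact: (ev2_in lp).
move=> Mh; have := loc_B lp Mh (ev2_snd P lp (loc_R lp Mc) Md); rewrite E subKr.
move=> Mh'; have := loc_B lp Mh' (ev1_const lp P`_0 (loc_R lp Mc) Mc); rewrite subKr.
exact: (loc_c lp).
Qed.

(** A member containing z^n has nonzero constant term at this point, as n = b. *)
Lemma etale_inf (p : point iota [:: [:: z^-1; x / z]]) :
  maximal_ideal p z^-1 -> maximal_ideal p (x / z) -> etale_at p.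
Proof.
move=> My Mu; have C := minimal_coords min; have [[_ l0 H] _] := min; have fgen := embedding_generates.
have x0 := coords_x0 C; have z0 := coords_z0 C.
have lp := stalk_local p; have sp := loc_sub lp.
have C' : coords z^-1 (x / z) by apply/coords_inv/coords_div/coords_swap.
have [h [P [hf E DP Pn]]] := minimal_top f0 fgen min.
have El h' P' : supp (polygon 1 n b) P' -> lam * h' = ev2 x z P' ->
    lam * z^-1 ^+ b * h' = ev2 z^-1 (x / z) (plane_flip b P').
  by move=> DP' E'; rewrite (@ev2_plane_flip _ _ _ n b x z P' z0 DP') -E'; ring.
apply: (etale_of_unit (lam' := lam * z^-1 ^+ b) C' hf) => [h' /H [P' [DP' E']]||D1 D2 d1 d2].
- by rewrite (El _ _ DP' E'); apply: (ev2_in lp); exact: (loc_R lp).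
- rewrite (El _ _ DP E) => Mh.
  have := loc_B lp Mh (ev2_snd (plane_flip b P) lp (loc_R lp My) Mu); rewrite subKr.
  move=> Mh'; have := loc_B lp Mh' (ev1_const lp (plane_flip b P)`_0 (loc_R lp My) My); rewrite subKr.
  apply: (loc_c lp).
  rewrite coef_poly /= coef_poly /= ?addn0 ?leq0n !subn0.
  have [a Pa] : exists a, P`_n`_a != 0 by exists (size P`_n).-1; rewrite -lead_coefE lead_coef_eq0.
  have [_] := DP a n Pa; rewrite mul1n => le'; have a0 : a = 0%N by move: nb; lia.
  by rewrite -nb; rewrite a0 in Pa.
have -> : jacobian D1 D2 z^-1 (x / z) = jacobian D1 D2 x z * z^-1 ^+ 3.
  by rewrite (jac_mul d1 d2) jac_swap (jac_inv d1 d2) //; field.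
have [v vf v0] := f0.
have h00 : h != 0.
  apply: contraNneq Pn => h0; have := E; rewrite h0 mulr0 => /esym /(proj1 C) ->; by rewrite coef0.
have : z^-1 ^+ b != 0 by rewrite expf_neq0 ?invr_eq0.
have : (z^-1 ^+ 3) ^+ b = (z^-1 ^+ b) ^+ 3 by rewrite -!exprM mulnC.
by move: (z^-1 ^+ 3) (z^-1 ^+ b) => Y3 Y EY Y0; rewrite exprMn EY; field; rewrite Y0 h00 l0.
Qed.
End Etale.

(** If n(e+2) <= 2b, the map to F_e is regular; for e = 1 it is followed by the contraction to the
    plane. Otherwise [minimal_b] and [minimal_e0] leave e = 1 and 2b < 3n. Then for n < b the map to
    F_1 is still regular, and for n = b the plane is unramified over X. *)
Lemma surface_model_embedded : [\/ exists x z e, [/\ coords x z, e <> 1%N & maps_to_ruled x z e],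
  exists x z, coords x z /\ maps_to_plane x z | exists x z, coords x z /\ etale_plane x z].
Proof.
have fgen := embedding_generates; have [_ _ reg] := smX.
have [x [z [e [n [b [lam min]]]]]] := minimal_ex f0 fgen C0.
have C := minimal_coords min; have x0 := coords_x0 C; have z0 := coords_z0 C.
have snd (a : pt X) x' z' lam' : minimal_system iota f x' z' e n b lam' -> stalk a x' -> ratio a z'.
  move=> min' Ox; have [g [gf g0 vg]] := embedding_at a.
  have [s [t [D1 [D2 [st dd pres]]]]] := parameters_ex C (reg a).
  exact: (map_snd f0 fgen (charts_generate (chart_in a)) (reg a) st dd pres gf g0 vg min' Ox).
have all (a : pt X) : ratio a x -> [/\ ratio a x, stalk a x -> ratio a z & stalk a x^-1 -> ratio a (z / x ^+ e)].
  by move=> rx; split=> //; [exact: (snd a _ _ _ min)|exact: (snd a _ _ _ (minimal_inv min))].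
have [le|lt] := leqP (n * (e + 2)) (2 * b).
  have fst (a : pt X) : ratio a x.
    have [g [gf g0 vg]] := embedding_at a.
    have [s [t [D1 [D2 [st dd pres]]]]] := parameters_ex C (reg a).
    exact: (map_fst f0 fgen (charts_generate (chart_in a)) (reg a) st dd pres gf g0 vg min le).
  have [e1|e1] := eqVneq e 1%N; last first.
    by constructor 1; exists x, z, e; split=> [//||a]; [exact/eqP|exact: all].
  constructor 2; exists x, z; split=> //; apply: plane_of_ratio => // a.
  by have := all a (fst a); rewrite e1 expr1.
have bn := minimal_b f0 fgen min; have n0 := minimal_n0 f0 fgen min.
have e1 : e = 1%N.
  case: e min lt bn all snd => [|[|e]] // min lt bn _ _; last by nia.
  by have := minimal_e0 f0 fgen min erefl; lia.
have le : (2 * b <= 3 * n)%N by move: lt; rewrite e1; lia.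
rewrite e1 in min all snd bn.
have [nb|nb] := eqVneq n b.
  constructor 3; exists x, z; split=> //; split.
  - exact: (etale_fst min le nb).
  - by have := minimal_inv min; rewrite expr1 => min'; exact: (etale_fst min' le nb).
  - exact: (etale_inf min le nb).
constructor 2; exists x, z; split=> //; apply: plane_of_ratio => // a.
have nb' : (n < b)%N by rewrite ltn_neqAle nb -(mul1n n).
have [g [gf g0 vg]] := embedding_at a.
have [s [t [D1 [D2 [st dd pres]]]]] := parameters_ex C (reg a).
have := all a (map_fst_plane f0 fgen (charts_generate (chart_in a)) (reg a) st dd pres gf g0 vg min le nb').
by rewrite expr1.
Qed.
End SurfaceModel.

Lemma surface_model (k : closedFieldType) (X : variety k) :
  smooth_projective_surface X -> rational X ->
  [\/ exists x z e, [/\ coords (scalar X) x z, e <> 1%N & maps_to_ruled x z e],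
      exists x z, coords (scalar X) x z /\ maps_to_plane x z |
      exists x z, coords (scalar X) x z /\ etale_plane x z].
Proof.
move=> smX rX; have [[f [/hasP [v vf v0] same]] _ _] := smX.
have [x [z [ind gen]]] := surface_coordinates smX rX.
apply: (surface_model_embedded smX (f := f)) => //; first by exists v.
by exists x, z; exact: indep_coords.
Qed.

(** * Birational maps given by coordinates *)

Section Comorphism.
Variables (k : closedFieldType) (K1 K2 : fieldType).
Variables (i1 : {rmorphism k -> K1}) (i2 : {rmorphism k -> K2}) (x1 z1 : K1) (x2 z2 : K2).
Hypothesis C1 : coords i1 x1 z1.
Hypothesis C2 : coords i2 x2 z2.
Local Notation e1 := (ev2 i1 x1 z1).
Local Notation e2 := (ev2 i2 x2 z2).

Let e10 P : P != 0 -> e1 P != 0.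
Proof. by apply: contra_neq => /(proj1 C1). Qed.
Let e20 P : P != 0 -> e2 P != 0.
Proof. by apply: contra_neq => /(proj1 C2). Qed.

Let graph (h : K1) (w : K2) := exists P Q, [/\ Q != 0, h = e1 P / e1 Q & w = e2 P / e2 Q].

Let graph_ex h : exists w, graph h w.
Proof.
have [P [Q [Q0 E]]] := coords_frac C1 h; exists (e2 P / e2 Q), P, Q; split=> //.
by apply: contraNneq Q0 => ->; rewrite ev2_0.
Qed.

Let graph_uniq h w w' : graph h w -> graph h w' -> w = w'.
Proof.
move=> [P [Q [Q0 -> ->]]] [P' [Q' [Q'0 E ->]]].
have {}E : P * Q' = P' * Q.
  apply: (coords_inj C1); rewrite !ev2M; move/eqP: E.
  by rewrite eqr_div ?e10 // => /eqP.
by apply/eqP; rewrite eqr_div ?e20 // -!ev2M E.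
Qed.

Let phi h := proj1_sig (constructive_indefinite_description _ (graph_ex h)).
Let phiP h : graph h (phi h).
Proof. exact: (proj2_sig (constructive_indefinite_description _ (graph_ex h))). Qed.
Let phiE h w : graph h w -> phi h = w.
Proof. exact: graph_uniq (phiP h). Qed.

Let phi_ev P : phi (e1 P) = e2 P.
Proof. by apply: phiE; exists P, 1; rewrite !ev2_1 !divr1 oner_neq0. Qed.

Let phi_B : zmod_morphism phi.
Proof.
move=> h h'; have [P [Q [Q0 -> ->]]] := phiP h; have [P' [Q' [Q'0 -> ->]]] := phiP h'.
apply: phiE; exists (P * Q' - P' * Q), (Q * Q'); rewrite mulf_neq0 // !ev2B !ev2M.
by split=> //; field; rewrite ?e10 ?e20.
Qed.

Let phi_M : monoid_morphism phi.
Proof.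
split; first by rewrite -(ev2_1 i1 x1 z1) phi_ev ev2_1.
move=> h h'; have [P [Q [Q0 -> ->]]] := phiP h; have [P' [Q' [Q'0 -> ->]]] := phiP h'.
apply: phiE; exists (P * P'), (Q * Q'); rewrite mulf_neq0 // !ev2M.
by split=> //; rewrite mulf_div.
Qed.

Lemma comorphism : exists f : {rmorphism K1 -> K2},
  [/\ bijective f, forall c, f (i1 c) = i2 c, f x1 = x2 & f z1 = z2].
Proof.
pose f : {rmorphism K1 -> K2} := HB.pack phi (GRing.isZmodMorphism.Build _ _ _ phi_B)
  (GRing.isMonoidMorphism.Build _ _ _ phi_M).
exists f; have Ec c : f (i1 c) = i2 c.
  by have := phi_ev c%:P%:P; rewrite !ev2C !ev1C.
split=> //; last 2 first.
- by have := phi_ev 'X%:P; rewrite !ev2C !ev1X.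
- by have := phi_ev 'X; rewrite !ev2X.
have sur w : exists h, f h == w.
  have [P [Q [Q0 ->]]] := coords_frac C2 w; exists (e1 P / e1 Q); apply/eqP.
  by apply: phiE; exists P, Q; split=> //; apply: contraNneq Q0 => ->; rewrite ev2_0.
exists (fun w => xchoose (sur w)) => [h|w]; last exact/eqP/(xchooseP (sur w)).
by apply: (fmorph_inj f); exact/eqP/(xchooseP (sur (f h))).
Qed.
End Comorphism.

(** * Equality of models *)

Section Separated.
Variables (k : closedFieldType) (K : fieldType) (iota : {rmorphism k -> K}).

Lemma center_chart (R M : K -> Prop) (cs : seq (seq K)) g : local_ring iota R M ->
  residue_k iota R M -> g \in cs -> (forall h, h \in g -> R h) ->
  exists a : point iota cs, [/\ forall h, stalk a h -> R h,
    forall h, maximal_ideal a h -> M h & forall h, h \in g -> stalk a h].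
Proof.
move=> lR res gcs Rg; have [a [sa ma H]] := center lR res gcs Rg.
exists a; split=> // h hg; have lt : (index h g < size g)%N by rewrite index_mem.
have := H 'X_(Ordinal lt) 1; rewrite evalKX evalK1 divr1 /= nth_index //.
by apply; [exact: oner_neq0|rewrite invr1; exact: (subr_1 (loc_sub lR))].
Qed.

Lemma dominated_ratio (R M R' M' : K -> Prop) u : local_ring iota R M -> local_ring iota R' M' ->
  (forall h, M' h -> M h) -> R u -> R' u \/ R' u^-1 -> R' u.
Proof.
move=> lR lR' sM Ru [//|R'u]; have [->|u0] := eqVneq u 0; first exact: (subr_0 (loc_sub lR')).
rewrite -(invrK u); apply: (loc_V lR') => // /sM Mu.
by apply: (loc_1 lR); rewrite -(mulfV u0); exact: (loc_Ml lR).
Qed.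

(** When O_a dominates O_a', the chart functions of a are regular at a'; by [stalk_eq_dominated] the
    two local rings then agree. *)
Definition separated (cs : seq (seq K)) := forall a a' : point iota cs,
  (forall h, stalk a' h -> stalk a h) -> (forall h, maximal_ideal a' h -> maximal_ideal a h) ->
  forall h, h \in chart a -> stalk a' h.

Lemma stalk_eq_dominated cs cs' (a : point iota cs) (a' : point iota cs') :
  (forall h, stalk a' h -> stalk a h) -> (forall h, maximal_ideal a' h -> maximal_ideal a h) ->
  (forall h, h \in chart a -> stalk a' h) -> forall h, stalk a h -> stalk a' h.
Proof.
move=> sa ma H; have la := stalk_local a; have la' := stalk_local a'.
apply: (proj1 (stalk_min la' _)) => i; set u := _ - _.
have Ou : stalk a' u.
  by apply: (subr_B (loc_sub la')); [apply/H/mem_nth|exact: (subr_c (loc_sub la'))].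
apply: NNPP => nM; have Mu := chart_max a i; apply: (loc_unit la (loc_R la Mu)) => //.
  by apply: sa; exact: (loc_V la').
exact: (loc_neq0 la').
Qed.

(** Centre a point of one model on the other and the result on the first again. The final point is
    dominated by the initial one, so both have the same local ring, and so does the point in
    between. *)
Lemma same_points_of cs cs' : separated cs -> separated cs' ->
  (forall a : point iota cs, exists2 g, g \in cs' & forall h, h \in g -> stalk a h) ->
  (forall b : point iota cs', exists2 g, g \in cs & forall h, h \in g -> stalk b h) ->
  same_points iota cs cs'.
Proof.
suff H (cs1 cs2 : seq (seq K)) : separated cs1 ->
  (forall a : point iota cs1, exists2 g, g \in cs2 & forall h, h \in g -> stalk a h) ->
  (forall b : point iota cs2, exists2 g, g \in cs1 & forall h, h \in g -> stalk b h) ->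
  forall a : point iota cs1, exists b : point iota cs2, forall h, stalk a h <-> stalk b h.
  move=> sep sep' H1 H2; split=> [a|b]; first exact: H.
  by have [a Ha] := H _ _ sep' H2 H1 b; exists a => h; split=> /Ha.
move=> sep H1 H2 a; have [g gin Hg] := H1 a.
have [b [sb mb _]] := center_chart (stalk_local a) (@stalk_residue _ _ _ _ a) gin Hg.
have [g' gin' Hg'] := H2 b.
have [a' [sa ma _]] := center_chart (stalk_local b) (@stalk_residue _ _ _ _ b) gin' Hg'.
exists b => h; split=> [Oh|/sb //]; apply: (sa).
have sa' h' : stalk a' h' -> stalk a h' by move=> /sa /sb.
have ma' h' : maximal_ideal a' h' -> maximal_ideal a h' by move=> /ma /mb.
exact: (stalk_eq_dominated sa' ma' (sep a a' sa' ma') Oh).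
Qed.

Lemma proj_separated f : separated (proj_charts f).
Proof.
move=> a a' sa ma h; have la := stalk_local a; have la' := stalk_local a'.
have /mapP [v] := chart_in a; rewrite mem_filter => /andP [v0 vf] Ea.
have /mapP [v'] := chart_in a'; rewrite mem_filter => /andP [v'0 v'f] Ea'.
have inchart cs (b : point iota cs) w u : chart b = [seq u / w | u <- f] -> u \in f -> stalk b (u / w).
  move=> Eb uf; have uc : u / w \in chart b by rewrite Eb; apply/mapP; exists u.
  have lt : (index (u / w) (chart b) < size (chart b))%N by rewrite index_mem.
  by have := chart_stalk b (Ordinal lt); rewrite /= nth_index.
rewrite Ea => /mapP [u uf ->].
have -> : u / v = u / v' * (v' / v) by field; apply/andP.
apply: (subr_M (loc_sub la')); first exact: inchart.
apply: (dominated_ratio la la' ma); first exact: inchart.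
by right; rewrite invf_div; exact: inchart.
Qed.
End Separated.

Section PlaneCharts.
Variables (k : closedFieldType) (K : fieldType) (iota : {rmorphism k -> K}).
Local Notation ev1 := (@ev1 k K iota).
Local Notation ev2 := (@ev2 k K iota).

Lemma ev2_taylor (R : K -> Prop) xi eta c d (P : {poly {poly k}}) : subring iota R -> R xi -> R eta ->
  exists e u v, [/\ R u, R v & ev2 xi eta P = iota e + u * (xi - iota c) + v * (eta - iota d)].
Proof.
move=> sR Rx Re; pose S h := R h /\ exists e u v, [/\ R u, R v & h = iota e + u * (xi - iota c) + v * (eta - iota d)].
have [R0 R1] := (subr_0 sR, subr_1 sR); have Rc := subr_c sR.
suff [] : S (ev2 xi eta P) by [].
have Sc e : S (iota e) by split=> //; exists e, 0, 0; split=> //; ring.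
have Sx : S xi by split=> //; exists c, 1, 0; split=> //; ring.
have Se : S eta by split=> //; exists d, 0, 1; split=> //; ring.
have SD h h' : S h -> S h' -> S (h + h').
  move=> [Rh [e [u [v [Ru Rv E]]]]] [Rh' [e' [u' [v' [Ru' Rv' E']]]]].
  split; first exact: (subr_D sR).
  by exists (e + e'), (u + u'), (v + v'); rewrite rmorphD E E'; split; [exact: (subr_D sR)|exact: (subr_D sR)|ring].
have SM h h' : S h -> S h' -> S (h * h').
  move=> [Rh [e [u [v [Ru Rv E]]]]] [Rh' [e' [u' [v' [Ru' Rv' E']]]]].
  split; first exact: (subr_M sR).
  exists (e * e'), (u * h' + iota e * u'), (v * h' + iota e * v'); split.
  - by apply: (subr_D sR); apply: (subr_M sR).
  - by apply: (subr_D sR); apply: (subr_M sR).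
  by rewrite rmorphM {1}E {1}E' /= [in RHS]E'; ring.
have S1 q : S (ev1 xi q).
  elim/poly_ind: q => [|q e IH]; first by rewrite ev1_0 -(rmorph0 iota).
  by rewrite ev1D ev1M ev1X ev1C; apply: SD => //; exact: SM.
elim/poly_ind: P => [|P q IH]; first by rewrite ev2_0 -(rmorph0 iota).
by rewrite ev2D ev2M ev2X ev2C; apply: SD => //; exact: SM.
Qed.

Lemma plane_regular cs (a : point iota cs) xi eta : chart a = [:: xi; eta] -> regular_point2 a.
Proof.
move=> Ea; have lO := stalk_local a; have sO := loc_sub lO.
have [Ox Oe H] := plane_stalkP Ea.
have [c Mc] := stalk_residue a Ox; have [d Md] := stalk_residue a Oe.
exists (xi - iota c), (eta - iota d) => h; split=> [Mh|[u [v [Ou Ov ->]]]]; last first.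
  by apply: (loc_D lO); exact: (loc_Ml lO).
have [P [Q [nQ Eh]]] := H h (loc_R lO Mh); have Q0 := loc_neq0 lO nQ.
have OQ : stalk a (ev2 xi eta Q) by exact: (ev2_in lO).
have [e [u [v [Ou Ov E]]]] := ev2_taylor c d P sO Ox Oe.
have MP : maximal_ideal a (ev2 xi eta P).
  by rewrite -[ev2 _ _ P](divfK Q0) -Eh; exact: (loc_Mr lO).
have e0 : e = 0.
  apply/eqP; apply: contraT => /(loc_c lO); case.
  have -> : iota e = ev2 xi eta P - (u * (xi - iota c) + v * (eta - iota d)) by rewrite E; ring.
  by apply: (loc_B lO) => //; apply: (loc_D lO); exact: (loc_Ml lO).
have OV := loc_V lO OQ nQ.
exists (u / ev2 xi eta Q), (v / ev2 xi eta Q); split; try exact: (subr_M sO).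
by rewrite Eh E e0 rmorph0 add0r; field.
Qed.

Lemma coords_trdeg xi eta : coords iota xi eta -> trdeg iota 2.
Proof.
move=> C; exists [:: xi; eta]; split=> //; first exact: coords_indep.
move=> h ind; have [P [Q [Q0 E]]] := proj2 C h.
pose up (p : {mpoly k[2]}) : {mpoly k[3]} := mmap (@mpolyC 3 k) (fun i : 'I_2 => 'X_(widen_ord (leqnSn 2) i)) p.
have upE (S : comNzRingType) (g : {rmorphism {mpoly k[3]} -> S}) (j : {rmorphism k -> S}) (y : 'I_2 -> S) p :
    (forall c, g c%:MP = j c) -> (forall i : 'I_2, g 'X_(widen_ord (leqnSn 2) i) = y i) -> g (up p) = mmap j y p.
  move=> gc gx; elim/mpolyind: p => [|c m p _ _ IH]; first by rewrite /up !mmap0 rmorph0.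
  rewrite /up !mmapD rmorphD; congr (_ + _); last exact: IH.
  rewrite !mmapZ !mmapX /mmap1 rmorphM gc; congr (_ * _); rewrite rmorph_prod.
  by apply: eq_bigr => i _; rewrite rmorphXn; congr (_ ^+ _); exact: gx.
have := ind (up Q * 'X_ord_max - up P).
rewrite evalKB evalKM (@evalKX _ _ iota [:: xi; eta; h] (ord_max : 'I_3)) /=.
have ev p : evalK iota (up p : {mpoly k[size (rcons [:: xi; eta] h)]}) = @evalK k K iota [:: xi; eta] p.
  apply: (upE _ (mmap iota (fun i : 'I_3 => (rcons [:: xi; eta] h)`_i)) iota (fun i : 'I_2 => [:: xi; eta]`_i)) => [c|i].
    by rewrite /= mmapC.
  rewrite /= mmapX mmap1U /=; case: i => -[|[|i]] //.
rewrite !ev {1}E mulrC divfK // subrr => /(_ erefl) E0.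
have Qn : Q != 0 by apply: contraNneq Q0 => ->; rewrite /evalK mmap0.
have [c Qc] := mpoly_nonroot Qn.
(* The third coordinate is chosen so that Q T - P takes the value 1; hence this relation for h is a
   nonzero polynomial. *)
pose y (i : 'I_3) := if i == 0 then c ord0 else if i == 1 then c (lift ord0 ord0) else (P.@[c] + 1) / Q.@[c].
have mv p : (up p).@[y] = p.@[c].
  apply: (upE _ (meval y) idfun c) => [d|i]; first by rewrite /= mevalC.
  by rewrite /= mevalXU /y; case: i => -[|[|i]] //= lt; congr c; apply: val_inj.
have := congr1 (meval y) E0; rewrite mevalB mevalM !mv mevalXU meval0 /y /= mulrC divfK //.
by rewrite addrAC subrr add0r => /eqP; rewrite oner_eq0.
Qed.
End PlaneCharts.

(** * Hirzebruch surfaces and the plane as smooth projective models *)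

Section StandardCharts.
Variables (k : closedFieldType) (K : fieldType) (iota : {rmorphism k -> K}).
Variables (x z : K).
Hypothesis x0 : x != 0.
Hypothesis z0 : z != 0.

Definition ruled_charts e : seq (seq K) := [:: [:: x; z]; [:: x; z^-1];
  [:: x^-1; z / x ^+ e]; [:: x^-1; (z / x ^+ e)^-1]].
Definition plane_charts : seq (seq K) := [:: [:: x; z]; [:: x^-1; z / x]; [:: z^-1; x / z]].

Definition ruled (R : K -> Prop) e := [/\ R x \/ R x^-1, R x -> R z \/ R z^-1 &
  R x^-1 -> R (z / x ^+ e) \/ R (z / x ^+ e)^-1].

Lemma ruled_chart (R : K -> Prop) e : ruled R e ->
  exists2 g, g \in ruled_charts e & forall h, h \in g -> R h.
Proof.
move=> [[Rx|Rx] H1 H2]; [case: (H1 Rx) => Rz|case: (H2 Rx) => Rz].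
- by exists [:: x; z]; [rewrite !inE eqxx|move=> h; rewrite !inE => /orP [] /eqP ->].
- by exists [:: x; z^-1]; [rewrite !inE eqxx orbT|move=> h; rewrite !inE => /orP [] /eqP ->].
- by exists [:: x^-1; z / x ^+ e]; [rewrite !inE eqxx !orbT|move=> h; rewrite !inE => /orP [] /eqP ->].
- by exists [:: x^-1; (z / x ^+ e)^-1]; [rewrite !inE eqxx !orbT|move=> h; rewrite !inE => /orP [] /eqP ->].
Qed.

Lemma chart_ruled (R : K -> Prop) e g : subring iota R -> g \in ruled_charts e -> (forall h, h \in g -> R h) -> ruled R e.
Proof.
move=> sR gin Rg; have xe : x ^+ e != 0 by rewrite expf_neq0.
have RX n : R x -> R (x ^+ n) by move=> Rx; exact: (subr_X sR).
have RV n : R x^-1 -> R (x ^+ n)^-1 by rewrite -exprVn => Rx; exact: (subr_X sR).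
have E1 : (z / x ^+ e)^-1 = x ^+ e * z^-1 by rewrite invf_div.
have E2 : z = z / x ^+ e * x ^+ e by rewrite divfK.
have E3 : z^-1 = (z / x ^+ e)^-1 * (x ^+ e)^-1 by rewrite invf_div mulrAC divff ?mul1r.
have rs u : R u -> R (u * 1) by rewrite mulr1.
move: gin; rewrite !inE => /or4P [] /eqP Eg; rewrite Eg in Rg.
- have Rx := Rg x (mem_head _ _); have Rz := Rg z (mem_last x [:: z]).
  by split=> [|_|Rv]; left=> //; apply: (subr_M sR); auto.
- have Rx := Rg x (mem_head _ _); have Rz := Rg _ (mem_last x [:: z^-1]).
  split=> [|_|Rv]; [by left|by right|right].
  by rewrite E1; apply: (subr_M sR); auto.
- have Rx := Rg _ (mem_head _ _); have Rz := Rg _ (mem_last x^-1 [:: z / x ^+ e]).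
  split=> [|Rv|_]; [by right|left|by left].
  by rewrite E2; apply: (subr_M sR); auto.
- have Rx := Rg _ (mem_head _ _); have Rz := Rg _ (mem_last x^-1 [:: (z / x ^+ e)^-1]).
  split=> [|Rv|_]; [by right|right|by right].
  by rewrite E3; apply: (subr_M sR); auto.
Qed.

Lemma point_chart cs (a : point iota cs) h : h \in chart a -> stalk a h.
Proof.
move=> hg; have lt : (index h (chart a) < size (chart a))%N by rewrite index_mem.
by have := chart_stalk a (Ordinal lt); rewrite /= nth_index.
Qed.

Lemma ruled_separated e : separated iota (ruled_charts e).
Proof.
move=> a a' sa ma h hin; have la := stalk_local a; have la' := stalk_local a'.
have [r1 r2 r3] := chart_ruled (loc_sub la') (chart_in a') (@point_chart _ a').
have dom u : stalk a u -> stalk a' u \/ stalk a' u^-1 -> stalk a' u by exact: dominated_ratio la la' ma.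
have sym u : stalk a' u \/ stalk a' u^-1 -> stalk a' u^-1 \/ stalk a' (u^-1)^-1.
  by rewrite invrK; case; [right|left].
have Oa := @point_chart _ a; have := chart_in a; rewrite !inE.
have two u w (g : seq K) (R : K -> Prop) : g = [:: u; w] -> (forall h, h \in g -> R h) -> R u /\ R w.
  by move=> -> H; split; apply: H; rewrite !inE eqxx ?orbT.
have fin u w : chart a = [:: u; w] -> stalk a' u -> stalk a' w -> stalk a' h.
  by move=> Ea Ou Ow; move: hin; rewrite Ea !inE => /orP [] /eqP ->.
move=> /or4P [] /eqP Ea; have [u1 u2] := two _ _ _ _ Ea Oa.
- have Ox := dom _ u1 r1; exact: (fin _ _ Ea Ox (dom _ u2 (r2 Ox))).
- have Ox := dom _ u1 r1; exact: (fin _ _ Ea Ox (dom _ u2 (sym _ (r2 Ox)))).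
- have Ox := dom _ u1 (sym _ r1); exact: (fin _ _ Ea Ox (dom _ u2 (r3 Ox))).
- have Ox := dom _ u1 (sym _ r1); exact: (fin _ _ Ea Ox (dom _ u2 (sym _ (r3 Ox)))).
Qed.

Lemma mem2P (a b h : K) : h \in [:: a; b] -> h = a \/ h = b.
Proof. by rewrite !inE => /orP [] /eqP ->; [left|right]. Qed.

Lemma plane_separated : separated iota plane_charts.
Proof.
move=> a a' sa ma h; have la := stalk_local a; have la' := stalk_local a'; have sa' := loc_sub la'.
have dom u : stalk a u -> stalk a' u \/ stalk a' u^-1 -> stalk a' u by exact: dominated_ratio la la' ma.
have Oa := @point_chart _ a; have Oa' := @point_chart _ a'.
have := chart_in a; have := chart_in a'; rewrite !inE.
have two u w (g : seq K) (R : K -> Prop) : g = [:: u; w] -> (forall h, h \in g -> R h) -> R u /\ R w.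
  by move=> -> H; split; apply: H; rewrite !inE eqxx ?orbT.
have fin u w : chart a = [:: u; w] -> stalk a' u -> stalk a' w -> h \in chart a -> stalk a' h.
  by move=> -> Ou Ow /mem2P [] ->.
move=> /or3P [] /eqP Ea' /or3P [] /eqP Ea; have [u1 u2] := two _ _ _ _ Ea Oa;
  have [w1 w2] := two _ _ _ _ Ea' Oa'; try exact: (fin _ _ Ea).
- have Ov : stalk a' x^-1 by apply: dom; rewrite ?invrK; auto.
  by apply: (fin _ _ Ea) => //; exact: (subr_M sa').
- have Ov : stalk a' z^-1 by apply: dom; rewrite ?invrK; auto.
  by apply: (fin _ _ Ea) => //; exact: (subr_M sa').
- have Ov : stalk a' x by apply: dom; auto.
  by apply: (fin _ _ Ea) => //; rewrite -(divfK x0 z); exact: (subr_M sa').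
- have Ov : stalk a' (x / z) by apply: dom; rewrite ?invf_div; auto.
  apply: (fin _ _ Ea) => //; have -> : z^-1 = x^-1 * (x / z) by rewrite mulrA mulVf ?mul1r.
  exact: (subr_M sa').
- have Ov : stalk a' z by apply: dom; auto.
  by apply: (fin _ _ Ea) => //; rewrite -(divfK z0 x); exact: (subr_M sa').
- have Ov : stalk a' (z / x) by apply: dom; rewrite ?invf_div; auto.
  apply: (fin _ _ Ea) => //; have -> : x^-1 = z^-1 * (z / x) by rewrite mulrA mulVf ?mul1r.
  exact: (subr_M sa').
Qed.

(* The scroll S(1, e + 1).                                                     *)
Definition scroll e : seq K := [:: z, x * z & [seq x ^+ i | i <- seq.iota 0 e.+2]].

Lemma scroll_mem e : [/\ z \in scroll e, x * z \in scroll e &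
  forall i, (i <= e.+1)%N -> x ^+ i \in scroll e].
Proof.
split; [exact: mem_head|by rewrite in_cons mem_head orbT|move=> i le]; rewrite 2!in_cons; apply/orP; right; apply/orP; right.
by apply/mapP; exists i => //; rewrite mem_iota.
Qed.

Lemma scrollP e u : u \in scroll e -> [\/ u = z, u = x * z | exists2 i, (i <= e.+1)%N & u = x ^+ i].
Proof.
rewrite 2!in_cons => /or3P [/eqP->|/eqP->|/mapP [i]]; [by constructor 1|by constructor 2|].
by rewrite mem_iota add0n ltnS => le ->; constructor 3; exists i.
Qed.

Lemma proj_chart_in (f : seq K) v : v \in f -> v != 0 -> [seq u / v | u <- f] \in proj_charts f.
Proof. by move=> vf v0; apply/mapP; exists v; rewrite ?mem_filter ?v0. Qed.

Lemma powers_inv (R : K -> Prop) i n : subring iota R -> R x^-1 -> (i <= n)%N -> R (x ^+ i / x ^+ n).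
Proof.
move=> sR Rx le; have -> : x ^+ i / x ^+ n = x^-1 ^+ (n - i).
  by rewrite -{1}(subnK le) exprD invfM mulrCA divff ?mulr1 ?expf_neq0 // exprVn.
exact: (subr_X sR).
Qed.

(** The charts of F_e, in order, arise by dividing by 1, z, x^(e+1) and x z; dividing by the other
    powers of x gives no further points. *)
Lemma ruled_projective e : same_points iota (ruled_charts e) (proj_charts (scroll e)).
Proof.
have [mz mxz mx] := scroll_mem e; have xz0 : x * z != 0 by rewrite mulf_neq0.
apply: same_points_of; [exact: ruled_separated|exact: proj_separated|move=> a|move=> b].
  have sR := stalk_sub a; have Oa := @point_chart _ a; have := chart_in a; rewrite !inE.
  have [O1 OX] := (subr_1 sR, subr_X sR).
  have two u w (g : seq K) (R : K -> Prop) : g = [:: u; w] -> (forall h, h \in g -> R h) -> R u /\ R w.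
    by move=> -> H; split; apply: H; rewrite !inE eqxx ?orbT.
  have fin v : v \in scroll e -> v != 0 -> stalk a (z / v) -> stalk a (x * z / v) ->
      (forall i, (i <= e.+1)%N -> stalk a (x ^+ i / v)) ->
      exists2 g, g \in proj_charts (scroll e) & forall h, h \in g -> stalk a h.
    move=> vin v0 H1 H2 H3; exists [seq u / v | u <- scroll e]; first exact: proj_chart_in.
    by move=> h /mapP [u /scrollP [->|->|[i le ->]] ->] //; exact: H3.
  have E3 i : (i <= e.+1)%N -> x ^+ i / (x * z) = x ^+ i / x ^+ e.+1 * (x ^+ e / z).
    by move=> _; rewrite exprS; field; rewrite x0 z0 expf_neq0.
  move=> /or4P [] /eqP Ea; have [u1 u2] := two _ _ _ _ Ea Oa.
  - apply: (fin 1); rewrite ?oner_neq0 ?divr1 //; first exact: (mx 0%N).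
      exact: (subr_M sR).
    by move=> i _; rewrite divr1; exact: OX.
  - apply: (fin z); rewrite // ?divff ?mulfK // => i _; apply: (subr_M sR) => //; exact: OX.
  - apply: (fin (x ^+ e.+1)); rewrite ?expf_neq0 ?mx //.
    + by rewrite exprSr invfM mulrA; exact: (subr_M sR).
    + by rewrite exprS invfM mulrACA divff // mul1r.
    by move=> i le; exact: powers_inv.
  rewrite invf_div in u2.
  apply: (fin (x * z)) => // [||i le].
  - by rewrite invfM mulrCA divff // mulr1.
  - by rewrite divff.
  by rewrite E3 //; apply: (subr_M sR) => //; exact: powers_inv.
have sR := stalk_sub b; have Ob := @point_chart _ b; have := chart_in b.
move=> /mapP [v]; rewrite mem_filter => /andP [v0 vin] Eb.
have Ov u : u \in scroll e -> stalk b (u / v) by move=> uin; apply: Ob; rewrite Eb; apply/mapP; exists u.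
apply: ruled_chart; have [Oz Oxz Ox] := And3 (Ov _ mz) (Ov _ mxz) (fun i le => Ov _ (mx i le)).
have RX u n : stalk b u -> stalk b (u ^+ n) by move=> Rx; exact: (subr_X sR).
move/scrollP: (vin) => [Ev|Ev|[i le Ev]]; rewrite Ev in Oz Oxz Ox v0.
- split=> [|_|_]; first by left; rewrite -(mulfK z0 x).
    by right; have := Ox 0%N isT; rewrite mul1r.
  by right; rewrite invf_div; exact: Ox.
- split=> [|Rx|_]; right.
  + by move: Oz; rewrite invfM mulrCA divff // mulr1.
  + have -> : z^-1 = x * (x ^+ 0 / (x * z)) by field; apply/andP.
    by apply: (subr_M sR) => //; exact: Ox.
  rewrite invf_div; have -> : x ^+ e / z = x ^+ e.+1 / (x * z) by rewrite exprS; field; apply/andP.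
  exact: Ox.
have [le'|lt] := leqP i e.
  split=> [|Rx|Rx]; left.
  + have -> : x = x ^+ i.+1 / x ^+ i by rewrite exprS mulfK.
    exact: Ox.
  + by rewrite -(divfK v0 z); apply: (subr_M sR) => //; exact: RX.
  have -> : z / x ^+ e = z / x ^+ i * (x ^+ i / x ^+ e) by field; rewrite !expf_neq0.
  by apply: (subr_M sR) => //; exact: powers_inv.
have Ei : i = e.+1 by apply/eqP; rewrite eqn_leq le lt.
rewrite Ei in Oz Oxz Ox.
have Oze : stalk b (z / x ^+ e) by move: Oxz; rewrite exprS invfM mulrACA divff // mul1r.
split=> [|Rx|_]; [right|left|by left].
  have -> : x^-1 = x ^+ e / x ^+ e.+1 by rewrite exprS; field; rewrite x0 expf_neq0.
  by apply: Ox; exact: leqnSn.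
rewrite -(divfK (expf_neq0 e x0) z); apply: (subr_M sR) => //; exact: RX.
Qed.

Lemma plane_projective : same_points iota plane_charts (proj_charts [:: 1; x; z]).
Proof.
apply: same_points_of; [exact: plane_separated|exact: proj_separated|move=> a|move=> b].
  have sR := stalk_sub a; have Oa := @point_chart _ a; have := chart_in a; rewrite !inE.
  have O1 := subr_1 sR.
  have two u w (g : seq K) (R : K -> Prop) : g = [:: u; w] -> (forall h, h \in g -> R h) -> R u /\ R w.
    by move=> -> H; split; apply: H; rewrite !inE eqxx ?orbT.
  have fin v : v \in [:: 1; x; z] -> v != 0 -> stalk a (1 / v) -> stalk a (x / v) -> stalk a (z / v) ->
      exists2 g, g \in proj_charts [:: 1; x; z] & forall h, h \in g -> stalk a h.
    move=> vin v0 H1 H2 H3; exists [seq u / v | u <- [:: 1; x; z]]; first exact: proj_chart_in.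
    by move=> h; rewrite !inE => /or3P [] /eqP ->.
  move=> /or3P [] /eqP Ea; have [u1 u2] := two _ _ _ _ Ea Oa.
  - by apply: (fin 1); rewrite ?oner_neq0 ?divr1 ?mem_head.
  - by apply: (fin x); rewrite ?div1r ?divff // !inE eqxx orbT.
  - by apply: (fin z); rewrite ?div1r ?divff // !inE eqxx !orbT.
have sR := stalk_sub b; have Ob := @point_chart _ b; have := chart_in b.
move=> /mapP [v]; rewrite mem_filter => /andP [v0 vin] Eb.
have Ov u : u \in [:: 1; x; z] -> stalk b (u / v) by move=> uin; apply: Ob; rewrite Eb; apply/mapP; exists u.
have [O1 Ox Oz] : [/\ stalk b (1 / v), stalk b (x / v) & stalk b (z / v)].
  by split; apply: Ov; rewrite !inE eqxx ?orbT.
move: vin; rewrite !inE => /or3P [] /eqP Ev; rewrite Ev ?div1r in O1 Ox Oz.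
- exists [:: x; z]; first by rewrite !inE eqxx.
  by move=> h; rewrite !inE => /orP [] /eqP ->; rewrite -[X in stalk b X]divr1.
- exists [:: x^-1; z / x]; first by rewrite !inE eqxx orbT.
  by move=> h; rewrite !inE => /orP [] /eqP ->.
- exists [:: z^-1; x / z]; first by rewrite !inE eqxx !orbT.
  by move=> h; rewrite !inE => /orP [] /eqP ->.
Qed.
End StandardCharts.

Section StandardVarieties.
Variable k : closedFieldType.
Local Notation x := (coordX k).
Local Notation z := (coordZ k).

Lemma coords2 : coords (const2 k) x z.
Proof.
have gen : generates (const2 k) [:: x; z].
  by apply: coords_generate; apply: in_field_gen; rewrite !inE eqxx ?orbT.
apply: indep_coords => // P.
have -> : evalK (const2 k) P = tofrac (P : {mpoly k[2]}).
  elim/mpolyind: (P : {mpoly k[2]}) => [|c m Q _ _ IH]; first by rewrite /evalK mmap0 rmorph0.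
  rewrite /evalK mmapD [RHS]rmorphD; congr (_ + _); last exact: IH.
  rewrite mmapZ -mul_mpolyC [RHS]rmorphM; congr (_ * _).
  rewrite mmapX mpolyXE_id rmorph_prod /mmap1; apply: eq_bigr => i _.
  by rewrite rmorphXn; congr (_ ^+ _); case: i => -[|[|i]] // lt; congr (tofrac 'X_ _); apply: val_inj.
by move/eqP; rewrite tofrac_eq0 => /eqP.
Qed.

Let x0 : x != 0 := coords_x0 coords2.
Let z0 : z != 0 := coords_z0 coords2.

Lemma smooth_projective_two (Y : variety k) (f : seq (function_field Y)) xi eta :
  coords (scalar Y) xi eta -> has (fun v => v != 0) f ->
  same_points (scalar Y) (charts Y) (proj_charts f) ->
  (forall g, g \in charts Y -> exists u v, g = [:: u; v]) -> smooth_projective_surface Y.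
Proof.
move=> C hf same H; split; [by exists f|exact: (coords_trdeg C)|move=> a].
by have [u [v E]] := H _ (chart_in a); exact: (plane_regular E).
Qed.

Lemma hirzebruch_smooth e : smooth_projective_surface (hirzebruch k e).
Proof.
apply: (@smooth_projective_two (hirzebruch k e) (scroll x z e) x z coords2).
- by apply/hasP; exists z => //; exact: mem_head.
- exact: (ruled_projective (const2 k) x0 z0 e).
by move=> g; rewrite !inE => /or4P [] /eqP ->; do 2 eexists.
Qed.

Lemma plane_charts_generate g : g \in plane_charts x z -> generates (const2 k) g.
Proof.
have C := coords2; rewrite !inE => /or3P [] /eqP ->; first by case: C.
  by have [] := coords_inv (coords_div C).
by have [] := coords_inv (coords_div (coords_swap C)).
Qed.

Definition plane : variety k := Variety plane_charts_generate.

Lemma plane_smooth : smooth_projective_surface plane.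
Proof.
apply: (@smooth_projective_two plane [:: 1; x; z] x z coords2).
- by apply/hasP; exists 1; [exact: mem_head|exact: oner_neq0].
- exact: (plane_projective (const2 k) x0 z0).
by move=> g; rewrite !inE => /or3P [] /eqP ->; do 2 eexists.
Qed.
End StandardVarieties.

(** * Consequences of minimality *)

Section Minimality.
Variables (k : closedFieldType) (X Y : variety k).
Variable phi : {rmorphism function_field Y -> function_field X}.
Hypothesis bphi : birational phi.

Lemma pullback_local (R M : function_field X -> Prop) : local_ring (scalar X) R M ->
  local_ring (scalar Y) (fun h => R (phi h)) (fun h => M (phi h)).
Proof.
move=> lR; have sR := loc_sub lR; have [_ phic] := bphi; split.
- by split=> [c|u v|u v]; rewrite ?phic ?rmorphD ?rmorphM; [exact: (subr_c sR)|exact: (subr_D sR)|exact: (subr_M sR)].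
- by move=> u; exact: (loc_R lR).
- by rewrite rmorph0; split=> [|u v]; rewrite ?rmorphD; [exact: (loc_0 lR)|exact: (loc_D lR)].
- by move=> u v; rewrite rmorphM; exact: (loc_Ml lR).
- by split=> [|u Ru nM]; rewrite ?rmorph1 ?fmorphV; [exact: (loc_1 lR)|exact: (loc_V lR)].
Qed.

Lemma pullback_residue (R M : function_field X -> Prop) : residue_k (scalar X) R M ->
  residue_k (scalar Y) (fun h => R (phi h)) (fun h => M (phi h)).
Proof. by move=> res u /res [c]; exists c; rewrite rmorphB (proj2 bphi). Qed.

Lemma minimal_isomorphism : minimal X -> smooth_projective_surface Y ->
  (forall a : pt X, exists2 g, g \in charts Y & forall h, h \in g -> stalk a (phi h)) ->
  isomorphism phi.
Proof.
move=> minX sY H; apply: minX => // a; have [g gin Hg] := H a.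
have [b [sb mb _]] := center_chart (pullback_local (stalk_local a))
  (pullback_residue (@stalk_residue _ _ _ _ a)) gin Hg.
by exists b => h; split; [exact: sb|exact: mb].
Qed.
End Minimality.

Lemma minimal_ruled (k : closedFieldType) (X : variety k) x z e : minimal X ->
  coords (scalar X) x z -> maps_to_ruled x z e ->
  exists phi : {rmorphism function_field (hirzebruch k e) -> function_field X},
    [/\ isomorphism phi, phi (coordX k) = x & phi (coordZ k) = z].
Proof.
move=> minX C H; have [phi [bij phic Ex Ez]] := comorphism (coords2 k) C.
exists phi; split=> //; have bphi : birational (X := X) (Y := hirzebruch k e) phi by [].
apply: minimal_isomorphism => //; first exact: hirzebruch_smooth.
move=> a; apply: (@ruled_chart _ _ _ (fun h => stalk a (phi h))).
by rewrite /ruled !fmorphV !fmorph_div rmorphXn Ex Ez; exact: H.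
Qed.

(** The point p has a centre on Y, which corresponds to a point a of X. The chart coordinates are in
    O_a and the derivations dual to parameters preserve O_a, so the Jacobian is in O_a. *)
Lemma isomorphism_etale (k : closedFieldType) (X Y : variety k)
  (phi : {rmorphism function_field Y -> function_field X}) u w : isomorphism phi ->
  [:: u; w] \in charts Y -> forall p : point (scalar X) [:: [:: phi u; phi w]], etale_at p.
Proof.
move=> [bphi _ iso] gin p; have [[psi psiK phiK] _] := bphi.
have lp := stalk_local p; have [p1 p2 _] := plane_stalkP (chart1 p).
have [|b [sb mb gb]] := center_chart (pullback_local bphi lp) (pullback_residue bphi (@stalk_residue _ _ _ _ p)) gin.
  by move=> h /mem2P [] ->.
have [a Ha] := iso b; have la := stalk_local a; have lb := stalk_local b.
have sa h : stalk a h -> stalk p h by rewrite -(phiK h) => /Ha /sb.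
exists a; split=> // [h Mh|s t D1 D2 [_ _ pres]].
  rewrite -(phiK h); apply: mb; apply: NNPP => nM.
  have Ob : stalk b (psi h) by apply/Ha; rewrite phiK; exact: (loc_R la).
  have := loc_V lb Ob nM => /Ha; rewrite fmorphV phiK => Ov.
  apply: (loc_unit la (loc_R la Mh) Ov) => //.
  by have := loc_neq0 lb nM; apply: contra_neq => h0; apply: (fmorph_inj phi); rewrite phiK h0 rmorph0.
apply: sa; have [Ou Ow] : stalk a (phi u) /\ stalk a (phi w).
  by split; apply/Ha/gb; rewrite !inE eqxx ?orbT.
have [O1u O2u] := pres _ Ou; have [O1w O2w] := pres _ Ow.
by apply: (subr_B (loc_sub la)); exact: (subr_M (loc_sub la)).
Qed.

Lemma isomorphism_chart (k : closedFieldType) (X Y : variety k)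
  (phi : {rmorphism function_field Y -> function_field X}) : isomorphism phi ->
  forall a : pt X, exists2 g, g \in charts Y &
    exists p : point (scalar X) [:: map phi g], forall h, stalk a h <-> stalk p h.
Proof.
move=> [bphi iso _] a; have [[psi psiK phiK] _] := bphi.
have [b Hb] := iso a; exists (chart b); first exact: chart_in.
have [|p [sp mp gp]] := center_chart (stalk_local a) (@stalk_residue _ _ _ _ a)
    (mem_head [seq phi i | i <- chart b] [::]).
  by move=> _ /mapP [h hb ->]; apply/Hb; exact: point_chart.
exists p => h; split=> [|/sp //]; have la := stalk_local a; have lp := stalk_local p.
have bp : forall h', stalk b h' -> stalk p (phi h').
  apply: (proj1 (stalk_min (pullback_local bphi lp) _)) => i.
  have Op : stalk p (phi ((chart b)`_i - scalar Y (coord b i))).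
    rewrite rmorphB (proj2 bphi); apply: (subr_B (loc_sub lp)); last exact: (subr_c (loc_sub lp)).
    by apply: gp; apply: map_f; exact: mem_nth.
  apply: NNPP => nM; have := loc_V lp Op nM => /sp; rewrite -fmorphV => /Hb Ov.
  have Mb := chart_max b i; have lb := stalk_local b; apply: (loc_unit lb (loc_R lb Mb) Ov) => //.
  by apply: contra_not_neq nM => ->; rewrite rmorph0; exact: (loc_0 lp).
by rewrite -(phiK h) => /Hb /bp.
Qed.

(** Reduces an X isomorphic to the plane to the unramified case, so that one argument excludes
    both. *)
Lemma minimal_plane (k : closedFieldType) (X : variety k) x z : minimal X ->
  coords (scalar X) x z -> maps_to_plane x z -> etale_plane x z.
Proof.
move=> minX C H; have [phi [bij phic Ex Ez]] := comorphism (coords2 k) C.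
have bphi : birational (X := X) (Y := plane k) phi by [].
have iso : isomorphism (X := X) (Y := plane k) phi.
  apply: minimal_isomorphism => //; first exact: plane_smooth.
  move=> a; case: (H a) => [] [O1 O2].
  - exists [:: coordX k; coordZ k]; first by rewrite !inE eqxx.
    by move=> h; rewrite !inE => /orP [] /eqP ->; rewrite ?Ex ?Ez.
  - exists [:: (coordX k)^-1; coordZ k / coordX k]; first by rewrite !inE eqxx orbT.
    by move=> h; rewrite !inE => /orP [] /eqP ->; rewrite ?fmorph_div ?fmorphV ?Ex ?Ez.
  - exists [:: (coordZ k)^-1; coordX k / coordZ k]; first by rewrite !inE eqxx !orbT.
    by move=> h; rewrite !inE => /orP [] /eqP ->; rewrite ?fmorph_div ?fmorphV ?Ex ?Ez.
have et (g : seq (function_field (plane k))) u w : g = [:: u; w] -> g \in charts (plane k) ->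
    forall p : point (scalar X) [:: [:: phi u; phi w]], etale_at p.
  by move=> -> gin; exact: (isomorphism_etale (Y := plane k) iso gin).
split.
- by have := et _ _ _ erefl _; rewrite -Ex -Ez; apply; rewrite !inE eqxx.
- have := et [:: (coordX k)^-1; coordZ k / coordX k] _ _ erefl; rewrite fmorph_div fmorphV Ex Ez.
  by apply; rewrite !inE eqxx orbT.
- have := et [:: (coordZ k)^-1; coordX k / coordZ k] _ _ erefl; rewrite fmorph_div fmorphV Ex Ez => H' p _ _.
  by apply: H'; rewrite !inE eqxx !orbT.
Qed.

(** * The foliation as a rational vector field *)
Section Line.
Variables (k : closedFieldType) (X : variety k) (F : foliation X).
Local Notation K := (function_field X).
Local Notation iota := (scalar X).
Implicit Types (a : pt X) (D E : K -> K).

Definition spans (D0 : K -> K) := [/\ der iota D0, exists h, D0 h != 0 &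
  forall a D, F a D <-> tangent a D /\ exists f, D =1 (fun h => f * D0 h)].

Variables x0 z0 : K.
Hypothesis C : coords iota x0 z0.
Hypothesis smX : smooth_projective_surface X.

Let ga a : generates iota (chart a) := charts_generate (chart_in a).

Lemma foliation_scale a u D E : stalk a u -> F a D -> E =1 (fun h => u * D h) -> F a E.
Proof.
move=> Ou; have [l [n [d [la Hd]]]] := @TF_coherent _ _ F a.
move=> /(Hd a la) [c [Oc ED]] EE; apply/(Hd a la); exists (fun i => u * c i); split=> [i|h].
  by apply: (subr_M (stalk_sub a)).
by rewrite EE ED /lin_comb mulr_sumr; apply: eq_bigr => i _; rewrite mulrA.
Qed.

(* Two points have a common neighbourhood on which the stalks of T_F have      *)
(* common generators.                                                          *)
Lemma foliation_line a b D0 : F a D0 -> (exists h, D0 h != 0) ->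
  (forall D, F a D -> exists f, D =1 (fun h => f * D0 h)) ->
  forall D, F b D -> exists f, D =1 (fun h => f * D0 h).
Proof.
move=> FD0 [h0 D0h] line D FD.
have [l [n [d [la Hd]]]] := @TF_coherent _ _ F a; have [l' [n' [d' [lb Hd']]]] := @TF_coherent _ _ F b.
have [c Hc] := generic_point (coords_indep C) (proj2 C) (l ++ l') (chart_in a) (@ga a).
have lc h : h \in l -> stalk c h by move=> hl; apply: Hc; rewrite mem_cat hl.
have lc' h : h \in l' -> stalk c h by move=> hl; apply: Hc; rewrite mem_cat hl orbT.
have unit m (e : 'I_m -> K -> K) i : e i =1 lin_comb (fun j => (j == i)%:R) e.
  move=> h; rewrite /lin_comb (bigD1 i) //= eqxx mul1r big1 ?addr0 // => j /negPf ->.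
  by rewrite mul0r.
have nat_in (p : pt X) m (i : 'I_m) (j : 'I_m) : stalk p (j == i)%:R by exact: (subr_n (stalk_sub p)).
have Fcd i : F c (d i) by apply/(Hd c lc); exists (fun j => (j == i)%:R); split.
have Fad i : F a (d i) by apply/(Hd a la); exists (fun j => (j == i)%:R); split.
have Fcd' i : F c (d' i) by apply/(Hd' c lc'); exists (fun j => (j == i)%:R); split.
have [Dc [_ _ lineC]] := @TF_rank_one _ _ F c.
have [e [_ E0]] := proj1 (Hd a la D0) FD0.
have [i di] : exists i, d i h0 != 0.
  apply: NNPP => H; move/eqP: D0h; apply; rewrite E0 /lin_comb big1 // => i _.
  have [->|di] := eqVneq (d i h0) 0; first by rewrite mulr0.
  by case: H; exists i.
have [f Ef] := lineC _ (Fcd i); have [f' Ef'] := line _ (Fad i).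
have f0 : f != 0 by apply: contraNneq di => f0; rewrite Ef f0 mul0r.
have EDc h : Dc h = f^-1 * f' * D0 h by rewrite -mulrA -Ef' Ef mulKf.
have [e' [_ ED]] := proj1 (Hd' b lb D) FD.
have gj j : exists g, d' j =1 (fun h => g * Dc h) by exact: lineC.
pose g j := proj1_sig (constructive_indefinite_description _ (gj j)).
have gE j : d' j =1 (fun h => g j * Dc h) := proj2_sig (constructive_indefinite_description _ (gj j)).
exists ((\sum_j e' j * g j) * (f^-1 * f')) => h; rewrite ED /lin_comb -mulrA -EDc mulr_suml.
by apply: eq_bigr => j _; rewrite gE mulrA.
Qed.

(** A generator at one point spans at all points by [foliation_line]. A tangent multiple of it lies
    in T_F after multiplication by a denominator, hence by saturation itself. *)
Lemma foliation_spans : exists D0, spans D0.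
Proof.
have [[f [/hasP [v vf v0] same]] _ _] := smX.
have [b] : inhabited (point iota (proj_charts f)).
  apply: (point_exists (coords_indep C) (proj2 C) (g := [seq u / v | u <- f])).
  by apply/mapP; exists v; rewrite ?mem_filter ?v0.
have [_ H] := same; have [a0 _] := H b.
have [D0 [FD0 nz line]] := @TF_rank_one _ _ F a0; exists D0; split=> //.
  by have [] := TF_sub FD0.
move=> a D; split=> [FD|[tD [g Eg]]].
  by split; [exact: (TF_sub FD)|exact: (foliation_line FD0 nz line FD)].
have [D1 [FD1 [h1 D1h] _]] := @TF_rank_one _ _ F a.
have [g1 Eg1] := foliation_line FD0 nz line FD1.
have g10 : g1 != 0 by apply: contraNneq D1h => g10; rewrite Eg1 g10 mul0r.
have [u [w [Ou Ow w0 E]]] := stalk_frac (@ga a) (g / g1).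
apply: (TF_saturated tD Ow w0); apply: (foliation_scale Ou FD1) => h.
by rewrite Eg Eg1 !mulrA; congr (_ * _); rewrite -(divfK g10 g) E; field.
Qed.

Section Regular.
Variable D0 : K -> K.
Hypothesis sD0 : spans D0.
Hypothesis regF : regular F.

(** Let p and q be the coordinates of [D1] and [D2] along a basis element of the free module T_X /
    T_F. Expressing that basis element by [D1] and [D2] shows that p and q generate the unit ideal,
    and T_F is annihilated by (p, q). So T_F has the direction (-q, p), which does not vanish at
    a. *)
Lemma unimodular_generator a s t D1 D2 : parameters a s t D1 D2 -> exists alpha beta f,
  [/\ stalk a alpha, stalk a beta, ~ (maximal_ideal a alpha /\ maximal_ideal a beta) &
      forall h, alpha * D1 h + beta * D2 h = f * D0 h].
Proof.
move=> [st dd pres]; have [d0 [h0 D0h] HF] := sD0; have lO := stalk_local a; have sO := loc_sub lO.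
have [d1 d2 [D1s D1t] [D2s D2t]] := dd.
have t1 : tangent a D1 by split=> // h /pres [].
have t2 : tangent a D2 by split=> // h /pres [].
have Os : stalk a s by apply: (loc_R lO); exact: (param_s st).
have Ot : stalk a t by apply: (loc_R lO); exact: (param_t st).
have basis D : der iota D -> forall h, D h = D s * D1 h + D t * D2 h.
  exact: (dual_ders_basis (coords_indep C) (proj2 C) dd).
have tc u v : stalk a u -> stalk a v -> tangent a (fun h => u * D1 h + v * D2 h).
  move=> Ou Ov; split; last by move=> h /pres [O1 O2]; apply: (subr_D sO); exact: (subr_M sO).
  split=> [h h'|h h'|c].
  - by rewrite (der_D d1) (der_D d2); ring.
  - by rewrite (der_M d1) (der_M d2); ring.
  - by rewrite (der_c d1) (der_c d2) !mulr0 addr0.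
have [_ [n [d [td Hd]]]] := regF a.
have [[p [Op Fp]] _] := Hd _ t1; have [[q [Oq Fq]] _] := Hd _ t2.
have [_ [f1 Ef1]] := proj1 (HF _ _) Fp; have [_ [f2 Ef2]] := proj1 (HF _ _) Fq.
have tlin c : (forall i, stalk a (c i)) -> tangent a (lin_comb c d).
  move=> Oc; rewrite /lin_comb; split.
    split=> [h h'|h h'|e].
    - by rewrite -big_split; apply: eq_bigr => i _; have [[H _ _] _] := td i; rewrite H mulrDr.
    - rewrite !mulr_sumr -big_split; apply: eq_bigr => i _; have [[_ H _] _] := td i.
      by rewrite H /=; ring.
    - by rewrite big1 // => i _; have [[_ _ H] _] := td i; rewrite H mulr0.
  by move=> h Oh; apply: (subr_sum sO) => i _; apply: (subr_M sO) => //; have [_] := td i; apply.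
have comb r r' E c : stalk a r -> stalk a r' -> tangent a E -> (forall i, stalk a (c i)) ->
    (exists f, forall h, E h - (r * D1 h + r' * D2 h) = f * D0 h) -> (forall i, c i = r * p i + r' * q i) ->
    F a (fun h => E h - lin_comb c d h).
  move=> Or Or' [[EA EM Ec] EO] Oc [f Ef] cE; apply/HF; split.
    have [[LA LM Lc] LO] := tlin c Oc; split.
      split=> [h h'|h h'|e]; rewrite ?EA ?LA ?EM ?LM ?Ec ?Lc; ring.
    by move=> h Oh; apply: (subr_B sO); auto.
  exists (f + r * f1 + r' * f2) => h.
  have -> : lin_comb c d h = r * lin_comb p d h + r' * lin_comb q d h.
    by rewrite /lin_comb !mulr_sumr -big_split; apply: eq_bigr => i _; rewrite cE /=; ring.
  have := Ef1 h; have := Ef2 h; have := Ef h => E1 E2 E3.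
  transitivity (E h - (r * D1 h + r' * D2 h) + r * (D1 h - lin_comb p d h) + r' * (D2 h - lin_comb q d h)).
    by ring.
  by rewrite E1 E2 E3; ring.
(* Rank 0 would make [D1] and [D2] proportional to [D0]. *)
case: n d td Hd p q Op Fp Oq Fq Ef1 Ef2 tlin comb => [|n] d td Hd p q Op Fp Oq Fq Ef1 Ef2 tlin comb.
  have E1 h : D1 h = f1 * D0 h by rewrite -Ef1 /lin_comb big_ord0 subr0.
  have E2 h : D2 h = f2 * D0 h by rewrite -Ef2 /lin_comb big_ord0 subr0.
  exfalso; have /eqP := oner_neq0 K; apply; rewrite -D2t E2.
  have : f2 * D0 s = 0 by rewrite -E2.
  move/eqP; rewrite mulf_eq0 => /orP [/eqP ->|/eqP D0s]; first by rewrite mul0r.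
  by have := oner_neq0 K; rewrite -D1s E1 D0s mulr0 eqxx.
pose i0 : 'I_n.+1 := ord0.
have [r Or] : {r | r = d i0 s} by exists (d i0 s).
have [r' Or'] : {r | r = d i0 t} by exists (d i0 t).
have [di0 Odi] := td i0.
have unim : r * p i0 + r' * q i0 = 1.
  have O1 : stalk a r by rewrite Or; exact: Odi.
  have O2 : stalk a r' by rewrite Or'; exact: Odi.
  have [_ uniq] := Hd _ (td i0).
  suff H : (fun i => r * p i + r' * q i) =1 (fun i => (i == i0)%:R) by rewrite (H i0) eqxx.
  have Oc i : stalk a (r * p i + r' * q i) by apply: (subr_D sO); exact: (subr_M sO).
  have On i : stalk a (i == i0)%:R by exact: (subr_n sO).
  apply: (uniq _ _ Oc On).
    by apply: (comb r r') => //; exists 0 => h; rewrite Or Or' -(basis _ di0) subrr mul0r.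
  apply/HF; have tdi : forall h, lin_comb (fun i => (i == i0)%:R) d h = d i0 h.
    move=> h; rewrite /lin_comb (bigD1 i0) // eqxx mul1r big1 => [|j /negPf ->]; last by rewrite mul0r.
    exact: addr0.
  have [T0 T0'] := tc 0 0 (subr_0 sO) (subr_0 sO).
  split; last by exists 0 => h; rewrite tdi subrr mul0r.
  split; last by move=> h _; rewrite tdi subrr; exact: (subr_0 sO).
  by split=> [h h'|h h'|e]; rewrite !tdi !subrr ?mulr0 ?addr0.
have [D [FD [h1 Dh] _]] := @TF_rank_one _ _ F a.
have [[dD OD] [f Ef]] := proj1 (HF _ _) FD.
have f0 : f != 0 by apply: contraNneq Dh => f0; rewrite Ef f0 mul0r.
have rel : D s * p i0 + D t * q i0 = 0.
  have [_ uniq] := Hd _ (conj dD OD).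
  suff H : (fun i => D s * p i + D t * q i) =1 (fun=> 0) by exact: (H i0).
  have Oc i : stalk a (D s * p i + D t * q i).
    by apply: (subr_D sO); apply: (subr_M sO) => //; exact: OD.
  have On (i : 'I_n.+1) : stalk a 0 by exact: (subr_0 sO).
  apply: (uniq _ _ Oc On).
    apply: (comb (D s) (D t)) => //; try exact: OD.
    by exists 0 => h; rewrite -(basis _ dD) subrr mul0r.
  apply: (foliation_scale (subr_1 sO) FD) => h.
  by rewrite /lin_comb big1 ?subr0 ?mul1r // => i _; rewrite mul0r.
exists (- q i0), (p i0).
have [g Hg] : exists g, - q i0 = g * D s /\ p i0 = g * D t.
  have [Ds0|Ds0] := eqVneq (D s) 0; last first.
    exists (- q i0 / D s); rewrite divfK //; split=> //; apply: (mulIf Ds0).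
    rewrite mulrAC divfK //; apply/eqP; rewrite -subr_eq0; apply/eqP; rewrite -rel; ring.
  have Dt0 : D t != 0 by apply: contraNneq Dh => Dt0; rewrite (basis _ dD) Ds0 Dt0 !mul0r addr0.
  move: rel; rewrite Ds0 mul0r add0r => /eqP; rewrite mulf_eq0 (negPf Dt0) /= => /eqP ->.
  by exists (p i0 / D t); rewrite mulr0 oppr0 divfK.
exists (g * f); split=> //; first exact: (subr_N sO).
  move=> [/(loc_N lO) Mq Mp]; rewrite opprK in Mq; apply: (loc_1 lO); rewrite -unim.
  have O1 : stalk a r by rewrite Or; exact: Odi.
  have O2 : stalk a r' by rewrite Or'; exact: Odi.
  by apply: (loc_D lO); exact: (loc_Ml lO).
by move=> h; rewrite -mulrA -Ef (basis _ dD h); case: Hg => -> ->; ring.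
Qed.

(** As J and its inverse are regular at p, the Jacobian matrix of (xi, eta) with respect to (s, t)
    is invertible over O_p. It carries the vector of [unimodular_generator] to one that does not
    vanish at p. *)
Lemma line_at xi eta (p : point iota [:: [:: xi; eta]]) : coords iota xi eta -> etale_at p ->
  exists f, [/\ stalk p (f * D0 xi), stalk p (f * D0 eta) &
    ~ (maximal_ideal p (f * D0 xi) /\ maximal_ideal p (f * D0 eta))].
Proof.
move=> C' [a [sa ma Ja]]; have [_ _ reg] := smX.
have [s [t [D1 [D2 par]]]] := parameters_ex C' (reg a).
have pJ := Ja _ _ _ _ par; have [st dd pres] := par; have [d1 d2 _ _] := dd.
have [al [be [f [Oa Ob nM E]]]] := unimodular_generator par.
have lp := stalk_local p; have sp := loc_sub lp; have la := stalk_local a.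
have ind := coords_indep C'; have gen := proj2 C'.
pose E1 := dX ind gen; pose E2 := dZ ind gen.
have EJ : jacobian E1 E2 s t * jacobian D1 D2 xi eta = 1 := jac_dual ind gen dd.
have bas D : der iota D -> forall h, D h = D xi * E1 h + D eta * E2 h by exact: der_dXZ.
have ps : stalk p s by apply: sa; apply: (loc_R la); exact: (param_s st).
have pt : stalk p t by apply: sa; apply: (loc_R la); exact: (param_t st).
have [p0 p1] := (subr_0 sp, subr_1 sp).
have pX h : stalk p h -> stalk p (E1 h).
  by apply: (plane_der (chart1 p)); [exact: dX_der|rewrite /E1 dXx|rewrite /E1 dXz].
have pZ h : stalk p h -> stalk p (E2 h).
  by apply: (plane_der (chart1 p)); [exact: dZ_der|rewrite /E2 dZx|rewrite /E2 dZz].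
have [_ _ [D1s D1t] [D2s D2t]] := dd.
have a1 := bas _ d1 s; have a2 := bas _ d1 t; have b1 := bas _ d2 s; have b2 := bas _ d2 t.
rewrite D1s in a1; rewrite D1t in a2; rewrite D2s in b1; rewrite D2t in b2.
pose J := jacobian D1 D2 xi eta; pose w := jacobian E1 E2 s t; rewrite -/J -/w in EJ pJ.
have w0 : w != 0 by apply: contraTneq (oner_neq0 K) => w0; rewrite -EJ w0 mul0r eqxx.
have JE u : u = J * (w * u) by rewrite mulrA [J * w]mulrC EJ mul1r.
have e1 : D1 xi = J * E2 t.
  rewrite (JE (D1 xi)); congr (_ * _); rewrite /w /jacobian -[RHS]mul1r a1.
  by transitivity (D1 xi * (E1 s * E2 t - E1 t * E2 s) + E2 s * (D1 xi * E1 t + D1 eta * E2 t) ); [rewrite -a2; ring|ring].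
have e2 : D1 eta = - (J * E1 t).
  rewrite (JE (D1 eta)) -mulrN; congr (_ * _); rewrite /w /jacobian -[RHS]mulr1 a1.
  by transitivity (D1 eta * (E1 s * E2 t - E1 t * E2 s) - E1 s * (D1 xi * E1 t + D1 eta * E2 t)); [rewrite -a2; ring|ring].
have e3 : D2 xi = - (J * E2 s).
  rewrite (JE (D2 xi)) -mulrN; congr (_ * _); rewrite /w /jacobian -[RHS]mulr1 b2.
  by transitivity (D2 xi * (E1 s * E2 t - E1 t * E2 s) - E2 t * (D2 xi * E1 s + D2 eta * E2 s)); [rewrite -b1; ring|ring].
have e4 : D2 eta = J * E1 s.
  rewrite (JE (D2 eta)); congr (_ * _); rewrite /w /jacobian -[RHS]mulr1 b2.
  by transitivity (D2 eta * (E1 s * E2 t - E1 t * E2 s) + E1 t * (D2 xi * E1 s + D2 eta * E2 s)); [rewrite -b1; ring|ring].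
have pE u : stalk p u -> stalk p (J * u) by exact: (subr_M sp).
exists f; rewrite -!E e1 e2 e3 e4; split.
- by apply: (subr_D sp); apply: (subr_M sp); try exact: sa; try apply: (subr_N sp); apply: pE; auto.
- by apply: (subr_D sp); apply: (subr_M sp); try exact: sa; try apply: (subr_N sp); apply: pE; auto.
rewrite -e1 -e2 -e3 -e4 => -[M1 M2].
have Ea : al = (al * D1 xi + be * D2 xi) * E1 s + (al * D1 eta + be * D2 eta) * E2 s.
  transitivity (al * 1 + be * 0); first by ring.
  by rewrite {1}a1 {1}b1; ring.
have Eb : be = (al * D1 xi + be * D2 xi) * E1 t + (al * D1 eta + be * D2 eta) * E2 t.
  transitivity (al * 0 + be * 1); first by ring.
  by rewrite {1}a2 {1}b2; ring.
have down u : stalk a u -> maximal_ideal p u -> maximal_ideal a u.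
  move=> Ou Mu; apply: NNPP => nMu; apply: (loc_unit lp (loc_R lp Mu)) Mu.
    by apply: sa; exact: (loc_V la).
  exact: (loc_neq0 la).
apply: nM; split; apply: down => //.
  by rewrite Ea; apply: (loc_D lp); apply: (loc_Mr lp); auto.
by rewrite Eb; apply: (loc_D lp); apply: (loc_Mr lp); auto.
Qed.
End Regular.
End Line.

(** * Polynomial multiples of a vector field *)

Section Lattice.
Variables (k : closedFieldType) (K : fieldType) (iota : {rmorphism k -> K}).
Local Notation ev1 := (@ev1 k K iota).
Local Notation ev2 := (@ev2 k K iota).
Local Notation coords := (@coords k K iota).

Definition affine xi eta h := exists P, h = ev2 xi eta P.

Lemma affine_sub xi eta : subring iota (affine xi eta).
Proof.
split=> [c|u v [P ->] [Q ->]|u v [P ->] [Q ->]].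
- by exists c%:P%:P; rewrite ev2C ev1C.
- by exists (P + Q); rewrite ev2D.
- by exists (P * Q); rewrite ev2M.
Qed.

Lemma affine_fst xi eta : affine xi eta xi.
Proof. by exists 'X%:P; rewrite ev2C ev1X. Qed.
Lemma affine_snd xi eta : affine xi eta eta.
Proof. by exists 'X; rewrite ev2X. Qed.

Lemma affine_min (R : K -> Prop) xi eta h : subring iota R -> R xi -> R eta -> affine xi eta h -> R h.
Proof.
move=> sR Rx Re [P ->]; have R1 q : R (ev1 xi q).
  by rewrite ev1E; apply: (subr_sum sR) => i _; apply: (subr_M sR); [exact: (subr_c sR)|exact: (subr_X sR)].
by rewrite ev2E; apply: (subr_sum sR) => i _; apply: (subr_M sR) => //; exact: (subr_X sR).
Qed.

Lemma affine_swap xi eta h : affine xi eta h -> affine eta xi h.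
Proof.
by apply: affine_min; [exact: affine_sub|exact: affine_snd|exact: affine_fst].
Qed.

Lemma fst_divides c (P : {poly {poly k}}) : map_poly (horner^~ c) P = 0 ->
  exists Q, P = ('X - c%:P)%:P * Q.
Proof.
move=> P0; exists (\poly_(i < size P) (P`_i %/ ('X - c%:P))).
apply/polyP => i; rewrite coefCM coef_poly; case: ltnP => le; last first.
  by rewrite mulr0 nth_default.
rewrite mulrC divpK // dvdp_XsubCl; apply/eqP.
by have := congr1 (fun q : {poly k} => q`_i) P0; rewrite -[horner^~ c]/(horner_eval c) coef_map coef0.
Qed.

Section Generator.
Variables xi eta : K.
Hypothesis C : coords xi eta.
Variables al be : K.

(** The multiple of (al, be) with polynomial entries and no common factor. *)
Definition lattice_generator g := [/\ g != 0, affine xi eta (g * al), affine xi eta (g * be) &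
  forall f, affine xi eta (f * al) -> affine xi eta (f * be) -> affine xi eta (f / g)].

Let ev_inj (P Q : {poly {poly k}}) : ev2 xi eta P = ev2 xi eta Q -> P = Q := @coords_inj _ _ _ _ _ C P Q.

(* A generator of least degree: the reflexive module of all multiples of       *)
(* (al, be) with polynomial entries is free.                                   *)
Lemma lattice_generator_both : al != 0 -> be != 0 -> exists g, lattice_generator g.
Proof.
move=> al0 be0.
pose L n f (A B : {poly {poly k}}) := [/\ f != 0, f * al = ev2 xi eta A, f * be = ev2 xi eta B & size A = n].
have [P [Q [Q0 Ea]]] := coords_frac C al; have [P' [Q' [Q'0 Eb]]] := coords_frac C be.
have L0 : L (size (P * Q')) (ev2 xi eta Q * ev2 xi eta Q') (P * Q') (P' * Q).
  split; rewrite ?mulf_neq0 // ?Ea ?Eb ev2M; first by field.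
  by field.
have [n [[f1 [A1 [B1 L1]]] minn]] := @nat_least (fun n => exists f A B, L n f A B)
  (ex_intro _ _ (ex_intro _ _ (ex_intro _ _ (ex_intro _ _ L0)))).
have [d [[f [A [B [LA dA]]]] mind]] := @nat_least (fun d => exists f A B, L n f A B /\ size (lead_coef A) = d)
  (ex_intro _ _ (ex_intro _ f1 (ex_intro _ A1 (ex_intro _ B1 (conj L1 erefl))))).
have [f0 EA EB sA] := LA.
have A0 : A != 0.
  by apply: contra_neq (mulf_neq0 f0 al0) => A0; rewrite EA A0 ev2_0.
have c0 : lead_coef A != 0 by rewrite lead_coef_eq0.
have ev1n q : q != 0 -> ev1 xi q != 0.
  by move=> q0; apply: contra_neq q0 => E; have := proj1 C q%:P; rewrite ev2C => /(_ E)/eqP; rewrite polyC_eq0 => /eqP.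
(* f' / f is a polynomial up to a denominator c in k[xi]. At a root r of c, either q vanishes on xi
   = r and a factor cancels, or A and B both vanish there, against the choice of f. *)
suff H N (c : {poly k}) (q : {poly {poly k}}) f' : (size c <= N)%N -> c != 0 -> affine xi eta (f' * al) -> affine xi eta (f' * be) ->
    ev1 xi c * f' = ev2 xi eta q * f -> affine xi eta (f' / f).
  exists f; split=> // [||f' [A' EA'] [B' EB']]; [by exists A|by exists B|].
  pose c := lead_coef A ^+ scalp A' A; pose q := A' %/ A.
  apply: (H (size c) c q) => //; first by rewrite expf_neq0.
  - by exists A'.
  - by exists B'.
  apply/eqP; rewrite -subr_eq0; apply: contraT => R0.
  have ER : (ev1 xi c * f' - ev2 xi eta q * f) * al = ev2 xi eta (A' %% A).
    have E := Pdiv.Idomain.divp_eq A' A.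
    have -> : A' %% A = c%:P * A' - q * A by rewrite mul_polyC E addrC addKr.
    by rewrite ev2B !ev2M ev2C -EA -EA'; ring.
  have := minn (size (A' %% A)); rewrite leqNgt -sA ltn_modp A0 => /(_ _)/negP; case=> //.
  exists (ev1 xi c * f' - ev2 xi eta q * f), (A' %% A), (c%:P * B' - q * B); split=> //.
  by rewrite ev2B !ev2M ev2C -EB -EB'; ring.
elim: N c q => [|N IH] c q; first by rewrite leqn0 size_poly_eq0 => /eqP ->; rewrite eqxx.
move=> sc cn0 [A' EA'] [B' EB'] E.
have [s1|s1] := eqVneq (size c) 1%N.
  have [e e0 Ec] : exists2 e, e != 0 & c = e%:P by apply/size_poly1P; rewrite s1.
  have -> : f' / f = iota e^-1 * ev2 xi eta q.
    apply: (mulIf f0); rewrite divfK // -mulrA -E Ec ev1C mulrA -rmorphM mulVf //.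
    by rewrite rmorph1 mul1r.
  by apply: (subr_M (affine_sub xi eta)); [exact: (subr_c (affine_sub xi eta))|exists q].
have [r /factor_theorem [c1 Ec]] := closed_rootP _ s1.
have c10 : c1 != 0 by apply: contraNneq cn0 => c10; rewrite Ec c10 mul0r.
have sc1 : (size c1 <= N)%N.
  by move: sc; rewrite Ec size_Mmonic ?monicXsubC // size_XsubC addn2.
have xr0 : ev1 xi ('X - r%:P) != 0 by apply: ev1n; rewrite polyXsubC_eq0.
have EqA : c%:P * A' = q * A.
  apply: ev_inj; rewrite !ev2M ev2C -EA' -EA mulrA E; ring.
have EqB : c%:P * B' = q * B.
  apply: ev_inj; rewrite !ev2M ev2C -EB' -EB mulrA E; ring.
have at_r (P1 Q1 : {poly {poly k}}) : c%:P * P1 = Q1 -> map_poly (horner^~ r) Q1 = 0.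
  move=> <-; rewrite -[horner^~ r]/(horner_eval r) rmorphM /= map_polyC /= /horner_eval Ec hornerM hornerXsubC subrr mulr0.
  by rewrite mul0r.
have qA0 := at_r _ _ EqA; have qB0 := at_r _ _ EqB.
rewrite -[horner^~ r]/(horner_eval r) rmorphM /= in qA0; rewrite -[horner^~ r]/(horner_eval r) rmorphM /= in qB0.
have [q0|q0] := eqVneq (map_poly (horner_eval r) q) 0.
  have [q1 Eq] := fst_divides q0.
  apply: (IH c1 q1) => //; [by exists A'|by exists B'|].
  by apply: (mulfI xr0); rewrite !mulrA -ev1M [_ * c1]mulrC -Ec E Eq ev2M ev2C.
exfalso; move/eqP: qA0; rewrite mulf_eq0 (negPf q0) /= => /eqP/fst_divides [A2 EA2].
move/eqP: qB0; rewrite mulf_eq0 (negPf q0) /= => /eqP/fst_divides [B2 EB2].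
have Xr : 'X - r%:P != 0 :> {poly k} by rewrite polyXsubC_eq0.
have lA : lead_coef A = ('X - r%:P) * lead_coef A2 by rewrite EA2 lead_coefM lead_coefC.
have A20 : lead_coef A2 != 0 by apply: contraNneq c0 => H0; rewrite lA H0 mulr0.
have := mind (size (lead_coef A2)); rewrite -dA lA mulrC size_Mmonic ?monicXsubC // size_XsubC addn2 ltnn.
move=> /(_ _)/notF; apply; exists (f / ev1 xi ('X - r%:P)), A2, B2; split=> //; split.
- by rewrite mulf_neq0 ?invr_eq0.
- by rewrite mulrAC EA EA2 ev2M ev2C mulrC mulKf.
- by rewrite mulrAC EB EB2 ev2M ev2C mulrC mulKf.
by rewrite -sA EA2 mul_polyC size_scale.
Qed.

Lemma lattice_generator_ex : al != 0 \/ be != 0 -> exists g, lattice_generator g.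
Proof.
have sA := affine_sub xi eta; have [A0 A1] := (subr_0 sA, subr_1 sA).
have [al0|al0] := eqVneq al 0.
  case=> // be0; exists be^-1; split; rewrite ?invr_eq0 ?al0 ?mulr0 ?mulVf // => f _.
  by rewrite invrK.
have [be0|be0] := eqVneq be 0; last by move=> _; exact: lattice_generator_both.
move=> _; exists al^-1; split; rewrite ?invr_eq0 ?be0 ?mulr0 ?mulVf // => f.
by rewrite invrK.
Qed.

(** After multiplication by denominators Q that are units at p, f is a polynomial multiple of g, so
    a zero of g (al, be) at p would be one of f (al, be). *)
Lemma lattice_generator_at cs (p : point iota cs) g f : chart p = [:: xi; eta] -> lattice_generator g ->
  stalk p (f * al) -> stalk p (f * be) -> ~ (maximal_ideal p (f * al) /\ maximal_ideal p (f * be)) ->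
  ~ (maximal_ideal p (g * al) /\ maximal_ideal p (g * be)).
Proof.
move=> Ep [g0 Ga Gb Gm] pa pb nM; have lp := stalk_local p; have sp := loc_sub lp.
have [px pe H] := plane_stalkP Ep.
have [P1 [Q1 [nQ1 E1]]] := H _ pa; have [P2 [Q2 [nQ2 E2]]] := H _ pb.
have Q10 := loc_neq0 lp nQ1; have Q20 := loc_neq0 lp nQ2.
have ap h : affine xi eta h -> stalk p h by exact: affine_min.
pose Q := ev2 xi eta Q1 * ev2 xi eta Q2.
have pQ : stalk p Q by apply: (subr_M sp); apply: ap; eexists.
have nQ : ~ maximal_ideal p Q.
  by move=> /(loc_prime lp _ _) []; [apply: ap; eexists|apply: ap; eexists| |].
have Q0 := loc_neq0 lp nQ.
have /ap pq : affine xi eta (Q * f / g).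
  apply: Gm; rewrite -mulrA ?E1 ?E2.
    by exists (Q2 * P1); rewrite ev2M /Q; field.
  by exists (Q1 * P2); rewrite ev2M /Q; field.
have down u : maximal_ideal p (g * u) -> maximal_ideal p (f * u).
  move=> Mu; have -> : f * u = Q^-1 * (Q * f / g * (g * u)) by field; apply/andP.
  by apply: (loc_Ml lp); [exact: (loc_V lp)|exact: (loc_Ml lp)].
by move=> [/down Ma /down Mb]; apply: nM.
Qed.
End Generator.

(** The localization S[1/u]. *)
Definition away (S : K -> Prop) u h := exists N, S (u ^+ N * h).

Lemma away_sub S u : subring iota S -> S u -> subring iota (away S u).
Proof.
move=> sS Su; have SX N : S (u ^+ N) by exact: (subr_X sS).
split=> [c|h h' [N Sh] [N' Sh']|h h' [N Sh] [N' Sh']].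
- by exists 0%N; rewrite mul1r; exact: (subr_c sS).
- exists (N + N')%N; rewrite mulrDr; apply: (subr_D sS).
    by rewrite exprD mulrAC mulrC; apply: (subr_M sS).
  by rewrite exprD -mulrA; apply: (subr_M sS).
- by exists (N + N')%N; rewrite exprD mulrACA; apply: (subr_M sS).
Qed.

Lemma away_in (S : K -> Prop) u h : S h -> away S u h.
Proof. by move=> Sh; exists 0%N; rewrite mul1r. Qed.

Lemma away_V S u : subring iota S -> u != 0 -> away S u u^-1.
Proof. by move=> sS u0; exists 1%N; rewrite expr1 mulfV //; exact: (subr_1 sS). Qed.

Lemma divisor_power (p q : {poly k}) n : p * q = 'X^n -> exists c i, c != 0 /\ p = c%:P * 'X^i.
Proof.
elim: n p q => [|n IH] p q E.
  have : size (p * q) == 1%N by rewrite E size_poly1.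
  rewrite size_mul_eq1 => /andP [/size_poly1P [c c0 ->] _].
  by exists c, 0%N; rewrite mulr1.
have n0 (r : {poly k}) : root r 0 -> exists r1, r = r1 * 'X.
  by move=> /factor_theorem [r1 ->]; exists r1; rewrite subr0.
have X0 : 'X != 0 :> {poly k} by rewrite polyX_eq0.
have := congr1 (horner^~ 0) E; rewrite hornerM hornerXn expr0n /= => /eqP.
rewrite mulf_eq0 => /orP [] /n0 [r Er].
  have [|c [i [c0 Ei]]] := IH r q; first by apply: (mulIf X0); rewrite -exprSr -E Er; ring.
  by exists c, i.+1; split=> //; rewrite Er Ei exprSr mulrA.
by apply: (IH p r); apply: (mulIf X0); rewrite -exprSr -E Er; ring.
Qed.

Lemma affine_unit xi eta u r r' n : coords xi eta -> u = xi \/ u = eta ->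
  affine xi eta r -> affine xi eta r' -> r * r' = u ^+ n -> exists c i, c != 0 /\ r = iota c * u ^+ i.
Proof.
wlog : xi eta / u = xi => [H C [Eu|Eu] Sr Sr' E|-> {u} C _ [P ->] [Q ->]].
- exact: (H xi eta Eu C (or_introl Eu) Sr Sr' E).
- exact: (H eta xi Eu (coords_swap C) (or_introl Eu) (affine_swap Sr) (affine_swap Sr') E).
have -> : xi ^+ n = ev2 xi eta ('X^n)%:P by rewrite ev2C ev1_exp ev1X.
rewrite -ev2M => /(coords_inj C) E.
have PQ0 : P * Q != 0 by rewrite E polyC_eq0 expf_neq0 ?polyX_eq0.
have := size_polyC ('X^n : {poly k}); rewrite -E expf_neq0 ?polyX_eq0 //= => s1.
have : size (P * Q) == 1%N by rewrite s1.
rewrite size_mul_eq1 => /andP [/size_poly1P [p p0 EP] /size_poly1P [q q0 EQ]].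
move: E; rewrite EP EQ -polyCM => /polyC_inj /divisor_power [c [i [c0 ->]]].
by exists c, i; split=> //; rewrite ev2C ev1M ev1C ev1_exp ev1X.
Qed.

(** On the overlap, where u is invertible, g and g' generate the same module; so g' / g is a unit of
    k[xi, eta][1/u], that is, a constant times a power of u. *)
Lemma transition al be al' be' xi eta xi' eta' u g g' : coords xi eta -> u = xi \/ u = eta ->
  lattice_generator xi eta al be g -> lattice_generator xi' eta' al' be' g' ->
  affine xi' eta' u^-1 ->
  away (affine xi eta) u xi' -> away (affine xi eta) u eta' ->
  away (affine xi' eta') u^-1 xi -> away (affine xi' eta') u^-1 eta ->
  (forall T, subring iota T -> T xi -> T eta -> T u^-1 -> forall f, T (f * al) -> T (f * be) -> T (f * al') /\ T (f * be')) ->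
  (forall T, subring iota T -> T xi' -> T eta' -> T u -> forall f, T (f * al') -> T (f * be') -> T (f * al) /\ T (f * be)) ->
  exists c (i : int), c != 0 /\ g' = iota c * u ^ i * g.
Proof.
move=> C uE [g0 Ga Gb Gm] [g'0 Ga' Gb' Gm'] Su' Txi' Teta' T'xi T'eta Hd Hd'.
have u0 : u != 0 by case: uE => ->; [exact: coords_x0 C|exact: coords_z0 C].
have sS := affine_sub xi eta; have sS' := affine_sub xi' eta'.
have Su : affine xi eta u by case: uE => ->; [exact: affine_fst|exact: affine_snd].
have sT := away_sub sS Su; have sT' := away_sub sS' Su'.
have TV := away_V sS u0.
have T'u : away (affine xi' eta') u^-1 u by have := away_V sS' (invr_neq0 u0); rewrite invrK.
have T'V : away (affine xi' eta') u^-1 u^-1 by exact: away_in.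
have Tu : away (affine xi eta) u u by exact: away_in.
have TT' h : away (affine xi eta) u h -> away (affine xi' eta') u^-1 h.
  move=> [N Sh]; have := affine_min sT' T'xi T'eta Sh => Th.
  have -> : h = u^-1 ^+ N * (u ^+ N * h) by rewrite mulrA -exprMn mulVf // expr1n mul1r.
  by apply: (subr_M sT') => //; exact: (subr_X sT').
have T'T h : away (affine xi' eta') u^-1 h -> away (affine xi eta) u h.
  move=> [N Sh]; have := affine_min sT Txi' Teta' Sh => Th.
  have -> : h = u ^+ N * (u^-1 ^+ N * h) by rewrite mulrA -exprMn mulfV // expr1n mul1r.
  by apply: (subr_M sT) => //; exact: (subr_X sT).
have common S v a b : subring iota S -> S v -> away S v a -> away S v b -> exists N, S (v ^+ N * a) /\ S (v ^+ N * b).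
  move=> sS1 Sv [N SN] [N' SN']; have SX M : S (v ^+ M) by exact: (subr_X sS1).
  exists (N + N')%N; split; first by rewrite exprD mulrAC mulrC; exact: (subr_M sS1).
  by rewrite exprD -mulrA; exact: (subr_M sS1).
have T1 : away (affine xi eta) u (g / g').
  have [Ta Tb] := Hd _ sT (away_in _ (affine_fst xi eta)) (away_in _ (affine_snd xi eta)) TV g (away_in _ Ga) (away_in _ Gb).
  have [N [Na Nb]] := common _ _ _ _ sS' Su' (TT' _ Ta) (TT' _ Tb).
  rewrite !mulrA in Na Nb; apply: T'T; exists N; rewrite mulrA; exact: Gm'.
have T2 : away (affine xi eta) u (g' / g).
  have [Ta Tb] := Hd' _ sT' (away_in _ (affine_fst xi' eta')) (away_in _ (affine_snd xi' eta')) T'u g' (away_in _ Ga') (away_in _ Gb').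
  have [N [Na Nb]] := common _ _ _ _ sS Su (T'T _ Ta) (T'T _ Tb).
  by rewrite !mulrA in Na Nb; exists N; rewrite mulrA; exact: Gm.
have [N S1] := T1; have [N' S2] := T2.
have [|c [i [c0 E]]] := affine_unit C uE S2 S1 (n := N' + N).
  by rewrite exprD; field; apply/andP.
exists c, (i%:Z - N'%:Z); split=> //; rewrite expfzDr // -mulrA -exprnN -exprnP.
transitivity (u ^+ N' * (g' / g) * (u ^- N' * g)); first by field; rewrite g0 expf_neq0.
by rewrite E; ring.
Qed.
End Lattice.

(** * Degrees of the vector field *)
Section VectorField.
Variables (k : closedFieldType) (K : fieldType) (iota : {rmorphism k -> K}).
Local Notation ev1 := (@ev1 k K iota).
Local Notation ev2 := (@ev2 k K iota).
Local Notation coords := (@coords k K iota).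
Variable D : K -> K.
Hypothesis dD : der iota D.

Definition generator xi eta g := lattice_generator iota xi eta (D xi) (D eta) g.

Lemma der_expn u n : u != 0 -> D (u ^+ n) = n%:R * u ^+ n / u * D u.
Proof.
move=> u0; case: n => [|n]; first by rewrite expr0 (der_1 dD) !mul0r.
by rewrite (der_X dD) exprSr; field.
Qed.

Lemma der_ruled x z e : x != 0 -> D x^-1 = - D x / x ^+ 2 /\
  D (z / x ^+ e) = D z / x ^+ e - e%:R * (z / x ^+ e) / x * D x.
Proof.
move=> x0; have xe : x ^+ e != 0 by rewrite expf_neq0.
split; first by rewrite (der_V dD) // expr2; field.
by rewrite (der_div dD) // der_expn //; field; rewrite x0 xe.
Qed.

Lemma transition_inf x z g g' : coords x z -> generator x z g -> generator x z^-1 g' ->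
  exists c (i : int), c != 0 /\ g' = iota c * z ^ i * g.
Proof.
move=> C G G'; have z0 := coords_z0 C; have x0 := coords_x0 C.
have sA := affine_sub iota x z; have sA' := affine_sub iota x z^-1.
have [Ax Az] := (affine_fst iota x z, affine_snd iota x z).
have [Ax' Az'] := (affine_fst iota x z^-1, affine_snd iota x z^-1).
have Dy : D z^-1 = - (z^-1 ^+ 2 * D z) by rewrite (der_V dD) // expr2; field.
apply: (transition C _ G G' Az').
- by right.
- exact: away_in.
- exact: (away_V sA z0).
- exact: away_in.
- by have := away_V sA' (invr_neq0 z0); rewrite invrK.
- move=> T sT Tx Tz TV f Ta Tb; split=> //; rewrite Dy mulrN; apply: (subr_N sT).
  by rewrite mulrCA; apply: (subr_M sT) => //; exact: (subr_X sT).
- move=> T sT Tx TV Tz f Ta Tb; split=> //.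
  have -> : f * D z = - (z ^+ 2 * (f * D z^-1)) by rewrite Dy; field.
  by apply: (subr_N sT); apply: (subr_M sT) => //; exact: (subr_X sT).
Qed.

Lemma transition_base x z e g g' : coords x z -> generator x z g -> generator x^-1 (z / x ^+ e) g' ->
  exists c (i : int), c != 0 /\ g' = iota c * x ^ i * g.
Proof.
move=> C G G'; have z0 := coords_z0 C; have x0 := coords_x0 C; have xe : x ^+ e != 0 by rewrite expf_neq0.
have sA := affine_sub iota x z; have sA' := affine_sub iota x^-1 (z / x ^+ e).
have [Ax Az] := (affine_fst iota x z, affine_snd iota x z).
have [Ax' Az'] := (affine_fst iota x^-1 (z / x ^+ e), affine_snd iota x^-1 (z / x ^+ e)).
have xV0 : x^-1 != 0 by rewrite invr_eq0.
have [Dx' Dz'] := der_ruled z e x0.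
have Ex : x^-1^-1 = x by rewrite invrK.
have Ez : z / x ^+ e / x^-1 ^+ e = z by rewrite exprVn invrK divfK.
have [Dx Dz] := der_ruled (z / x ^+ e) e xV0; rewrite Ex Ez in Dx Dz.
have sT := away_sub sA Ax; have sT' := away_sub sA' Ax'.
have half T (y w y1 w1 : K) : subring iota T -> T y -> T w -> T y^-1 -> D y1 = - D y / y ^+ 2 ->
    D w1 = D w / y ^+ e - e%:R * w1 / y * D y -> w1 = w / y ^+ e ->
    forall f, T (f * D y) -> T (f * D w) -> T (f * D y1) /\ T (f * D w1).
  move=> sT1 Ty Tw TV E1 E2 E3 f Ta Tb; have TX n : T (y^-1 ^+ n) by exact: (subr_X sT1).
  split.
    have -> : f * D y1 = - (y^-1 ^+ 2 * (f * D y)) by rewrite E1 exprVn; ring.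
    by apply: (subr_N sT1); exact: (subr_M sT1).
  have -> : f * D w1 = y^-1 ^+ e * (f * D w) - e%:R * (w * y^-1 ^+ e) * y^-1 * (f * D y).
    by rewrite E2 E3 !exprVn; ring.
  apply: (subr_B sT1); apply: (subr_M sT1) => //; apply: (subr_M sT1) => //.
  by apply: (subr_M sT1); [exact: (subr_n sT1)|exact: (subr_M sT1)].
have TV := away_V sA x0.
have T'x : away (affine iota x^-1 (z / x ^+ e)) x^-1 x by have := away_V sA' xV0; rewrite invrK.
apply: (transition C _ G G' Ax').
- by left.
- exact: TV.
- by apply: (subr_M sT); [exact: away_in|rewrite -exprVn; exact: (subr_X sT)].
- exact: T'x.
- rewrite -[X in away _ _ X](divfK xe z); apply: (subr_M sT'); [exact: away_in|exact: (subr_X sT')].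
- by move=> T sT1 Tx Tz TV1; apply: half.
- move=> T sT1 Tx Tz TV1; apply: half; rewrite ?invrK //.
Qed.

Lemma transition_plane x z g g' : coords x z -> generator x z g -> generator z^-1 (x / z) g' ->
  exists c (i : int), c != 0 /\ g' = iota c * z ^ i * g.
Proof.
move=> C G G'; have z0 := coords_z0 C; have x0 := coords_x0 C.
have sA := affine_sub iota x z; have sA' := affine_sub iota z^-1 (x / z).
have [Ax Az] := (affine_fst iota x z, affine_snd iota x z).
have [As At] := (affine_fst iota z^-1 (x / z), affine_snd iota z^-1 (x / z)).
have sT := away_sub sA Az; have sT' := away_sub sA' As.
have Ds : D z^-1 = - (z^-1 ^+ 2 * D z) by rewrite (der_V dD) // expr2; field.
have Dt : D (x / z) = z^-1 * D x - x * z^-1 ^+ 2 * D z by rewrite (der_div dD) //; field.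
have T'z : away (affine iota z^-1 (x / z)) z^-1 z by have := away_V sA' (invr_neq0 z0); rewrite invrK.
apply: (transition C _ G G' As).
- by right.
- exact: (away_V sA z0).
- by apply: (subr_M sT); [exact: away_in|exact: (away_V sA z0)].
- by rewrite -[X in away _ _ X](divfK z0 x); apply: (subr_M sT') => //; exact: away_in.
- exact: T'z.
- move=> T sT1 Tx Tz TV f Ta Tb; have TX n : T (z^-1 ^+ n) by exact: (subr_X sT1).
  split.
    have -> : f * D z^-1 = - (z^-1 ^+ 2 * (f * D z)) by rewrite Ds; ring.
    by apply: (subr_N sT1); exact: (subr_M sT1).
  have -> : f * D (x / z) = z^-1 * (f * D x) - x * z^-1 ^+ 2 * (f * D z) by rewrite Dt; ring.
  by apply: (subr_B sT1); apply: (subr_M sT1) => //; exact: (subr_M sT1).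
- move=> T sT1 Ts Tt Tz f Ta Tb; have TX n : T (z ^+ n) by exact: (subr_X sT1).
  have Ez : f * D z = - (z ^+ 2 * (f * D z^-1)) by rewrite Ds; field.
  have Tfz : T (f * D z) by rewrite Ez; apply: (subr_N sT1); exact: (subr_M sT1).
  split=> //; have -> : f * D x = z * (f * D (x / z)) + x / z * (f * D z) by rewrite Dt; field.
  by apply: (subr_D sT1); exact: (subr_M sT1).
Qed.
End VectorField.

Section Reversal.
Variables (k : closedFieldType) (K : fieldType) (iota : {rmorphism k -> K}).
Local Notation ev1 := (@ev1 k K iota).
Local Notation ev2 := (@ev2 k K iota).
Local Notation coords := (@coords k K iota).

(** Multiplied by a large power of z, this is an identity of polynomials, in which coefficient j of
    P meets coefficient m - j of P'. *)
Lemma reversal x z (m : int) (P P' : {poly {poly k}}) : coords x z ->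
  ev2 x z P = z ^ m * ev2 x z^-1 P' -> forall j : nat, P`_j = if j%:Z <= m then P'`_(`|m - j%:Z|)%N else 0.
Proof.
move=> C E; have z0 := coords_z0 C.
pose M := (absz m + size P')%N; pose d := absz (m + M%:Z).
have dE : d%:Z = m + M%:Z by rewrite /d gez0_abs // /M; lia.
have sd : (size P' <= d)%N by move: dE; rewrite /M; lia.
have EP : 'X^M * P = \sum_(l < size P') P'`_l *: 'X^(d - l).
  apply: (coords_inj C); rewrite ev2M ev2_exp ev2X E (ev2E _ x z^-1) rmorph_sum mulrA mulr_sumr /=.
  apply: eq_bigr => l _; rewrite -mul_polyC ev2M ev2C ev2_exp ev2X mulrCA; congr (_ * _).
  have ld : (l <= d)%N by apply: leq_trans sd; exact: ltnW.
  rewrite exprVn exprnN !exprnP -!expfzDr //; congr (_ ^ _); lia.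
move=> j; have := congr1 (fun Q : {poly {poly k}} => Q`_(j + M)) EP.
rewrite mulrC coefMXn ltnNge leq_addl /= addnK coef_sum => ->.
case: ifP => [le|nle]; last first.
  apply: big1 => l _; rewrite coefZ coefXn; case: eqP => [H|_]; last by rewrite mulr0.
  by exfalso; have := ltn_ord l; move: H nle dE sd; lia.
have H l : (l < size P')%N -> (j + M == d - l)%N = (l == `|m - j%:Z|)%N.
  by move=> lt; apply/eqP/eqP; move: le dE sd lt; lia.
have [lt|ge] := ltnP (absz (m - j%:Z)) (size P').
  rewrite (bigD1 (Ordinal lt)) //= coefZ coefXn H // eqxx mulr1 big1 ?addr0 // => l ne.
  by rewrite coefZ coefXn H // -[X in X == _]/(val l) -[X in _ == X]/(val (Ordinal lt)) val_eqE (negPf ne) mulr0.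
rewrite nth_default // big1 // => l _; rewrite coefZ coefXn H //.
by rewrite (ltn_eqF (leq_trans (ltn_ord l) ge)) mulr0.
Qed.

(* Bihomogeneous degrees of the coefficients of a vector field                 *)
(* A d/dx + B d/dz without zeros on the fibers of x.                           *)
Definition saturated_degrees d m (A B : {poly {poly k}}) :=
  [/\ forall j, (m < j)%N -> A`_j = 0, forall j, (m + d < j)%N -> B`_j = 0,
      forall c, ~ ((A`_m).[c] = 0 /\ (B`_(m + d)).[c] = 0) &
      forall c y, ~ ((map_poly (horner^~ c) A).[y] = 0 /\ (map_poly (horner^~ c) B).[y] = 0)].

Lemma point_at xi eta c d : coords xi eta -> exists p : point iota [:: [:: xi; eta]],
  maximal_ideal p (xi - iota c) /\ maximal_ideal p (eta - iota d).
Proof.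
move=> C; pose y (i : 'I_(size [:: xi; eta])) := if i == 0%N :> nat then c else d.
exists (affine_point (coords_indep C) y); split.
  exact: (chart_max (affine_point (coords_indep C) y) (ord0 : 'I_2)).
exact: (chart_max (affine_point (coords_indep C) y) (lift ord0 ord0 : 'I_2)).
Qed.

Lemma ev1_at (R M : K -> Prop) x c q : local_ring iota R M -> M (x - iota c) -> M (ev1 x q - iota q.[c]).
Proof.
move=> lR Mx; have Rx : R x.
  by rewrite -(subrK (iota c) x); apply: (subr_D (loc_sub lR)); [exact: (loc_R lR)|exact: (subr_c (loc_sub lR))].
elim/poly_ind: q => [|q d IH]; first by rewrite ev1_0 horner0 rmorph0 subrr; exact: (loc_0 lR).
rewrite ev1D ev1M ev1X ev1C hornerMXaddC rmorphD rmorphM /= opprD addrACA subrr addr0.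
have -> : ev1 x q * x - iota q.[c] * iota c = (ev1 x q - iota q.[c]) * x + iota q.[c] * (x - iota c) by ring.
apply: (loc_D lR); first exact: (loc_Mr lR).
by apply: (loc_Ml lR) => //; exact: (subr_c (loc_sub lR)).
Qed.

Lemma ev2_at (R M : K -> Prop) x z c d P : local_ring iota R M -> M (x - iota c) -> M (z - iota d) ->
  M (ev2 x z P - iota (map_poly (horner^~ c) P).[d]).
Proof.
move=> lR Mx Mz; have Rz : R z.
  by rewrite -(subrK (iota d) z); apply: (subr_D (loc_sub lR)); [exact: (loc_R lR)|exact: (subr_c (loc_sub lR))].
by have := loc_D lR (ev2_fst lR P Rz Mx) (ev1_at (map_poly (horner^~ c) P) lR Mz); rewrite addrA subrK.
Qed.

Section Degrees.
Variables (D : K -> K) (x z : K).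
Hypothesis dD : der iota D.
Hypothesis C : coords x z.

Definition nonvanishing xi eta (p : point iota [:: [:: xi; eta]]) := exists f,
  [/\ stalk p (f * D xi), stalk p (f * D eta) &
    ~ (maximal_ideal p (f * D xi) /\ maximal_ideal p (f * D eta))].

Hypothesis G : generator iota D x z 1.
Hypothesis nv : forall p : point iota [:: [:: x; z]], nonvanishing p.
Hypothesis Dxz : D x != 0 \/ D z != 0.
Variables A B : {poly {poly k}}.
Hypothesis EA : D x = ev2 x z A.
Hypothesis EB : D z = ev2 x z B.

Lemma nonvanishing_affine c y : ~ ((map_poly (horner^~ c) A).[y] = 0 /\ (map_poly (horner^~ c) B).[y] = 0).
Proof.
move=> [A0 B0]; have [p [Mx Mz]] := point_at c y C; have [f [p1 p2 np]] := nv p.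
have lp := stalk_local p; apply: (lattice_generator_at (chart1 p) G p1 p2 np).
have := ev2_at A lp Mx Mz; have := ev2_at B lp Mx Mz.
by rewrite A0 B0 rmorph0 !subr0 !mul1r EA EB.
Qed.

(** In the coordinate y = 1/z the saturated field is c z^i D, and Dy = - z^-2 Dz. Its polynomiality
    bounds the degrees of A and B by m = -i and m + 2; its nonvanishing on y = 0 keeps the top
    coefficients without common zero. *)
Lemma degrees_ruled : D x != 0 -> (forall p : point iota [:: [:: x; z^-1]], nonvanishing p) ->
  exists m, saturated_degrees 2 m A B.
Proof.
move=> Dx0 nv'; have z0 := coords_z0 C; have C' := coords_inv2 C.
have [g' G'] := lattice_generator_ex C' (or_introl Dx0 : D x != 0 \/ D z^-1 != 0).
have [c [i [c0 Eg]]] := transition_inf dD C G G'; rewrite mulr1 in Eg.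
have [_ [P' EP] [Q' EQ] _] := G'.
have Dy : D z^-1 = - (z ^ (-2) * D z).
  by rewrite (der_V dD) // -exprnN expr2; field.
have zi0 : z ^ i != 0 by rewrite expfz_neq0.
have ic0 : iota c != 0 by rewrite fmorph_eq0.
have E1 : ev2 x z (c%:P%:P * A) = z ^ (- i) * ev2 x z^-1 P'.
  by rewrite ev2M ev2C ev1C -EA -EP Eg -invr_expz; field.
have E2 : ev2 x z ((- c)%:P%:P * B) = z ^ (- i + 2) * ev2 x z^-1 Q'.
  rewrite ev2M ev2C ev1C rmorphN /= -EB -EQ Eg Dy expfzDr // -invr_expz.
  by rewrite -exprnN -exprnP; field; rewrite z0.
have R1 := reversal C E1; have R2 := reversal C E2.
have cj (P : {poly {poly k}}) e j : (e%:P%:P * P)`_j = e%:P * P`_j by rewrite coefCM.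
have cP0 : c%:P != 0 :> {poly k} by rewrite polyC_eq0.
have cN0 : (- c)%:P != 0 :> {poly k} by rewrite polyC_eq0 oppr_eq0.
have i_le : 0 <= - i.
  have [j Aj] : exists j, A`_j != 0.
    apply: NNPP => H; move/eqP: Dx0; apply; rewrite EA.
    suff -> : A = 0 by rewrite ev2_0.
    apply/polyP => j; rewrite coef0; have [//|Aj] := eqVneq A`_j 0; by case: H; exists j.
  have := R1 j; rewrite cj; case: ifP => [le _|_ /eqP]; first exact: le_trans le.
  by rewrite mulf_eq0 (negPf cP0) (negPf Aj).
have [m Em] : exists m : nat, - i = m%:Z by exists (absz (- i)); rewrite gez0_abs.
exists m; split; last exact: nonvanishing_affine.
- move=> j lt; have := R1 j; rewrite cj Em lez_nat leqNgt lt /= => /eqP.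
  by rewrite mulf_eq0 (negPf cP0) => /eqP.
- move=> j lt; have := R2 j; rewrite cj Em -PoszD lez_nat leqNgt lt /= => /eqP.
  by rewrite mulf_eq0 (negPf cN0) => /eqP.
move=> e [A0 B0].
have := R1 m; rewrite cj Em lexx subrr absz0 => EPm.
have := R2 (m + 2)%N; rewrite cj Em -PoszD lexx subrr absz0 => EQm.
have [p [Mx My]] := point_at e 0 C'; rewrite rmorph0 subr0 in My.
have [f [p1 p2 np]] := nv' p; have lp := stalk_local p.
apply: (lattice_generator_at (chart1 p) G' p1 p2 np).
have at0 (P : {poly {poly k}}) : (P`_0).[e] = 0 -> maximal_ideal p (ev2 x z^-1 P).
  move=> P0; have sp := loc_sub lp; have px : stalk p x by have [] := plane_stalkP (chart1 p).
  rewrite -(subrK (ev1 x P`_0) (ev2 _ _ P)); apply: (loc_D lp); first exact: (ev2_snd P lp px My).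
  by have := ev1_at P`_0 lp Mx; rewrite P0 rmorph0 subr0.
by rewrite EP EQ; split; apply: at0; rewrite -?EPm -?EQm hornerM ?A0 ?B0 mulr0.
Qed.

(** The same at the point of the plane with coordinates 1/z and x/z, where the formula for D(x/z)
    makes the difference of degrees 1. If A were 0, the field would vanish at this point. *)
Lemma degrees_plane : (forall p : point iota [:: [:: z^-1; x / z]],
    maximal_ideal p z^-1 -> maximal_ideal p (x / z) -> nonvanishing p) ->
  D x != 0 /\ exists m, saturated_degrees 1 m A B.
Proof.
move=> nv'; have z0 := coords_z0 C; have x0 := coords_x0 C; have Cy := coords_inv2 C.
have C' : coords z^-1 (x / z) by apply/coords_inv/coords_div/coords_swap.
have Dy : D z^-1 = - (z^-1 ^+ 2 * D z) by rewrite (der_V dD) // expr2; field.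
have Dt : D (x / z) = z^-1 * D x + x * D z^-1 by rewrite (der_M dD); ring.
have nzD : D z^-1 != 0 \/ D (x / z) != 0.
  have [Dy0|] := eqVneq (D z^-1) 0; last by left.
  right; rewrite Dt Dy0 mulr0 addr0 mulf_neq0 ?invr_eq0 //.
  case: Dxz => // Dz0; move/eqP: Dy0; rewrite Dy oppr_eq0 mulf_eq0 (negPf Dz0) orbF.
  by rewrite expf_eq0 invr_eq0 (negPf z0).
have [g' G'] := lattice_generator_ex C' nzD.
have [c [i [c0 Eg]]] := transition_plane dD C G G'; rewrite mulr1 in Eg.
have [_ AP AQ _] := G'.
have [p [Ms Mt]] := point_at 0 0 C'; rewrite rmorph0 !subr0 in Ms Mt.
have lp := stalk_local p; have [f [p1 p2 np]] := nv' p Ms Mt.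
have npg := lattice_generator_at (chart1 p) G' p1 p2 np.
(* k[1/z, x/z] is contained in k[x, 1/z], with constant terms in 1/z.          *)
pose T h := exists P e, [/\ h = ev2 x z^-1 P, P`_0 = e%:P & maximal_ideal p (h - iota e)].
have sT : subring iota T.
  split=> [e|u v [P [e [-> P0 M1]]] [Q [e' [-> Q0 M2]]]|u v [P [e [-> P0 M1]]] [Q [e' [-> Q0 M2]]]].
  - by exists e%:P%:P, e; rewrite ev2C ev1C coefC eqxx subrr; split=> //; exact: (loc_0 lp).
  - exists (P + Q), (e + e'); rewrite ev2D coefD P0 Q0 polyCD; split=> //.
    by rewrite rmorphD /= opprD addrACA; exact: (loc_D lp).
  - exists (P * Q), (e * e'); rewrite ev2M coef0M P0 Q0 polyCM; split=> //.
    rewrite rmorphM /=; have -> : ev2 x z^-1 P * ev2 x z^-1 Q - iota e * iota e' =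
      (ev2 x z^-1 P - iota e) * (ev2 x z^-1 Q - iota e') + iota e' * (ev2 x z^-1 P - iota e) + iota e * (ev2 x z^-1 Q - iota e') by ring.
    have sp := loc_sub lp; apply: (loc_D lp); [apply: (loc_D lp)|]; apply: (loc_Ml lp) => //.
    + exact: (loc_R lp).
    + exact: (subr_c sp).
    + exact: (subr_c sp).
have Ts : T z^-1 by exists 'X, 0; rewrite ev2X coefX polyC0 (rmorph0 iota) subr0.
have Tt : T (x / z).
  by exists ('X%:P * 'X), 0; rewrite ev2M ev2C ev1X ev2X coefMX polyC0 (rmorph0 iota) subr0.
have [P [e [EP P0 MP]]] := affine_min sT Ts Tt AP.
have [Q [e' [EQ Q0 MQ]]] := affine_min sT Ts Tt AQ.
have nee : ~ (e = 0 /\ e' = 0).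
  by move=> [e0 e'0]; apply: npg; move: MP MQ; rewrite e0 e'0 rmorph0 !subr0.
have zi0 : z ^ i != 0 by rewrite expfz_neq0.
have ic0 : iota c != 0 by rewrite fmorph_eq0.
have E1 : ev2 x z (c%:P%:P * A) = z ^ (- i + 1) * ev2 x z^-1 (Q - 'X%:P * P).
  rewrite ev2M ev2C ev1C ev2B ev2M ev2C ev1X -EA -EP -EQ Eg Dt expfzDr // -invr_expz expr1z.
  by field; rewrite z0.
have E2 : ev2 x z ((- c)%:P%:P * B) = z ^ (- i + 2) * ev2 x z^-1 P.
  rewrite ev2M ev2C ev1C rmorphN /= -EB -EP Eg Dy expfzDr // -invr_expz.
  by rewrite -exprnP; field; rewrite z0.
have R1 := reversal C E1; have R2 := reversal C E2.
have cj (R : {poly {poly k}}) d j : (d%:P%:P * R)`_j = d%:P * R`_j by rewrite coefCM.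
have cP0 : c%:P != 0 :> {poly k} by rewrite polyC_eq0.
have cN0 : (- c)%:P != 0 :> {poly k} by rewrite polyC_eq0 oppr_eq0.
have A0 : A != 0.
  apply: contra_notN nee => /eqP A0; move/eqP: E1; rewrite A0 mulr0 ev2_0 eq_sym mulf_eq0 expfz_eq0 (negPf z0) andbF /=.
  move=> /eqP/(proj1 Cy) QP; have := congr1 (fun R : {poly {poly k}} => R`_0) QP.
  rewrite coefB coefCM P0 Q0 coef0 => /eqP; rewrite subr_eq0 => /eqP Ee.
  have e0 : e = 0 by have := congr1 (fun q : {poly k} => q`_1) Ee; rewrite coefC coefXM coefC.
  split=> //; have := congr1 (fun q : {poly k} => q`_0) Ee; by rewrite e0 polyC0 mulr0 coef0 coefC.
have Dx0 : D x != 0 by rewrite EA; apply: contra_neq A0 => /(proj1 C).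
split=> //.
have i_le : 0 <= - i + 1.
  have [j Aj] : exists j, A`_j != 0.
    apply: NNPP => H; move/eqP: A0; apply; apply/polyP => j; rewrite coef0.
    by have [//|Aj] := eqVneq A`_j 0; case: H; exists j.
  have := R1 j; rewrite cj; case: ifP => [le _|_ /eqP]; first exact: le_trans le.
  by rewrite mulf_eq0 (negPf cP0) (negPf Aj).
have [m Em] : exists m : nat, - i + 1 = m%:Z by exists (absz (- i + 1)); rewrite gez0_abs.
have Em' : - i + 2 = (m + 1)%:Z by rewrite PoszD -Em -addrA.
exists m; split; last exact: nonvanishing_affine.
- move=> j lt; have := R1 j; rewrite cj Em lez_nat leqNgt lt /= => /eqP.
  by rewrite mulf_eq0 (negPf cP0) => /eqP.
- move=> j lt; have := R2 j; rewrite cj Em' lez_nat leqNgt lt /= => /eqP.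
  by rewrite mulf_eq0 (negPf cN0) => /eqP.
move=> d [Ad B0].
have := R1 m; rewrite cj Em lexx subrr absz0 coefB coefCM P0 Q0 => EPm.
have := R2 (m + 1)%N; rewrite cj Em' lexx subrr absz0 P0 => EQm.
have e0 : e = 0.
  by have := congr1 (horner^~ d) EQm; rewrite hornerM B0 mulr0 hornerC.
apply: nee; split=> //; have := congr1 (horner^~ d) EPm.
by rewrite hornerM Ad mulr0 e0 polyC0 mulr0 subr0 hornerC.
Qed.
End Degrees.
End Reversal.

(** * Sylvester resultants *)

Section Sylvester.
Variable R : comNzRingType.
Implicit Types p q : {poly R}.

Definition shifts r N p : 'M[R]_(r, N) := \matrix_(a, j) ('X^a * p)`_j.

(* Rows T^a p (a < n) and T^b q (b < m): p and q have formal degrees m and n.  *)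
Definition sylvester m n p q : 'M[R]_(n + m) := col_mx (shifts n (n + m) p) (shifts m (n + m) q).

(** Row operations; m < n ensures that the rows of p to be added are present in the matrix. *)
Lemma sylvester_shift m n p q u : (m < n)%N ->
  \det (sylvester m n p (q + u *: ('X * p))) = \det (sylvester m n p q).
Proof.
move=> mn; pose S : 'M[R]_(m, n) := \matrix_(b, a) (u *+ (a == b.+1 :> nat)).
have -> : sylvester m n p (q + u *: ('X * p)) = block_mx 1%:M 0 S 1%:M *m sylvester m n p q.
  rewrite /sylvester mul_block_col !mul1mx mul0mx addr0; congr col_mx.
  apply/matrixP => b j; rewrite !mxE.
  have lt : (b.+1 < n)%N by apply: leq_ltn_trans mn; exact: ltn_ord.
  rewrite (bigD1 (Ordinal lt)) //= big1 => [|a ne]; last first.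
    by rewrite !mxE; case: eqP => [E|_]; [case/eqP: ne; apply: val_inj|rewrite mulr0n mul0r].
  rewrite !mxE eqxx addr0 mulrDr coefD addrC; congr (_ + _).
  by rewrite -scalerAr coefZ mulrA -exprSr.
by rewrite det_mulmx det_lblock !det1 !mul1r.
Qed.
End Sylvester.

Lemma sylvester_map (R S : comNzRingType) (f : {rmorphism R -> S}) m n p q :
  f (\det (sylvester m n p q)) = \det (sylvester m n (map_poly f p) (map_poly f q)).
Proof.
rewrite -det_map_mx; congr (\det _); rewrite /sylvester map_col_mx.
by congr col_mx; apply/matrixP => a j; rewrite !mxE -coef_map rmorphM /= map_polyXn.
Qed.

(** The new matrix is the old one between diagonal matrices: column j is scaled by l^j, row a by s
    l^-a or t l^-a. *)
Lemma sylvester_scale (F : fieldType) m n (p q p' q' : {poly F}) s t l : l != 0 ->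
  (forall j, p'`_j = s * l ^+ j * p`_j) -> (forall j, q'`_j = t * l ^+ j * q`_j) ->
  \det (sylvester m n p' q') = s ^+ n * t ^+ m * l ^+ (n * m) * \det (sylvester m n p q).
Proof.
move=> l0 Ep Eq.
pose c (i : 'I_(n + m)) := match split i with inl a => s * l^-1 ^+ a | inr b => t * l^-1 ^+ b end.
have -> : sylvester m n p' q' = diag_mx (\row_i c i) *m sylvester m n p q *m diag_mx (\row_(j < n + m) l ^+ j).
  apply/matrixP => i j; rewrite mul_mx_diag mxE mul_diag_mx !mxE /c.
  have H (r r' : {poly F}) w (a : nat) : (forall j, r'`_j = w * l ^+ j * r`_j) ->
      ('X^a * r')`_j = w * l^-1 ^+ a * ('X^a * r)`_j * l ^+ j.
    move=> E; rewrite !coefXnM; case: ltnP => le; first by rewrite mulr0 mul0r.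
    rewrite E; have -> : l ^+ j = l ^+ (j - a) * l ^+ a by rewrite -exprD subnK.
    by rewrite exprVn; field; rewrite expf_neq0.
  by case: split_ordP => a _; rewrite !mxE; [exact: (H p p')|exact: (H q q')].
rewrite !det_mulmx !det_diag mulrAC; congr (_ * _).
under eq_bigr do rewrite mxE; under [X in _ * X]eq_bigr do rewrite mxE.
rewrite !big_split_ord /=.
have E1 (a : 'I_n) : c (lshift m a) = s * l^-1 ^+ a by rewrite /c (unsplitK (inl a)).
have E2 (b : 'I_m) : c (rshift n b) = t * l^-1 ^+ b by rewrite /c (unsplitK (inr b)).
rewrite (eq_bigr _ (fun a _ => E1 a)) (eq_bigr _ (fun b _ => E2 b)) !big_split /=.
rewrite !prodr_const !card_ord.
have -> : \prod_(i < m) l ^+ (n + i) = l ^+ (n * m) * \prod_(i < m) l ^+ i.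
  by under eq_bigr do rewrite exprD; rewrite big_split /= prodr_const card_ord exprM.
have inv r : \prod_(i < r) l^-1 ^+ i * \prod_(i < r) l ^+ i = 1.
  rewrite -big_split big1 // => i _ /=; rewrite exprVn mulVf ?expf_neq0 //.
transitivity (s ^+ n * t ^+ m * l ^+ (n * m) * (\prod_(i < n) l^-1 ^+ i * \prod_(i < n) l ^+ i)
   * (\prod_(i < m) l^-1 ^+ i * \prod_(i < m) l ^+ i)); first by ring.
by rewrite !inv !mulr1.
Qed.

(** A kernel vector is a relation u p + w q = 0 with deg u < n and deg w < m. As p and q are coprime
    and one of them has full degree, the relation is trivial. *)
Lemma sylvester_neq0 (k : closedFieldType) m n (p q : {poly k}) :
  (size p <= m.+1)%N -> (size q <= n.+1)%N -> ~ (p`_m = 0 /\ q`_n = 0) ->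
  (forall y, ~ (p.[y] = 0 /\ q.[y] = 0)) -> \det (sylvester m n p q) != 0.
Proof.
move=> sp sq top nz; apply/negP => /det0P [v v0].
rewrite -[v]hsubmxK mul_row_col; set u := lsubmx v; set w := rsubmx v => E.
have row r (c : 'rV[k]_r) (f : {poly k}) : c *m shifts r (n + m) f = \row_j (rVpoly c * f)`_j.
  apply/rowP => j; rewrite !mxE; have -> : rVpoly c = \sum_(a < r) c 0 a *: 'X^a.
    by rewrite /rVpoly poly_def; apply: eq_bigr => a _; rewrite insubT //= => lt; congr (c 0 _ *: _); apply: val_inj.
  by rewrite mulr_suml coef_sum; apply: eq_bigr => a _; rewrite !mxE -scalerAl coefZ.
have E0 : rVpoly u * p + rVpoly w * q = 0.
  apply/polyP => j; rewrite coef0; have [lt|ge] := ltnP j (n + m).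
    have := congr1 (fun M : 'rV_(n + m) => M 0 (Ordinal lt)) E.
    by rewrite !row !mxE coefD.
  have big (f g : {poly k}) i i' : (size f <= i)%N -> (size g <= i'.+1)%N -> (i + i' <= j)%N -> (f * g)`_j = 0.
    move=> sf sg le; rewrite nth_default //; have := size_polyMleq f g.
    by move: (size (f * g)) (size f) (size g) sf sg le => A B D; lia.
  rewrite coefD (big _ _ n m) ?size_poly // (big _ _ m n) ?size_poly ?addr0 //.
  by rewrite addnC.
have cop : coprimep p q.
  rewrite /coprimep; apply: contraT => /closed_rootP [y].
  by rewrite root_gcd => /andP [/rootP py /rootP qy]; case: (nz y).
have uw : rVpoly u = 0 -> rVpoly w = 0 -> False.
  move=> u0 w0; move/eqP: v0; apply; rewrite -[v]hsubmxK -/u -/w.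
  by rewrite -(rVpolyK u) -(rVpolyK w) u0 w0 !linear0 row_mx0.
have dv (f g a b : {poly k}) r : coprimep f g -> a * f + b * g = 0 -> (size b <= r)%N -> f`_r != 0 -> b = 0.
  move=> fg Ea sb fr; apply/eqP; apply: contraT => b0.
  have /(dvdp_leq b0) : f %| b.
    rewrite -(Gauss_dvdpl _ fg) //; have -> : b * g = - a * f by apply/eqP; rewrite mulNr -addr_eq0 addrC Ea.
    exact: dvdp_mulIr.
  by move=> le; move: fr; rewrite (nth_default 0 (leq_trans le sb)) eqxx.
have [pm|pm] := eqVneq p`_m 0.
  have qn : q`_n != 0 by apply/eqP => qn; apply: top.
  have u0 : rVpoly u = 0.
    apply: (dv q p (rVpoly w) (rVpoly u) n) => //; [by rewrite coprimep_sym|by rewrite addrC|exact: size_poly].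
  apply: uw => //; move/eqP: E0; rewrite u0 mul0r add0r mulf_eq0 => /orP [/eqP //|/eqP q0].
  by rewrite q0 coef0 eqxx in qn.
have w0 : rVpoly w = 0 by apply: (dv p q (rVpoly u) (rVpoly w) m) => //; exact: size_poly.
apply: uw => //; move/eqP: E0; rewrite w0 mul0r addr0 mulf_eq0 => /orP [/eqP //|/eqP p0].
by rewrite p0 coef0 eqxx in pm.
Qed.

(** * Comparison with the fiber over infinity *)

Section FiberAtInfinity.
Variables (k : closedFieldType) (K : fieldType) (iota : {rmorphism k -> K}).
Local Notation ev1 := (@ev1 k K iota).
Local Notation ev2 := (@ev2 k K iota).
Local Notation coords := (@coords k K iota).
Variables x z : K.
Hypothesis C : coords x z.
Let x0 : x != 0 := coords_x0 C.

Lemma constant_power c (i : int) : c != 0 -> x ^ i = iota c -> i = 0.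
Proof.
move=> c0; wlog i0 : i c c0 / 0 <= i => [H E|].
  case: (lerP 0 i) => le; first exact: (H i c).
  apply/eqP; rewrite -oppr_eq0; apply/eqP; apply: (H (- i) c^-1); rewrite ?invr_eq0 ?oppr_ge0 ?ltW //.
  by rewrite -invr_expz E fmorphV.
case: i i0 => // [[|n]] _ // E; exfalso.
have : ev2 x z ('X^(n.+1) - c%:P)%:P = 0.
  by rewrite ev2C ev1B ev1_exp ev1X ev1C -exprnP in E *; rewrite E subrr.
move/(proj1 C)/eqP; rewrite polyC_eq0 subr_eq0 => /eqP/(congr1 (fun q : {poly k} => q`_0)).
by rewrite coefXn coefC /= => /esym/eqP; rewrite (negPf c0).
Qed.

(** Both sides are polynomials in z over k[x, 1/x], and z^j on the right carries the factor x^(-e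
    j). *)
Lemma base_coefs e (n : int) (P P' : {poly {poly k}}) :
  ev2 x z P = x ^ n * ev2 x^-1 (z / x ^+ e) P' ->
  forall j : nat, ev1 x P`_j = x ^ (n - (e * j)%:Z) * ev1 x^-1 P'`_j.
Proof.
move=> E; pose S h := exists q, h = ev1 x q.
have sS : subring iota S.
  split=> [c|u v [p ->] [q ->]|u v [p ->] [q ->]].
  - by exists c%:P; rewrite ev1C.
  - by exists (p + q); rewrite ev1D.
  - by exists (p * q); rewrite ev1M.
have Sx : S x by exists 'X; rewrite ev1X.
have sT := away_sub sS Sx.
have TV : away S x x^-1 by exact: (away_V sS x0).
have Tx : away S x x by exact: away_in.
pose f j := x ^ (n - (e * j)%:Z) * ev1 x^-1 P'`_j.
have Tf j : away S x (f j).
  apply: (subr_M sT).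
    case: (n - _) => i; first by rewrite -exprnP; exact: (subr_X sT).
    by rewrite NegzE -exprnN -exprVn; exact: (subr_X sT).
  rewrite ev1E; apply: (subr_sum sT) => i _; apply: (subr_M sT); [exact: (subr_c sT)|exact: (subr_X sT)].
have [M HM] : exists M, forall j, (j < size P + size P')%N -> S (x ^+ M * f j).
  elim: (size P + size P')%N => [|s [M IH]]; first by exists 0%N.
  have [M' S'] := Tf s; exists (M + M')%N => j; rewrite ltnS leq_eqVlt => /predU1P [->|lt].
    by rewrite exprD -mulrA; apply: (subr_M sS) => //; exact: (subr_X sS).
  rewrite addnC exprD -mulrA; apply: (subr_M sS); [exact: (subr_X sS)|exact: IH].
have gex (j : 'I_(size P + size P')) : exists q, x ^+ M * f j = ev1 x q by exact: HM.
pose g j := proj1_sig (constructive_indefinite_description _ (gex j)).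
have gE (j : 'I_(size P + size P')) : x ^+ M * f j = ev1 x (g j) := proj2_sig (constructive_indefinite_description _ (gex j)).
pose G i := if insub i is Some j then g j else 0.
have GE j : (j < size P + size P')%N -> x ^+ M * f j = ev1 x (G j).
  by move=> lt; rewrite /G insubT /= -gE.
have EQ : ('X^M)%:P * P = \poly_(j < size P + size P') G j.
  apply: (coords_inj C); rewrite ev2M ev2C ev1_exp ev1X ev2_poly E.
  rewrite [ev2 x^-1 _ P']ev2E !mulr_sumr.
  rewrite (big_ord_widen (size P + size P') (fun j => x ^+ M * (x ^ n * (ev1 x^-1 P'`_j * (z / x ^+ e) ^+ j)))) ?leq_addl //.
  rewrite big_mkcond; apply: eq_bigr => j _ /=; rewrite -GE //; case: ltnP => le; last first.
    by rewrite /f nth_default // ev1_0 !(mulr0, mul0r).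
  rewrite /f expfzDr // -invr_expz -exprnP exprM expr_div_n; ring.
move=> j; rewrite -/(f j); have xM : x ^+ M != 0 by rewrite expf_neq0.
have [lt|ge] := ltnP j (size P + size P').
  apply: (mulfI xM); rewrite GE //.
  have := congr1 (fun Q : {poly {poly k}} => Q`_j) EQ; rewrite coefCM coef_poly lt => <-.
  by rewrite ev1M ev1_exp ev1X.
rewrite /f !nth_default ?ev1_0 ?mulr0 //; first by apply: leq_trans ge; exact: leq_addl.
by apply: leq_trans ge; exact: leq_addr.
Qed.

Lemma base_degree e (n : int) (P P' : {poly {poly k}}) :
  ev2 x z P = x ^ n * ev2 x^-1 (z / x ^+ e) P' ->
  forall j i : nat, (P`_j)`_i != 0 -> i%:Z + (e * j)%:Z <= n.
Proof.
move=> E j i; have := base_coefs E j; set m := n - _ => Ej.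
have lift y q : ev1 y q = ev2 z y (map_poly polyC q).
  elim/poly_ind: q => [|q c IH]; first by rewrite map_poly0 ev1_0 ev2_0.
  have -> : map_poly polyC (q * 'X + c%:P) = map_poly polyC q * 'X + c%:P%:P.
    by rewrite rmorphD rmorphM /= map_polyX map_polyC.
  by rewrite ev1D ev1M ev1X ev1C ev2D ev2M ev2X ev2C ev1C IH.
rewrite !lift in Ej; have := reversal (coords_swap C) Ej i; rewrite coef_map /=.
case: ifP => [le _ _|_ /eqP]; last by rewrite polyC_eq0 => /eqP ->; rewrite eqxx.
by move: le; rewrite /m lerBrDr.
Qed.

Section Fields.
Variables (d e m m' : nat) (w : int) (A B A' B' : {poly {poly k}}).
Hypothesis d0 : (0 < d)%N.
Hypothesis sat : saturated_degrees d m A B.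
Hypothesis sat' : saturated_degrees d m' A' B'.
Hypothesis EA : ev2 x z A = - (x ^ (w + 2) * ev2 x^-1 (z / x ^+ e) A').
Hypothesis EB : x * ev2 x z B - e%:R * (z * ev2 x z A) = x ^ (w + e%:Z + 1) * ev2 x^-1 (z / x ^+ e) B'.

(** The second component at infinity up to a power of x, from D(z / x^e) = x^(-e-1) (x Dz - e z
    Dx). *)
Let Cp : {poly {poly k}} := 'X%:P * B - e%:R * ('X * A).

Let EA' : ev2 x z A = x ^ (w + 2) * ev2 x^-1 (z / x ^+ e) (- A').
Proof. by rewrite EA -mulrN -[in RHS](sub0r A') ev2B ev2_0 sub0r. Qed.

Let EC : ev2 x z Cp = x ^ (w + e%:Z + 1) * ev2 x^-1 (z / x ^+ e) B'.
Proof.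
rewrite -EB /Cp ev2B !ev2M ev2C ev1X ev2X; congr (_ - _ * _).
by elim: (e) => [|n IH]; rewrite ?ev2_0 // -!natr1 ev2D ev2_1 IH.
Qed.

Let CpE j : Cp`_j.+1 = 'X * B`_j.+1 - e%:R * A`_j.
Proof.
rewrite /Cp coefB coefCM; congr (_ - _).
have -> : e%:R = (e%:R : {poly k})%:P :> {poly {poly k}} by rewrite rmorph_nat.
by rewrite coefCM coefXM.
Qed.

Let zero_iff (n : int) (P P' : {poly {poly k}}) j : ev2 x z P = x ^ n * ev2 x^-1 (z / x ^+ e) P' ->
  P`_j = 0 <-> P'`_j = 0.
Proof.
move=> E; have Ej := base_coefs E j.
have inj y : coords y z -> forall q, ev1 y q = 0 -> q = 0.
  move=> Cy q q0; apply/eqP; rewrite -polyC_eq0; apply/eqP; apply: (proj1 Cy).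
  by rewrite ev2C.
split=> H; rewrite H ev1_0 in Ej.
  apply: (inj _ (coords_inv C)); apply/eqP; move/esym/eqP: Ej.
  by rewrite mulf_eq0 expfz_eq0 (negPf x0) andbF.
by apply: (inj _ C); rewrite Ej mulr0.
Qed.

(** By [zero_iff] corresponding coefficients vanish together; if the degrees differed, both top
    coefficients on the side of larger degree would vanish. *)
Lemma same_degree : m' = m.
Proof.
have [A1 B1 t1 _] := sat; have [A2 B2 t2 _] := sat'.
have X0 : 'X != 0 :> {poly k} by rewrite polyX_eq0.
have zA j : A`_j = 0 <-> A'`_j = 0.
  have := zero_iff j EA'; rewrite coefN => -[H1 H2]; split=> [/H1/eqP|H]; last by apply: H2; rewrite H oppr0.
  by rewrite oppr_eq0 => /eqP.
case: d d0 B1 t1 B2 t2 => // d1 _ B1 t1 B2 t2; rewrite addnS in t1; rewrite addnS in t2.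
have [lt|gt|//] := ltngtP m m'.
  case: (t2 0); have -> : A'`_m' = 0 by apply/zA/A1.
  have -> : B'`_(m' + d1).+1 = 0; last by rewrite horner0.
  apply/(zero_iff _ EC); rewrite CpE (A1 (m' + d1)%N) ?(leq_trans lt (leq_addr _ _)) //.
  by rewrite (B1 (m' + d1).+1) ?mulr0 ?subrr // addnS ltnS ltn_add2r.
case: (t1 0); have -> : A`_m = 0 by apply/zA/A2.
have -> : B`_(m + d1).+1 = 0; last by rewrite horner0.
have : Cp`_(m + d1).+1 = 0 by apply/(zero_iff _ EC)/B2; rewrite addnS ltnS ltn_add2r.
have -> : Cp`_(m + d1).+1 = 'X * B`_(m + d1).+1.
  rewrite CpE (_ : A`_(m + d1) = 0) ?mulr0 ?subr0 //; apply/zA/A2.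
  exact: leq_trans gt (leq_addr _ _).
by move/eqP; rewrite mulf_eq0 (negPf X0) => /eqP.
Qed.

(** The resultant could vanish at c only if the field had a zero on the fiber x = c, infinity
    included; a polynomial without roots is a nonzero constant. *)
Let sylvester_const n (P Q : {poly {poly k}}) : saturated_degrees d n P Q ->
  exists2 c, c != 0 & \det (sylvester n (n + d) P Q) = c%:P.
Proof.
move=> [Pn Qn top nz]; set delta := \det _.
have dc c : delta.[c] != 0.
  have -> : delta.[c] = \det (sylvester n (n + d) (map_poly (horner_eval c) P) (map_poly (horner_eval c) Q)).
    by rewrite -sylvester_map.
  apply: sylvester_neq0 => [||[H1 H2]|y]; last exact: nz.
  - by apply/leq_sizeP => j lt; rewrite coef_map /= Pn // /horner_eval horner0.
  - by apply/leq_sizeP => j lt; rewrite coef_map /= Qn // /horner_eval horner0.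
  by apply: (top c); move: H1 H2; rewrite !coef_map.
have : size delta == 1%N.
  by apply: contraT => /closed_rootP [y /rootP y0]; have := dc y; rewrite y0 eqxx.
by case/size_poly1P => c c0 ->; exists c.
Qed.

(** From one chart to the other, A and B are scaled by powers of x, z is scaled by x^e, and a
    multiple of z A' is added to the second component. So the two constant resultants differ by a
    power of x whose exponent is this expression up to sign, and [constant_power] makes it 0. *)
Lemma base_number : (w + 2) * (m + d)%:Z + (w + e%:Z) * m%:Z - (e * m * (m + d))%:Z = 0.
Proof.
have Em := same_degree; have sat2 := sat'; rewrite Em in sat2.
have [c c0 Ec] := sylvester_const sat; have [c' c'0 Ec'] := sylvester_const sat2.
have := congr1 (ev1 x) Ec; have := congr1 (ev1 x^-1) Ec'; rewrite !ev1C !sylvester_map.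
set n := (m + d)%N; set a := map_poly _ A; set b := map_poly _ B; set a' := map_poly _ A'; set b' := map_poly _ B'.
have xe0 : x ^+ e != 0 by rewrite expf_neq0.
have xz (i : int) : x ^ i != 0 by rewrite expfz_neq0.
have step (i : int) j : x ^ (i - (e * j)%:Z) * (x ^+ e) ^+ j = x ^ i.
  by rewrite expfzDr // -invr_expz -exprnP exprM divfK // !expf_neq0.
have ea j : a'`_j = - x ^ (- (w + 2)) * (x ^+ e) ^+ j * a`_j.
  rewrite !coef_map /= (base_coefs EA') coefN -(sub0r A'`_j) ev1B ev1_0 sub0r -invr_expz.
  have <- := step (w + 2) j; field; rewrite xz !expf_neq0 ?expfz_neq0 //.
have ec j : b'`_j = x ^ (- (w + e%:Z + 1)) * (x ^+ e) ^+ j * ev1 x Cp`_j.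
  rewrite coef_map /= (base_coefs EC) -invr_expz.
  have <- := step (w + e%:Z + 1) j; field; rewrite xz !expf_neq0 ?expfz_neq0 //.
pose q := \poly_(j < size b) (x ^ (- (w + e%:Z)) * (x ^+ e) ^+ j * b`_j).
have eq j : q`_j = x ^ (- (w + e%:Z)) * (x ^+ e) ^+ j * b`_j.
  by rewrite coef_poly; case: ltnP => // le; rewrite nth_default ?mulr0.
have eb : b' = q + (e%:R * x) *: ('X * a').
  apply/polyP => j; rewrite coefD coefZ coefXM eq ec.
  have E1 : x ^ (- (w + e%:Z)) = x ^ (- (w + e%:Z + 1)) * x.
    by rewrite (_ : - (w + e%:Z) = - (w + e%:Z + 1) + 1) ?expfzDr ?expr1z //; ring.
  case: j => [|j] /=.
    rewrite !expr0 mulr0 addr0 !mulr1 E1 -mulrA; congr (_ * _).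
    rewrite /Cp coefB coefCM ev1B ev1M ev1X coef_map.
    have -> : e%:R = (e%:R : {poly k})%:P :> {poly {poly k}} by rewrite rmorph_nat.
    by rewrite coefCM coefXM mulr0 ev1_0 subr0.
  rewrite CpE ev1B !ev1M ev1X ea coef_map E1 rmorph_nat.
  have -> : x ^ (- (w + 2)) = x ^ (- (w + e%:Z + 1)) * x ^+ e / x.
    by rewrite -exprN1 exprnP -!expfzDr //; congr (x ^ _); ring.
  by rewrite coef_map exprS; field.
have mn : (m < n)%N by rewrite /n -{1}(addn0 m) ltn_add2l.
rewrite eb sylvester_shift // (sylvester_scale m n xe0 ea eq) => Ec2 Ec1.
move: Ec2; rewrite Ec1 => Ec2.
have ic0 : iota c != 0 by rewrite fmorph_eq0.
have H : x ^ (- (w + 2) * n%:Z - (w + e%:Z) * m%:Z + (e * (n * m))%:Z) = iota ((-1) ^+ n * c' / c).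
  have p1 : x ^ (- (w + 2) * n%:Z) = (x ^ (- (w + 2))) ^+ n by rewrite exprnP exprz_exp.
  have p2 : x ^ (- (w + e%:Z) * m%:Z) = (x ^ (- (w + e%:Z))) ^+ m by rewrite exprnP exprz_exp.
  rewrite -mulNr !expfzDr // p1 p2 -exprnP exprM !rmorphM rmorphXn rmorphN1 fmorphV -Ec2 [(- (x ^ _)) ^+ n]exprNn.
  have : (-1) ^+ n * (-1) ^+ n = 1 :> K by rewrite -exprMn mulrNN mulr1 expr1n.
  by move: ((-1) ^+ n) => s ss; rewrite -[LHS]mul1r -ss; field.
have : (-1) ^+ n * c' / c != 0 by rewrite !mulf_neq0 ?invr_eq0 ?expf_neq0 ?oppr_eq0 ?oner_neq0.
move=> /constant_power /(_ H) H0.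
have -> : (e * m * n)%:Z = (e * (n * m))%:Z by rewrite -mulnA [(m * n)%N]mulnC.
by move/eqP: H0; rewrite -oppr_eq0 => /eqP <-; ring.
Qed.

Lemma coef_bounds : (forall j i : nat, (A`_j)`_i != 0 -> i%:Z + (e * j)%:Z <= w + 2) /\
  (forall j i : nat, (Cp`_j)`_i != 0 -> i%:Z + (e * j)%:Z <= w + e%:Z + 1).
Proof. by split; [exact: base_degree EA'|exact: base_degree EC]. Qed.

(** The equation reads (2m + 1)(2m - 5 - 4w) = 3, so (m, w) is (0, -2) or (1, -1). In both cases the
    degree bounds make A_m constant and x B_(m+1) - A_m zero; so both top coefficients vanish. *)
Lemma plane_no_field : d = 1%N -> e = 1%N -> False.
Proof.
move=> d1 e1; have N := base_number; have [bA bC] := coef_bounds; have [A1 B1 top _] := sat.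
rewrite d1 in N A1 B1 top; rewrite e1 mul1n in N.
have eq0 (q : {poly k}) : (forall i, q`_i != 0 -> False) -> q = 0.
  by move=> H; apply/polyP => i; rewrite coef0; apply/eqP; apply: contraT => /H.
have X0 : 'X != 0 :> {poly k} by rewrite polyX_eq0.
have mw : (m = 0%N /\ w = -2) \/ (m = 1%N /\ w = -1).
  have : (2 * m%:Z + 1) * (2 * m%:Z - 5 - 4 * w) = 3.
    have -> : (2 * m%:Z + 1) * (2 * m%:Z - 5 - 4 * w) = 3 - 4 * ((w + 2) * (m + 1)%:Z + (w + 1) * m%:Z - (m * (m + 1))%:Z).
      by rewrite !PoszM !PoszD; ring.
    by rewrite N mulr0 subr0.
  clear; move: (m) => [|[|l]]; [left; lia|right; lia|].
  move: (2 * _ - _ - _) => t H; exfalso; have [t0|t0] := lerP t 0; nia.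
have Cm : Cp`_m.+1 = 0.
  apply: eq0 => i /bC; rewrite e1; clear -mw; case: mw => -[-> ->]; lia.
have Am : exists a, A`_m = a%:P.
  exists (A`_m)`_0; apply: size1_polyC; apply/leq_sizeP => i i0; apply/eqP; apply: contraT => /bA.
  by rewrite e1; clear -mw i0; case: mw => -[-> ->]; lia.
have [a Ea] := Am; move: Cm; rewrite CpE e1 Ea => H.
have Ea0 : a = 0.
  have := congr1 (fun q : {poly k} => q`_0) H; rewrite coefB coefXM sub0r mulr1n mul1r coefC coef0.
  by move/eqP; rewrite oppr_eq0 => /eqP.
move: H; rewrite Ea0 polyC0 mulr0 subr0 => /eqP; rewrite mulf_eq0 (negPf X0) /= => /eqP Bm.
by apply: (top 0); rewrite addn1 Bm Ea Ea0 polyC0 horner0.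
Qed.

(** The equation reads (m + 1)(e m - 2 - 2w) = 2. If m = 1 and 2w = e - 3, then e is odd, hence at
    least 3, and the degree bounds kill the top coefficients. If m = 0 and w = -2, they make A
    constant and the coefficient x B_1 - e A_0 of [Cp] zero; as A_0 is a nonzero constant, e = 0 in
    k and B_1 = 0. The coefficient x B_0 has degree at most e - 1, whence the bound on b. *)
Lemma ruled_field : d = 2%N -> e <> 1%N -> exists a b, [/\ a != 0, A = a%:P%:P, B = b%:P,
  e%:R = 0 :> k & forall i, b`_i != 0 -> (i + 2 <= e)%N].
Proof.
move=> d2 e1; have N := base_number; have [bA bC] := coef_bounds; have [A1 B1 top _] := sat.
rewrite d2 in N A1 B1 top.
have eq0 (q : {poly k}) : (forall i, q`_i != 0 -> False) -> q = 0.
  by move=> H; apply/polyP => i; rewrite coef0; apply/eqP; apply: contraT => /H.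
have X0 : 'X != 0 :> {poly k} by rewrite polyX_eq0.
have mw : (m = 0%N /\ w = -2) \/ (m = 1%N /\ 2 * w = e%:Z - 3).
  have : (m%:Z + 1) * (e%:Z * m%:Z - 2 - 2 * w) = 2.
    have -> : (m%:Z + 1) * (e%:Z * m%:Z - 2 - 2 * w) = 2 - ((w + 2) * (m + 2)%:Z + (w + e%:Z) * m%:Z - (e * m * (m + 2))%:Z).
      by rewrite !PoszM !PoszD; ring.
    by rewrite N subr0.
  clear; move: (m) => [|[|l]]; [left; lia|right; lia|].
  move: (_ * _ - _ - _) => t H; exfalso; have [t0|t0] := lerP t 0; nia.
have [[m0 w2]|[m1 w2]] := mw; last first.
  exfalso; have A10 : A`_1 = 0.
    by apply: eq0 => i /bA; clear -w2 e1; lia.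
  have : Cp`_3 = 0 by apply: eq0 => i /bC; clear -w2 e1; lia.
  rewrite CpE (A1 2%N) ?m1 // mulr0 subr0 => /eqP; rewrite mulf_eq0 (negPf X0) /= => /eqP B3.
  by apply: (top 0); rewrite m1 A10 B3 horner0.
rewrite m0 in A1 B1 top.
have Ea : A = ((A`_0)`_0)%:P%:P.
  have -> : ((A`_0)`_0)%:P = A`_0.
    apply/esym/size1_polyC; apply/leq_sizeP => i i0; apply/eqP; apply: contraT => /bA.
    by clear -w2 i0; rewrite w2; lia.
  by apply: size1_polyC; apply/leq_sizeP.
have C2 : Cp`_2 = 0 by apply: eq0 => i /bC; clear -w2; rewrite w2; lia.
have B2 : B`_2 = 0.
  move: C2; rewrite CpE (A1 1%N) // mulr0 subr0 => /eqP.
  by rewrite mulf_eq0 (negPf X0) => /eqP.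
have a0 : (A`_0)`_0 != 0.
  by apply/eqP => a0; apply: (top 0); rewrite add0n B2 Ea a0 !polyC0 coef0 horner0.
have C1 : Cp`_1 = 0 by apply: eq0 => i /bC; clear -w2; rewrite w2; lia.
move: (C1); rewrite CpE => C1'.
have ek : e%:R = 0 :> k.
  have := congr1 (fun q : {poly k} => q`_0) C1'; rewrite coefB coefXM sub0r coef0 Ea coefC /=.
  have -> : e%:R = (e%:R : k)%:P :> {poly k} by rewrite rmorph_nat.
  by rewrite -polyCM coefC /= => /eqP; rewrite oppr_eq0 mulf_eq0 (negPf a0) orbF => /eqP.
have eP : e%:R = 0 :> {poly k} by rewrite -(rmorph_nat polyC) ek.
have B10 : B`_1 = 0.
  by move/eqP: C1'; rewrite eP mul0r subr0 mulf_eq0 (negPf X0) => /eqP.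
have EB0 : B = (B`_0)%:P.
  apply: size1_polyC; apply/leq_sizeP => -[|[|[|j]]] // _.
  by apply: B1.
exists (A`_0)`_0, B`_0; split=> // i Bi.
have : (Cp`_0)`_i.+1 != 0.
  rewrite /Cp coefB coefCM.
  have -> : e%:R = (e%:R : {poly k})%:P :> {poly {poly k}} by rewrite rmorph_nat.
  by rewrite coefCM coefXM mulr0 subr0 coefXM.
by move/bC; clear -w2; rewrite w2; lia.
Qed.
End Fields.
End FiberAtInfinity.

(** * Saturated generators over the two charts of the base *)

Section Rescaling.
Variables (k : closedFieldType) (K : fieldType) (iota : {rmorphism k -> K}).
Local Notation ev1 := (@ev1 k K iota).
Local Notation ev2 := (@ev2 k K iota).
Local Notation coords := (@coords k K iota).

Lemma lattice_generator_scale xi eta al be g h : h != 0 -> lattice_generator iota xi eta al be g ->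
  lattice_generator iota xi eta (h * al) (h * be) (g / h).
Proof.
move=> h0 [g0 Ga Gb Gm]; split.
- by rewrite mulf_neq0 ?invr_eq0.
- by rewrite mulrA divfK.
- by rewrite mulrA divfK.
by move=> f; rewrite !mulrA invf_div mulrA => fa fb; exact: Gm.
Qed.

Lemma lattice_generator_const xi eta al be g c : c != 0 -> lattice_generator iota xi eta al be (iota c * g) ->
  lattice_generator iota xi eta al be g.
Proof.
move=> c0 [g0 Ga Gb Gm]; have sA := affine_sub iota xi eta.
have ic0 : iota c != 0 by rewrite fmorph_eq0.
have cA d h : affine iota xi eta h -> affine iota xi eta (iota d * h).
  by apply: (subr_M sA); exact: (subr_c sA).
have E u : g * u = iota c^-1 * (iota c * g * u) by rewrite fmorphV -mulrA mulKf.
split.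
- by apply: contraNneq g0 => ->; rewrite mulr0.
- by rewrite E; exact: cA.
- by rewrite E; exact: cA.
move=> f fa fb; have -> : f / g = iota c * (f / (iota c * g)).
  have gn : g != 0 by apply: contraNneq g0 => ->; rewrite mulr0.
  by field; rewrite gn ic0.
by apply: cA; exact: Gm.
Qed.

Lemma der_scale D g : der iota D -> der iota (fun h => g * D h).
Proof.
move=> dD; split=> [u v|u v|c].
- by rewrite (der_D dD) mulrDr.
- by rewrite (der_M dD); ring.
- by rewrite (der_c dD) mulr0.
Qed.

Lemma nonvanishing_scale D g xi eta (p : point iota [:: [:: xi; eta]]) : g != 0 ->
  nonvanishing D p -> nonvanishing (fun h => g * D h) p.
Proof. by move=> g0 [f H]; exists (f / g); rewrite !mulrA divfK. Qed.

Lemma point_swap xi eta (p : point iota [:: [:: xi; eta]]) : exists p' : point iota [:: [:: eta; xi]],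
  (forall h, stalk p h <-> stalk p' h) /\ (forall h, maximal_ideal p h <-> maximal_ideal p' h).
Proof.
have [|p' [sp mp gp]] := center_chart (stalk_local p) (@stalk_residue _ _ _ _ p) (mem_head [:: eta; xi] [::]).
  by move=> h; rewrite !inE orbC => hp; apply: point_chart; rewrite (chart1 p) !inE.
have H h : stalk p h -> stalk p' h.
  apply: (stalk_eq_dominated sp mp) => h'; rewrite (chart1 p) !inE orbC => hp.
  by apply: gp; rewrite !inE.
have lp := stalk_local p; have lp' := stalk_local p'.
exists p'; split=> h; split; [exact: H|exact: sp| |exact: mp].
move=> Mh; apply: NNPP => nM; have Oh := H _ (loc_R lp Mh).
by apply: (loc_unit lp (loc_R lp Mh) (sp _ (loc_V lp' Oh nM)) (loc_neq0 lp' nM)).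
Qed.

Lemma nonvanishing_swap D xi eta (p : point iota [:: [:: xi; eta]]) (p' : point iota [:: [:: eta; xi]]) :
  (forall h, stalk p h <-> stalk p' h) -> (forall h, maximal_ideal p h <-> maximal_ideal p' h) ->
  nonvanishing D p' -> nonvanishing D p.
Proof.
move=> sp mp [f [p1 p2 np]]; exists f; split; [exact/sp|exact/sp|].
by move=> [/mp M1 /mp M2]; apply: np.
Qed.

Lemma base_change_data D0 x z e : der iota D0 -> coords x z -> D0 x != 0 \/ D0 z != 0 ->
  exists g g' A B A' B' w, [/\ g != 0 /\ g' != 0,
    generator iota (fun h => g * D0 h) x z 1 /\ generator iota (fun h => g' * D0 h) x^-1 (z / x ^+ e) 1,
    [/\ g * D0 x = ev2 x z A, g * D0 z = ev2 x z B, g' * D0 x^-1 = ev2 x^-1 (z / x ^+ e) A' &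
        g' * D0 (z / x ^+ e) = ev2 x^-1 (z / x ^+ e) B'],
    ev2 x z A = - (x ^ (w + 2) * ev2 x^-1 (z / x ^+ e) A') &
    x * ev2 x z B - e%:R * (z * ev2 x z A) = x ^ (w + e%:Z + 1) * ev2 x^-1 (z / x ^+ e) B'].
Proof.
move=> d0 C nz; have x0 := coords_x0 C; have xe0 : x ^+ e != 0 by rewrite expf_neq0.
have C' : coords x^-1 (z / x ^+ e) by apply/coords_inv/coords_divX.
have [Dx' Dz'] := der_ruled d0 z e x0.
have nz' : D0 x^-1 != 0 \/ D0 (z / x ^+ e) != 0.
  have [Dx0|Dx0] := eqVneq (D0 x) 0; [right|left].
    by rewrite Dz' Dx0 mulr0 subr0 mulf_neq0 ?invr_eq0 //; case: nz => //; rewrite Dx0 eqxx.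
  by rewrite Dx' mulf_neq0 ?oppr_eq0 ?invr_eq0 ?expf_neq0.
have [g G] := lattice_generator_ex C nz; have [g1 G1] := lattice_generator_ex C' nz'.
have [c [i [c0 Eg]]] := transition_base d0 C G G1; rewrite Eg -mulrA in G1.
have {}G1 := lattice_generator_const c0 G1; set g' := x ^ i * g in G1.
have [g0 [A EA] [B EB] _] := G; have [g'0 [A' EA'] [B' EB'] _] := G1.
exists g, g', A, B, A', B', (- i); split=> //.
- split.
    by have := lattice_generator_scale g0 G; rewrite divff.
  by have := lattice_generator_scale g'0 G1; rewrite divff.
- have xi0 : x ^ i != 0 by rewrite expfz_neq0.
  by rewrite -EA -EA' Dx' /g' expfzDr // -invr_expz -exprnP; field; rewrite xi0 x0.
have xi0 : x ^ i != 0 by rewrite expfz_neq0.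
rewrite -EA -EB -EB' Dz' /g' !expfzDr // -invr_expz -exprnP expr1z.
by field; rewrite xi0 x0 xe0.
Qed.
End Rescaling.

Section Geometry.
Variables (k : closedFieldType) (X : variety k) (F : foliation X).
Local Notation K := (function_field X).
Local Notation iota := (scalar X).
Hypothesis smX : smooth_projective_surface X.
Hypothesis regF : regular F.
Variables (D0 : K -> K).
Hypothesis sD0 : spans F D0.
Let d0 : der iota D0. Proof. by case: sD0. Qed.

Lemma spans_nonzero x z : coords iota x z -> D0 x != 0 \/ D0 z != 0.
Proof.
move=> C; have [_ [h Dh] _] := sD0; have [Dx|] := eqVneq (D0 x) 0; last by left.
right; apply: contraNneq Dh => Dz.
by rewrite (der_dXZ (coords_indep C) (proj2 C) d0) Dx Dz !mul0r addr0.
Qed.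

Lemma etale_nonvanishing xi eta (p : point iota [:: [:: xi; eta]]) : coords iota xi eta ->
  etale_at p -> nonvanishing D0 p.
Proof. by move=> C; exact: (line_at C smX sD0 regF C). Qed.

(** The lines x = const are used as fibers with e = 1, and their common point at infinity supplies
    the degrees m and m + 1. *)
Lemma no_regular_plane x z : coords iota x z -> ~ etale_plane x z.
Proof.
move=> C [et1 et2 et3]; have x0 := coords_x0 C; have z0 := coords_z0 C.
have [g [g' [A [B [A' [B' [w [[g0 g'0] [G G'] [EA EB EA' EB'] R1 R2]]]]]]]] :=
  base_change_data 1 d0 C (spans_nonzero C).
rewrite !expr1 in G' EA' EB' R1 R2.
have C' : coords iota x^-1 (z / x) by apply/coords_inv/coords_div.
have C3 : coords iota z^-1 (x / z) by apply/coords_inv/coords_div/coords_swap.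
have nz g1 xi eta : g1 != 0 -> coords iota xi eta -> g1 * D0 xi != 0 \/ g1 * D0 eta != 0.
  by move=> g10 /spans_nonzero [] D1; [left|right]; rewrite mulf_neq0.
have nv3 g1 : g1 != 0 -> forall p : point iota [:: [:: z^-1; x / z]],
    maximal_ideal p z^-1 -> maximal_ideal p (x / z) -> nonvanishing (fun h => g1 * D0 h) p.
  by move=> g10 p M1 M2; apply: nonvanishing_scale => //; apply: etale_nonvanishing => //; exact: et3.
have [_ [m sat]] := degrees_plane (der_scale g d0) C G
  (fun p => nonvanishing_scale g0 (etale_nonvanishing C (et1 p))) (nz _ _ _ g0 C) EA EB (nv3 _ g0).
have nv3' : forall p : point iota [:: [:: (z / x)^-1; x^-1 / (z / x)]],
    maximal_ideal p (z / x)^-1 -> maximal_ideal p (x^-1 / (z / x)) -> nonvanishing (fun h => g' * D0 h) p.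
  have -> : x^-1 / (z / x) = z^-1 by field; apply/andP.
  rewrite invf_div => p M1 M2; have [p' [sp mp]] := point_swap p.
  by apply: (nonvanishing_swap sp mp); apply: nv3 => //; exact/mp.
have [_ [m' sat']] := degrees_plane (der_scale g' d0) C' G'
  (fun p => nonvanishing_scale g'0 (etale_nonvanishing C' (et2 p))) (nz _ _ _ g'0 C') EA' EB' nv3'.
apply: (plane_no_field C (isT : 0 < 1)%N sat sat' _ _ erefl erefl (w := w)); rewrite !expr1 //.
Qed.

Lemma ruled_foliation x z e : coords iota x z -> e <> 1%N -> D0 x != 0 ->
  (forall xi eta, [:: xi; eta] \in ruled_charts x z e ->
     forall p : point iota [:: [:: xi; eta]], etale_at p) ->
  exists a b g, [/\ a != 0 /\ g != 0, g * D0 x = iota a, g * D0 z = ev1 iota x b, e%:R = 0 :> k &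
    forall i, b`_i != 0 -> (i + 2 <= e)%N].
Proof.
move=> C e1 Dx0 et; have x0 := coords_x0 C; have xe0 : x ^+ e != 0 by rewrite expf_neq0.
have [g [g' [A [B [A' [B' [w [[g0 g'0] [G G'] [EA EB EA' EB'] R1 R2]]]]]]]] :=
  base_change_data e d0 C (spans_nonzero C).
have C' : coords iota x^-1 (z / x ^+ e) by apply/coords_inv/coords_divX.
have nv xi eta g1 : g1 != 0 -> coords iota xi eta -> [:: xi; eta] \in ruled_charts x z e ->
    forall p : point iota [:: [:: xi; eta]], nonvanishing (fun h => g1 * D0 h) p.
  move=> g10 C1 gin p; apply: nonvanishing_scale => //; apply: etale_nonvanishing => //.
  exact: et.
have Dx'0 : D0 x^-1 != 0.
  have [-> _] := der_ruled d0 z e x0.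
  by rewrite mulf_neq0 ?oppr_eq0 ?invr_eq0 ?expf_neq0.
have gD : g * D0 x != 0 by rewrite mulf_neq0.
have gD' : g' * D0 x^-1 != 0 by rewrite mulf_neq0.
have i1 : [:: x; z] \in ruled_charts x z e by rewrite !inE eqxx.
have i2 : [:: x; z^-1] \in ruled_charts x z e by rewrite !inE eqxx !orbT.
have i3 : [:: x^-1; z / x ^+ e] \in ruled_charts x z e by rewrite !inE eqxx !orbT.
have i4 : [:: x^-1; (z / x ^+ e)^-1] \in ruled_charts x z e by rewrite !inE eqxx !orbT.
have [m sat] := degrees_ruled (der_scale g d0) C G (nv _ _ _ g0 C i1) EA EB gD (nv _ _ _ g0 (coords_inv2 C) i2).
have [m' sat'] := degrees_ruled (der_scale g' d0) C' G' (nv _ _ _ g'0 C' i3) EA' EB' gD' (nv _ _ _ g'0 (coords_inv2 C') i4).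
have [a [b [a0 Ea Eb ek deg]]] := ruled_field C (isT : 0 < 2)%N sat sat' R1 R2 erefl e1.
exists a, b, g; split=> //; first by rewrite EA Ea ev2C ev1C.
by rewrite EB Eb ev2C.
Qed.
End Geometry.

(** * The dichotomy *)
Lemma reverse_monomial (L : fieldType) (c y : L) m i : y != 0 ->
  c * y ^+ m = y ^+ m * y ^+ i * y ^+ 2 * (c * (y ^+ i)^-1 / y ^+ 2).
Proof. by move=> y0; field; rewrite y0 expf_neq0. Qed.

(** Reversal of the coefficients at e - 2; the sign comes from d(1/x) = - x^-2 dx. *)
Lemma twisted_form_reverse (k : closedFieldType) e (P : {poly k}) : (forall i, P`_i != 0 -> (i + 2 <= e)%N) ->
  exists Q, twisted_form e P Q.
Proof.
move=> deg; exists (\poly_(i < e.-1) - P`_(e - 2 - i)); rewrite /twisted_form.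
have cx0 : coordX k != 0 := coords_x0 (coords2 k).
have cN u : const2 k (- u) = - const2 k u by exact: (rmorphN (const2 k)).
rewrite -[LHS]/(ev1 (const2 k) (coordX k) P) -[(map_poly _ _).[_^-1]]/(ev1 (const2 k) (coordX k)^-1 _).
rewrite ev1_poly ev1E mulr_suml -sumrN mulr_sumr.
have sP : (size P <= e.-1)%N.
  apply/leq_sizeP => i le; apply/eqP; apply: contraT => /deg; move: le; clear; lia.
rewrite (big_ord_widen e.-1 (fun i => const2 k P`_i * coordX k ^+ i)) // big_mkcond (reindex_inj rev_ord_inj).
apply: eq_bigr => i _; have lt := ltn_ord i; have [le h] : (i <= e - 2)%N /\ (rev_ord i = e - 2 - i :> nat)%N.
  by rewrite /=; move: lt; clear; lia.
rewrite h cN !mulNr opprK; case: ltnP => [_|ge]; last first.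
  by rewrite nth_default // rmorph0 !mul0r mulr0.
have -> : coordX k ^+ e = coordX k ^+ (e - 2 - i) * coordX k ^+ i * coordX k ^+ 2.
  by rewrite -!exprD; congr (_ ^+ _); move: lt; clear; lia.
rewrite exprVn; exact: reverse_monomial.
Qed.

Section Conclusion.
Variables (k : closedFieldType) (X : variety k) (F : foliation X).
Local Notation K := (function_field X).
Local Notation iota := (scalar X).
Local Notation ev1 := (@ev1 k K iota).
Hypothesis smX : smooth_projective_surface X.
Hypothesis regF : regular F.
Variables (D0 : K -> K).
Hypothesis sD0 : spans F D0.
Let d0 : der iota D0. Proof. by case: sD0. Qed.
Let HF a D : F a D <-> tangent a D /\ exists f, D =1 (fun h => f * D0 h).
Proof. by case: sD0. Qed.

Lemma ruled_charts_map (L : fieldType) (phi : {rmorphism L -> K}) u w e :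
  ruled_charts (phi u) (phi w) e = [seq map phi g | g <- ruled_charts u w e].
Proof. by rewrite /ruled_charts /= !fmorphV !fmorph_div rmorphXn. Qed.

(** A derivation is determined by its values on x and z, so proportionality to [D0] is one linear
    equation. *)
Lemma spans_ratio x z u : coords iota x z -> D0 z = u * D0 x ->
  forall a D, F a D <-> tangent a D /\ D z = u * D x.
Proof.
move=> C E a D; rewrite HF; split=> -[[dD OD] H]; split=> //.
  by have [f Ef] := H; rewrite !Ef E; ring.
have Dx0 : D0 x != 0.
  by have [//|] := spans_nonzero sD0 C; apply: contraNneq => Dx; rewrite E Dx mulr0.
exists (D x / D0 x) => h; have bas := der_dXZ (coords_indep C) (proj2 C).
have := bas _ dD h; have := bas _ d0 h; rewrite H E => -> ->; field; exact: Dx0.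
Qed.

Lemma spans_fibration x z : coords iota x z -> D0 x = 0 ->
  forall a D, F a D <-> relative_tangent x a D.
Proof.
move=> C Dx a D; have H := spans_ratio (coords_swap C) (u := 0) _ a D.
by rewrite mul0r in H; have := H Dx; rewrite mul0r.
Qed.

Variables (e : nat) (phi : {rmorphism function_field (hirzebruch k e) -> K}).
Hypothesis iso : isomorphism phi.
Let x := phi (coordX k).
Let z := phi (coordZ k).

Let C : coords iota x z.
Proof.
have [[[psi psiK phiK] phic] _ _] := iso; have [inj gen] := coords2 k.
have ev P : ev2 iota x z P = phi (ev2 (const2 k) (coordX k) (coordZ k) P).
  rewrite !ev2E rmorph_sum; apply: eq_bigr => j _; rewrite rmorphM rmorphXn; congr (_ * _).
  rewrite !ev1E rmorph_sum; apply: eq_bigr => i _; rewrite rmorphM rmorphXn; congr (_ * _).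
  by rewrite -phic.
split=> [P|]; first by rewrite ev => /eqP; rewrite fmorph_eq0 => /eqP /inj.
apply/generates2 => h; have [P [Q [Q0 E]]] := coords_frac (coords2 k) (psi h).
by exists P, Q; rewrite !ev fmorph_eq0 -fmorph_div -E phiK.
Qed.
Let x0 : x != 0 := coords_x0 C.
Let z0 : z != 0 := coords_z0 C.

Lemma ruled_charts_etale xi eta : [:: xi; eta] \in ruled_charts x z e ->
  forall p : point iota [:: [:: xi; eta]], etale_at p.
Proof.
rewrite ruled_charts_map => /mapP [[|u [|w [|]]] // gin [-> ->]] p.
exact: (isomorphism_etale iso gin).
Qed.

Lemma ruled_charts_cover (a : pt X) : exists g, g \in ruled_charts x z e /\
  exists p : point iota [:: g], forall h, stalk a h <-> stalk p h.
Proof.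
have [g gin H] := isomorphism_chart iso a; exists (map phi g); split=> //.
by rewrite ruled_charts_map; apply: map_f.
Qed.

Section Riccati.
Variables (D1 : K -> K) (b : {poly k}).
Hypothesis d1 : der iota D1.
Hypothesis D1x : D1 x = 1.
Hypothesis D1z : D1 z = ev1 x b.
Hypothesis ek : e%:R = 0 :> k.
Hypothesis deg : forall i, b`_i != 0 -> (i + 2 <= e)%N.

(** The horizontal lift has no poles. Over x = infinity, D1(z / x^e) = b / x^e because e = 0 in k,
    and D x = - x^2 D(1/x); the product is regular as deg b <= e - 2. *)
Lemma tangent_lift (a : pt X) D : tangent a D -> tangent a (fun h => D x * D1 h).
Proof.
move=> [dD OD]; split; first exact: der_scale.
have [g [gin [p Hp]]] := ruled_charts_cover a.
have eK : e%:R = 0 :> K by rewrite -(rmorph_nat iota) ek rmorph0.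
have xe0 : x ^+ e != 0 by rewrite expf_neq0.
have lp := stalk_local p; have sp := loc_sub lp.
have pD h : stalk p h -> stalk p (D h) by move=> /Hp /OD /Hp.
have dL : der iota (fun h => D x * D1 h) by exact: der_scale.
suff H : forall h, h \in g -> stalk p (D x * D1 h).
  have two : exists xi eta, g = [:: xi; eta].
    by move: gin; rewrite !inE => /or4P [] /eqP ->; do 2 eexists.
  have [xi [eta Eg]] := two; rewrite Eg in p Hp lp sp pD H *.
  move=> h /Hp ph; apply/Hp; apply: (plane_der (chart1 p) dL) ph; apply: H; rewrite !inE eqxx ?orbT.
    by [].
  by [].
have inv w : w != 0 -> stalk p w^-1 -> stalk p (D x * D1 w) -> stalk p (D x * D1 w^-1).
  move=> w0 pw pDw; have -> : D x * D1 w^-1 = - (w^-1 ^+ 2 * (D x * D1 w)).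
    by rewrite (der_V d1) // exprVn; field.
  by apply: (subr_N sp); apply: (subr_M sp) => //; exact: (subr_X sp).
have gp h : h \in g -> stalk p h by move=> hg; apply: point_chart; rewrite (chart1 p).
have [Dx' Dz'] := der_ruled d1 z e x0.
have fst_aff : stalk p x -> stalk p (D x * D1 x) /\ stalk p (D x * D1 z).
  move=> px; rewrite D1x mulr1 D1z; split; first exact: pD.
  by apply: (subr_M sp); [exact: pD|exact: (ev1_in lp)].
have snd_aff : stalk p x^-1 -> stalk p (D x * D1 x^-1) /\ stalk p (D x * D1 (z / x ^+ e)).
  move=> px; have E : D x * D1 x^-1 = D x^-1.
    by rewrite Dx' D1x (der_V dD) //; ring.
  split; first by rewrite E; exact: pD.
  have -> : D x * D1 (z / x ^+ e) = - (D x^-1 * \sum_(i < size b) iota b`_i * (x ^+ i * x ^+ 2 / x ^+ e)).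
    rewrite Dz' eK mul0r mul0r mul0r subr0 -E Dx' D1x D1z ev1E.
    have -> : \sum_(i < size b) iota b`_i * (x ^+ i * x ^+ 2 / x ^+ e) =
      (\sum_(i < size b) iota b`_i * x ^+ i) * (x ^+ 2 / x ^+ e).
      by rewrite mulr_suml; apply: eq_bigr => i _; rewrite !mulrA.
    by field; rewrite xe0 x0.
  apply: (subr_N sp); apply: (subr_M sp); first exact: pD.
  apply: (subr_sum sp) => i _; have [->|bi] := eqVneq b`_i 0.
    by rewrite rmorph0 mul0r; exact: (subr_0 sp).
  apply: (subr_M sp); first exact: (subr_c sp).
  by rewrite -exprD; exact: (powers_inv x0 sp px (deg bi)).
have {}gp t : t \in g -> t \in g /\ stalk p t by move=> tg; split=> //; exact: gp.
have gE (g' : seq K) : g = g' -> forall t, t \in g' -> stalk p t by move=> E t; rewrite -E => /gp [].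
have gE' (g' : seq K) : g = g' -> forall t, t \in g -> t \in g' by move=> E t; rewrite -E.
move: gin; rewrite /ruled_charts !in_cons in_nil orbF => /or4P [] /eqP Eg h /(gE' _ Eg);
  have {}gp := gE _ Eg; rewrite !inE => /orP [] /eqP ->.
- by apply: (proj1 (fst_aff _)); apply: gp; rewrite !inE eqxx.
- by apply: (proj2 (fst_aff _)); apply: gp; rewrite !inE eqxx.
- by apply: (proj1 (fst_aff _)); apply: gp; rewrite !inE eqxx.
- apply: inv => //; first by apply: gp; rewrite !inE eqxx orbT.
  by apply: (proj2 (fst_aff _)); apply: gp; rewrite !inE eqxx.
- by apply: (proj1 (snd_aff _)); apply: gp; rewrite !inE eqxx.
- by apply: (proj2 (snd_aff _)); apply: gp; rewrite !inE eqxx.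
- by apply: (proj1 (snd_aff _)); apply: gp; rewrite !inE eqxx.
- apply: inv; [by rewrite mulf_neq0 ?invr_eq0|by apply: gp; rewrite !inE eqxx orbT|].
  by apply: (proj2 (snd_aff _)); apply: gp; rewrite !inE eqxx.
Qed.

(** D is the sum of its horizontal lift (D x) D1 and a vertical field, at every point; so q = r = 1
    will do. *)
Lemma spans_riccati f : D1 =1 (fun h => f * D0 h) -> riccati F x.
Proof.
move=> Ef a D tD; have tL := tangent_lift tD; have [dD OD] := tD; have [dL OL] := tL.
exists (fun h => D x * D1 h), (fun h => D h - D x * D1 h), 1, 1; split; rewrite ?oner_neq0 //.
- by apply/HF; split=> //; exists (D x * f) => h; rewrite Ef mulrA.
- split; last by rewrite D1x mulr1 subrr.
  split; last by move=> h Oh; apply: (subr_B (stalk_sub a)); [exact: OD|exact: OL].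
  split=> [u v|u v|c].
  - by rewrite (der_D dD) (der_D d1); ring.
  - by rewrite (der_M dD) (der_M d1); ring.
  - by rewrite (der_c dD) (der_c d1) mulr0 subrr.
by move=> h; rewrite rmorph1 hornerC; ring.
Qed.
End Riccati.

(** If [D0 x] is 0, the leaves are the fibers. Otherwise [D0] is proportional to a d/dx + b(x) d/dz
    with deg b <= e - 2. For e = 0 this gives b = 0 and the other ruling; for e > 0 the vanishing of
    e in k provides p, and gamma = - b / a. *)
Lemma foliation_dichotomy : e <> 1%N -> is_fibration F phi \/
  exists p : nat, [/\ p \in [pchar k], (p %| e)%N, riccati F x &
    exists gamma0 gamma1 : {poly k}, is_kernel_dz_plus F phi gamma0 gamma1].
Proof.
move=> e1; have [Dx|Dx] := eqVneq (D0 x) 0.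
  by left; left; exact: (spans_fibration C Dx).
have [a [b [g [[a0 g0] Ea Eb ek deg]]]] := ruled_foliation smX regF sD0 C e1 Dx ruled_charts_etale.
have ia0 : iota a != 0 by rewrite fmorph_eq0.
have [e0|e0] := posnP e.
  left; right; split=> //; apply: (spans_fibration (coords_swap C)).
  have b0 : b = 0.
    by apply/polyP => i; rewrite coef0; apply/eqP; apply: contraT => /deg; rewrite e0 addn2.
  by move/eqP: Eb; rewrite b0 ev1_0 mulf_eq0 (negPf g0) => /eqP.
right; have /natf0_pchar := e0; move/(_ k); rewrite ek eqxx => /(_ isT) [p pk].
pose c := a^-1 *: b.
have degc i : c`_i != 0 -> (i + 2 <= e)%N.
  by rewrite coefZ mulf_eq0 negb_or => /andP [_ /deg].
have evc : ev1 x c = (iota a)^-1 * ev1 x b by rewrite /c -mul_polyC ev1M ev1C fmorphV.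
have Ez : D0 z = ev1 x c * D0 x.
  apply: (mulfI g0); rewrite Eb evc mulrCA Ea; field; exact: ia0.
exists p; split=> //; first by rewrite (dvdn_pcharf pk) ek.
  pose D1 h := (iota a)^-1 * g * D0 h.
  apply: (@spans_riccati D1 c _ _ _ ek degc ((iota a)^-1 * g)) => //.
  - exact: der_scale.
  - by rewrite /D1 -mulrA Ea mulVf.
  - by rewrite /D1 -mulrA Eb evc.
have degN i : (- c)`_i != 0 -> (i + 2 <= e)%N by rewrite coefN oppr_eq0; exact: degc.
have [Q TQ] := twisted_form_reverse degN.
exists (- c), Q; split=> // a' D; rewrite (spans_ratio C Ez a' D).
have evN : (map_poly iota (- c)).[x] = - ev1 x c by rewrite (rmorphN (map_poly iota)) hornerN.
rewrite -/x -/z evN mulNr; split=> -[tD H]; split=> //; first by rewrite H subrr.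
by apply/eqP; rewrite -subr_eq0; apply/eqP.
Qed.
End Conclusion.

Local Close Scope ring_scope.

Theorem theorem2p15 (k : closedFieldType) (X : variety k)
  (X_surface : smooth_projective_surface X)
  (X_rational : rational X)
  (X_minimal : minimal X)
  (F : foliation X)
  (F_regular : regular F) :
  exists e : nat, e <> 1 /\
  exists phi : {rmorphism function_field (hirzebruch k e) -> function_field X},
    isomorphism phi /\
    (is_fibration F phi \/
     exists p : nat,
       [/\ p \in [pchar k]%R, p %| e, riccati F (phi (coordX k)) &
           exists gamma0 gamma1 : {poly k}, is_kernel_dz_plus F phi gamma0 gamma1]).
Proof.
case: (surface_model X_surface X_rational) =>
  [[x [z [e [C e1 H]]]]|[x [z [C H]]]|[x [z [C H]]]].
- have [D0 sD0] := foliation_spans F C X_surface.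
  have [phi [iso _ _]] := minimal_ruled X_minimal C H.
  exists e; split=> //; exists phi; split=> //.
  exact: (foliation_dichotomy X_surface F_regular sD0 iso e1).
- have [D0 sD0] := foliation_spans F C X_surface.
  by case: (no_regular_plane X_surface F_regular sD0 C (minimal_plane X_minimal C H)).
- have [D0 sD0] := foliation_spans F C X_surface.
  by case: (no_regular_plane X_surface F_regular sD0 C H).
Qed.
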